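(* Let $f:\mathbb{R}^p\to\mathbb{R}$, its maximizer $x^*$, and a symmetric positive semidefinite matrix $G^2\le -\nabla^2 f(x^* )$ be such that $u\mapsto \ell(x^*+u)=f(x^*+u)+\frac12\|Gu\|^2$ is concave on $\mathbb{R}^p$. With the notation of the context, suppose that $-\ell(\cdot)=n\,h(\cdot)$ for a strongly convex function $h$ satisfying $$\sup_{u\in\mathcal{U}}\sup_{t\in[0,1]}\frac{|\langle\nabla^3h(x^*+tu),u^{\otimes3}\rangle|}{\langle\nabla^2h(x^* ),u^{\otimes2}\rangle^{3/2}}\le \mathsf{c}_3,\qquad \mathsf{c}_3\,\mathtt{r}_G\,n^{-1/2}\le 3/4,$$ and that $\omega\le 1/3$, $\omega\,\mathtt{p}_G\le2/3$. Then, with some absolute constant $C$, for any linear mapping $Q:\mathbb{R}^p\to\mathbb{R}^q$ with $Q^\top Q\le\mathsf{D}^2$ and $3\|Q\mathsf{D}_G^{-2}Q^\top\|^2\le\|Q\mathsf{D}_G^{-2}Q^\top\|_{\mathrm{Fr}}^2$, it holds for $X\sim P_f$ with mean $\bar{x}$ and $\gamma_G\sim N(0,\mathsf{D}_G^{-2})$ $$\sup_{r>0}\Bigl|P_f\bigl(\|Q(X-\bar{x})\|\le r\bigr)-\mathbb{P}\bigl(\|Q\gamma_G\|\le r\bigr)\Bigr|\le 4(\diamondsuit_3+e^{-\mathtt{x}})+\frac{C\,\|Q(\bar{x}-x^* )\|^2}{\|Q\mathsf{D}_G^{-2}Q^\top\|_{\mathrm{Fr}}},$$ where, with an absolute constant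 $C$, $\|Q(\bar{x}-x^* )\|\le 2.4\,\mathsf{c}_3\,\|Q\mathsf{D}_G^{-2}Q^\top\|^{1/2}\,(\mathtt{p}_G+1)^{3/2}n^{-1/2}+C e^{-\mathtt{x}}$ and, for $Q=\mathsf{D}$, $\|\mathsf{D}(\bar{x}-x^* )\|\le 2.4\,\mathsf{c}_3(\mathtt{p}_G+1)^{3/2}n^{-1/2}+C e^{-\mathtt{x}}$.
   Context: Setting: $f:\mathbb{R}^p\to\mathbb{R}$ is three times continuously differentiable, $\int e^{f(x)}dx<\infty$, $x^*$ is a point of global maximum of $f$, and $-\nabla^2 f(x^* )$ is strictly positive definite. $P_f$ is the probability measure with density proportional to $e^{f(x)}$ and $\bar{x}=\int x\,e^{f(x)}dx\big/\int e^{f(x)}dx$. The number $n>0$ plays the role of a sample size. Notation: $\mathsf{D}_G^2=-\nabla^2 f(x^* )$, $\mathsf{D}^2=-\nabla^2 f(x^* )-G^2=-\nabla^2\ell(x^* )$; $\mathsf{D},\mathsf{D}_G,G$ are symmetric positive semidefinite square roots. $\mathtt{p}_G=\operatorname{tr}(\mathsf{D}^2\mathsf{D}_G^{-2})$. Some $\nu\in(0,1)$ (e.g. $\nu=2/3$) and some $\mathtt{x}>0$ (chosen so that $e^{-\mathtt{x}}$ is negligible) are fixed, and $\mathtt{r}_G=2\sqrt{\mathtt{p}_G}+\sqrt{2\mathtt{x}}$, $\mathcal{U}=\{u\in\mathbb{R}^p:\|\mathsf{D}u\|\le\nu^{-1}\mathtt{r}_G\}$. In the supremum $u\neq0$. $\delta_3(x^*,u)=f(x^*+u)-f(x^*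 )-\langle\nabla f(x^* ),u\rangle-\frac12\langle\nabla^2f(x^* ),u^{\otimes2}\rangle$, $\omega=\sup_{u\in\mathcal{U}}\frac{|\delta_3(x^*,u)|}{\|\mathsf{D}u\|^2/2}$. $\diamondsuit_3=\frac{\mathbb{E}\tau_3(\gamma_G)}{4(1-\omega)^{3/2}}$, where $\tau_3$ is a 3-homogeneous function, $\tau_3(tu)=|t|^3\tau_3(u)$, such that $|\delta_3(x^*,u)|\le\frac16\tau_3(u)$. $\|\cdot\|$ is the Euclidean norm for vectors and the operator norm for matrices, $\|\cdot\|_{\mathrm{Fr}}$ the Frobenius norm. *)

(* Defs.v *)
From HB Require Import structures.
From mathcomp Require Import all_boot all_order all_algebra.
From mathcomp Require Import all_classical all_reals all_analysis.

Set Implicit Arguments.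
Unset Strict Implicit.
Unset Printing Implicit Defensive.

Import Order.TTheory GRing.Theory Num.Theory.
Import numFieldNormedType.Exports.

Local Open Scope classical_set_scope.
Local Open Scope ring_scope.

(* R^p is 'cV[R]_p.  Its norm in mathcomp-analysis is the sup norm, which is
   used below only through the topology; the Euclidean norm is [norm2]. *)

Section linear_algebra.
Context {R : realType}.

Definition dot p (u v : 'cV[R]_p) : R := \sum_i u i 0 * v i 0.

Definition norm2 p (u : 'cV[R]_p) : R := Num.sqrt (dot u u).

Definition qform p (A : 'M[R]_p) (u : 'cV[R]_p) : R := dot u (A *m u).

Definition psd p (A : 'M[R]_p) : Prop := A^T = A /\ forall u, 0 <= qform A u.

Definition posdef p (A : 'M[R]_p) : Prop :=
  A^T = A /\ forall u, u != 0 -> 0 < qform A u.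

Definition loewner p (A B : 'M[R]_p) : Prop := psd (B - A).

Definition opnorm q p (A : 'M[R]_(q, p)) : R :=
  sup [set norm2 (A *m u) | u in [set u | norm2 u <= 1]].

Definition frobenius q p (A : 'M[R]_(q, p)) : R :=
  Num.sqrt (\sum_i \sum_j A i j ^+ 2).

End linear_algebra.

Section calculus.
Context {R : realType} {p : nat}.
Implicit Types (f : 'cV[R]_p -> R) (x u : 'cV[R]_p) (i j k : 'I_p).

Definition partial i f : 'cV[R]_p -> R := 'D_(delta_mx i 0) f.

(* C^m: all iterated partial derivatives of order <= m exist, and those of
   order m are continuous. *)
Fixpoint Ck (m : nat) f : Prop :=
  if m is m'.+1 then
    forall i, (forall x, derivable f x (delta_mx i 0)) /\ Ck m' (partial i f)
  else continuous f.

Definition grad f x : 'cV[R]_p := \col_i partial i f x.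

Definition hess f x : 'M[R]_p := \matrix_(i, j) partial i (partial j f) x.

(* <nabla^3 f(x), u (x) u (x) u> *)
Definition third f x u : R :=
  \sum_i \sum_j \sum_k
    partial i (partial j (partial k f)) x * (u i 0 * u j 0 * u k 0).

Definition delta3 f x u : R :=
  f (x + u) - f x - dot (grad f x) u - qform (hess f x) u / 2.

Definition strongly_convex f : Prop :=
  exists2 m : R, 0 < m &
    convex_function setT (fun x => f x - m / 2 * norm2 x ^+ 2).

End calculus.

(* The product (= Borel) sigma-algebra on R^p, generated by the coordinates. *)
Definition cV_display : measure_display.
Proof. exact: default_measure_display. Qed.

Section measurable_cV.
Context {R : realType} (p : nat).

Definition cV_coord (i : 'I_p) (v : 'cV[R]_p) : measurableTypeR R := v i 0.

Let cV_set0 : g_sigma_preimage cV_coord set0.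
Proof. exact: sigma_algebra0. Qed.

Let cV_setC A : g_sigma_preimage cV_coord A -> g_sigma_preimage cV_coord (~` A).
Proof. exact: sigma_algebraC. Qed.

Let cV_bigcup (F : (set 'cV[R]_p)^nat) :
  (forall i, g_sigma_preimage cV_coord (F i)) ->
  g_sigma_preimage cV_coord (\bigcup_i F i).
Proof. exact: sigma_algebra_bigcup. Qed.

HB.instance Definition _ := @isMeasurable.Build cV_display 'cV[R]_p
  (g_sigma_preimage cV_coord) cV_set0 cV_setC cV_bigcup.

End measurable_cV.

Lemma measurable_cV_coord {R : realType} p (i : 'I_p) :
  measurable_fun [set: 'cV[R]_p] (cV_coord i).
Proof.
move=> _ Y mY; rewrite setTI; apply: sub_sigma_algebra => /=.
rewrite -bigcup_seq/=; exists i => /=; first by rewrite mem_index_enum.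
by exists Y => //; rewrite setTI.
Qed.

Lemma measurable_fun_cVP {R : realType} p d (T : measurableType d)
    (f : T -> 'cV[R]_p) :
  (forall i, measurable_fun [set: T] (cV_coord i \o f)) ->
  measurable_fun [set: T] f.
Proof.
move=> mf.
have H : g_sigma_preimage (fun i => cV_coord i \o f) `<=` measurable.
  apply: smallest_sub; first exact: sigma_algebra_measurable.
  move=> A; rewrite -bigcup_seq => -[i _] [B mB <-].
  exact: mf.
move=> _ A mA; apply: H; rewrite g_sigma_preimage_comp.
by exists A.
Qed.

Section lebesgue_cV.
Context {R : realType}.

Definition cV_cons p (xv : measurableTypeR R * 'cV[R]_p) : 'cV[R]_p.+1 :=
  col_mx (xv.1)%:M xv.2.

Definition cV_uncons p (v : 'cV[R]_p.+1) : measurableTypeR R * 'cV[R]_p :=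
  (v 0 0, dsubmx (v : 'cV[R]_(1 + p))).

Lemma cV_consK p : cancel (@cV_cons p) (@cV_uncons p).
Proof.
move=> [x v]; rewrite /cV_uncons /cV_cons/= col_mxKd; congr pair.
transitivity (col_mx (x : R)%:M v (lshift p 0) 0).
  by congr (col_mx _ _ _ _); apply/val_inj.
by rewrite col_mxEu mxE eqxx.
Qed.

Lemma cV_unconsK p : cancel (@cV_uncons p) (@cV_cons p).
Proof.
move=> v; rewrite /cV_uncons /cV_cons/=.
have -> : (v 0 0)%:M = usubmx (v : 'cV[R]_(1 + p)).
  apply/matrixP => i j; rewrite !mxE !ord1 eqxx mulr1n.
  by congr (v _ _); apply/val_inj.
exact: (@vsubmxK _ 1 p 1).
Qed.

Lemma measurable_cV_cons p : measurable_fun setT (@cV_cons p).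
Proof.
apply: measurable_fun_cVP => i.
case: (split_ordP (i : 'I_(1 + p))) => j ->.
- rewrite (_ : _ \o _ = fst); first exact: measurable_fst.
  apply/funext => -[x v]; apply: etrans; first exact: (@col_mxEu _ 1 p 1).
  by rewrite mxE !ord1 eqxx.
- rewrite (_ : _ \o _ = cV_coord j \o snd).
    by apply: measurableT_comp; [exact: measurable_cV_coord|exact: measurable_snd].
  by apply/funext => -[x v]; exact: (@col_mxEd _ 1 p 1).
Qed.

Lemma measurable_cV_uncons p : measurable_fun setT (@cV_uncons p).
Proof.
apply: measurable_fun_pair; first exact: measurable_cV_coord.
apply: measurable_fun_cVP => i.
rewrite (_ : _ \o _ = cV_coord (rshift 1 i : 'I_p.+1)).
  exact: measurable_cV_coord.
by apply/funext => v; rewrite /cV_coord/= mxE.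
Qed.

Section step.
Context p (mu : {sigma_finite_measure set 'cV[R]_p -> \bar R}).
Local Open Scope ereal_scope.

Definition lebesgue_prod : set 'cV[R]_p.+1 -> \bar R :=
  pushforward (@lebesgue_measure R \x mu) (@cV_cons p).

Let lebesgue_prod0 : lebesgue_prod set0 = 0.
Proof. by rewrite /lebesgue_prod /pushforward preimage_set0 measure0. Qed.

Let lebesgue_prod_ge0 A : 0 <= lebesgue_prod A.
Proof. by rewrite /lebesgue_prod /pushforward; exact: measure_ge0. Qed.

Let mcons A : measurable A -> measurable (@cV_cons p @^-1` A).
Proof. by move=> mA; rewrite -[X in measurable X]setTI; exact: measurable_cV_cons. Qed.

Let lebesgue_prod_sigma_additive : semi_sigma_additive lebesgue_prod.
Proof.
move=> F mF tF mUF; rewrite /lebesgue_prod /pushforward preimage_bigcup.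
apply: measure_semi_sigma_additive.
- by move=> n; exact: mcons.
- apply/trivIsetP => /= i j _ _ ij; rewrite -preimage_setI.
  by move/trivIsetP : tF => /(_ _ _ _ _ ij) ->//; rewrite preimage_set0.
- by rewrite -preimage_bigcup; exact: mcons.
Qed.

HB.instance Definition _ := isMeasure.Build _ _ _ lebesgue_prod
  lebesgue_prod0 lebesgue_prod_ge0 lebesgue_prod_sigma_additive.

Let lebesgue_prod_sigma_finite : sigma_finite setT lebesgue_prod.
Proof.
have /sigma_finiteP[F [TF ndF Foo]] := sigma_finiteT (@lebesgue_measure R).
have /sigma_finiteP[G [TG ndG Goo]] := sigma_finiteT mu.
exists (fun n => @cV_uncons p @^-1` (F n `*` G n)).
  rewrite -preimage_bigcup (_ : \bigcup_n _ = setT) ?preimage_setT//.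
  apply/seteqP; split => // -[x v] _.
  have [n _ Fnx] : (\bigcup_n F n) x by rewrite -TF.
  have [k _ Gkv] : (\bigcup_n G n) v by rewrite -TG.
  exists (maxn n k) => //; split.
  - exact: (subsetPset _ _ (ndF _ _ (leq_maxl n k))).
  - exact: (subsetPset _ _ (ndG _ _ (leq_maxr n k))).
move=> n; have [mFn Fnoo] := Foo n; have [mGn Gnoo] := Goo n; split.
  rewrite -[X in measurable X]setTI; apply: measurable_cV_uncons => //.
  exact: measurableX.
rewrite /lebesgue_prod /pushforward -comp_preimage.
rewrite (_ : _ \o _ = id) ?preimage_id; last first.
  by apply/funext => v /=; rewrite cV_consK.
by rewrite product_measure1E// lte_mul_pinfty// ge0_fin_numE.
Qed.

HB.instance Definition _ := Measure_isSigmaFinite.Build _ _ _ lebesgue_prod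
  lebesgue_prod_sigma_finite.

End step.

(* On R^0 this is the unit point mass, so that R^(p+1) = R x R^p. *)
Fixpoint lebesgue_cV p : {sigma_finite_measure set 'cV[R]_p -> \bar R} :=
  match p with
  | 0 => (\d_ (0 : 'cV[R]_0) : {sigma_finite_measure set 'cV[R]_0 -> \bar R})
  | p'.+1 => lebesgue_prod (lebesgue_cV p')
  end.

End lebesgue_cV.

Section laws.
Context {R : realType} {p : nat}.
Implicit Types (f : 'cV[R]_p -> R) (A : set 'cV[R]_p) (S : 'M[R]_p).

Local Notation leb := (@lebesgue_cV R p).

(* The probability with density proportional to e^f; meaningful when the
   integral of e^f over R^p is finite. *)
Definition gibbs f A : R :=
  (\int[leb]_(x in A) expR (f x)) / (\int[leb]_x expR (f x)).

Definition gibbs_mean f : 'cV[R]_p :=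
  \col_i ((\int[leb]_x (x i 0 * expR (f x))) / (\int[leb]_x expR (f x))).

(* Density of N(0, S), for positive definite S. *)
Definition gauss_pdf S (u : 'cV[R]_p) : R :=
  expR (- (qform (invmx S) u / 2)) / Num.sqrt ((2 * pi) ^+ p * \det S).

Definition gauss S A : R := \int[leb]_(u in A) gauss_pdf S u.

Definition gauss_expectation S (g : 'cV[R]_p -> R) : \bar R :=
  (\int[leb]_u (g u * gauss_pdf S u)%:E)%E.

End laws.

Section local_quantities.
Context {R : realType} {p : nat}.
Implicit Types (f h : 'cV[R]_p -> R) (xs : 'cV[R]_p) (D S : 'M[R]_p).

(* tr (D^2 D_G^-2), from D2 = D^2 and DG2 = D_G^2 *)
Definition eff_dim (D2 DG2 : 'M[R]_p) : R := \tr (D2 *m invmx DG2).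

Definition conc_radius (pG x : R) : R := 2 * Num.sqrt pG + Num.sqrt (2 * x).

Definition ellipsoid D (r : R) : set 'cV[R]_p := [set u | norm2 (D *m u) <= r].

Definition omega f xs D (U : set 'cV[R]_p) : \bar R :=
  ereal_sup [set (`|delta3 f xs u| / (norm2 (D *m u) ^+ 2 / 2))%:E
            | u in U `\ 0].

Definition third_ratio_sup h xs (U : set 'cV[R]_p) : \bar R :=
  ereal_sup [set ereal_sup [set
      (`|third h (xs + t *: u) u| / qform (hess h xs) u `^ (3 / 2))%:E
    | t in `[0, 1]] | u in U `\ 0].

(* [fine om] is om itself as soon as om is finite. *)
Definition diamond3 S (tau3 : 'cV[R]_p -> R) (om : \bar R) : \bar R :=
  (gauss_expectation S tau3 * ((4 * (1 - fine om) `^ (3 / 2))^-1)%:E)%E.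

End local_quantities.

(* Main.v *)
(* Substitute y = x* + B v with B^T (- hess f x* ) B = 1 and B^T D^2 B diagonal, with
   entries l_i in (0, 1].  Then N(0, D_G^-2) becomes the standard Gaussian law, P_f
   becomes its reweighting by e^psi with psi v = delta3 (B v), and the ellipsoid of
   radius r becomes {Y <= r^2} with Y v = sum_i l_i v_i^2.

   Total variation: it suffices to bound the means of (1 - e^psi)_+ and
   (e^psi - 1)_+.  Where |psi| is small these are compared with |psi| <= tau_3 / 6.
   Where psi is large inside the ellipsoid, concavity of psi - Y / 2 forces tau_3 to be
   large at contractions of v, and a change of variables along the contractions bounds
   the contribution by the mean of tau_3.  Outside the ellipsoid concavity gives a
   linear gain and Chernoff bounds on shells give e^-x.

   Mean: for a linear form z, the mean of z e^psi is that of z (e^psi - 1) by symmetry,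
   and |psi| <= kap Y^(3/2) / 6 inside the ellipsoid.

   Recentring at the mean shifts the argument of a Gaussian quadratic form
   sum_i mu_i v_i^2 by b.  Since 3 mu_i^2 <= F^2 = sum_j mu_j^2, the form without one
   of its coordinates still has a distribution function with Lipschitz constant of
   order 1 / F (decay of characteristic functions); shifting the coordinates one
   after the other, and because the first order effect of each shift vanishes by
   symmetry, the probability of a ball moves by at most C sum_i mu_i b_i^2 / F. *)

Require Import Defs.
From HB Require Import structures.
From mathcomp Require Import all_boot all_order all_algebra.
From mathcomp Require Import fingroup perm.
From mathcomp Require Import all_classical all_reals all_analysis.
From mathcomp Require Import measurable_realfun.
From mathcomp Require Import ring lra.
Set Implicit Arguments.
Unset Strict Implicit.
Unset Printing Implicit Defensive.
Import Order.TTheory GRing.Theory Num.Theory.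
Import numFieldNormedType.Exports.
Local Open Scope classical_set_scope.
Local Open Scope ring_scope.

(** The constants are explicit: with T = tau_3 / 6 in the coordinates v, the target 4 (diamond_3 +
    e^-x) is 6 E T / (1 - omega)^(3/2) + 4 e^-x, so the mean of (e^psi - 1)_+ must be bounded by
    little more than 6 E T. The obstacle is that psi is not bounded on the ellipsoid: |psi| <= w Y /
    2 with Y up to r^2, which grows with x, while w P <= 2/3 controls only the typical size P of Y.
    Apart from dominating the remainder, tau_3 is only known to be homogeneous, so points of large
    psi can be charged to E T only through maps with an explicit effect on the Gaussian law.
    Contractions by 1 - c l_i are such maps, and their Jacobians are controlled by the trace P, not
    by the dimension p. The ratio w is the smaller of omega and kap r / 3, hence at most 1/4. Two
    reductions simplify the numerical part: for P < 1 a rescaling normalizes P to 1, and for x <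
    32/25 the claim is void because 4 e^-x >= 1. *)

Section lebesgue1.
Context {R : realType}.
Local Notation mu := (@lebesgue_measure R).
Local Open Scope ereal_scope.

(** * Affine changes of variables on the real line *)

Lemma lebesgue_affine_set (a b : R) (A : set (measurableTypeR R)) :
  a != 0%R -> measurable A ->
  `|a|%:E * mu ((fun x => a * x + b)%R @^-1` A) = mu A.
Proof.
move=> a0 mA.
have mf : measurable_fun setT ((fun x => a * x + b)%R : _ -> measurableTypeR R).
  by apply: measurable_funD => //; exact: measurable_funM.
pose f := ((fun x => a * x + b)%R : measurableTypeR R -> measurableTypeR R).
pose m0 := pushforward mu f.
pose an : {nonneg R} := NngNum (normr_ge0 a).
pose M : {measure set (measurableTypeR R) -> \bar R} := mscale an m0.
(* By uniqueness of Lebesgue measure it is enough to evaluate the scaled pushforward on intervals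
   []c, d]]; for a negative slope the preimage is closed on the left and open on the right, with the
   same length. *)
apply/esym; rewrite -[RHS]/(M mf A); apply: lebesgue_measure_unique => // _ [[c d]] /= cd <-.
rewrite /M /mscale/= /m0 /pushforward/=.
have ag : (0 < `|a|)%R by rewrite normr_gt0.
have [ap|an0] := ltP 0%R a.
  rewrite (_ : f @^-1` _ = `]((c - b) / a)%R, ((d - b) / a)%R]%classic); last first.
    apply/seteqP; split => x; rewrite /f/= !in_itv/= => /andP[h1 h2]; apply/andP; split.
    - by rewrite ltr_pdivrMr// ltrBlDr mulrC.
    - by rewrite ler_pdivlMr// lerBrDr mulrC.
    - by move: h1; rewrite ltr_pdivrMr// ltrBlDr mulrC.
    - by move: h2; rewrite ler_pdivlMr// lerBrDr mulrC.
  rewrite !lebesgue_measure_itv/= !lte_fin ltr_pM2r ?invr_gt0// ltrD2r.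
  case: ifPn => //; rewrite ?mule0// => _.
  rewrite -!EFinB -EFinM gtr0_norm//; congr EFin; field; lra.
have {}an0 : (a < 0)%R by rewrite lt_neqAle a0.
rewrite (_ : f @^-1` _ = `[((d - b) / a)%R, ((c - b) / a)%R[%classic); last first.
  apply/seteqP; split => x; rewrite /f/= !in_itv/= => /andP[h1 h2]; apply/andP; split.
  - by rewrite ler_ndivrMr// lerBrDr mulrC.
  - by rewrite ltr_ndivlMr// ltrBlDr mulrC.
  - by move: h2; rewrite ltr_ndivlMr// ltrBlDr mulrC.
  - by move: h1; rewrite ler_ndivrMr// lerBrDr mulrC.
rewrite !lebesgue_measure_itv/= !lte_fin ltr_nM2r ?invr_lt0// ltrD2r.
case: ifPn => //; rewrite ?mule0// => _.
rewrite -!EFinB -EFinM ltr0_norm//; congr EFin; field; lra.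
Qed.

Lemma lebesgue_affine (a b : R) (F : R -> \bar R) :
  a != 0%R -> measurable_fun setT F -> (forall x, 0 <= F x) ->
  `|a|%:E * \int[mu]_x F (a * x + b)%R = \int[mu]_x F x.
Proof.
move=> a0 mF F0.
have mf : measurable_fun setT ((fun x => a * x + b)%R : _ -> measurableTypeR R).
  by apply: measurable_funD => //; exact: measurable_funM.
pose f := ((fun x => a * x + b)%R : measurableTypeR R -> measurableTypeR R).
pose an : {nonneg R} := NngNum (normr_ge0 a).
rewrite [RHS](@eq_measure_integral _ _ _ _
  (mscale an (pushforward mu f))); last first.
  by move=> A mA _; apply/esym; exact: (lebesgue_affine_set b a0 mA).
pose m0 : {measure set (measurableTypeR R) -> \bar R} := pushforward mu f.
have -> : \int[mscale an (m0 mf)]_x F x = an%:num%:E * \int[m0 mf]_x F x.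
  by rewrite ge0_integral_mscale.
congr (_ * _); rewrite /m0 ge0_integral_pushforward//.
Qed.

End lebesgue1.

(** * Measurability of linear maps and translations of R^p *)

Section cV_measurability.
Context {R : realType}.

Lemma measurable_cV_component p (i : 'I_p) :
  measurable_fun setT (fun v : 'cV[R]_p => v i 0).
Proof. exact: (@measurable_cV_coord R p i). Qed.

Lemma measurable_mulmx p q (A : 'M[R]_(q, p)) :
  measurable_fun setT (fun v : 'cV[R]_p => A *m v).
Proof.
apply: measurable_fun_cVP => i.
rewrite (_ : _ \o _ = fun v : 'cV[R]_p => \sum_j A i j * v j 0); last first.
  by apply/funext => v; rewrite /cV_coord/= mxE.
apply: measurable_sum => j; apply: measurable_funM => //.
exact: measurable_cV_component.
Qed.

Lemma measurable_cV_trans p (w : 'cV[R]_p) :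
  measurable_fun setT (fun v : 'cV[R]_p => v + w).
Proof.
apply: measurable_fun_cVP => i.
rewrite (_ : _ \o _ = fun v : 'cV[R]_p => v i 0 + w i 0); last first.
  by apply/funext => v; rewrite /cV_coord/= mxE.
by apply: measurable_funD => //; exact: measurable_cV_component.
Qed.

End cV_measurability.

(** * Translations and linear changes of variables on R^p *)

Section lebesgue_cV_change.
Context {R : realType}.
Local Notation mu := (@lebesgue_measure R).
Local Notation leb := (@lebesgue_cV R).
Local Open Scope ereal_scope.

Section rec.
Variables (p : nat) (F : 'cV[R]_p.+1 -> \bar R).
Hypotheses (mF : measurable_fun setT F) (F0 : forall v, 0 <= F v).

Let mFc : measurable_fun setT (F \o @cV_cons R p).
Proof. by apply: measurableT_comp => //; exact: measurable_cV_cons. Qed.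

Lemma lebesgue_cV_rec :
  \int[leb p.+1]_v F v = \int[mu]_x \int[leb p]_v F (cV_cons (x, v)).
Proof.
rewrite /=; have mc := @measurable_cV_cons R p.
transitivity (\int[pushforward (mu \x leb p) (@cV_cons R p)]_v F v) => //.
rewrite ge0_integral_pushforward//=.
by rewrite fubini_tonelli1//= => x; exact: F0.
Qed.

Lemma lebesgue_cV_rec_swap :
  \int[leb p.+1]_v F v = \int[leb p]_v \int[mu]_x F (cV_cons (x, v)).
Proof.
by rewrite lebesgue_cV_rec (fubini_tonelli (F \o @cV_cons R p))//=.
Qed.

Lemma measurable_cV_cons_slice1 (x : R) :
  measurable_fun setT (fun v => F (cV_cons (x, v))).
Proof. by apply: (measurableT_comp mFc); exact: measurable_pair1. Qed.

Lemma measurable_cV_cons_slice2 (v : 'cV[R]_p) :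
  measurable_fun setT (fun x : measurableTypeR R => F (cV_cons (x, v))).
Proof. by apply: (measurableT_comp mFc); exact: measurable_pair2. Qed.

Lemma measurable_cV_cons_int1 :
  measurable_fun setT (fun x : measurableTypeR R => \int[leb p]_v F (cV_cons (x, v))).
Proof.
apply: (measurable_fun_fubini_tonelli_F (F \o @cV_cons R p)) => //=.
Qed.

End rec.

Lemma cV_consD p (x y : R) (v w : 'cV[R]_p) :
  (cV_cons (x, v) + cV_cons (y, w))%R = cV_cons ((x + y)%R, (v + w)%R).
Proof. by rewrite /cV_cons/= (@add_col_mx _ 1 p 1) -raddfD. Qed.

Lemma cV_consP p (v : 'cV[R]_p.+1) :
  v = cV_cons (v ord0 ord0, dsubmx (v : 'cV[R]_(1 + p))).
Proof. by rewrite -[LHS]cV_unconsK. Qed.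

Lemma lebesgue_cV_trans p (w : 'cV[R]_p) (F : 'cV[R]_p -> \bar R) :
  measurable_fun setT F -> (forall v, 0 <= F v) ->
  \int[leb p]_v F (v + w)%R = \int[leb p]_v F v.
Proof.
elim: p w F => [|p IH] w F mF F0.
  by apply: eq_integral => v _; congr F; apply/matrixP => -[].
have mFw : measurable_fun setT (fun v : 'cV[R]_p.+1 => F (v + w)%R).
  by apply: (measurableT_comp mF); exact: measurable_cV_trans.
rewrite (lebesgue_cV_rec mFw (fun=> F0 _)) (lebesgue_cV_rec mF F0).
pose G x := \int[leb p]_v F (cV_cons (x, v)).
transitivity (\int[mu]_x G (x + w ord0 ord0)%R).
  apply: eq_integral => x _; rewrite /G.
  rewrite -(IH (dsubmx (w : 'cV[R]_(1 + p)))
    (fun v => F (cV_cons ((x + w ord0 ord0)%R, v))))//.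
    by apply: eq_integral => v _; rewrite [in LHS](cV_consP w) cV_consD.
  exact: measurable_cV_cons_slice1.
have := @lebesgue_affine R 1 (w ord0 ord0) G (oner_neq0 _) (measurable_cV_cons_int1 mF F0).
rewrite normr1 mul1e => <-.
- by apply: eq_integral => x _; rewrite mul1r.
- by move=> x; exact: integral_ge0.
Qed.

(** The change of variables formula is made a predicate on matrices because it is stable under
    products: it is proved for shears and block diagonal matrices and then multiplied along Gaussian
    elimination. *)
Definition lebesgue_scales p (A : 'M[R]_p) := forall F : 'cV[R]_p -> \bar R,
  measurable_fun setT F -> (forall v, 0 <= F v) ->
  `|\det A|%:E * \int[leb p]_v F (A *m v) = \int[leb p]_v F v.

Lemma lebesgue_scales_mul p (A B : 'M[R]_p) :
  lebesgue_scales A -> lebesgue_scales B -> lebesgue_scales (A *m B).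
Proof.
move=> hA hB F mF F0; rewrite -(hA F)// -[in RHS](hB (F \o mulmx A)); last 2 first.
- by apply: (measurableT_comp mF); exact: measurable_mulmx.
- by move=> v; exact: F0.
rewrite muleA -EFinM -normrM det_mulmx; congr (_ * _).
by apply: eq_integral => v _ /=; rewrite mulmxA.
Qed.

(** The map sends (x, v) to (x + w v, v): when x is integrated for fixed v, it is a translation of
    the line. *)
Lemma lebesgue_scales_ublock p (w : 'rV[R]_p) :
  lebesgue_scales (block_mx 1%:M w 0 1%:M : 'M[R]_(1 + p)).
Proof.
move=> F mF F0; rewrite det_ublock !det1 mulr1 normr1 mul1e.
rewrite (lebesgue_cV_rec_swap (measurableT_comp mF (measurable_mulmx _)) (fun=> F0 _)).
rewrite (lebesgue_cV_rec_swap mF F0); apply: eq_integral => v _.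
have := @lebesgue_affine R 1 ((w *m v) ord0 ord0) (fun x => F (cV_cons (x, v)))
  (oner_neq0 _) (measurable_cV_cons_slice2 mF v) (fun=> F0 _).
rewrite normr1 mul1e => <-.
apply: eq_integral => x _; congr F.
rewrite /cV_cons/= (@mul_block_col _ 1 p 1 p 1) mul0mx !mul1mx add0r; congr col_mx.
by rewrite mul1r raddfD/= -mx11_scalar.
Qed.

(** The map sends (x, v) to (x, v + x w): when v is integrated for fixed x, it is a translation of
    R^p. *)
Lemma lebesgue_scales_lblock p (w : 'cV[R]_p) :
  lebesgue_scales (block_mx 1%:M 0 w 1%:M : 'M[R]_(1 + p)).
Proof.
move=> F mF F0; rewrite det_lblock !det1 mulr1 normr1 mul1e.
rewrite (lebesgue_cV_rec (measurableT_comp mF (measurable_mulmx _)) (fun=> F0 _)).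
rewrite (lebesgue_cV_rec mF F0); apply: eq_integral => x _.
rewrite -(lebesgue_cV_trans (x *: w) (measurable_cV_cons_slice1 mF x) (fun=> F0 _)).
apply: eq_integral => v _; congr F.
rewrite /cV_cons/= (@mul_block_col _ 1 p 1 p 1) mul0mx !mul1mx addr0; congr col_mx.
by rewrite mul_mx_scalar addrC.
Qed.

Lemma lebesgue_scales_diag p (a : R) (A : 'M[R]_p) : a != 0%R ->
  lebesgue_scales A -> lebesgue_scales (block_mx a%:M 0 0 A : 'M[R]_(1 + p)).
Proof.
move=> a0 hA F mF F0; rewrite det_ublock det_scalar expr1 normrM.
rewrite (lebesgue_cV_rec (measurableT_comp mF (measurable_mulmx _)) (fun=> F0 _)).
rewrite (lebesgue_cV_rec mF F0).
rewrite -(lebesgue_affine 0 a0 (measurable_cV_cons_int1 mF F0)); last first.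
  by move=> x; exact: integral_ge0.
rewrite EFinM -muleA; congr (_ * _).
rewrite -ge0_integralZl//; last 2 first.
- exact: (measurable_cV_cons_int1 (measurableT_comp mF (measurable_mulmx _)) (fun=> F0 _)).
- by move=> x _; apply: integral_ge0 => v _; exact: F0.
apply: eq_integral => x _.
rewrite addr0 -(hA (fun v => F (cV_cons ((a * x)%R, v)))); last 2 first.
- exact: measurable_cV_cons_slice1.
- by move=> v; exact: F0.
congr (_ * _); apply: eq_integral => v _; congr F.
rewrite /cV_cons/= (@mul_block_col _ 1 p 1 p 1) !mul0mx addr0 add0r; congr col_mx.
by rewrite -scalar_mxM.
Qed.

Local Close Scope ereal_scope.
(** Induction by elimination: a matrix with nonzero corner entry is a lower shear times a block
    diagonal matrix, with the Schur complement as second block, times an upper shear. *)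
Lemma lebesgue_cV_linear p (A : 'M[R]_p) : \det A != 0%R -> lebesgue_scales A.
Proof.
elim: p A => [|p IH] A A0.
  move=> F mF F0; rewrite det_mx00 normr1 mul1e.
  by apply: eq_integral => v _; congr F; apply/matrixP => -[].
have piv (M : 'M[R]_(1 + p)) : \det M != 0%R -> M ord0 ord0 != 0%R -> lebesgue_scales M.
  move=> M0 m0.
  pose a := M ord0 ord0; pose b := ursubmx M; pose c := dlsubmx M.
  pose S := drsubmx M - a^-1 *: (c *m b).
  have aE : ulsubmx M = a%:M.
    rewrite [LHS]mx11_scalar; congr (_%:M); rewrite !mxE.
    by congr (M _ _); apply/val_inj.
  have ME : M = block_mx 1%:M 0 (a^-1 *: c) 1%:M *m
      (block_mx a%:M 0 0 S *m block_mx 1%:M (a^-1 *: b) 0 1%:M).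
    rewrite !mulmx_block !mul0mx !mul1mx !mulmx1 !mulmx0 !addr0 !add0r.
    rewrite -!scalar_mxC -!scalemxAl ?mul_scalar_mx ?mul_mx_scalar !scalerA ?mulVf ?mulfV//.
    rewrite !scale1r -[LHS]submxK aE -/b -/c; congr (block_mx _ _ _ _).
    by rewrite /S addrC subrK.
  rewrite ME; apply: lebesgue_scales_mul; first exact: lebesgue_scales_lblock.
  apply: lebesgue_scales_mul; last exact: lebesgue_scales_ublock.
  apply: lebesgue_scales_diag => //; apply: IH.
  apply: contraNneq M0 => S0; rewrite ME !det_mulmx.
  by rewrite (@det_ublock _ 1 p a%:M) S0 mulr0 mul0r mulr0.
have [a0|] := eqVneq (A ord0 ord0) 0%R; last exact: piv.
have [i ci] : exists i : 'I_p, (A : 'M[R]_(1 + p)) (rshift 1 i) ord0 != 0%R.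
  apply/not_existsP => ci; move/negP : A0; apply.
  rewrite (expand_det_col _ ord0) big1//= => i _.
  rewrite (_ : A i ord0 = 0%R) ?mul0r//.
  case: (split_ordP (i : 'I_(1 + p))) => j ->.
    by rewrite -[RHS]a0; congr (A _ _); apply/val_inj; rewrite /= ord1.
  by apply/eqP/negPn/negP; exact: ci.
(* A zero pivot is repaired by adding to the first row a row whose entry in column 0 is nonzero;
   [T 1] is this row operation and [T (-1)] undoes it. *)
pose w : 'rV[R]_p := delta_mx ord0 i.
pose T (s : R) : 'M[R]_(1 + p) := block_mx 1%:M (s *: w) 0 1%:M.
have TT : T (-1)%R *m T 1%R = 1%:M.
  rewrite /T mulmx_block !mul0mx !mul1mx !mulmx1 !mulmx0 !addr0 !add0r.
  by rewrite scaleN1r scale1r subrr -scalar_mx_block.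
have detT s : \det (T s) = 1%R by rewrite det_ublock !det1 mulr1.
have -> : A = T (-1)%R *m (T 1%R *m A) by rewrite mulmxA TT mul1mx.
apply: lebesgue_scales_mul; first exact: lebesgue_scales_ublock.
apply: piv; first by rewrite det_mulmx detT mul1r.
have T1 j : T 1 ord0 (rshift 1 j) = w ord0 j.
  transitivity (T 1 (lshift p ord0) (rshift 1 j)); last first.
    by rewrite /T block_mxEur scale1r.
  by congr (T 1 _ _); exact/val_inj.
rewrite mxE (bigD1 (rshift 1 i))//= [X in _ + X](_ : _ = 0).
  by rewrite addr0 T1 mxE !eqxx mul1r.
apply: big1 => j ji; case: (split_ordP j) => k jE; rewrite jE.
  by rewrite (_ : lshift p k = ord0) ?a0 ?mulr0//; apply/val_inj; rewrite /= ord1.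
rewrite T1 mxE eqxx/= (_ : k == i = false) ?mul0r//.
by apply: contraNF ji => /eqP <-; rewrite jE.
Qed.

End lebesgue_cV_change.

(** * Continuity and differentiability on R^p from partial derivatives *)

Section cV_topology.
Context {R : realType} {p : nat}.
Implicit Types (f : 'cV[R]_p -> R) (x u h : 'cV[R]_p).

Lemma near_cVP x (P : set 'cV[R]_p) : (\forall y \near x, P y) <->
  exists2 e : R, 0 < e & forall y : 'cV[R]_p, (forall i, `|y i 0 - x i 0| < e) -> P y.
Proof.
split=> [/nbhs_ballP[e e0 he]|[e e0 he]].
  exists e => // y hy; apply: he; split => // i j.
  by rewrite ord1 /ball/= distrC.
apply/nbhs_ballP; exists e => // y [_ hy]; apply: he => i.
by have := hy i 0; rewrite /ball/= distrC.
Qed.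

(** The sigma-algebra is generated by the coordinates and not by open sets. The bridge is that an
    open set is the countable union of the boxes it contains with rational centre and radius 1 / (n
    + 1). *)
Lemma continuous_measurable_cV f : continuous f -> measurable_fun setT f.
Proof.
move=> cf; apply: (measurability _ (RGenOInfty.measurableE R)) => // _ [_ [a ->] <-].
rewrite setTI preimage_itvoy.
set U := [set y | _].
pose box (qn : 'cV[rat]_p * nat) :=
  [set y : 'cV[R]_p | forall i, `|y i 0 - ratr (qn.1 i 0)| < (qn.2.+1%:R^-1 : R)].
pose F qn := if `[< box qn `<=` U >] then box qn else set0.
have mbox qn : measurable (box qn).
  rewrite (_ : box qn = \big[setI/setT]_(i < p)
    ((fun y : 'cV[R]_p => `|y i 0 - ratr (qn.1 i 0)|) @^-1` `]-oo, (qn.2.+1%:R^-1 : R)[%classic)).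
    apply: bigsetI_measurable => i _; rewrite -[X in measurable X]setTI.
    apply: (_ : measurable_fun _ _) => //; apply: measurableT_comp => //.
    by apply: measurable_funB => //; exact: measurable_cV_component.
  rewrite -bigcap_seq; apply/seteqP; split => y/=.
    by move=> yb i _; rewrite /= in_itv/=; exact: yb.
  by move=> yb i; have := yb i (mem_index_enum _); rewrite /= in_itv.
suff -> : U = \bigcup_qn F qn.
  apply: countable_bigcupT_measurable => // qn.
  by rewrite /F; case: asboolP => _; [exact: mbox|exact: measurable0].
apply/seteqP; split=> [y Uy|y [qn _]]; last by rewrite /F; case: asboolP => //= h ?; exact: h.
have [e e0 he] : exists2 e : R, 0 < e & forall z : 'cV[R]_p, (forall i, `|z i 0 - y i 0| < e) -> U z.
  apply/near_cVP; have := cf y; move/cvgr_gt => /(_ a Uy).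
  exact.
have [n ne] : exists n, n.+1%:R^-1 < e / 2.
  by have [n] := ltr_add_invr (divr_gt0 e0 (ltr0n R 2)); rewrite add0r; exists n.
have n0 : 0 < n.+1%:R^-1 :> R by rewrite invr_gt0.
set k : R := n.+1%:R^-1 in ne n0.
have /choice[q hq] i : exists q, `|y i 0 - ratr q| < k.
  have : y i 0 - k < y i 0 + k by rewrite ltrD2l (lt_trans _ n0)// oppr_lt0.
  move=> /rat_in_itvoo[q]; rewrite in_itv/= => /andP[q1 q2].
  by exists q; rewrite distrC ltr_distl q1 q2.
exists ((\col_i q i), n) => //; rewrite /F; case: asboolP => [_ i|[]] /=.
  by rewrite mxE.
move=> z zb; apply: he => i; have := zb i; rewrite /= mxE => {}zb.
rewrite (_ : z i 0 - y i 0 = (z i 0 - ratr (q i)) - (y i 0 - ratr (q i))); last by rewrite opprB addrA subrK.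
by rewrite (le_lt_trans (ler_normB _ _))// (splitr e) ltrD ?(lt_trans _ ne).
Qed.

Lemma derivable_line f x u : (forall y, derivable f y u) ->
  forall s : R, is_derive s 1 (fun s : R => f (x + s *: u)) ('D_u f (x + s *: u)).
Proof.
move=> df s; have := df (x + s *: u); rewrite /derivable.
have E : (fun h : R => h^-1 *: (f (x + (h *: (1 : R) + s) *: u) - f (x + s *: u))) =
         (fun h : R => h^-1 *: (f (h *: u + (x + s *: u)) - f (x + s *: u))).
  apply/funext => h; congr (_ *: (f _ - _)).
  by rewrite [h *: 1]mulr1 scalerDl addrCA.
move=> cv; split; first by rewrite /derivable/= E.
by rewrite /derive E.
Qed.

(** The mean value theorem is applied to t in [0, 1] along t s, so that the sign of s does not
    matter. *)
Lemma derivable_line_mean f x u : (forall y, derivable f y u) -> forall s : R,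
  exists2 t : R, 0 <= t <= 1 & f (x + s *: u) - f x = s * 'D_u f (x + (t * s) *: u).
Proof.
move=> df s.
have dF (t : R) : is_derive t 1 (fun t : R => f (x + (t * s) *: u)) (s * 'D_u f (x + (t * s) *: u)).
  have h1 := @derivable_line f x u df (t * s).
  have := @is_derive1_comp R (fun s => f (x + s *: u)) (fun t => t * s) t _ s h1.
  rewrite mulrC /comp; apply.
  by apply: is_derive_eq; rewrite /GRing.scale/= mulr1 mulr0 add0r.
have [|t t01] := @MVT_segment R _ _ 0 1 ler01 (fun t _ => dF t).
  apply: continuous_subspaceT => t; apply: differentiable_continuous.
  by apply/derivable1_diffP; have [] := dF t.
rewrite mul0r scale0r addr0 mul1r subr0 mulr1 => ->.
by exists t => //; move: t01; rewrite in_itv.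
Qed.

Section C1.
Variable f : 'cV[R]_p -> R.
Hypothesis df : forall i x, derivable f x (delta_mx i 0).
Hypothesis cdf : forall i, continuous (partial i f).

Lemma C1_taylor x (e : R) : 0 < e -> exists2 d : R, 0 < d &
  forall h : 'cV[R]_p, (forall i, `|h i 0| < d) ->
  `|f (x + h) - f x - \sum_i h i 0 * partial i f x| <= e * \sum_i `|h i 0|.
Proof.
move=> e0.
have [d d0 hd] : exists2 d : R, 0 < d & forall y : 'cV[R]_p, (forall i, `|y i 0 - x i 0| < d) ->
    forall i, `|partial i f y - partial i f x| < e.
  suff H : \forall y \near x, forall i, `|partial i f y - partial i f x| < e.
    by have /near_cVP := H.
  apply: (@filter_forall _ _ _ (nbhs x) _) => i.
  have /cvgr_distC_lt/(_ e e0) := @cdf i x.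
  by apply: filterS => y.
exists d => // h hh.
pose tk k : 'cV[R]_p := \col_i (if (i < k)%N then h i 0 else 0).
have key k : (k <= p)%N -> `|f (x + tk k) - f x - \sum_(i < p | (i < k)%N) h i 0 * partial i f x|
    <= e * \sum_(i < p | (i < k)%N) `|h i 0|.
  elim: k => [_|k IH kp].
    rewrite (_ : tk 0%N = 0); last by apply/colP => i; rewrite !mxE.
    by rewrite addr0 !big_pred0// subrr subr0 normr0 mulr0.
  pose i0 := Ordinal kp.
  have sumE (g : 'I_p -> R) :
      \sum_(i < p | (i < k.+1)%N) g i = g i0 + \sum_(i < p | (i < k)%N) g i.
    rewrite (bigD1 i0)//=; congr (_ + _); apply: eq_bigl => i.
    by rewrite -val_eqE/= ltnS ltn_neqAle andbC.
  have tkS : tk k.+1 = tk k + h i0 0 *: delta_mx i0 0.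
    apply/colP => i; rewrite !mxE eqxx andbT -val_eqE/= ltnS leq_eqVlt.
    have [ik|ik] := eqVneq (i : nat) k; last by rewrite /= mulr0 addr0.
    by rewrite ik ltnn mulr1 add0r; congr (h _ _); exact/val_inj.
  rewrite !sumE mulrDr tkS addrA.
  have [t /andP[t0 t1] mv] := @derivable_line_mean f (x + tk k) _ (@df i0) (h i0 0).
  have := hd (x + tk k + (t * h i0 0) *: delta_mx i0 0) _ i0.
  rewrite /partial => hde; move: mv hde.
  set a := f (_ + _ + _); set b := f (x + _); set D := 'D_ _ f _; set D0 := 'D_ _ f x.
  move=> mv hde.
  have {}hde : `|D - D0| < e.
    apply: hde => i; rewrite !mxE eqxx andbT.
    have [->|ii0] := eqVneq i i0; last first.
      rewrite mulr0 addr0 addrAC subrr add0r; case: ifP => _ //.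
      by rewrite normr0.
    rewrite ltnn addr0 mulr1 addrAC subrr add0r normrM.
    rewrite (le_lt_trans _ (hh i0))// ler_piMl// ger0_norm//.
  have {}IH := IH (ltnW kp).
  have E : `|h i0 0 * (D - D0)| <= e * `|h i0 0|.
    by rewrite normrM mulrC ler_wpM2r// ltW.
  rewrite (_ : a - f x - _ = h i0 0 * (D - D0) +
    (b - f x - \sum_(i < p | (i < k)%N) h i 0 * partial i f x)); last first.
    rewrite mulrBr -mv; set S := \sum_(_ < _ | _) _; rewrite /partial -/D0; ring.
  by rewrite (le_trans (ler_normD _ _))// lerD.
have := key p (leqnn p).
rewrite (_ : tk p = h); last by apply/colP => i; rewrite mxE ltn_ord.
have E (g : 'I_p -> R) : \sum_(i < p | (i < p)%N) g i = \sum_i g i.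
  by apply: eq_bigl => i; rewrite ltn_ord.
by rewrite !E.
Qed.

Lemma C1_continuous : continuous f.
Proof.
move=> x; apply/(@cvgrPdistC_le _ _ _ (nbhs x)) => e e0.
have [d d0 hd] := @C1_taylor x 1 ltr01.
pose M := \sum_i (1 + `|partial i f x|).
have M0 : 0 <= M by apply: sumr_ge0 => i _; rewrite addr_ge0.
apply/near_cVP; exists (Num.min d (e / (1 + M))).
  by rewrite lt_min d0 divr_gt0//; lra.
move=> y hy; have hyd i : `|(y - x) i 0| < d.
  by have := hy i; rewrite !mxE lt_min => /andP[].
have hye i : `|(y - x) i 0| <= e / (1 + M).
  by have := hy i; rewrite !mxE lt_min => /andP[_ /ltW].
have {}H : `|f y - f x| <= \sum_i `|(y - x) i 0| * (1 + `|partial i f x|).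
  have h1 := hd _ hyd; rewrite (addrC x) subrK mul1r in h1.
  rewrite (_ : f y - f x = f y - f x - \sum_i (y - x) i 0 * partial i f x +
     \sum_i (y - x) i 0 * partial i f x); last by rewrite subrK.
  rewrite (le_trans (ler_normD _ _))//.
  under [X in _ <= X]eq_bigr do rewrite mulrDr mulr1.
  rewrite big_split/= lerD// (le_trans (ler_norm_sum _ _ _))//.
  by apply: ler_sum => i _; rewrite normrM.
rewrite (le_trans H)// (@le_trans _ _ (e / (1 + M) * M))//.
  by rewrite /M mulr_sumr; apply: ler_sum => i _; apply: ler_wpM2r => //.
rewrite mulrAC ler_pdivrMr; last lra.
by rewrite ler_wpM2l ?ltW//; lra.
Qed.

Lemma C1_is_derive x u : is_derive x u f (\sum_i u i 0 * partial i f x).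
Proof.
suff H : h^-1 *: (f (h *: u + x) - f x) @[h --> 0^'] --> (\sum_i u i 0 * partial i f x : R).
  by split; [apply/cvg_ex; exists (\sum_i u i 0 * partial i f x)|exact/cvg_lim].
apply/cvgrPdistC_le => e e0.
pose M := 1 + \sum_i `|u i 0|.
have M0 : 0 < M by rewrite ltr_wpDr// sumr_ge0.
have [d d0 hd] := @C1_taylor x (e / M) (divr_gt0 e0 M0).
near=> t.
have t0 : t != 0 by near: t; exact: nbhs_dnbhs_neq.
have td : `|t| < d / M.
  by near: t; apply: dnbhs0_lt; rewrite divr_gt0.
have hyd i : `|(t *: u) i 0| < d.
  rewrite mxE normrM (@le_lt_trans _ _ (`|t| * M))//.
    rewrite ler_wpM2l// /M (bigD1 i)//= addrCA lerDl addr_ge0// sumr_ge0//.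
  by rewrite -ltr_pdivlMr.
have := hd _ hyd; rewrite (addrC x).
rewrite (_ : \sum_i (t *: u) i 0 * _ = t * \sum_i u i 0 * partial i f x); last first.
  by rewrite mulr_sumr; apply: eq_bigr => i _; rewrite mxE mulrA.
rewrite (_ : \sum_i `|(t *: u) i 0| = `|t| * \sum_i `|u i 0|); last first.
  by rewrite mulr_sumr; apply: eq_bigr => i _; rewrite mxE normrM.
set S := \sum_i u i 0 * _; set A := \sum_i `|u i 0| => H.
rewrite (_ : _ - S = t^-1 * (f (t *: u + x) - f x - t * S)); last first.
  by rewrite [RHS]mulrBr mulKf.
rewrite normrM normfV ler_pdivrMl ?normr_gt0// (le_trans H)//.
rewrite mulrCA ler_wpM2l// mulrAC ler_pdivrMr// ler_wpM2l ?ltW//.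
by rewrite /M ltrDr.
Unshelve. all: by end_near. Qed.

End C1.
End cV_topology.

(** * Quadratic forms and simultaneous diagonalization *)

Section quadratic_forms.
Context {R : realType}.

Lemma dotE p (u v : 'cV[R]_p) : dot u v = (u^T *m v) 0 0.
Proof. by rewrite mxE; apply: eq_bigr => i _; rewrite mxE. Qed.

Lemma qformE p (A : 'M[R]_p) (u : 'cV[R]_p) : qform A u = (u^T *m A *m u) 0 0.
Proof. by rewrite /qform dotE mulmxA. Qed.

Lemma qform_mulmx p q (A : 'M[R]_p) (B : 'M[R]_(p, q)) (u : 'cV[R]_q) :
  qform A (B *m u) = qform (B^T *m A *m B) u.
Proof. by rewrite !qformE trmx_mul !mulmxA. Qed.

Lemma qform_diag p (d : 'rV[R]_p) (u : 'cV[R]_p) :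
  qform (diag_mx d) u = \sum_i d 0 i * u i 0 ^+ 2.
Proof.
by apply: eq_bigr => i _; rewrite mul_diag_mx mxE mulrCA expr2.
Qed.

Lemma qform1 p (u : 'cV[R]_p) : qform 1%:M u = \sum_i u i 0 ^+ 2.
Proof. by apply: eq_bigr => i _; rewrite mul1mx expr2. Qed.

Lemma qform_block p (a : R) (S : 'M[R]_p) (x : R) (v : 'cV[R]_p) :
  qform (block_mx a%:M 0 0 S) (col_mx x%:M v) = a * x ^+ 2 + qform S v.
Proof.
rewrite !qformE tr_col_mx mul_row_block !mulmx0 addr0 add0r mul_row_col mxE.
by rewrite tr_scalar_mx -!scalar_mxM mxE eqxx mulr1n; congr (_ + _); ring.
Qed.

(** One symmetric elimination step. The row w is a parameter, constrained by an equation, so that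
    the same w can clear the first row and column of two matrices at once. *)
Lemma sym_elim p (M : 'M[R]_(1 + p)) (w : 'rV[R]_p) : M^T = M ->
  M 0 0 *: w + ursubmx M = 0 ->
  let E := block_mx 1%:M w 0 1%:M : 'M[R]_(1 + p) in
  exists2 S : 'M[R]_p, S^T = S & E^T *m M *m E = block_mx (M 0 0)%:M 0 0 S.
Proof.
move=> MT Mw E; set a := M 0 0 in Mw *; set b := ursubmx M in Mw.
have aE : ulsubmx M = a%:M.
  rewrite [LHS]mx11_scalar; congr (_%:M); rewrite !mxE.
  by congr (M _ _); apply/val_inj.
have bE : dlsubmx M = b^T by rewrite /b trmx_ursub MT.
have MwT : a *: w^T + b^T = 0 by rewrite -linearZ -linearD/= Mw trmx0.
set T := E^T *m M *m E.
have TT : T^T = T by rewrite /T !trmx_mul trmxK MT mulmxA.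
have TE : T = block_mx a%:M 0 0 (w^T *m b + drsubmx M).
  rewrite /T /E -[X in _ *m X *m _]submxK aE bE -/b tr_block_mx !trmx1 trmx0 !mulmx_block.
  rewrite !mul0mx !mul1mx !mulmx1 !mulmx0 !addr0 !mul_scalar_mx mul_mx_scalar Mw MwT.
  by rewrite mul0mx add0r.
exists (drsubmx T); first by rewrite trmx_drsub TT.
by rewrite TE block_mxKdr.
Qed.

Lemma posdef_congr p (A B : 'M[R]_p) : B \in unitmx -> posdef A ->
  posdef (B^T *m A *m B).
Proof.
move=> uB [AT Ap]; split; first by rewrite !trmx_mul trmxK AT mulmxA.
move=> u u0; rewrite -qform_mulmx; apply: Ap.
by apply: contra_neq u0 => Bu0; rewrite -[u](mulKmx uB) Bu0 mulmx0.
Qed.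

Lemma posdef_diag0 p (A : 'M[R]_(1 + p)) : posdef A -> 0 < A 0 0.
Proof.
case=> _ /(_ (delta_mx 0 0)); rewrite qformE trmx_delta.
rewrite -rowE -colE !mxE; apply; apply/eqP => /matrixP /(_ 0 0).
by rewrite !mxE !eqxx => /eqP; rewrite oner_eq0.
Qed.

Lemma elim_unitmx p (b : 'rV[R]_p) : (block_mx 1%:M b 0 1%:M : 'M[R]_(1 + p)) \in unitmx.
Proof. by rewrite unitmxE det_ublock !det1 mulr1 unitr1. Qed.

Lemma posdef_block p (a : R) (S : 'M[R]_p) :
  posdef (block_mx a%:M 0 0 S : 'M[R]_(1 + p)) -> posdef S.
Proof.
case=> AT Ap; split.
  have := congr1 (@drsubmx _ 1 p 1 p) AT.
  by rewrite tr_block_mx !block_mxKdr.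
move=> u u0.
have <- : qform (block_mx a%:M 0 0 S) (col_mx (0 : R)%:M u) = qform S u.
  by rewrite qform_block expr2 mul0r mulr0 add0r.
apply: Ap.
by apply: contra_neq u0 => /(congr1 dsubmx); rewrite col_mxKd linear0.
Qed.

Lemma cholesky p (A : 'M[R]_p) : posdef A ->
  exists2 B, B \in unitmx & B^T *m A *m B = 1%:M.
Proof.
elim: p A => [|p IH] A pA.
  by exists 1%:M; [exact: unitmx1|apply/matrixP => -[]].
have a0 := posdef_diag0 (pA : posdef (A : 'M[R]_(1 + p))).
pose a := (A : 'M[R]_(1 + p)) 0 0.
have [|S ST EAE] := sym_elim (w := - a^-1 *: ursubmx (A : 'M[R]_(1 + p)))
    (proj1 pA : (A : 'M[R]_(1 + p))^T = A).
  by rewrite scalerA mulrN mulfV ?gt_eqF// scaleN1r addNr.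
set E := block_mx 1%:M _ 0 1%:M in EAE.
have uE : E \in unitmx := elim_unitmx _.
have pS : posdef S by apply: (@posdef_block _ a); rewrite -EAE; exact: posdef_congr.
have [B uB BSB] := IH _ pS.
pose F : 'M[R]_(1 + p) := block_mx (Num.sqrt a)^-1%:M 0 0 B.
have sa : 0 < Num.sqrt a by rewrite sqrtr_gt0.
exists (E *m F).
  rewrite unitmx_mul uE/= unitmxE (@det_ublock _ 1) det_scalar1 unitrM unitfE.
  by rewrite invr_neq0 ?gt_eqF//= -unitmxE.
rewrite [LHS](_ : _ = F^T *m (E^T *m A *m E) *m F); last by rewrite trmx_mul !mulmxA.
rewrite EAE.
rewrite /F tr_block_mx !trmx0 tr_scalar_mx !mulmx_block !mulmx0 !mul0mx !addr0 !add0r.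
rewrite !mul0mx BSB -!scalar_mxM (_ : _ * _ = 1) ?scalar_mx_block//.
  by rewrite -scalar_mx_block.
by rewrite mulrAC -invfM -expr2 sqr_sqrtr ?ltW// mulVf ?gt_eqF.
Qed.

(** First order condition at a minimum: at t = - b / (1 + |c|) the expression is negative unless b =
    0. The 1 in the denominator covers c = 0. *)
Lemma nonneg_quadratic_eq0 (b c : R) : (forall t, 0 <= 2 * t * b + t ^+ 2 * c) -> b = 0.
Proof.
move=> H; apply/eqP/negPn/negP => b0.
have c1 : 0 < 1 + `|c| by rewrite ltr_pwDl.
have := H (- b / (1 + `|c|)).
rewrite (_ : _ + _ = - (b ^+ 2 / (1 + `|c|)) * (2 - c / (1 + `|c|))); last by field; lra.
have b2 : 0 < b ^+ 2 / (1 + `|c|) by rewrite divr_gt0// exprn_even_gt0.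
have : c / (1 + `|c|) <= 1 by rewrite ler_pdivrMr// mul1r (le_trans (ler_norm _))// lerDr.
move: (c / _) (b ^+ 2 / _) b2 => x y y0 x1; rewrite mulNr oppr_ge0 => /le_lt_trans.
have : 0 < y * (2 - x) by apply: mulr_gt0; lra.
by move=> h /(_ _ h); rewrite ltxx.
Qed.

Lemma continuous_sum_fun (T : topologicalType) (I : finType) (F : I -> T -> R) :
  (forall i, continuous (F i)) -> continuous (fun x => \sum_i F i x).
Proof.
move=> cF; rewrite (_ : (fun x => _) = \sum_i F i); last first.
  by apply/funext => x; rewrite fct_sumE.
by apply: (@big_ind _ (fun f : T -> R => continuous f)) => [x|f g cf cg x|i _];
  [exact: cvg_cst|apply: cvgD; [exact: cf|exact: cg]|exact: cF].
Qed.

(** The eigenvector maximizes the Rayleigh quotient on the unit sphere, which is compact; the first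
    variation at the maximizer r vanishes in every direction t, which says that r (l - C) = 0. *)
Lemma sym_eigenvector p (C : 'M[R]_p) : (0 < p)%N -> C^T = C ->
  exists (u : 'cV[R]_p) (l : R), u != 0 /\ C *m u = l *: u.
Proof.
move=> p0 CT.
pose q (M : 'M[R]_p) (r : 'rV[R]_p) := (r *m M *m r^T) 0 0.
have cq M : continuous (q M).
  rewrite (_ : q M = fun r => \sum_i (\sum_j r 0 j * M j i) * r 0 i); last first.
    by apply/funext => r; rewrite /q mxE; apply: eq_bigr => i _; rewrite !mxE.
  apply: continuous_sum_fun => i.
  have c1 : continuous (fun r : 'rV[R]_p => \sum_j r 0 j * M j i).
    apply: continuous_sum_fun => j s.
    by apply: continuousM; [exact: coord_continuous|exact: cst_continuous].
  by move=> r; apply: continuousM; [exact: c1|exact: coord_continuous].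
have q1 r : q 1%:M r = \sum_i r 0 i ^+ 2.
  by rewrite /q mulmx1 mxE; apply: eq_bigr => i _; rewrite mxE expr2.
pose K : set 'rV[R]_p := [set r | q 1%:M r = 1].
have K0 : K !=set0.
  exists (delta_mx 0 (Ordinal p0)); rewrite /K/= q1 (bigD1 (Ordinal p0))//= big1.
    by rewrite mxE !eqxx expr1n addr0.
  by move=> i i0; rewrite mxE (negbTE i0) andbF expr0n.
have cK : compact K.
  apply: bounded_closed_compact.
    exists 1; split => // M M1 r; rewrite /K/= q1 => r1.
    apply: (le_trans _ (ltW M1)); rewrite [leLHS]/Num.norm/= mx_normrE.
    apply: bigmax_le => // -[i j] _ /=; rewrite ord1.
    rewrite -(@ler_pXn2r _ 2%N) ?nnegrE// expr1n real_normK ?num_real// -r1.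
    by rewrite (bigD1 j)//= lerDl sumr_ge0// => k _; exact: sqr_ge0.
  rewrite (_ : K = q 1%:M @^-1` [set 1]) //.
  by apply: closed_comp; [move=> r _; exact: cq|exact: closed_eq].
have [r /set_mem rK rmax] := compact_EVT_max K0 cK (continuous_subspaceT (cq C)).
pose l := q C r.
have qZ M c s : q M (c *: s) = c ^+ 2 * q M s.
  by rewrite /q linearZ/= -!scalemxAl -scalemxAr !mxE mulrA expr2.
have le_q s : q C s <= l * q 1%:M s.
  have [s0|s0] := eqVneq (q 1%:M s) 0.
    have -> : s = 0.
      apply/rowP => i; rewrite mxE; apply/eqP; rewrite -sqrf_eq0; apply/eqP.
      move: s0; rewrite q1 => /psumr_eq0P -> // j _; exact: sqr_ge0.
    by rewrite /q mul0mx mul0mx mxE mul0mx mul0mx mxE mulr0.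
  have s1 : 0 < q 1%:M s.
    by rewrite lt_neqAle eq_sym s0 q1 sumr_ge0// => i _; exact: sqr_ge0.
  pose c := (Num.sqrt (q 1%:M s))^-1.
  have c2 : c ^+ 2 = (q 1%:M s)^-1 by rewrite exprVn sqr_sqrtr// ltW.
  have : q C (c *: s) <= q C r.
    by apply: rmax; rewrite inE /K/= qZ c2 mulVf.
  by rewrite qZ c2 mulrC ler_pdivrMr.
exists r^T, l; split.
  apply/eqP => /(congr1 trmx); rewrite trmxK trmx0 => r0.
  by move: rK; rewrite /K/= r0 /q !mul0mx mxE => /esym/eqP; rewrite oner_eq0.
have bil M s t x : M^T = M ->
    q M (s + x *: t) = q M s + 2 * x * (s *m M *m t^T) 0 0 + x ^+ 2 * q M t.
  move=> MT; rewrite /q [(s + x *: t)^T]raddfD/= [(x *: t)^T]linearZ/= !mulmxDl !mulmxDr -!scalemxAl -!scalemxAr.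
  have -> : (t *m M *m s^T) = (s *m M *m t^T)^T by rewrite !trmx_mul trmxK MT mulmxA.
  by rewrite !mxE; ring.
have key (t : 'rV[R]_p) : (r *m (l%:M - C) *m t^T) 0 0 = 0.
  apply: (@nonneg_quadratic_eq0 _ (l * q 1%:M t - q C t)) => x.
  have := le_q (r + x *: t).
  rewrite !bil ?trmx1// rK -/l => h.
  rewrite mulmxBr mulmxBl mul_mx_scalar -scalemxAl -[r in l *: (r *m _)]mulmx1.
  rewrite [in X in 2 * x * X]mxE [X in 2 * x * (X + _)]mxE [X in 2 * x * (_ + X)]mxE.
  by move: h; nra.
have rC : r *m (l%:M - C) = 0.
  by apply/rowP => i; rewrite [RHS]mxE; move: (key (delta_mx 0 i)); rewrite trmx_delta -colE mxE.
move/(congr1 trmx): rC; rewrite trmx_mul trmx0 linearB/= tr_scalar_mx CT mulmxBl.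
by rewrite mul_scalar_mx => /eqP; rewrite subr_eq0 => /eqP.
Qed.

(** After A is reduced to the identity, an eigenvector of C is completed to a basis that need not be
    orthogonal. In that basis the first columns of both matrices are proportional, so one
    elimination splits both and the induction continues on the lower blocks. *)
Theorem simultaneous_diag p (A C : 'M[R]_p) : posdef A -> C^T = C ->
  exists (B : 'M[R]_p) (d : 'rV[R]_p),
    [/\ B \in unitmx, B^T *m A *m B = 1%:M & B^T *m C *m B = diag_mx d].
Proof.
elim: p A C => [|p IH] A C pA CT.
  exists 1%:M, 0; split; [exact: unitmx1|by apply/matrixP => -[]|by apply/matrixP => -[]].
have [B0 uB0 B0A] := cholesky pA.
have [C0 C0E C0T] : exists2 C0, C0 = B0^T *m C *m B0 & C0^T = C0.
  by exists (B0^T *m C *m B0); rewrite // !trmx_mul trmxK CT mulmxA.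
have [u [l [u0 Cu]]] := sym_eigenvector (ltn0Sn p) C0T.
(* [row_ebase] completes u to a basis: the first column of P is a multiple of u. *)
pose P : 'M[R]_(1 + p) := (row_ebase u^T)^T.
have uP : P \in unitmx by rewrite unitmx_tr row_ebase_unit.
have Pe : C0 *m col 0 P = l *: col 0 P.
  have ut0 : u^T != 0 by apply: contra_neq u0 => /(congr1 trmx); rewrite trmxK trmx0.
  have := mulmx_ebase u^T; rewrite rank_rV ut0/= => uE.
  have : u = (col_ebase u^T) 0 0 *: col 0 P.
    apply: (can_inj trmxK); rewrite -{1}uE [in LHS](mx11_scalar (col_ebase _)) -mulmxA mul_scalar_mx [RHS]linearZ/=.
    congr (_ *: _); apply/rowP => i; rewrite [LHS]mxE (bigD1 0)//= big1.
      by rewrite !mxE eqxx mul1r addr0.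
    by move=> [[|k] kp] // _; rewrite mxE /= mul0r.
  set c := (col_ebase _) 0 0 => uc.
  have c0 : c != 0 by apply: contra_neq u0 => c0; rewrite uc c0 scale0r.
  move: Cu; rewrite uc -scalemxAr scalerA mulrC -scalerA => /(scalerI c0).
  exact.
pose A1 : 'M[R]_(1 + p) := P^T *m P; pose C1 : 'M[R]_(1 + p) := P^T *m C0 *m P.
have pA1 : posdef A1.
  have := posdef_congr uP (_ : posdef (1%:M : 'M[R]_(1 + p))); rewrite mulmx1; apply.
  split; first exact: trmx1.
  move=> v v0; rewrite qform1 lt_neqAle sumr_ge0 ?andbT; last by move=> i _; exact: sqr_ge0.
  apply: contra_neq v0 => /esym /psumr_eq0P vE; apply/colP => i; rewrite mxE.
  by apply/eqP; rewrite -sqrf_eq0; apply/eqP/vE => // j _; exact: sqr_ge0.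
have C1col : col 0 C1 = l *: col 0 A1.
  by rewrite colE in Pe; rewrite /C1 /A1 !colE -(mulmxA (P^T *m C0)) -(mulmxA P^T C0) Pe -scalemxAr mulmxA.
have C1T : C1^T = C1 by rewrite /C1 !trmx_mul trmxK C0T mulmxA.
have a0 := posdef_diag0 pA1.
pose a := A1 0 0; pose w := - a^-1 *: ursubmx A1.
have Aw : a *: w + ursubmx A1 = 0.
  by rewrite scalerA mulrN mulfV ?gt_eqF// scaleN1r addNr.
have C1E i : C1 i 0 = l * A1 i 0.
  by have := congr1 (fun M : 'cV[R]_p.+1 => M i 0) C1col; rewrite !mxE.
(* The first column of C1 is l times that of A1, so the w chosen for A1 also clears C1. *)
have Cw : C1 0 0 *: w + ursubmx C1 = 0.
  rewrite C1E -[ursubmx C1]trmxK trmx_ursub C1T (_ : dlsubmx C1 = l *: dlsubmx A1).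
    by rewrite [(l *: _)^T]linearZ/= trmx_dlsub (proj1 pA1) -scalerA -scalerDr Aw scaler0.
  have dlE (M : 'M[R]_(1 + p)) i : dlsubmx M i 0 = M (rshift 1 i) ord0.
    by rewrite !mxE; congr (M _ _); exact/val_inj.
  by apply/colP => i; rewrite [RHS]mxE !dlE C1E.
have [S ST EA] := sym_elim (proj1 pA1) Aw.
have [S' S'T EC] := sym_elim C1T Cw.
set E := block_mx 1%:M _ 0 1%:M in EA EC.
have uE : E \in unitmx := elim_unitmx _.
have pS : posdef S by apply: (@posdef_block _ a); rewrite -EA; exact: posdef_congr.
have [B [d [uB BS BS']]] := IH _ _ pS S'T.
have sa : 0 < Num.sqrt a by rewrite sqrtr_gt0.
pose F : 'M[R]_(1 + p) := block_mx (Num.sqrt a)^-1%:M 0 0 B.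
have FE x y (X Y : 'M[R]_p) : B^T *m X *m B = Y -> a^-1 * x = y ->
    F^T *m block_mx x%:M 0 0 X *m F = block_mx y%:M 0 0 Y.
  move=> <- <-; rewrite /F tr_block_mx !trmx0 tr_scalar_mx !mulmx_block !mulmx0 !mul0mx.
  rewrite !addr0 !add0r !mul0mx -!scalar_mxM; congr (block_mx _%:M _ _ _).
  by rewrite mulrAC -invfM -expr2 sqr_sqrtr// ltW.
exists (B0 *m (P *m (E *m F))), (row_mx l%:M d); split.
- rewrite !unitmx_mul uB0 uP uE/= unitmxE (@det_ublock _ 1) det_scalar1 unitrM unitfE.
  by rewrite invr_neq0 ?gt_eqF//= -unitmxE.
- rewrite [LHS](_ : _ = F^T *m (E^T *m (P^T *m (B0^T *m A *m B0) *m P) *m E) *m F); last first.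
    by rewrite !trmx_mul !mulmxA.
  rewrite B0A mulmx1 EA.
  by rewrite (FE _ _ _ _ BS (mulVf _)) ?gt_eqF// -scalar_mx_block.
- rewrite [LHS](_ : _ = F^T *m (E^T *m C1 *m E) *m F); last first.
    by rewrite /C1 C0E !trmx_mul !mulmxA.
  rewrite EC.
  rewrite (FE _ l _ _ BS'); last by rewrite C1E mulrCA mulVf ?mulr1// gt_eqF.
  have h := diag_mx_row (l%:M : 'rV[R]_1) d.
  apply: (etrans _ (esym h)); congr block_mx.
  by apply/matrixP => i j; rewrite !mxE !ord1.
Qed.

End quadratic_forms.

Ltac meas1 := lazymatch goal with
  | |- measurable_fun _ (fun x => (@?f x)%:E) => apply/measurable_EFinP
  | |- measurable_fun _ (EFin \o _) => apply/measurable_EFinP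
  | |- measurable_fun _ (fun x => expR (@?f x)) => apply: measurableT_comp
  | |- measurable_fun _ (fun x => cos (@?f x)) => apply: measurableT_comp
  | |- measurable_fun _ (fun x => `|(@?f x)|%R) => apply: measurableT_comp
  | |- measurable_fun _ (fun x => (- (@?f x))%R) => apply: measurable_funN
  | |- measurable_fun _ (fun x => ((@?f x) - (@?g x))%R) => apply: measurable_funB
  | |- measurable_fun _ (fun x => ((@?f x) + (@?g x))%R) => apply: measurable_funD
  | |- measurable_fun _ (fun x => ((@?f x) * (@?g x))%R) => apply: measurable_funM
  | |- measurable_fun _ (fun x => ((@?f x) ^+ _)%R) => apply: measurable_funX
  | |- measurable_fun _ (fun x => (\sum_(i <- _ | _) (@?f x i))%R) => apply: measurable_sum => ?
  | |- measurable_fun _ (fun x => (\prod_(i <- _ | _) (@?f x i))%R) => apply: measurable_prod => ? _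
  | |- measurable_fun _ (fun x => fun_of_matrix x _ _) => exact: measurable_cV_component
  end.
Ltac meas := repeat first [ done | meas1 ].

(** * Integrals against a measure given by a density *)

Section density.
Context d (T : measurableType d) (R : realType).
Variables (mu nu : {measure set T -> \bar R}) (g : T -> \bar R).
Hypotheses (mg : measurable_fun setT g) (g0 : forall x, (0 <= g x)%E).
Hypothesis gfin : forall x, g x \is a fin_num.
Hypothesis nuE : forall A, measurable A -> nu A = (\int[mu]_(x in A) g x)%E.
Local Open Scope ereal_scope.
Import HBNNSimple.

(** The hypothesis [nuE] is the case of indicators; simple functions follow by linearity and the
    general case by monotone convergence of [nnsfun_approx]. *)
Lemma ge0_integral_density f : measurable_fun setT f -> (forall x, 0 <= f x) ->
  \int[nu]_x f x = \int[mu]_x (f x * g x).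
Proof.
move=> mf f0; pose h := nnsfun_approx measurableT mf.
have hf x : (h n x)%:E @[n --> \oo] --> f x by apply: cvg_nnsfun_approx.
have mh n : measurable_fun setT (EFin \o h n) by exact/measurable_EFinP.
have hnd x m n : (m <= n)%N -> (h m x <= h n x)%R by move=> mn; exact/lefP/nd_nnsfun_approx.
have E1 : \int[nu]_x f x = limn (fun n => \int[nu]_x (h n x)%:E).
  rewrite -monotone_convergence//.
  - by apply: eq_integral => x _; apply/esym/cvg_lim.
  - by move=> n x _; rewrite lee_fin.
  - by move=> x _ m n mn; rewrite lee_fin hnd.
have E2 : \int[mu]_x (f x * g x) = limn (fun n => \int[mu]_x ((h n x)%:E * g x)).
  rewrite -monotone_convergence//.
  - apply: eq_integral => x _; apply/esym/cvg_lim => //.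
    by apply: cvgeZr; [exact: gfin|exact: hf].
  - by move=> n; apply: emeasurable_funM => //; exact: mh.
  - by move=> n x _; rewrite mule_ge0// lee_fin.
  - by move=> x _ m n mn; rewrite lee_wpmul2r// lee_fin hnd.
rewrite E1 E2; congr (limn _); apply/funext => n.
transitivity (\int[nu]_x (\sum_(y \in range (h n)) (y * \1_(h n @^-1` [set y]) x)%:E)).
  by apply: eq_integral => x _; rewrite /= fimfunE -fsumEFin.
rewrite ge0_integral_fsum//; last 2 first.
- by move=> y; exact/measurable_EFinP/measurable_funM.
- by move=> y x _; exact: nnfun_muleindic_ge0.
transitivity (\int[mu]_x (\sum_(y \in range (h n)) (y * \1_(h n @^-1` [set y]) x)%:E * g x)).
  rewrite ge0_integral_fsum//; last 2 first.
  - by move=> y; apply: emeasurable_funM => //; exact/measurable_EFinP/measurable_funM.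
  - by move=> y x _; rewrite mule_ge0// nnfun_muleindic_ge0.
  apply: eq_fsbigr => y _; rewrite integralZl_indic_nnsfun//.
  rewrite integral_indic// setIT nuE//.
  under [RHS]eq_integral do rewrite EFinM -muleA.
  have [y0|y0] := leP 0%R y; last first.
    rewrite preimage_nnfun0// integral_set0 mule0 integral0_eq// => x _.
    by rewrite indic0 mul0e mule0.
  rewrite ge0_integralZl//; last 2 first.
  - by apply: emeasurable_funM => //; exact/measurable_EFinP.
  - by move=> x _; rewrite mule_ge0// lee_fin.
  congr (_ * _); rewrite integral_mkcond; apply: eq_integral => x _.
  by rewrite patchE indicE; case: ifPn => _; rewrite ?mul1e ?mul0e.
apply: eq_integral => x _; rewrite -ge0_mule_fsuml => [|y]; last exact: nnfun_muleindic_ge0.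
by rewrite fsumEFin// -fimfunE.
Qed.

End density.

(** * The standard Gaussian law on the line *)

Section std_normal.
Context {R : realType}.
Local Notation mu := (@lebesgue_measure R).
Definition phi1 (x : R) : R := (Num.sqrt (2 * pi))^-1 * expR (- (x ^+ 2 / 2)).

Lemma phi1E : normal_pdf 0 1 = phi1.
Proof.
rewrite normal_pdfE ?oner_neq0//; apply/funext => x; rewrite /normal_peak /normal_fun /phi1.
by rewrite expr1n mul1r subr0 -mulr_natl mulNr.
Qed.

Lemma phi1_gt0 x : 0 < phi1 x.
Proof. by rewrite mulr_gt0 ?expR_gt0// invr_gt0 sqrtr_gt0 mulr_gt0// pi_gt0. Qed.

Lemma measurable_phi1 : measurable_fun setT phi1.
Proof. by rewrite -phi1E; exact: measurable_normal_pdf. Qed.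

Definition gauss1 := @normal_prob R 0 1.
HB.instance Definition _ := Probability.on gauss1.

Local Open Scope ereal_scope.

Lemma integral_phi1 : \int[mu]_x (phi1 x)%:E = 1.
Proof. by rewrite -phi1E integral_normal_pdf. Qed.

Lemma integral_gauss1 f : measurable_fun setT f -> (forall x, 0 <= f x) ->
  \int[gauss1]_x f x = \int[mu]_x (f x * (phi1 x)%:E).
Proof.
move=> mf f0; apply: (@ge0_integral_density _ _ R mu gauss1 (fun x => (phi1 x)%:E)) => //.
- by apply/measurable_EFinP; exact: measurable_phi1.
- by move=> x; rewrite lee_fin ltW// phi1_gt0.
- by move=> A mA; rewrite -phi1E.
Qed.

Lemma gauss1_mgf (a m : R) : (m < 1)%R ->
  \int[gauss1]_x (expR (a * x + m * (x ^+ 2 / 2)))%:E =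
  ((Num.sqrt (1 - m))^-1 * expR (a ^+ 2 / (2 * (1 - m))))%:E.
Proof.
move=> m1; have s0 : (0 < 1 - m)%R by rewrite subr_gt0.
pose s := Num.sqrt (1 - m); have sp : (0 < s)%R by rewrite sqrtr_gt0.
have s2 : (s ^+ 2 = 1 - m)%R by rewrite sqr_sqrtr// ltW.
rewrite integral_gauss1//; last by meas.
(* Completing the square: with s^2 = 1 - m, a x + m x^2 / 2 - x^2 / 2 equals a^2 / (2 s^2) - (s x -
   a / s)^2 / 2, and s x - a / s is an affine change of variable. *)
have E x : ((expR (a * x + m * (x ^+ 2 / 2)))%:E * (phi1 x)%:E =
    (expR (a ^+ 2 / (2 * (1 - m))))%:E * (phi1 (s * x + - (a / s)))%:E).
  rewrite -!EFinM /phi1; congr EFin; rewrite mulrCA [RHS]mulrCA -!expRD.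
  congr (_ * expR _)%R; rewrite -s2; have -> : m = (1 - s ^+ 2)%R by rewrite s2; ring.
  by field; rewrite gt_eqF.
under eq_integral do rewrite E.
rewrite ge0_integralZl//; last 2 first.
- by apply/measurable_EFinP; apply: (measurableT_comp measurable_phi1); meas.
- by move=> x _; rewrite lee_fin ltW// phi1_gt0.
have mphi1 : measurable_fun setT (fun x => (phi1 x)%:E).
  by apply/measurable_EFinP; exact: measurable_phi1.
have := lebesgue_affine (- (a / s)) (lt0r_neq0 sp) mphi1.
rewrite integral_phi1 gtr0_norm// => /(_ (fun x => ltW (phi1_gt0 x))) H.
rewrite (mulrC ((Num.sqrt (1 - m))^-1)%R) EFinM; congr (_ * _); set I := integral _ _ _ in H *.
have : (s^-1)%:E * (s%:E * I) = (s^-1)%:E by rewrite H mule1.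
by rewrite muleA -EFinM mulVf ?gt_eqF// mul1e.
Qed.

End std_normal.

(** * The standard Gaussian law on R^p and its product structure *)

Section gauss_cV.
Context {R : realType}.
Local Notation leb := (@lebesgue_cV R).
Local Notation mu := (@lebesgue_measure R).

Lemma cV_cons0 p (x : R) (v : 'cV[R]_p) : cV_cons (x, v) ord0 0 = x.
Proof.
rewrite /cV_cons/= -[RHS](mulr1n x) (_ : _ *+ 1 = x%:M (0 : 'I_1) (0 : 'I_1)); last first.
  by rewrite mxE eqxx.
by rewrite -[RHS](col_mxEu _ v); congr (col_mx _ _ _ _); exact/val_inj.
Qed.

Lemma cV_consS p (x : R) (v : 'cV[R]_p) i : cV_cons (x, v) (lift ord0 i) 0 = v i 0.
Proof.
rewrite /cV_cons/= -[RHS](col_mxEd (x%:M : 'M[R]_1)).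
by congr (col_mx _ _ _ _); exact/val_inj.
Qed.

Definition phi p (v : 'cV[R]_p) : R := \prod_i phi1 (v i 0).

Lemma phi_cons p x (v : 'cV[R]_p) : phi (cV_cons (x, v)) = phi1 x * phi v.
Proof.
rewrite /phi big_ord_recl cV_cons0; congr (_ * _).
by apply: eq_bigr => i _; rewrite cV_consS.
Qed.

Lemma phiE p (v : 'cV[R]_p) :
  phi v = (Num.sqrt ((2 * pi) ^+ p))^-1 * expR (- ((\sum_i v i 0 ^+ 2) / 2)).
Proof.
rewrite /phi big_split/= prodr_const card_ord; congr (_ * _).
  have : 0 <= 2 * pi :> R by rewrite mulr_ge0// pi_ge0.
  rewrite exprVn; move: (2 * pi) => x x0; congr (_^-1).
  elim: (p) => [|q IH]; first by rewrite !expr0 sqrtr1.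
  by rewrite !exprS IH sqrtrM.
by rewrite -expR_sum mulr_suml -sumrN.
Qed.

Lemma phi_gt0 p (v : 'cV[R]_p) : 0 < phi v.
Proof. by apply: prodr_gt0 => i _; exact: phi1_gt0. Qed.

Lemma measurable_phi p : measurable_fun setT (@phi p).
Proof.
apply: measurable_prod => i _; apply: (measurableT_comp measurable_phi1).
exact: measurable_cV_component.
Qed.

Local Open Scope ereal_scope.

Lemma integral_phi p : \int[leb p]_v (phi v)%:E = 1.
Proof.
elim: p => [|p IH].
  transitivity (\int[leb 0]_v (cst 1 v : \bar R)).
    by apply: eq_integral => v _; rewrite /phi big_ord0.
  by rewrite integral_cst//= diracT mule1.
rewrite lebesgue_cV_rec; last 2 first.
- by apply/measurable_EFinP; exact: measurable_phi.
- by move=> v; rewrite lee_fin ltW// phi_gt0.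
rewrite -integral_phi1; apply: eq_integral => x _.
under eq_integral do rewrite phi_cons EFinM.
rewrite ge0_integralZl ?IH ?mule1//.
- by apply/measurable_EFinP; exact: measurable_phi.
- by move=> v _; rewrite lee_fin ltW// phi_gt0.
- by rewrite lee_fin ltW// phi1_gt0.
Qed.

Definition gaussN p (A : set 'cV[R]_p) : \bar R := \int[leb p]_(v in A) (phi v)%:E.

Section inst.
Variable p : nat.

Let integrable_phi : (leb p).-integrable setT (fun v => (phi v)%:E).
Proof.
apply/integrableP; split.
  by apply/measurable_EFinP; exact: measurable_phi.
under eq_integral do rewrite gee0_abs ?lee_fin ?ltW ?phi_gt0//.
by rewrite integral_phi ltry.
Qed.

Let gaussN0 : @gaussN p set0 = 0.
Proof. by rewrite /gaussN integral_set0. Qed.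

Let gaussN_ge0 A : 0 <= @gaussN p A.
Proof. by apply: integral_ge0 => v _; rewrite lee_fin ltW// phi_gt0. Qed.

Let gaussN_sigma_additive : semi_sigma_additive (@gaussN p).
Proof.
move=> A mA tA mUA; rewrite /gaussN integral_bigcup//=; last first.
  by apply: (integrableS _ _ (subsetT _)) => //; exact: integrable_phi.
apply: is_cvg_ereal_nneg_natsum_cond => n _ _.
by apply: integral_ge0 => v _; rewrite lee_fin ltW// phi_gt0.
Qed.

HB.instance Definition _ := isMeasure.Build _ _ _ (@gaussN p)
  gaussN0 gaussN_ge0 gaussN_sigma_additive.

Let gaussNT : @gaussN p setT = 1.
Proof. exact: integral_phi. Qed.

HB.instance Definition _ := @Measure_isProbability.Build _ _ R (@gaussN p) gaussNT.

End inst.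

Lemma integral_gaussN p f : measurable_fun setT f -> (forall v, 0 <= f v) ->
  \int[@gaussN p]_v f v = \int[leb p]_v (f v * (phi v)%:E).
Proof.
move=> mf f0.
apply: (@ge0_integral_density _ _ R (leb p) (@gaussN p) (fun v => (phi v)%:E)) => //.
- by apply/measurable_EFinP; exact: measurable_phi.
- by move=> v; rewrite lee_fin ltW// phi_gt0.
Qed.

Section gaussN_rec.
Variables (p : nat) (F : 'cV[R]_p.+1 -> \bar R).
Hypotheses (mF : measurable_fun setT F) (F0 : forall v, 0 <= F v).

Let mphi q : measurable_fun setT (fun v : 'cV[R]_q => (phi v)%:E).
Proof. by apply/measurable_EFinP; exact: measurable_phi. Qed.

Let phi0 q (v : 'cV[R]_q) : 0 <= (phi v)%:E.
Proof. by rewrite lee_fin ltW// phi_gt0. Qed.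

Let phi10 (x : R) : 0 <= (phi1 x)%:E.
Proof. by rewrite lee_fin ltW// phi1_gt0. Qed.

Lemma gaussN_rec_swap : \int[@gaussN p.+1]_v F v =
  \int[@gaussN p]_v \int[gauss1]_x F (cV_cons (x, v)).
Proof.
have mI : measurable_fun setT (fun v : 'cV[R]_p => \int[gauss1]_x F (cV_cons (x, v))).
  apply: (@measurable_fun_fubini_tonelli_G _ _ _ _ R gauss1 (F \o @cV_cons R p)) => //=.
  by apply: measurableT_comp => //; exact: measurable_cV_cons.
rewrite integral_gaussN// lebesgue_cV_rec_swap; last 2 first.
- by apply: emeasurable_funM => //; exact: mphi.
- by move=> v; rewrite mule_ge0.
rewrite integral_gaussN//; last by move=> v; exact: integral_ge0.
apply: eq_integral => v _.
rewrite integral_gauss1//; last exact: measurable_cV_cons_slice2.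
rewrite -ge0_integralZr//.
- by apply: eq_integral => x _; rewrite phi_cons EFinM muleA.
- apply: emeasurable_funM; first exact: measurable_cV_cons_slice2.
  by apply/measurable_EFinP; exact: measurable_phi1.
- by move=> x _; rewrite mule_ge0.
Qed.

Lemma gaussN_rec : \int[@gaussN p.+1]_v F v =
  \int[gauss1]_x \int[@gaussN p]_v F (cV_cons (x, v)).
Proof.
rewrite gaussN_rec_swap; apply/esym.
apply: (@fubini_tonelli _ _ _ _ R gauss1 (@gaussN p) (F \o @cV_cons R p)) => [|z]; last exact: F0.
by apply: measurableT_comp => //; exact: measurable_cV_cons.
Qed.

End gaussN_rec.

Lemma gaussN_prod p (h : 'I_p -> R -> R) (c : 'I_p -> R) :
  (forall i, measurable_fun setT (h i)) -> (forall i x, 0 <= h i x)%R ->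
  (forall i, \int[gauss1]_x (h i x)%:E = (c i)%:E) ->
  \int[@gaussN p]_v (\prod_i h i (v i 0%R))%:E = (\prod_i c i)%:E.
Proof.
elim: p h c => [|p IH] h c mh h0 hc.
  transitivity (\int[@gaussN 0]_v (cst 1 v : \bar R)).
    by apply: eq_integral => v _; rewrite big_ord0.
  by rewrite integral_cst//= probability_setT mule1 big_ord0.
rewrite gaussN_rec; last 2 first.
- apply/measurable_EFinP/measurable_prod => i _.
  by apply: (measurableT_comp (mh i)); exact: measurable_cV_component.
- by move=> v; rewrite lee_fin prodr_ge0.
rewrite big_ord_recl EFinM -hc.
rewrite -(IH (fun i => h (lift ord0 i)) (fun i => c (lift ord0 i)))//.
set I := (X in _ = _ * X).
have I0 : 0 <= I by apply: integral_ge0 => v _; rewrite lee_fin prodr_ge0.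
rewrite -ge0_integralZr//; last 2 first.
- by apply/measurable_EFinP; exact: mh.
- by move=> x _; rewrite lee_fin.
apply: eq_integral => x _; rewrite /I -ge0_integralZl//.
- apply: eq_integral => v _; rewrite big_ord_recl cV_cons0 EFinM.
  by congr (_ * _%:E); apply: eq_bigr => i _; rewrite cV_consS.
- apply/measurable_EFinP/measurable_prod => i _.
  by apply: (measurableT_comp (mh _)); exact: measurable_cV_component.
- by move=> v _; rewrite lee_fin prodr_ge0.
- by rewrite lee_fin.
Qed.

Lemma gaussN_mgf p (a m : 'I_p -> R) : (forall i, m i < 1)%R ->
  \int[@gaussN p]_v (expR (\sum_i (a i * v i 0%R + m i * (v i 0%R ^+ 2 / 2))))%:E =
  (\prod_i (Num.sqrt (1 - m i))^-1 * expR (\sum_i a i ^+ 2 / (2 * (1 - m i))))%:E.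
Proof.
move=> m1; under eq_integral do rewrite expR_sum.
rewrite (@gaussN_prod _ (fun i x => expR (a i * x + m i * (x ^+ 2 / 2)))
  (fun i => (Num.sqrt (1 - m i))^-1 * expR (a i ^+ 2 / (2 * (1 - m i))))%R).
- by rewrite big_split/= expR_sum.
- move=> i; apply: measurableT_comp => //.
  by apply: measurable_funD; apply: measurable_funM => //; apply: measurable_funM.
- by move=> i x; exact: expR_ge0.
- by move=> i; exact: gauss1_mgf.
Qed.

End gauss_cV.

(** * Series of functions with geometrically decaying integrals *)

Section series.
Context d (X : measurableType d) (R : realType) (mu : {measure set X -> \bar R}).
Local Open Scope ereal_scope.

Lemma nneseries_geometric (a q : R) : (0 <= a)%R -> (0 <= q < 1)%R ->
  \sum_(0 <= k <oo) (a * q ^+ k)%:E = (a / (1 - q))%:E.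
Proof.
move=> a0 /andP[q0 q1].
have /cvg_geometric_series H : (`|q| < 1)%R by rewrite ger0_norm.
apply/cvg_lim => //.
rewrite (_ : (fun n => _) = EFin \o series (geometric a q)); last first.
  by apply/funext => n; rewrite /= /series/= sumEFin.
by apply/cvg_EFin; [exact: nearW|exact: H].
Qed.

(** The layers of large psi and the shells outside the ellipsoid are both summed in this form. [Z]
    is an extended real because the mean of T may be infinite. *)
Lemma integral_geometric_le (F : nat -> X -> \bar R) (a q : R) (Z : \bar R) :
  (forall k, measurable_fun setT (F k)) -> (forall k x, 0 <= F k x) ->
  (0 <= a)%R -> (0 <= q < 1)%R -> 0 <= Z ->
  (forall k, \int[mu]_x F k x <= (a * q ^+ k)%:E * Z) ->
  \int[mu]_x (\sum_(0 <= k <oo) F k x) <= (a / (1 - q))%:E * Z.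
Proof.
move=> mF F0 a0 q01 Z0 H; have /andP[q0 q1] := q01.
have gq k : 0 <= (a * q ^+ k)%:E by rewrite lee_fin mulr_ge0// exprn_ge0.
rewrite integral_nneseries//; apply: lime_le.
  by apply: is_cvg_nneseries => k _ _; apply: integral_ge0 => x _; exact: F0.
apply: nearW => n; apply: (@le_trans _ _ (\sum_(0 <= k < n) ((a * q ^+ k)%:E * Z))).
  by apply: lee_sum => k _; exact: H.
rewrite -ge0_sume_distrl//; apply: lee_wpmul2r => //.
by rewrite -nneseries_geometric//; apply: nneseries_lim_ge.
Qed.

Lemma nneseries_ge_term (F : nat -> \bar R) k : (forall n, 0 <= F n) ->
  F k <= \sum_(0 <= n <oo) F n.
Proof.
move=> F0; apply: le_trans (nneseries_lim_ge k.+1 _); last by [].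
by rewrite big_nat_recr//= leeDr// sume_ge0.
Qed.

Lemma le_integralT (f g : X -> \bar R) : measurable_fun setT f ->
  measurable_fun setT g -> (forall x, 0 <= f x) -> (forall x, f x <= g x) ->
  \int[mu]_x f x <= \int[mu]_x g x.
Proof. by move=> mf mg f0 fg; apply: ge0_le_integral => // x _; exact: le_trans (fg x). Qed.

End series.

(** * Gaussian means of quadratic forms in terms of their trace *)

Section quad.
Context {R : realType}.

(** Concavity of ln between 1 - m and 1. It replaces a sum over eigenvalues l_i of ln (1 - m l_i) by
    the trace times ln (1 - m), so that bounds depend on P only. *)
Lemma ln_convex (m l : R) : 0 <= l <= 1 -> m < 1 -> l * ln (1 - m) <= ln (1 - m * l).
Proof.
move=> l01 m1; have /andP[l0 l1] := l01.
have H := @concave_ln R (@Itv01 _ l l0 l1) (1 - m) 1.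
have := H ltac:(lra) ltac:(lra).
rewrite !convRE/= ln1 mulr0 addr0 => /le_trans; apply.
by rewrite le_eqVlt; apply/orP; left; apply/eqP; congr ln; rewrite /unstable.onem; ring.
Qed.


Definition quad p (l : 'I_p -> R) (v : 'cV[R]_p) : R := \sum_i l i * v i 0 ^+ 2.

Lemma measurable_quad p (l : 'I_p -> R) : measurable_fun setT (quad l).
Proof. by rewrite /quad; meas. Qed.

Lemma quad_ge0 p (l : 'I_p -> R) v : (forall i, 0 <= l i) -> 0 <= quad l v.
Proof. by move=> l0; apply: sumr_ge0 => i _; rewrite mulr_ge0// sqr_ge0. Qed.

Lemma quadZ p (l : 'I_p -> R) c v : quad l (c *: v) = c ^+ 2 * quad l v.
Proof. by rewrite /quad mulr_sumr; apply: eq_bigr => i _; rewrite mxE; ring. Qed.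

Lemma inv_sqrt_expR (y : R) : 0 < y -> (Num.sqrt y)^-1 = expR (- (ln y / 2)).
Proof.
move=> y0; rewrite expRN; congr (_^-1); apply/eqP.
rewrite -(@eqrXn2 _ 2)// ?sqrtr_ge0 ?expR_ge0// sqr_sqrtr ?ltW// -expRM_natl.
by rewrite (mulrC 2) divfK ?pnatr_eq0// lnK.
Qed.

Local Open Scope ereal_scope.

Lemma gaussN_quad_mgf p (l : 'I_p -> R) (m : R) : (forall i, 0 <= l i <= 1)%R ->
  (0 <= m < 1)%R ->
  \int[@gaussN R p]_v (expR (m * (quad l v / 2)))%:E <=
  (expR (- (\sum_i l i) / 2 * ln (1 - m)))%:E.
Proof.
move=> l01 /andP[m0 m1].
have lt1 i : (m * l i < 1)%R.
  by have /andP[a b] := l01 i; rewrite (le_lt_trans _ m1)// ler_piMr.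
have := @gaussN_mgf R p (fun=> 0%R) (fun i => m * l i)%R lt1.
rewrite (eq_integral (fun v => (expR (m * (quad l v / 2)))%:E)); last first.
  move=> v _; congr (expR _)%:E; rewrite /quad mulr_suml mulr_sumr.
  by apply: eq_bigr => i _; ring.
move=> ->; rewrite lee_fin.
rewrite (big1 (op := +%R)) => [|i _]; last by rewrite expr0n mul0r.
rewrite expR0 mulr1 (eq_bigr (fun i => expR (- (ln (1 - m * l i) / 2)))); last first.
  by move=> i _; rewrite inv_sqrt_expR ?subr_gt0.
rewrite -expR_sum ler_expR (_ : - _ / 2 * _ = \sum_i - (l i * ln (1 - m) / 2))%R; last first.
  by rewrite sumrN -!mulr_suml; ring.
by apply: ler_sum => i _; rewrite lerN2 ler_pM2r ?invr_gt0//; exact: ln_convex.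
Qed.


Definition scalev p (s : 'I_p -> R) (v : 'cV[R]_p) : 'cV[R]_p := \col_i (s i * v i 0)%R.

Lemma scalevE p (s : 'I_p -> R) v : scalev s v = (diag_mx (\row_i s i) *m v)%R.
Proof.
by apply/matrixP => i j; rewrite mul_diag_mx !mxE (ord1 j).
Qed.

Lemma measurable_scalev p (s : 'I_p -> R) : measurable_fun setT (scalev s).
Proof.
by rewrite (_ : scalev s = mulmx (diag_mx (\row_i s i)));
  [exact: measurable_mulmx|apply/funext => v; exact: scalevE].
Qed.

(** The exponential weight is the ratio of the Gaussian densities at [scalev s v] and at v; after
    the linear change of variables only the determinant is left. *)
Lemma gaussN_scalev p (s : 'I_p -> R) (T : 'cV[R]_p -> R) : (forall i, 0 < s i)%R ->
  measurable_fun setT T -> (forall v, 0 <= T v)%R ->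
  \int[@gaussN R p]_v (T (scalev s v) *
    expR ((\sum_i v i 0 ^+ 2) / 2 - (\sum_i scalev s v i 0 ^+ 2) / 2))%:E =
  ((\prod_i s i)^-1)%:E * \int[@gaussN R p]_v (T v)%:E.
Proof.
move=> s0 mT T0.
have mTs : measurable_fun setT (fun v => T (scalev s v)).
  by apply: (measurableT_comp mT); exact: measurable_scalev.
have mss : measurable_fun setT (fun v : 'cV[R]_p => \sum_i scalev s v i 0%R ^+ 2)%R.
  rewrite (_ : (fun v => _) = (fun v : 'cV[R]_p => \sum_i (s i * v i 0) ^+ 2)%R); last first.
    by apply/funext => v; apply: eq_bigr => i _; rewrite mxE.
  by meas.
have P0 : (0 < \prod_i s i)%R by exact: prodr_gt0.
have dE : \det (diag_mx (\row_i s i)) = (\prod_i s i)%R.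
  by rewrite det_diag; apply: eq_bigr => i _; rewrite mxE.
rewrite !integral_gaussN; first last.
- by move=> v; rewrite lee_fin mulr_ge0// expR_ge0.
- by apply/measurable_EFinP; apply: measurable_funM => //; meas.
- by move=> v; rewrite lee_fin.
- exact/measurable_EFinP.
rewrite -(@lebesgue_cV_linear R p (diag_mx (\row_i s i)) _ (fun v => (T v)%:E * (phi v)%:E)).
- rewrite dE ger0_norm ?ltW// muleA -EFinM mulVf ?gt_eqF// mul1e.
  apply: eq_integral => v _; rewrite -scalevE -!EFinM -mulrA; congr (_ * _)%:E.
  rewrite !phiE mulrCA -expRD; congr (_ * expR _)%R; ring.
- by rewrite dE gt_eqF.
- apply: emeasurable_funM; first exact/measurable_EFinP.
  by apply/measurable_EFinP; exact: measurable_phi.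
- by move=> v; rewrite mule_ge0// lee_fin// ltW// phi_gt0.
Qed.
End quad.

(** * Rational certificates for exponentials; the exponent of the radius *)

Section exp_bounds.
Context {R : realType}.
Implicit Types x y : R.

Lemma expR_ge_pow n x : - n.+1%:R <= x -> (1 + x / n.+1%:R) ^+ n.+1 <= expR x.
Proof.
move=> xn; rewrite -[in leRHS](divfK (_ : n.+1%:R != 0) x) ?pnatr_eq0//.
rewrite expRM_natr lerXn2r ?nnegrE ?expR_ge0 ?expR_ge1Dx//.
by rewrite -lerBlDl sub0r ler_pdivlMr ?ltr0n// mulN1r.
Qed.

Lemma expRN_le_pow n x : 0 <= x -> expR (- x) <= ((1 + x / n.+1%:R) ^+ n.+1)^-1.
Proof.
move=> x0; rewrite expRN lef_pV2 ?posrE ?expR_gt0 ?exprn_gt0//; last first.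
  by rewrite ltr_pwDl// divr_ge0.
by apply: expR_ge_pow; rewrite (le_trans _ x0)// oppr_le0.
Qed.

(** Turns a numerical bound on e^-x into a polynomial inequality between rationals, from 1 + y <=
    e^y raised to the power n + 1; n is chosen at each use according to the accuracy required. *)
Lemma expRN_le_num n x c : 0 <= x -> 0 < c ->
  1 <= c * (1 + x / n.+1%:R) ^+ n.+1 -> expR (- x) <= c.
Proof.
move=> x0 c0 h; apply: le_trans (expRN_le_pow n x0) _.
by rewrite -[leLHS]mul1r ler_pdivrMr// exprn_gt0// ltr_pwDl// divr_ge0.
Qed.

Lemma expR_le_num n x c : 0 < c -> x <= n.+1%:R ->
  1 <= c * (1 - x / n.+1%:R) ^+ n.+1 -> expR x <= c.
Proof.
move=> c0 xn h; rewrite -[x]opprK expRN -[leLHS]mul1r ler_pdivrMr ?expR_gt0//.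
apply: (le_trans h); rewrite ler_pM2l//.
by apply: le_trans (@expR_ge_pow n (- x) _); rewrite ?mulNr// lerN2.
Qed.

Lemma ratio_le (a b c q k : R) : 0 <= a -> a <= b -> c <= q -> 0 <= k ->
  1 <= k * (1 - q) -> a / (1 - c) <= b * k.
Proof.
move=> a0 ab cq k0 kq.
have q1 : 0 < 1 - q by rewrite ltNge; apply/negP => q1; nra.
apply: ler_pM => //; first by rewrite invr_ge0 ltW// (lt_le_trans q1)// lerD2l lerN2.
rewrite -[leLHS]mul1r ler_pdivrMr; last by rewrite (lt_le_trans q1)// lerD2l lerN2.
by apply: (le_trans kq); rewrite ler_wpM2l// lerD2l lerN2.
Qed.

Lemma expR_convex (t a b : R) : 0 <= t <= 1 ->
  expR (t * a + (1 - t) * b) <= t * expR a + (1 - t) * expR b.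
Proof.
move=> t01; have /andP[t0 t1] := t01.
have := @convex_expR R (@Itv01 _ t t0 t1) a b.
by rewrite !convRE/=.
Qed.

Lemma expR_ge1 x : (1 <= expR x) = (0 <= x).
Proof. by rewrite -[X in X <= _]expR0 ler_expR. Qed.

(** 71/100 is an upper bound for ln 2. The argument is r / sqrt P for r = 2 sqrt P + u. *)
Lemma ln_2D (s u : R) : 0 < s -> 0 <= u ->
  ln ((2 * s + u) / s) <= 71 / 100 + u / (2 * s).
Proof.
move=> s0 u0; have us : 0 <= u / (2 * s) by rewrite divr_ge0// mulr_ge0// ltW.
rewrite -[leRHS]expRK ler_ln ?posrE ?expR_gt0 ?divr_gt0//; last by lra.
have -> : (2 * s + u) / s = 2 * (1 + u / (2 * s)) by field; rewrite gt_eqF.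
rewrite expRD; apply: ler_pM => //; first by lra.
  apply: le_trans (@expR_ge_pow 15 (71/100) _); last by lra.
  by lra.
exact: expR_ge1Dx.
Qed.

(** The Chernoff exponent of {Y > r^2} at the parameter 1 - P / r^2, with s^2 = P, u^2 = 2 x and r =
    2 s + u. It is below - x by 319/100, a surplus that pays for the prefactors of the shells; 8/5
    is sqrt (2 x) at x = 32/25. *)
Lemma radius_exponent (s u : R) : 1 <= s -> 8 / 5 <= u ->
  s ^+ 2 / 2 + s ^+ 2 * ln ((2 * s + u) / s) - (2 * s + u) ^+ 2 / 2 <=
  - (u ^+ 2 / 2) - 319 / 100.
Proof.
move=> s1 u1; have H := @ln_2D s u ltac:(lra) ltac:(lra).
have : s ^+ 2 * ln ((2 * s + u) / s) <= s ^+ 2 * (71 / 100) + s * u / 2.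
  have -> : s ^+ 2 * (71 / 100) + s * u / 2 = s ^+ 2 * (71 / 100 + u / (2 * s)).
    by field; rewrite gt_eqF//; lra.
  by rewrite ler_wpM2l// sqr_ge0.
have : 1 <= s ^+ 2 by rewrite exprn_ege1.
have : 8 / 5 <= s * u by nra.
by rewrite !expr2; nra.
Qed.

End exp_bounds.

(** * Exponents for the region where psi is large *)

Section deep_exponent.
Context {R : realType}.

(** [deepa g s] is the guaranteed gain of the Gaussian exponent, per unit of Y, under the
    contraction with factors 1 - g s l_i. [deepe g s] bounds psi - [deepa g s] Y on the range of psi
    attached to s: it is 13/5 (1 - 2 [deepa g s] / s^2) plus the slack 3/4 (1/s - 2), which is spent
    outside the ellipsoid. *)
Definition deepa (g s : R) := g * s - g ^+ 2 * s ^+ 2 / 2.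
Definition deepe (g s : R) := 13 / 5 * (1 + g ^+ 2) - 3 / 2 - (26 / 5 * g - 3 / 4) / s.

Lemma deep_q (g s : R) : 119 / 200 <= g <= 17 / 20 -> 0 < s <= 1 / 2 ->
  26 / 3 * (3 / 8 + 5 / 6 * s ^+ 2 - 2 * deepa g s - deepa g s * (5 / 3 * s ^+ 2))
  <= 3 / 4 * (1 / s - 2).
Proof.
move=> /andP[g0 g1] /andP[s0 s1].
(* On this range [deepa g s] is smallest at g = 119/200, so the inequality reduces to a polynomial
   one in s. *)
have aE : 119 / 200 * s - (119 / 200) ^+ 2 * s ^+ 2 / 2 <= deepa g s.
  rewrite /deepa; set h := 119 / 200.
  have : 0 <= (g - h) * s * (1 - (g + h) * s / 2).
    by rewrite mulr_ge0 ?mulr_ge0//; rewrite /h; nra.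
  by rewrite /h !expr2; nra.
have -> : 3 / 4 * (1 / s - 2) = 3 / 4 * (1 - 2 * s) / s by field; rewrite gt_eqF.
rewrite ler_pdivlMr//.
set a := deepa g s in aE *.
have h1 : 0 <= (a - (119 / 200 * s - (119 / 200) ^+ 2 * s ^+ 2 / 2)) *
    (2 + 5 / 3 * s ^+ 2) * s.
  apply: mulr_ge0; last exact: ltW.
  by apply: mulr_ge0; rewrite ?subr_ge0// addr_ge0// mulr_ge0// sqr_ge0.
suff : 26 / 3 * (3 / 8 + 5 / 6 * s ^+ 2 -
    (119 / 200 * s - (119 / 200) ^+ 2 * s ^+ 2 / 2) * (2 + 5 / 3 * s ^+ 2)) * s
    <= 3 / 4 * (1 - 2 * s).
  by move: h1; rewrite !expr2; lra.
clear -s0 s1.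
(* The gap is tightest near s = 9/25. The certificate is a combination of products of (s - 9/25)^2
   with powers of s and with 1/2 - s. *)
have s2 : 0 <= (s - 9 / 25) ^+ 2 by exact: sqr_ge0.
have h2 : 0 <= (s - 9 / 25) ^+ 2 * s by rewrite mulr_ge0// ltW.
have h3 : 0 <= (s - 9 / 25) ^+ 2 * (1 / 2 - s) by rewrite mulr_ge0// subr_ge0.
have h4 : 0 <= (s - 9 / 25) ^+ 2 * s * (1 / 2 - s) by rewrite mulr_ge0// subr_ge0.
have h5 : 0 <= (s - 9 / 25) ^+ 2 * s * s by rewrite mulr_ge0// ltW.
have h6 : 0 <= (s - 9 / 25) ^+ 2 * s * s * (1 / 2 - s) by rewrite mulr_ge0// subr_ge0.
have h7 : 0 <= (s - 9 / 25) ^+ 2 * s * s * s by rewrite mulr_ge0// ltW.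
by move: s2 h2 h3 h4 h5 h6 h7; rewrite !expr2; lra.
Qed.

(** Here d is psi and w is 2 psi / Y, so that 2 d / w is Y. As [deepa g s] >= s^2 / 2 >= w / 2, the
    factor 1 - 2 [deepa g s] / w is not positive: the worst case is the least d, 13/5, and the
    largest w, s^2. *)
Lemma deep_inside (g s w d : R) : 119 / 200 <= g <= 17 / 20 -> 0 < s <= 1 / 2 ->
  0 < w <= s ^+ 2 -> 13 / 5 <= d -> d - deepa g s * (2 * d / w) <= deepe g s.
Proof.
move=> g01 s01 /andP[w0 ws] d0; have /andP[g0 g1] := g01; have /andP[s0 s1] := s01.
have a0 : 0 < deepa g s.
  have -> : deepa g s = g * s * (1 - g * s / 2) by rewrite /deepa; field.
  by rewrite mulr_gt0 ?mulr_gt0//; nra.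
have a1 : s ^+ 2 <= 2 * deepa g s.
  have -> : 2 * deepa g s = s * (2 * g - g ^+ 2 * s) by rewrite /deepa; field.
  by rewrite expr2 ler_pM2l//; rewrite expr2; nra.
have aw : 2 * deepa g s / s ^+ 2 <= 2 * deepa g s / w.
  by rewrite ler_pM2l ?mulr_gt0// lef_pV2 ?posrE// (lt_le_trans w0).
have s2 : 0 < s ^+ 2 by rewrite exprn_gt0.
have h1 : 1 <= 2 * deepa g s / s ^+ 2 by rewrite ler_pdivlMr// mul1r.
have -> : d - deepa g s * (2 * d / w) = d * (1 - 2 * deepa g s / w) by field; rewrite gt_eqF.
apply: (@le_trans _ _ (13 / 5 * (1 - 2 * deepa g s / s ^+ 2))).
  by nra.
have -> : 2 * deepa g s / s ^+ 2 = 2 * g / s - g ^+ 2.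
  by rewrite /deepa; field; rewrite gt_eqF.
rewrite /deepe; have : 2 <= 1 / s by rewrite ler_pdivlMr//; lra.
rewrite !mul1r -!mulrA; set z := s^-1; lra.
Qed.

(** For v = (1 + e) vh with Y vh = r^2 and w = 2 psi vh / r^2, the linear gain 5/8 leaves psi v <=
    r^2 (w / 2 + e (3/8 + e / 2)), and Y v = r^2 (1 + e)^2. The bound e <= 5/3 w delimits the part
    that the shells do not cover. *)
Lemma deep_outside (g s w d r e : R) : 119 / 200 <= g <= 17 / 20 -> 0 < s <= 1 / 2 ->
  0 < w <= s ^+ 2 -> 13 / 5 <= d -> d = w * r ^+ 2 / 2 -> 0 <= e <= 5 / 3 * w ->
  r ^+ 2 * (w / 2 + e * (3 / 8 + e / 2) - deepa g s * (1 + e) ^+ 2) <= deepe g s.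
Proof.
move=> g01 s01 w01 d0 dE /andP[e0 ew]; have /andP[g0 g1] := g01.
have /andP[s0 s1] := s01; have /andP[w0 ws] := w01.
have a12 : deepa g s <= 1 / 2.
  by rewrite /deepa !expr2; nra.
have s2 : 0 < s ^+ 2 by rewrite exprn_gt0.
have z2 : 2 <= s^-1 by rewrite -[s^-1]mul1r ler_pdivlMr//; lra.
have Q := @deep_q g s g01 s01.
have E : 13 / 5 * (1 - 2 * deepa g s / s ^+ 2) + 3 / 4 * (1 / s - 2) = deepe g s.
  by rewrite /deepe /deepa; field; rewrite gt_eqF.
have Eneg : deepe g s < 0.
  rewrite /deepe; set z := s^-1 in z2 *; rewrite !expr2; nra.
have a0 : 0 <= deepa g s.
  have -> : deepa g s = g * s * (1 - g * s / 2) by rewrite /deepa; field.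
  by rewrite mulr_ge0 ?mulr_ge0//; nra.
pose M := 9 / 104 * (1 / s - 2).
have M0 : 0 <= M by rewrite /M mul1r; lra.
set a := deepa g s in Q E a0 a12 *.
have QM : 3 / 8 + 5 / 6 * s ^+ 2 - 2 * a - a * (5 / 3 * s ^+ 2) <= M by rewrite /M; lra.
have B : w / 2 + e * (3 / 8 + e / 2) - a * (1 + e) ^+ 2 <= w / 2 - a + 5 / 3 * w * M.
  have : e * (3 / 8 - 2 * a + (1 / 2 - a) * e) <= 5 / 3 * w * M.
    apply: (@le_trans _ _ (e * M)); last by rewrite ler_wpM2r.
    rewrite ler_wpM2l//; apply: le_trans QM.
    have : (1 / 2 - a) * e <= (1 / 2 - a) * (5 / 3 * s ^+ 2).
      by rewrite ler_wpM2l ?subr_ge0// (le_trans ew)// ler_wpM2l.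
    lra.
  by rewrite !expr2; lra.
have r2 : r ^+ 2 = 2 * d / w by rewrite dE; field; rewrite gt_eqF.
apply: (@le_trans _ _ (r ^+ 2 * (w / 2 - a + 5 / 3 * w * M))).
  by rewrite ler_wpM2l// sqr_ge0.
have -> : r ^+ 2 * (w / 2 - a + 5 / 3 * w * M) = d * (1 - 2 * a / w + 10 / 3 * M).
  by rewrite r2; field; rewrite gt_eqF.
have aw : 2 * a / s ^+ 2 <= 2 * a / w.
  by rewrite ler_wpM2l ?mulr_ge0// lef_pV2 ?posrE.
have K : 13 / 5 * (1 - 2 * a / w + 10 / 3 * M) <= deepe g s by rewrite -E /M; lra.
set b := 1 - _ + _ in K *; have bneg : b <= 0 by rewrite ltW//; lra.
by apply: le_trans K; exact: ler_wnM2r.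
Qed.

End deep_exponent.

(** * Numerical constants of the upper bound *)

Section core_constants.
Context {R : realType} (w : R).

(** [deepr g] is the coefficient of - 1/s in [deepe g s]. For s = sqrt w (17/20)^k the k-th layer
    costs at most [deepc g] [deepq g]^k times the mean of T: the subtracted 2/3 g / (1 - g / 2) is
    the Jacobian under w P <= 2/3, and 6/17 = 2 * 3/17 comes from 1 / sqrt w >= 2 and (20/17)^k >= 1
    + 3 k / 17. *)
Definition deepr g : R := (26 / 5 * g - 3 / 4)%R.
Definition deepc g : R := expR (13 / 5 * (1 + g ^+ 2) - 3 / 2
  - (deepr g - 2 / 3 * g / (1 - g / 2)) * (Num.sqrt w)^-1).
Definition deepq g : R := expR (- (6 / 17 * deepr g)).

Lemma deepr_ge0 g : 119 / 200 <= g -> 0 <= deepr g.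
Proof. by rewrite /deepr; lra. Qed.

Lemma deep_range1 : 119 / 200 <= (119 / 200 : R) <= 17 / 20.
Proof. by lra. Qed.

Lemma deep_range2 : 119 / 200 <= (17 / 20 : R) <= 17 / 20.
Proof. by lra. Qed.

Lemma shell_ge0_1 : 0 <= (5 / 8 : R).
Proof. by lra. Qed.

Lemma shell_ge0_2 : 0 <= (13 / 40 : R).
Proof. by lra. Qed.

Lemma shell_range1 : 1 / 4 < (5 / 8 : R).
Proof. by lra. Qed.

Lemma shell_range2 : 1 / 4 < (13 / 40 : R).
Proof. by lra. Qed.

Hypothesis w14 : 0 < w <= 1 / 4.

Lemma sqrtw01 : (0 < Num.sqrt w <= 1 / 2)%R.
Proof.
have /andP[w0 w1] := w14; rewrite sqrtr_gt0 w0/=.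
have := sqrtr_ge0 w; have : (Num.sqrt w ^+ 2 <= 1 / 4)%R by rewrite sqr_sqrtr// ltW.
by rewrite expr2; nra.
Qed.

Lemma deepc_le g z m : 119 / 200 <= g <= 17 / 20 -> z <= (Num.sqrt w)^-1 ->
  2 / 3 * g <= m * (1 - g / 2) -> m <= deepr g ->
  deepc g <= expR (- ((deepr g - m) * z - (13 / 5 * (1 + g ^+ 2) - 3 / 2))).
Proof.
move=> /andP[g0 g1] zw hm md; rewrite /deepc ler_expR.
have D : 0 < 1 - g / 2 by lra.
have h : 2 / 3 * g / (1 - g / 2) <= m by rewrite ler_pdivrMr.
have z0 : 0 <= (Num.sqrt w)^-1 by rewrite invr_ge0 sqrtr_ge0.
have md0 : 0 <= deepr g - m by rewrite subr_ge0.
have := ler_wpM2r z0 h; have := ler_wpM2l md0 zw; lra.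
Qed.

Lemma expR_chord_num : (expR (13 / 5) - 1) / (13 / 5) <= 5 :> R.
Proof.
have : expR (13 / 5) <= 14 :> R by apply: (@expR_le_num _ 129); lra.
lra.
Qed.

Lemma deepq_num1 : deepq (119 / 200) <= 9 / 20.
Proof. by rewrite /deepq; apply: (@expRN_le_num _ 15); rewrite /deepr; lra. Qed.

Lemma deepq_num2 : deepq (17 / 20) <= 3 / 10.
Proof. by rewrite /deepq; apply: (@expRN_le_num _ 15); rewrite /deepr; lra. Qed.

Lemma weight_ge0_1 : 0 <= 43 / 10 :> R.
Proof. by lra. Qed.

Lemma weight_ge0_2 : 0 <= 301 / 100 :> R.
Proof. by lra. Qed.

Lemma deepc_num1 : 2 <= (Num.sqrt w)^-1 -> deepc (119 / 200) <= 1 / 4.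
Proof.
move=> z2; apply: le_trans (@deepc_le _ _ (113 / 200) _ z2 _ _) _; rewrite /deepr; try lra.
by apply: (@expRN_le_num _ 15); lra.
Qed.

Lemma deepc_num2 : 2 <= (Num.sqrt w)^-1 -> deepc (17 / 20) <= 11 / 100.
Proof.
move=> z2; apply: le_trans (@deepc_le _ _ (99 / 100) _ z2 _ _) _; rewrite /deepr; try lra.
by apply: (@expRN_le_num _ 15); lra.
Qed.

Lemma deepc_num3 : 22 / 9 <= (Num.sqrt w)^-1 -> deepc (119 / 200) <= 8 / 75.
Proof.
move=> z2; apply: le_trans (@deepc_le _ _ (113 / 200) _ z2 _ _) _; rewrite /deepr; try lra.
by apply: (@expRN_le_num _ 31); lra.
Qed.

Lemma deepc_num4 : 22 / 9 <= (Num.sqrt w)^-1 -> deepc (17 / 20) <= 1 / 29.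
Proof.
move=> z2; apply: le_trans (@deepc_le _ _ (99 / 100) _ z2 _ _) _; rewrite /deepr; try lra.
by apply: (@expRN_le_num _ 31); lra.
Qed.

(** The three terms are the slope of the chord of e^y - 1 on [0, 13/5] and the two layer series,
    with weights 43/10 and 7/10 of it. When w <= 1/6 one has 1 / sqrt w >= 22/9, and the series are
    small enough for 6. *)
Lemma core_constant (W : R) : W = 39 / 5 \/ W = 6 /\ w <= 1 / 6 ->
  (expR (13 / 5) - 1) / (13 / 5) +
  (43 / 10 * (deepc (119 / 200) / (1 - deepq (119 / 200))) +
   301 / 100 * (deepc (17 / 20) / (1 - deepq (17 / 20)))) <= W.
Proof.
move=> hW.
have w0 := w14; have /andP[s0 s1] := sqrtw01.
suff [c1 [c2 [cc1 cc2 cW]]] : exists c1 c2, [/\ deepc (119 / 200) <= c1 , deepc (17 / 20) <= c2 &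
    5 + (43 / 10 * (c1 * (20 / 11)) + 301 / 100 * (c2 * (10 / 7))) <= W].
  have h1 : deepc (119 / 200) / (1 - deepq (119 / 200)) <= c1 * (20 / 11).
    by apply: ratio_le cc1 deepq_num1 _ _; rewrite ?expR_ge0//; lra.
  have h2 : deepc (17 / 20) / (1 - deepq (17 / 20)) <= c2 * (10 / 7).
    by apply: ratio_le cc2 deepq_num2 _ _; rewrite ?expR_ge0//; lra.
  apply: le_trans cW; apply: (lerD expR_chord_num); apply: lerD; apply: ler_wpM2l.
  - exact: weight_ge0_1.
  - exact: h1.
  - exact: weight_ge0_2.
  - exact: h2.
have [->|[-> w6]] := hW.
  have z2 : 2 <= (Num.sqrt w)^-1 by rewrite -[leRHS]mul1r ler_pdivlMr//; lra.
  exists (1 / 4), (11 / 100); split; last by lra.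
    exact: deepc_num1.
  exact: deepc_num2.
have z2 : 22 / 9 <= (Num.sqrt w)^-1.
  rewrite -[leRHS]mul1r ler_pdivlMr//.
  have : Num.sqrt w ^+ 2 <= 1 / 6 by rewrite sqr_sqrtr//; lra.
  rewrite expr2; nra.
exists (8 / 75), (1 / 29); split; last by lra.
  exact: deepc_num3.
exact: deepc_num4.
Qed.

(** This 4 is the coefficient of e^-x in the theorem. The two series are the shells with the full
    gain 5/8 and those where 3/10 of it is spent on psi, leaving 13/40; in both, 1/4 per shell is
    lost to the Chernoff exponent. *)
Lemma shell_constant : expR (13 / 5 - 29 / 10) / (1 - expR (- (5 / 8 - 1 / 4))) +
  expR (0 - 29 / 10) / (1 - expR (- (13 / 40 - 1 / 4))) <= 4 :> R.
Proof.
have h1 : expR (13 / 5 - 29 / 10) / (1 - expR (- (5 / 8 - 1 / 4))) <= (19 / 25) * (10 / 3) :> R.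
  apply: (@ratio_le _ _ _ _ (7 / 10)); rewrite ?expR_ge0//.
  - by rewrite -[13 / 5 - _]opprK; apply: (@expRN_le_num _ 3); lra.
  - by apply: (@expRN_le_num _ 7); lra.
  - by lra.
have h2 : expR (0 - 29 / 10) / (1 - expR (- (13 / 40 - 1 / 4))) <= (7 / 100) * 15 :> R.
  apply: (@ratio_le _ _ _ _ (14 / 15)); rewrite ?expR_ge0//.
  - by rewrite sub0r; apply: (@expRN_le_num _ 15); lra.
  - by apply: (@expRN_le_num _ 0); lra.
  - by lra.
apply: le_trans (lerD h1 h2) _; lra.
Qed.

End core_constants.

(** * Mean of (e^psi - 1)_+ for effective dimension at least 1 *)

Section core.
Context {R : realType} (p : nat) (l : 'I_p -> R) (psi T : 'cV[R]_p -> R) (r w : R).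
Hypothesis l01 : forall i, 0 <= l i <= 1.
Hypothesis r0 : 0 < r.
Local Notation Y := (quad l).
Hypothesis Tle : forall v, Y v <= r ^+ 2 -> `|psi v| <= T v.
Hypothesis psiw : forall v, Y v <= r ^+ 2 -> `|psi v| <= w * Y v / 2.
Hypothesis psi_cvx : forall (t : R) (v u : 'cV[R]_p), 0 <= t <= 1 ->
  (1 - t) * psi v + t * psi u - t * (1 - t) / 2 * Y (v - u) <= psi ((1 - t) *: v + t *: u).
Hypothesis T3 : forall (t : R) (v : 'cV[R]_p), T (t *: v) = `|t| ^+ 3 * T v.
Hypothesis T0 : forall v, 0 <= T v.

(** Coordinates are contracted in proportion to l_i. The inverse Jacobian is therefore controlled by
    P = sum_i l_i, and the gain in the Gaussian exponent is a multiple of Y. *)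
Definition shrink (c : R) : 'cV[R]_p -> 'cV[R]_p := scalev (fun i => 1 - c * l i).

Lemma shrink_quad c v : 0 <= c <= 1 -> Y (shrink c v) <= Y v.
Proof.
move=> /andP[c0 c1]; apply: ler_sum => i _; have /andP[li0 li1] := l01 i.
rewrite mxE exprMn ler_wpM2l// ler_piMl ?sqr_ge0// expr_le1//; nra.
Qed.

Lemma shrinkZ c t v : shrink c (t *: v) = t *: shrink c v.
Proof. by apply/matrixP => i j; rewrite !mxE; ring. Qed.

(* Semiconcavity of psi between v and its contraction shrink c2 v: a large value
   of psi at v forces T to be large at one of two contractions of v. *)
Lemma deep_T (s : R) v : Y v <= r ^+ 2 -> 0 < s <= 1 ->
  (17 / 20 * s) ^+ 2 * Y v <= 2 * psi v ->
  9 / 100 * psi v <= T (shrink (119 / 200 * s) v) + 7 / 10 * T (shrink (17 / 20 * s) v).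
Proof.
move=> Yv /andP[s0 s1] ws.
(* Since 7/10 * 17/20 = 119/200, the intermediate point is again a contraction of v. The weight left
   on psi v is 3/10 - 21/100 = 9/100, the subtracted part being 7/10 * 3/10 / 2 times Y of the
   displacement, which is at most 2 psi v. *)
have /= := @psi_cvx (7 / 10) v (shrink (17 / 20 * s) v) ltac:(lra).
have -> : (1 - 7 / 10) *: v + (7 / 10) *: shrink (17 / 20 * s) v = shrink (119 / 200 * s) v.
  by apply/matrixP => i j; rewrite !mxE (ord1 j); field.
have d1 : Y (v - shrink (17 / 20 * s) v) <= (17 / 20 * s) ^+ 2 * Y v.
  rewrite /quad mulr_sumr; apply: ler_sum => i _; have /andP[li0 li1] := l01 i.
  have -> : (v - shrink (17 / 20 * s) v) i 0 = (17 / 20 * s) * l i * v i 0 by rewrite !mxE; ring.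
  have -> : l i * (17 / 20 * s * l i * v i 0) ^+ 2 =
      (17 / 20 * s) ^+ 2 * (l i * v i 0 ^+ 2) * l i ^+ 2 by ring.
  by rewrite ler_piMr ?expr_le1// mulr_ge0 ?sqr_ge0// mulr_ge0// sqr_ge0.
have t1 := le_trans (ler_norm _) (Tle (le_trans (@shrink_quad (119 / 200 * s) v ltac:(lra)) Yv)).
have := Tle (le_trans (@shrink_quad (17 / 20 * s) v ltac:(lra)) Yv).
rewrite ler_norml => /andP[t2 _]; lra.
Qed.


(** The ratio of the standard Gaussian densities at [shrink c v] and at v, not a determinant; with
    this weight the change of variables along [shrink] is exact. *)
Definition shrink_jac c (v : 'cV[R]_p) := expR ((\sum_i v i 0 ^+ 2) / 2 - (\sum_i shrink c v i 0 ^+ 2) / 2).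

Lemma shrink_jac_ge g s v : expR (deepa g s * Y v) <= shrink_jac (g * s) v.
Proof.
rewrite ler_expR -mulrBl -sumrB mulr_sumr mulr_suml; apply: ler_sum => i _.
have /andP[li0 li1] := l01 i; rewrite mxE /deepa.
have -> : (v i 0 ^+ 2 - ((1 - g * s * l i) * v i 0) ^+ 2) / 2 =
  v i 0 ^+ 2 * (g * s * l i - (g * s) ^+ 2 * l i ^+ 2 / 2) by field.
have -> : (g * s - g ^+ 2 * s ^+ 2 / 2) * (l i * v i 0 ^+ 2) =
  v i 0 ^+ 2 * (g * s * l i - (g * s) ^+ 2 * l i / 2) by field.
rewrite ler_wpM2l ?sqr_ge0// lerD2l lerN2 ler_wpM2r// ler_wpM2l ?sqr_ge0//.
by rewrite expr2 ler_piMr.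
Qed.

Definition deepF g s v := expR (deepe g s) * (T (shrink (g * s) v) * shrink_jac (g * s) v).

Lemma deepF_ge0 g s v : 0 <= deepF g s v.
Proof. by rewrite mulr_ge0 ?expR_ge0// mulr_ge0// expR_ge0. Qed.

Lemma deepF_ge g s v : psi v <= deepe g s + deepa g s * Y v ->
  expR (psi v) * T (shrink (g * s) v) <= deepF g s v.
Proof.
move=> H; rewrite /deepF mulrCA mulrC ler_wpM2l//.
apply: (@le_trans _ _ (expR (deepe g s + deepa g s * Y v))); first by rewrite ler_expR.
by rewrite expRD ler_wpM2l ?expR_ge0// shrink_jac_ge.
Qed.

(** The point vh is v itself or its radial projection onto the boundary of the ellipsoid; as c >= 1,
    homogeneity makes T at v at least T at vh. The combination of the two values of T is at least
    9/100 * 13/5 = 117/500, whose inverse is below 43/10. *)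
Lemma deep_sum s v vh c : 1 <= c -> v = c *: vh -> 13 / 5 <= psi vh ->
  9 / 100 * psi vh <= T (shrink (119 / 200 * s) vh) + 7 / 10 * T (shrink (17 / 20 * s) vh) ->
  (forall g, 119 / 200 <= g <= 17 / 20 -> psi v <= deepe g s + deepa g s * Y v) ->
  expR (psi v) <= 43 / 10 * (deepF (119 / 200) s v + 7 / 10 * deepF (17 / 20) s v).
Proof.
move=> c1 vE d0 HT He.
have c3 : 1 <= `|c| ^+ 3 by rewrite exprn_ege1// ger0_norm//; lra.
have Tc g : T (shrink (g * s) vh) <= T (shrink (g * s) v).
  by rewrite vE shrinkZ T3 ler_peMl.
have h1 := @deepF_ge (119 / 200) s v (He (119 / 200) ltac:(lra)).
have h2 := @deepF_ge (17 / 20) s v (He (17 / 20) ltac:(lra)).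
have t1 := Tc (119 / 200); have t2 := Tc (17 / 20).
have h3 : 117 / 500 <= T (shrink (119 / 200 * s) v) + 7 / 10 * T (shrink (17 / 20 * s) v) by lra.
have h4 : 117 / 500 * expR (psi v) <= 
    expR (psi v) * (T (shrink (119 / 200 * s) v) + 7 / 10 * T (shrink (17 / 20 * s) v)).
  by rewrite mulrC ler_wpM2l// expR_ge0.
have := expR_ge0 (psi v); lra.
Qed.

Lemma deep_in s v : 0 < s <= 1 / 2 -> Y v <= r ^+ 2 -> 13 / 5 <= psi v ->
  (17 / 20 * s) ^+ 2 * Y v <= 2 * psi v <= s ^+ 2 * Y v ->
  expR (psi v) <= 43 / 10 * (deepF (119 / 200) s v + 7 / 10 * deepF (17 / 20) s v).
Proof.
move=> s01 Yv d0 /andP[w1 w2]; have /andP[s0 s1] := s01.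
apply: (@deep_sum s v v 1) => //; first by rewrite scale1r.
  by apply: deep_T => //; lra.
move=> g g01.
have Y0 : 0 < Y v.
  rewrite lt_neqAle quad_ge0 ?andbT => [|i]; last by have /andP[] := l01 i.
  by apply/eqP => y0; move: w2; rewrite -y0; lra.
have := @deep_inside R g s (2 * psi v / Y v) (psi v) g01 s01.
rewrite divr_gt0 ?(ler_pdivrMr _ _ Y0)//=; last by lra.
have -> : 2 * psi v / (2 * psi v / Y v) = Y v by field; rewrite !gt_eqF//; lra.
by move=> /(_ w2 d0); rewrite lerBlDr.
Qed.

Lemma deep_out s v t : 0 < s <= 1 / 2 -> t ^+ 2 = Y v -> r < t ->
  let vh := (r / t) *: v in
  psi v <= (t ^+ 2 - r ^+ 2) / 2 - 5 / 8 * r * (t - r) + psi vh ->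
  13 / 5 <= psi vh -> (17 / 20 * s) ^+ 2 * r ^+ 2 <= 2 * psi vh <= s ^+ 2 * r ^+ 2 ->
  r * (t - r) <= 10 / 3 * psi vh ->
  expR (psi v) <= 43 / 10 * (deepF (119 / 200) s v + 7 / 10 * deepF (17 / 20) s v).
Proof.
move=> s01 tY rt vh H3 d0 /andP[w1 w2] he; have /andP[s0 s1] := s01.
have t0 : 0 < t by exact: lt_trans rt.
have Yvh : Y vh = r ^+ 2.
  by rewrite quadZ -tY expr_div_n divfK// gt_eqF// exprn_gt0.
apply: (@deep_sum s v vh (t / r)) => //.
- by rewrite ler_pdivlMr// mul1r ltW.
- by rewrite scalerA (_ : t / r * (r / t) = 1) ?scale1r//; field; rewrite !gt_eqF.
- by apply: deep_T; rewrite ?Yvh//; lra.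
move=> g g01.
have r2 : 0 < r ^+ 2 by rewrite exprn_gt0.
pose e := (t - r) / r; pose ww := 2 * psi vh / r ^+ 2.
have := @deep_outside R g s ww (psi vh) r e g01 s01.
rewrite {1 2}/ww divr_gt0 ?(ler_pdivrMr _ _ r2)//=; last by lra.
move=> /(_ w2 d0); have -> : psi vh = ww * r ^+ 2 / 2 by rewrite /ww; field; rewrite gt_eqF.
move=> /(_ erefl).
have -> : (0 <= e <= 5 / 3 * ww).
  apply/andP; split; first by apply: divr_ge0; [rewrite subr_ge0|]; exact: ltW.
  rewrite /e /ww (ler_pdivrMr _ _ r0).
  have -> : 5 / 3 * (2 * psi vh / r ^+ 2) * r = 10 / 3 * psi vh / r by field; rewrite gt_eqF.
  by rewrite ler_pdivlMr// mulrC.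
move=> /(_ isT) Ho; move: H3; have -> : psi vh = ww * r ^+ 2 / 2 by rewrite /ww; field; rewrite gt_eqF.
have tE : t = r * (1 + e) by rewrite /e; field; rewrite gt_eqF.
rewrite -tY tE; move: Ho; set a := deepa g s; rewrite !expr2; lra.
Qed.


Hypothesis mT : measurable_fun setT T.
Hypothesis mpsi : measurable_fun setT psi.
Local Notation P := (\sum_i l i).

Lemma measurable_shrink_jac c : measurable_fun setT (shrink_jac c).
Proof.
apply: measurableT_comp => //; apply: measurable_funB; first by meas.
apply: measurable_funM => //; apply: measurable_sum => i.
rewrite (_ : (fun v => _) = (fun v : 'cV[R]_p => ((1 - c * l i) * v i 0) ^+ 2)).
  by meas.
by apply/funext => v; rewrite mxE.
Qed.

Lemma measurable_deepF g s : measurable_fun setT (deepF g s).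
Proof.
apply: measurable_funM => //; apply: measurable_funM; last exact: measurable_shrink_jac.
by apply: (measurableT_comp mT); exact: measurable_scalev.
Qed.

Local Open Scope ereal_scope.

(** The change of variables leaves the product of 1 / (1 - g s l_i). Since g s <= g / 2, each factor
    is at most 1 + l_i g s / (1 - g / 2), and the product is bounded by an exponential in P. *)
Lemma integral_deepF g s : (119 / 200 <= g <= 17 / 20)%R -> (0 < s <= 1 / 2)%R ->
  \int[@gaussN R p]_v (deepF g s v)%:E <=
  (expR (deepe g s + P * (g * s / (1 - g / 2))))%:E * \int[@gaussN R p]_v (T v)%:E.
Proof.
move=> /andP[g0 g1] /andP[s0 s1].
have gs0 : (0 <= g * s)%R by rewrite mulr_ge0//; lra.
have gs1 : (g * s <= g / 2)%R by nra.
have pos i : (0 < 1 - g * s * l i)%R.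
  by have /andP[li0 li1] := l01 i; rewrite subr_gt0 (le_lt_trans (ler_piMr gs0 li1))//; lra.
have int0 : 0 <= \int[@gaussN R p]_v (T v)%:E.
  by apply: integral_ge0 => v _; rewrite lee_fin.
under eq_integral do rewrite EFinM.
rewrite ge0_integralZl//; first last.
- by move=> v _; rewrite lee_fin mulr_ge0// expR_ge0.
- apply/measurable_EFinP; apply: measurable_funM; last exact: measurable_shrink_jac.
  by apply: (measurableT_comp mT); exact: measurable_scalev.
have -> : \int[@gaussN R p]_x (T (shrink (g * s) x) * shrink_jac (g * s) x)%:E =
  ((\prod_i (1 - g * s * l i))^-1)%:E * \int[@gaussN R p]_v (T v)%:E by exact: gaussN_scalev.
rewrite (expRD (deepe g s)) EFinM -muleA; apply: lee_wpmul2l; first by rewrite lee_fin expR_ge0.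
apply: lee_wpmul2r => //; rewrite lee_fin -prodfV mulr_suml expR_sum.
apply: ler_prod => i _; rewrite invr_ge0 ltW//=.
have /andP[li0 li1] := l01 i.
apply: (@le_trans _ _ (1 + l i * (g * s / (1 - g / 2)))%R); last exact: expR_ge1Dx.
rewrite -[leLHS]mul1r ler_pdivrMr//.
have D : (0 < 1 - g / 2)%R by lra.
have -> : ((1 + l i * (g * s / (1 - g / 2))) * (1 - g * s * l i) =
  1 + l i * (g * s) * (g / 2 - g * s * l i) / (1 - g / 2))%R.
  by field; rewrite gt_eqF//; lra.
rewrite lerDl; apply: divr_ge0; last exact: ltW.
apply: mulr_ge0; first by rewrite mulr_ge0.
rewrite subr_ge0.
by apply: le_trans gs1; exact: ler_piMr.
Qed.

(** A geometric grid of contraction sizes starting at sqrt w, the largest possible value of sqrt (2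
    psi / Y) in the ellipsoid. Its ratio is the larger contraction parameter 17/20, so that on the
    bin of [deeps k] the hypothesis of [deep_T] holds. *)
Definition deeps k : R := (Num.sqrt w * (17 / 20) ^+ k)%R.
Local Notation deepc := (deepc w).
Hypothesis w14 : (0 < w <= 1 / 4)%R.
Hypothesis wP : (w * P <= 2 / 3)%R.

Lemma deeps01 k : (0 < deeps k <= 1 / 2)%R.
Proof.
have /andP[w0 w1] := (sqrtw01 w14); rewrite /deeps mulr_gt0 ?exprn_gt0//=.
by apply: le_trans w1; rewrite ler_piMr ?(ltW w0)//; apply: exprn_ile1; lra.
Qed.

Lemma inv_pow_ge k : (1 + k%:R * (3 / 17) <= ((17 / 20) ^+ k)^-1 :> R)%R.
Proof.
rewrite -exprVn (_ : (17 / 20)^-1 = 1 + 3 / 17 :> R)%R; last by field.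
elim: k => [|k IH]; first by rewrite mul0r addr0 expr0.
rewrite exprS; apply: le_trans (ler_wpM2l _ IH); last by lra.
have : (0 <= k%:R :> R)%R by [].
by rewrite -natr1; nra.
Qed.

(** From w P <= 2/3 one gets P sqrt w <= 2/3 / sqrt w: the Jacobian cost and the gain - [deepr g] /
    s are then both of order 1 / sqrt w, and the gain wins for both values of g. *)
Lemma deep_exponent g k : (119 / 200 <= g <= 17 / 20)%R ->
  (expR (deepe g (deeps k) + P * (g * deeps k / (1 - g / 2))) <=
  deepc g * deepq g ^+ k)%R.
Proof.
move=> /andP[g0 g1]; have /andP[s0 s1] := (sqrtw01 w14); have /andP[w0 w1] := w14.
have D : (0 < 1 - g / 2)%R by lra.
rewrite /deepc /deepq -expRM_natl -expRD ler_expR /deepe -/(deepr g) /deeps.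
set s := Num.sqrt w in s0 s1 *; set z := (s^-1)%R; set q := ((17 / 20) ^+ k)%R.
have q0 : (0 < q)%R by rewrite exprn_gt0.
have q1 : (q <= 1)%R by apply: exprn_ile1; lra.
have z2 : (2 <= z)%R by rewrite -[z]mul1r ler_pdivlMr//; lra.
have dr : (0 <= deepr g)%R by rewrite /deepr; lra.
have ww : w = (s ^+ 2)%R by rewrite sqr_sqrtr// ltW.
have h1 : (P * (g * (s * q) / (1 - g / 2)) <= 2 / 3 * g / (1 - g / 2) * z)%R.
  have -> : (2 / 3 * g / (1 - g / 2) * z = 2 / 3 * (g / (1 - g / 2)) * z)%R by ring.
  have -> : (P * (g * (s * q) / (1 - g / 2)) = P * w * q * (g / (1 - g / 2)) * z)%R.
    by rewrite /z ww; set b := (1 - g / 2)%R in D *; field; rewrite !gt_eqF.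
  rewrite ler_wpM2r ?(le_trans _ z2)// ler_wpM2r//.
    by rewrite divr_ge0 ?(ltW D)//; lra.
  have : (0 <= P)%R by apply: sumr_ge0 => i _; have /andP[] := l01 i.
  move=> P0; apply: (@le_trans _ _ (P * w * 1)%R); last by rewrite mulr1 mulrC.
  by rewrite ler_wpM2l// mulr_ge0// ltW.
have h2 : (z * (1 + k%:R * (3 / 17)) <= (s * q)^-1)%R.
  by rewrite invfM ler_wpM2l ?(le_trans _ z2)//; exact: inv_pow_ge.
have h3 : (deepr g * (z * (1 + k%:R * (3 / 17))) <= deepr g / (s * q))%R.
  by rewrite ler_wpM2l.
have h4 : (deepr g * k%:R * 2 <= deepr g * k%:R * z)%R by rewrite ler_wpM2l// mulr_ge0.
lra.
Qed.

Lemma integral_deep_series g : (119 / 200 <= g <= 17 / 20)%R ->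
  \int[@gaussN R p]_v (\sum_(0 <= k <oo) (deepF g (deeps k) v)%:E) <=
  (deepc g / (1 - deepq g))%:E * \int[@gaussN R p]_v (T v)%:E.
Proof.
move=> g01; have /andP[g0 g1] := g01.
have int0 : 0 <= \int[@gaussN R p]_v (T v)%:E.
  by apply: integral_ge0 => v _; rewrite lee_fin.
apply: integral_geometric_le => //.
- by move=> k; apply/measurable_EFinP; exact: measurable_deepF.
- by move=> k v; rewrite lee_fin deepF_ge0.
- exact: expR_ge0.
- by rewrite expR_ge0 expR_lt1 oppr_lt0 mulr_gt0// /deepr; lra.
move=> k; apply: le_trans (integral_deepF g01 (deeps01 k)) _.
by rewrite lee_wpmul2r// lee_fin; exact: deep_exponent.
Qed.

(** k + 1 is the first index with [deeps]^2 y < 2 d. It is not 0, because [deeps 0]^2 = w and 2 d <=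
    w y. *)
Lemma deeps_bin d y : (0 < y)%R -> (0 < d)%R -> (d <= w * y / 2)%R ->
  exists k, ((17 / 20 * deeps k) ^+ 2 * y <= 2 * d <= deeps k ^+ 2 * y)%R.
Proof.
move=> y0 d0 dw; have /andP[w0 w1] := w14.
pose A k := (deeps k ^+ 2 * y < 2 * d)%R.
have sq k : (deeps k ^+ 2 = w * (289 / 400) ^+ k)%R.
  rewrite /deeps exprMn sqr_sqrtr ?ltW// -exprM mulnC exprM; congr (_ * _ ^+ _)%R.
  by rewrite expr2; field.
have [n An] : exists n, A n.
  have c0 : (`|289 / 400 : R| < 1)%R by rewrite ger0_norm; lra.
  have e0 : (0 < 2 * d / (w * y))%R by rewrite divr_gt0// mulr_gt0.
  have /cvgr0_norm_lt /(_ _ e0) [n _ /(_ n (leqnn n))/=] := cvg_expr c0.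
  rewrite ger0_norm; last by apply: exprn_ge0; lra.
  rewrite ltr_pdivlMr ?mulr_gt0// => H; exists n; rewrite /A sq.
  by rewrite (le_lt_trans _ H)// mulrA (mulrC w).
have := ex_minnP (ex_intro A n An) => -[[|k] Ak mk].
  by move: Ak; rewrite /A sq expr0 mulr1; lra.
exists k; apply/andP; split; last first.
  by rewrite leNgt; apply/negP => /mk; rewrite ltnn.
have E : deeps k.+1 = (17 / 20 * deeps k)%R by rewrite /deeps exprS mulrCA.
by rewrite -E ltW.
Qed.


Local Close Scope ereal_scope.

Hypothesis P1 : 1 <= P.
Variable x : R.
Hypothesis x13 : 32 / 25 <= x.
Hypothesis rE : r = 2 * Num.sqrt P + Num.sqrt (2 * x).
Hypothesis psi_out : forall v t, t ^+ 2 = Y v -> r < t ->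
  psi v <= (t ^+ 2 - r ^+ 2) / 2 - 5 / 8 * r * (t - r) + psi ((r / t) *: v).

Lemma P_gt0 : 0 < P. Proof. exact: lt_le_trans P1. Qed.

Lemma sqrtP1 : 1 <= Num.sqrt P.
Proof.
have := sqrtr_ge0 P; have := P1; have : Num.sqrt P ^+ 2 = P by rewrite sqr_sqrtr// ltW// P_gt0.
rewrite expr2; nra.
Qed.

Lemma sqr_sqrtx : Num.sqrt (2 * x) ^+ 2 = 2 * x.
Proof. by rewrite sqr_sqrtr//; have := x13; lra. Qed.

Lemma sqrtx : 8 / 5 <= Num.sqrt (2 * x).
Proof.
have := sqrtr_ge0 (2 * x); have := sqr_sqrtx; have := x13.
rewrite expr2; nra.
Qed.

Lemma ln_radius : P / 2 + P * ln (r / Num.sqrt P) - r ^+ 2 / 2 <= - x - 319 / 100.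
Proof.
have := radius_exponent sqrtP1 sqrtx; rewrite -rE sqr_sqrtx sqr_sqrtr ?(ltW P_gt0)//.
lra.
Qed.

Lemma r2_ge : 4 * P <= r ^+ 2.
Proof.
have s1 := sqrtP1; have u1 := sqrtx.
have <- : Num.sqrt P ^+ 2 = P by rewrite sqr_sqrtr// ltW// P_gt0.
rewrite rE !expr2; nra.
Qed.

Lemma r2_ge12 : 12 <= r ^+ 2.
Proof. have s1 := sqrtP1; have u1 := sqrtx; rewrite rE expr2; nra. Qed.

(** The spacing 1 / r makes r (t - r) increase by one from shell to shell. [shellm j] is the optimal
    Chernoff parameter for the level [shellt j]^2, and [shellF c e j] dominates e^psi on shell j
    wherever psi <= (Y - r^2) / 2 + c - e r (t - r), t being sqrt Y. *)
Definition shellt (j : nat) := r + j%:R / r.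
Definition shellm j := 1 - P / shellt j ^+ 2.
Definition shellF c e (j : nat) v := expR (c - e * j%:R) *
  expR ((P / shellt j ^+ 2 * shellt j.+1 ^+ 2 - r ^+ 2) / 2) * expR (shellm j * (Y v / 2)).

Lemma shellt_ge j : r <= shellt j.
Proof. by rewrite lerDl divr_ge0// ltW. Qed.

Lemma shellt_gt0 j : 0 < shellt j.
Proof. exact: lt_le_trans (shellt_ge j). Qed.

Lemma shellm01 j : 0 <= shellm j < 1.
Proof.
have t0 := shellt_gt0 j; have t2 : 0 < shellt j ^+ 2 by rewrite exprn_gt0.
rewrite /shellm subr_ge0 ltrBlDr ltrDl divr_gt0 ?P_gt0// andbT ler_pdivrMr// mul1r.
apply: (@le_trans _ _ (r ^+ 2)).
  by apply: le_trans r2_ge; have := P_gt0; lra.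
by rewrite lerXn2r// ?nnegrE ?(ltW r0) ?(ltW t0)// shellt_ge.
Qed.

Lemma shellF_ge0 c e j v : 0 <= shellF c e j v.
Proof. by rewrite !mulr_ge0 ?expR_ge0. Qed.

Lemma measurable_shellF c e j : measurable_fun setT (shellF c e j).
Proof.
apply: measurable_funM => //; apply: measurableT_comp => //.
by apply: measurable_funM => //; apply: measurable_funM => //; exact: measurable_quad.
Qed.

(** Of the surplus 319/100 of [ln_radius], 29/100 pays for the width of a shell. The growth of the
    logarithm with j contributes P / r^2 <= 1/4 per shell. *)
Lemma shell_exponent j :
  (P / shellt j ^+ 2 * shellt j.+1 ^+ 2 - r ^+ 2) / 2 - P / 2 * ln (1 - shellm j) <=
  - x - 29 / 10 + j%:R / 4.
Proof.
have t0 := shellt_gt0 j; have t2 : 0 < shellt j ^+ 2 by rewrite exprn_gt0.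
have P0 := P_gt0; have r20 : 0 < r ^+ 2 by rewrite exprn_gt0.
have rr := r2_ge; have r12 := r2_ge12.
pose e := (r ^+ 2)^-1.
have e0 : 0 < e by rewrite invr_gt0.
have e12 : e <= 1 / 12 by rewrite /e -[leLHS]mul1r ler_pdivrMr//; lra.
have Pe : P * e <= 1 / 4 by rewrite ler_pdivrMr//; lra.
have st : 0 < Num.sqrt P by rewrite sqrtr_gt0.
have h1 : P / shellt j ^+ 2 * shellt j.+1 ^+ 2 <= P * (1 + e) ^+ 2.
  rewrite mulrAC -mulrA ler_pM2l// -expr_div_n lerXn2r// ?nnegrE.
  - by rewrite divr_ge0// ltW// shellt_gt0.
  - by rewrite addr_ge0// ltW.
  rewrite ler_pdivrMr//.
  have -> : shellt j.+1 = shellt j + e * r.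
    rewrite /shellt -natr1 mulrDl mul1r addrA; congr (_ + _).
    by rewrite /e expr2 invfM -mulrA mulVf ?mulr1// gt_eqF.
  by rewrite mulrDl mul1r lerD2l ler_pM2l// shellt_ge.
have h2 : ln (1 - shellm j) = - (2 * ln (shellt j / Num.sqrt P)).
  rewrite mulr_natl -lnXn ?posrE ?divr_gt0// -lnV ?posrE ?exprn_gt0 ?divr_gt0//.
  rewrite expr_div_n sqr_sqrtr ?ltW// invf_div /shellm; congr ln; ring.
have h3 : ln (shellt j / Num.sqrt P) <= ln (r / Num.sqrt P) + j%:R * e.
  have -> : shellt j / Num.sqrt P = r / Num.sqrt P * (1 + j%:R * e).
    by rewrite /shellt /e; field; rewrite !gt_eqF.
  have je : 0 <= j%:R * e by rewrite mulr_ge0// ltW.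
  rewrite lnM ?posrE ?divr_gt0 ?ltr_pwDl// lerD2l; apply: le_ln1Dx.
  by apply: lt_le_trans je; rewrite ltrN10.
rewrite h2; have hr := ln_radius.
have h4 : P * ln (shellt j / Num.sqrt P) <= P * ln (r / Num.sqrt P) + P * e * j%:R.
  by rewrite -mulrA (mulrC e) -mulrDr ler_pM2l.
have h5 : P * e * j%:R <= 1 / 4 * j%:R by rewrite ler_wpM2r.
have h6 : P * (1 + e) ^+ 2 <= P + 53 / 100 by rewrite expr2; nra.
lra.
Qed.

Local Open Scope ereal_scope.

Lemma integral_shellF c e j : \int[@gaussN R p]_v (shellF c e j v)%:E <=
  (expR (- x) * expR (c - 29 / 10) * expR (- (e - 1 / 4)) ^+ j)%:E.
Proof.
under eq_integral do rewrite EFinM.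
rewrite ge0_integralZl//; first last.
- apply/measurable_EFinP; apply: measurableT_comp => //.
  by apply: measurable_funM => //; apply: measurable_funM => //; exact: measurable_quad.
apply: le_trans (lee_wpmul2l _ (gaussN_quad_mgf l01 (shellm01 j))) _.
  by rewrite lee_fin mulr_ge0 ?expR_ge0.
rewrite -EFinM lee_fin -expRM_natl -!expRD ler_expR; have := shell_exponent j; lra.
Qed.

Lemma integral_shell_series c e : (1 / 4 < e)%R ->
  \int[@gaussN R p]_v (\sum_(0 <= j <oo) (shellF c e j v)%:E) <=
  (expR (- x) * (expR (c - 29 / 10) / (1 - expR (- (e - 1 / 4)))))%:E.
Proof.
move=> e0; rewrite mulrA -[leRHS]mule1; apply: integral_geometric_le => //.
- by move=> k; apply/measurable_EFinP; exact: measurable_shellF.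
- by move=> k v; rewrite lee_fin shellF_ge0.
- by rewrite expR_ge0 expR_lt1 oppr_lt0 subr_gt0.
by move=> k; rewrite mule1; exact: integral_shellF.
Qed.

Local Close Scope ereal_scope.

Lemma shell_pointwise c e v t : 0 <= e -> t ^+ 2 = Y v -> r < t ->
  psi v <= (t ^+ 2 - r ^+ 2) / 2 + c - e * (r * (t - r)) ->
  exists j, expR (psi v) <= shellF c e j v.
Proof.
move=> e0 tY rt H; have hr := r0; have tr : 0 < t - r by rewrite subr_gt0.
have y0 : 0 <= r * (t - r) by rewrite mulr_ge0// ltW.
have /andP[j1 j2] := truncn_itv y0; set j := Num.truncn _ in j1 j2.
exists j; rewrite /shellF -!expRD ler_expR; apply: (le_trans H).
have ej : e * j%:R <= e * (r * (t - r)) by rewrite ler_wpM2l.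
have t2 : t ^+ 2 <= shellt j.+1 ^+ 2.
  rewrite lerXn2r ?nnegrE ?(ltW (lt_trans hr rt)) ?(ltW (shellt_gt0 _))//.
  by rewrite /shellt -lerBlDl ler_pdivlMr// mulrC ltW.
have m0 : 0 <= P / shellt j ^+ 2 by rewrite divr_ge0 ?ltW ?P_gt0// exprn_gt0// shellt_gt0.
have := ler_wpM2l m0 t2; rewrite -tY /shellm; lra.
Qed.

Lemma expR_chord (y : R) : 0 <= y <= 13 / 5 -> expR y - 1 <= (expR (13 / 5) - 1) / (13 / 5) * y.
Proof.
move=> /andP[y0 y1]; have := @expR_convex R (y / (13 / 5)) (13 / 5) 0.
rewrite mulr0 addr0 divfK// expR0 => /(_ _) H.
have {}H := H ltac:(lra).
lra.
Qed.

Definition ser (F : nat -> 'cV[R]_p -> R) (v : 'cV[R]_p) : \bar R :=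
  (\sum_(0 <= k <oo) (F k v)%:E)%E.

(** Inside the ellipsoid the chord handles psi <= 13/5 and [deep_in] the rest. Outside, with vh the
    radial projection, the shells keep the gain 5/8 if psi vh <= 13/5, and 5/8 - 3/10 = 13/40 if psi
    vh < 3/10 r (t - r); otherwise the overshoot t - r is short compared with psi vh and [deep_out]
    applies. *)
Lemma core_pointwise (k1 k2 : R) v : k1 = 43 / 10 -> k2 = 301 / 100 ->
  ((Num.max 0 (expR (psi v) - 1))%:E <=
  ((expR (13 / 5) - 1) / (13 / 5) * T v)%:E +
  (k1%:E * ser (fun k => deepF (119 / 200) (deeps k)) v +
   k2%:E * ser (fun k => deepF (17 / 20) (deeps k)) v) +
  (ser (shellF (13 / 5) (5 / 8)) v + ser (shellF 0 (13 / 40)) v))%E.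
Proof.
move=> k1E k2E; have k10 : 0 <= k1 by lra.
have k20 : 0 <= k2 by lra.
pose S F := ser F v; rewrite -!/(S _).
have S0 F : (forall k u, 0 <= F k u) -> (0 <= S F)%E.
  by move=> F0; apply: nneseries_ge0 => k _ _; rewrite lee_fin.
have SF F k : (forall k u, 0 <= F k u) -> ((F k v)%:E <= S F)%E.
  by move=> F0; apply: (@nneseries_ge_term _ (fun k => (F k v)%:E)) => n; rewrite lee_fin.
have A0 : 0 <= (expR (13 / 5) - 1) / (13 / 5) :> R.
  by rewrite divr_ge0// subr_ge0 expR_ge1.
have b1 : (0 <= ((expR (13 / 5) - 1) / (13 / 5) * T v)%:E)%E by rewrite lee_fin mulr_ge0.
have b2 : (0 <= k1%:E * S (fun k => deepF (119 / 200) (deeps k)))%E.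
  by rewrite mule_ge0 ?lee_fin ?k10 ?k20// S0// => k u; exact: deepF_ge0.
have b3 : (0 <= k2%:E * S (fun k => deepF (17 / 20) (deeps k)))%E.
  by rewrite mule_ge0 ?lee_fin ?k10 ?k20// S0// => k u; exact: deepF_ge0.
have b4 : (0 <= S (shellF (13 / 5) (5 / 8)))%E by rewrite S0// => k u; exact: shellF_ge0.
have b5 : (0 <= S (shellF 0 (13 / 40)))%E by rewrite S0// => k u; exact: shellF_ge0.
have M (a : R) : expR (psi v) <= a -> Num.max 0 (expR (psi v) - 1) <= a.
  by move=> h; rewrite ge_max; have := expR_ge0 (psi v); lra.
have deep k : expR (psi v) <= 43 / 10 * (deepF (119 / 200) (deeps k) v +
    7 / 10 * deepF (17 / 20) (deeps k) v) -> ((Num.max 0 (expR (psi v) - 1))%:E <=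
  ((expR (13 / 5) - 1) / (13 / 5) * T v)%:E +
  (k1%:E * S (fun k => deepF (119 / 200) (deeps k)) +
   k2%:E * S (fun k => deepF (17 / 20) (deeps k))) +
  (S (shellF (13 / 5) (5 / 8)) + S (shellF 0 (13 / 40))))%E.
  move=> /M h; apply: (@le_trans _ _ (k1%:E * S (fun k => deepF (119 / 200) (deeps k)) +
   k2%:E * S (fun k => deepF (17 / 20) (deeps k)))%E); last first.
    exact: (le_trans (leeDr _ b1) (leeDl _ (adde_ge0 b4 b5))).
  apply: (@le_trans _ _ (k1%:E * (deepF (119 / 200) (deeps k) v)%:E +
     k2%:E * (deepF (17 / 20) (deeps k) v)%:E)%E).
    by rewrite -!EFinM -EFinD lee_fin k1E k2E; lra.
  apply: leeD; apply: lee_wpmul2l; rewrite ?lee_fin ?k10 ?k20//.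
    by apply: (SF (fun k => deepF (119 / 200) (deeps k))) => n u; exact: deepF_ge0.
  by apply: (SF (fun k => deepF (17 / 20) (deeps k))) => n u; exact: deepF_ge0.
have Y0 := quad_ge0 v (fun i => proj1 (andP (l01 i))).
have hr := r0.
have d26 : 0 < 13 / 5 :> R by lra.
have [Yr|Yr] := leP (Y v) (r ^+ 2).
  have [p1|p1] := leP (psi v) (13 / 5).
    apply: (@le_trans _ _ ((expR (13 / 5) - 1) / (13 / 5) * T v)%:E); last first.
      by rewrite -addeA; apply: leeDl; exact: (adde_ge0 (adde_ge0 b2 b3) (adde_ge0 b4 b5)).
    rewrite lee_fin; have Tv := le_trans (ler_norm _) (Tle Yr).
    have [p0|p0] := leP (psi v) 0.
      by rewrite max_l ?mulr_ge0// subr_le0 expR_le1.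
    rewrite max_r; last by rewrite subr_ge0 expR_ge1 ltW.
    apply: le_trans (expR_chord _) _; first by rewrite (ltW p0).
    by rewrite ler_wpM2l.
  have pp : psi v <= w * Y v / 2 by exact: le_trans (ler_norm _) (psiw Yr).
  have pY : 0 < Y v.
    rewrite lt_neqAle Y0 andbT; apply/eqP => y0; move: pp; rewrite -y0; lra.
  have [k hk] := deeps_bin pY (lt_trans d26 p1) pp.
  apply: (deep k); apply: deep_in => //; [exact: deeps01|exact: ltW].
pose t := Num.sqrt (Y v).
have tY : t ^+ 2 = Y v by rewrite sqr_sqrtr.
have rt : r < t.
  rewrite -(@ltr_pXn2r _ 2)// ?nnegrE ?ltW// ?tY//.
  by rewrite /t sqrtr_gt0 (le_lt_trans _ Yr)// sqr_ge0.
have Yvh : Y ((r / t) *: v) = r ^+ 2.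
  have t0 : 0 < t by exact: lt_trans rt.
  by rewrite quadZ -tY expr_div_n divfK// gt_eqF// exprn_gt0.
have Hout := psi_out tY rt.
set vh := (r / t) *: v in Yvh Hout.
have [p1|p1] := leP (psi vh) (13 / 5).
  have [|j /M Hj] := @shell_pointwise (13 / 5) (5 / 8) v t shell_ge0_1 tY rt; first lra.
  apply: (@le_trans _ _ (shellF (13 / 5) (5 / 8) j v)%:E); first by rewrite lee_fin.
  apply: (@le_trans _ _ (S (shellF (13 / 5) (5 / 8)))); first by apply: SF => n u; exact: shellF_ge0.
  by apply: (@le_trans _ _ (_ + _)%E); [apply: leeDl|apply: leeDr; exact: (adde_ge0 b1 (adde_ge0 b2 b3))].
have [p2|p2] := ltP (10 / 3 * psi vh) (r * (t - r)).
  have [|j /M Hj] := @shell_pointwise 0 (13 / 40) v t shell_ge0_2 tY rt; first lra.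
  apply: (@le_trans _ _ (shellF 0 (13 / 40) j v)%:E); first by rewrite lee_fin.
  apply: (@le_trans _ _ (S (shellF 0 (13 / 40)))); first by apply: SF => n u; exact: shellF_ge0.
  by apply: (@le_trans _ _ (_ + _)%E); [apply: leeDr|apply: leeDr; exact: (adde_ge0 b1 (adde_ge0 b2 b3))].
have pp : psi vh <= w * Y vh / 2.
  by apply: le_trans (ler_norm _) (psiw _); rewrite Yvh.
have [k hk] := @deeps_bin (psi vh) (Y vh) ltac:(by rewrite Yvh exprn_gt0) (lt_trans d26 p1) pp.
apply: (deep k); apply: (@deep_out _ v t) => //; [exact: deeps01|exact: ltW|].
by rewrite Yvh in hk.
Qed.


Lemma measurable_ser (F : nat -> 'cV[R]_p -> R) : (forall k, measurable_fun setT (F k)) ->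
  (forall k v, 0 <= F k v) -> measurable_fun setT (ser F).
Proof.
move=> mF F0; apply: ge0_emeasurable_sum => [k v _ _|k _]; first by rewrite lee_fin.
exact/measurable_EFinP.
Qed.

Lemma ser_ge0 (F : nat -> 'cV[R]_p -> R) v : (forall k v, 0 <= F k v) -> (0 <= ser F v)%E.
Proof. by move=> F0; apply: nneseries_ge0 => k _ _; rewrite lee_fin. Qed.

Theorem core_bound (W : R) : W = 39 / 5 \/ W = 6 /\ w <= 1 / 6 ->
  (\int[@gaussN R p]_v (Num.max 0 (expR (psi v) - 1))%:E <=
   W%:E * \int[@gaussN R p]_v (T v)%:E + (4 * expR (- x))%:E)%E.
Proof.
move=> hW; have hc := core_constant w14 hW.
have int0 : (0 <= \int[@gaussN R p]_v (T v)%:E)%E.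
  by apply: integral_ge0 => v _; rewrite lee_fin.
have deep0 g k v : 0 <= deepF g (deeps k) v by exact: deepF_ge0.
have shell0 c e k v : 0 <= shellF c e k v by exact: shellF_ge0.
have mdeep g : measurable_fun setT (ser (fun k => deepF g (deeps k))).
  by apply: measurable_ser => // k; exact: measurable_deepF.
have mshell c e : measurable_fun setT (ser (shellF c e)).
  by apply: measurable_ser => // k; exact: measurable_shellF.
have [k1 k1E] : exists k : R, k = 43 / 10 by exists (43 / 10).
have [k2 k2E] : exists k : R, k = 301 / 100 by exists (301 / 100).
have [A AE] : exists A : R, A = (expR (13 / 5) - 1) / (13 / 5) by exists ((expR (13 / 5) - 1) / (13 / 5)).
have A0 : 0 <= A by rewrite AE divr_ge0 ?subr_ge0 ?expR_ge1//; lra.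
have k10 : 0 <= k1 by rewrite k1E; lra.
have k20 : 0 <= k2 by rewrite k2E; lra.
have [c1 c1E] : exists c : R, c = 119 / 200 by exists (119 / 200).
have [c2 c2E] : exists c : R, c = 17 / 20 by exists (17 / 20).
have [[s1 s2] sE] : exists s : R * R, s = (13 / 5, 5 / 8) by exists (13 / 5, 5 / 8).
have [[s3 s4] s'E] : exists s : R * R, s = (0, 13 / 40) by exists (0, 13 / 40).
move: sE s'E => [s1E s2E] [s3E s4E].
pose D g v := ser (fun k => deepF g (deeps k)) v.
pose S c e v := ser (shellF c e) v.
have D0 g v : (0 <= D g v)%E by exact: ser_ge0.
have S0 c e v : (0 <= S c e v)%E by exact: ser_ge0.
have mA : measurable_fun setT (fun v => (A * T v)%:E).
  by apply/measurable_EFinP; exact: measurable_funM.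
have mkD k g : measurable_fun setT (fun v => k%:E * D g v)%E by apply: measurable_funeM; exact: mdeep.
have mS c e : measurable_fun setT (S c e) by exact: mshell.
have kD0 k g v : 0 <= k -> (0 <= k%:E * D g v)%E by move=> k0; rewrite mule_ge0.
apply: (@le_trans _ _ (\int[@gaussN R p]_v ((A * T v)%:E + (k1%:E * D c1 v + k2%:E * D c2 v)
   + (S s1 s2 v + S s3 s4 v)))%E).
  apply: le_integralT.
  - by apply/measurable_EFinP; apply: measurable_maxr => //; apply: measurable_funB => //; exact: measurableT_comp.
  - apply: emeasurable_funD; apply: emeasurable_funD => //.
    exact: emeasurable_funD.
  - by move=> v; rewrite lee_fin le_max lexx.
  - move=> v; have := core_pointwise v k1E k2E.
    by rewrite -AE -c1E -c2E -s1E -s2E -s3E -s4E.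
rewrite ge0_integralD//; first last.
- exact: emeasurable_funD.
- by move=> v _; rewrite adde_ge0.
- by apply: emeasurable_funD => //; exact: emeasurable_funD.
- by move=> v _; rewrite !adde_ge0 ?kD0 ?lee_fin ?mulr_ge0.
rewrite ge0_integralD//.
rewrite ge0_integralD//; first last.
- exact: emeasurable_funD.
- by move=> v _; rewrite adde_ge0 ?kD0.
- by move=> v _; rewrite lee_fin mulr_ge0.
rewrite !ge0_integralD//; first last.
- by move=> v _; rewrite kD0.
- by move=> v _; rewrite kD0.
rewrite !ge0_integralZl//; try exact: mdeep.
have h1 := @integral_deep_series c1 ltac:(rewrite c1E; exact: deep_range1).
have h2 := @integral_deep_series c2 ltac:(rewrite c2E; exact: deep_range2).
have h3 := @integral_shell_series s1 s2 ltac:(rewrite s2E; exact: shell_range1).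
have h4 := @integral_shell_series s3 s4 ltac:(rewrite s4E; exact: shell_range2).
have EA : (\int[@gaussN R p]_v (A * T v)%:E = A%:E * \int[@gaussN R p]_v (T v)%:E)%E.
  under eq_integral do rewrite EFinM.
  rewrite ge0_integralZl//; first by apply/measurable_EFinP.
  by move=> v _; rewrite lee_fin.
rewrite EA; set I := (\int[_]_v (T v)%:E)%E in int0 h1 h2 *.
have {}h1 := lee_wpmul2l (_ : (0 <= k1%:E)%E) h1.
have {}h2 := lee_wpmul2l (_ : (0 <= k2%:E)%E) h2.
have d0 g : 119 / 200 <= g <= 17 / 20 -> 0 <= deepc g / (1 - deepq g).
  move=> /andP[g1 g2]; rewrite divr_ge0 ?expR_ge0// subr_ge0 expR_le1 oppr_le0.
  by rewrite mulr_ge0 ?deepr_ge0// divr_ge0.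
have d1 : 0 <= deepc c1 / (1 - deepq c1) by apply: d0; rewrite c1E; exact: deep_range1.
have d2 : 0 <= deepc c2 / (1 - deepq c2) by apply: d0; rewrite c2E; exact: deep_range2.
apply: (@le_trans _ _ ((A%:E * I + (k1%:E * ((deepc c1 / (1 - deepq c1))%:E * I) +
  k2%:E * ((deepc c2 / (1 - deepq c2))%:E * I))) +
  ((expR (- x) * (expR (s1 - 29 / 10) / (1 - expR (- (s2 - 1 / 4)))))%:E +
   (expR (- x) * (expR (s3 - 29 / 10) / (1 - expR (- (s4 - 1 / 4)))))%:E))%E).
  apply: leeD; last exact: leeD.
  by apply: leeD => //; apply: leeD; [apply: h1|apply: h2]; rewrite lee_fin.
rewrite !muleA -!EFinM -!ge0_muleDl; last first.
- by rewrite lee_fin mulr_ge0.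
- by rewrite lee_fin mulr_ge0.
- by apply: adde_ge0; rewrite lee_fin mulr_ge0.
- by rewrite lee_fin.
apply: leeD.
  by apply: lee_wpmul2r => //; rewrite lee_fin AE k1E k2E c1E c2E.
rewrite lee_fin -mulrDr mulrC ler_wpM2r ?expR_ge0// s1E s2E s3E s4E.
exact: shell_constant.
Qed.

End core.

(** * Gaussian tail of the ellipsoid, mean of (1 - e^psi)_+, and the case w = 0 *)

Section general_dimension.
Context {R : realType} (p : nat) (l : 'I_p -> R).
Hypothesis l01 : forall i, 0 <= l i <= 1.
Local Notation Y := (quad l).
Local Notation P := (\sum_i l i).
Variables (r x : R).
Hypothesis P0 : 0 < P.
Hypothesis rE : r = 2 * Num.sqrt P + Num.sqrt (2 * x).

(** The Chernoff bound at the optimal parameter 1 - P / r^2. The surplus 79/100 P is 2 - 1/2 -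
    71/100 times P; it is what keeps the partition function away from 0 when x is small. *)
Lemma gaussN_tail_strong : 0 <= x ->
  (\int[@gaussN R p]_v (if r ^+ 2 < Y v then 1 else 0)%:E <=
   (expR (- (x + 79 / 100 * P)))%:E)%E.
Proof.
move=> x0.
pose s := Num.sqrt P; pose u := Num.sqrt (2 * x).
have s0 : 0 < s by rewrite sqrtr_gt0.
have u0 : 0 <= u by exact: sqrtr_ge0.
have sP : s ^+ 2 = P by rewrite sqr_sqrtr// ltW.
have ux : u ^+ 2 = 2 * x by rewrite sqr_sqrtr// mulr_ge0.
have r0 : 0 < r by rewrite rE -/s -/u; lra.
have r2 : 0 < r ^+ 2 by rewrite exprn_gt0.
have m01 : 0 <= 1 - P / r ^+ 2 < 1.
  rewrite subr_ge0 ltrBlDr ltrDl divr_gt0// andbT ler_pdivrMr// mul1r -sP rE -/s -/u !expr2.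
  nra.
set m := 1 - _ in m01.
apply: (@le_trans _ _ (\int[@gaussN R p]_v ((expR (- m * (r ^+ 2 / 2)))%:E *
    (expR (m * (Y v / 2)))%:E))%E).
  apply: le_integralT.
  - apply/measurable_EFinP; apply: measurable_fun_ifT => //.
    by apply: measurable_fun_ltr => //; exact: measurable_quad.
  - apply/measurable_EFinP; apply: measurable_funM => //; apply: measurableT_comp => //.
    by apply: measurable_funM => //; apply: measurable_funM => //; exact: measurable_quad.
  - by move=> v; case: ifP.
  - move=> v; rewrite -EFinM lee_fin -expRD; case: ifPn => [h|_]; last exact: expR_ge0.
    rewrite expR_ge1; have /andP[m0 _] := m01; nra.
rewrite ge0_integralZl//; first last.
- by apply/measurable_EFinP; apply: measurableT_comp => //; apply: measurable_funM => //;
    apply: measurable_funM => //; exact: measurable_quad.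
apply: le_trans (lee_wpmul2l _ (gaussN_quad_mgf l01 m01)) _; first by rewrite lee_fin expR_ge0.
rewrite -EFinM lee_fin -expRD ler_expR.
have -> : ln (1 - m) = - (2 * ln (r / s)).
  rewrite mulr_natl -lnXn ?posrE ?divr_gt0// -lnV ?posrE ?exprn_gt0 ?divr_gt0//.
  by rewrite expr_div_n sP invf_div /m; congr ln; ring.
have hln : P * ln (r / s) <= P * (71 / 100) + s * u / 2.
  have -> : P * (71 / 100) + s * u / 2 = P * (71 / 100 + u / (2 * s)).
    by rewrite -sP; field; rewrite gt_eqF.
  by rewrite ler_pM2l// rE; exact: ln_2D.
have -> : - m * (r ^+ 2 / 2) = P / 2 - r ^+ 2 / 2 by rewrite /m; field; rewrite gt_eqF.
have r2E : r ^+ 2 = 4 * P + 4 * s * u + 2 * x by rewrite rE -/s -/u -sP -ux; ring.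
have su : 0 <= s * u by rewrite mulr_ge0// ltW.
have P0' := P0; rewrite r2E; lra.
Qed.

Lemma gaussN_tail : 0 <= x ->
  (\int[@gaussN R p]_v (if r ^+ 2 < Y v then 1 else 0)%:E <= (expR (- x))%:E)%E.
Proof.
move=> x0; apply: le_trans (gaussN_tail_strong x0) _.
by rewrite lee_fin ler_expR lerN2 lerDl mulr_ge0// ltW.
Qed.

Variables (psi T : 'cV[R]_p -> R).
Hypothesis x13 : 32 / 25 <= x.
Hypothesis Tle : forall v, Y v <= r ^+ 2 -> `|psi v| <= T v.
Hypothesis T0 : forall v, 0 <= T v.
Hypothesis mT : measurable_fun setT T.
Hypothesis mpsi : measurable_fun setT psi.

Lemma lower_bound :
  (\int[@gaussN R p]_v (Num.max 0 (1 - expR (psi v)))%:E <=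
   \int[@gaussN R p]_v (T v)%:E + (expR (- x))%:E)%E.
Proof.
have x0 : 0 <= x by have := x13; lra.
apply: le_trans (leeD2l _ (gaussN_tail x0)).
have mi : measurable_fun setT (fun v : 'cV[R]_p => if r ^+ 2 < Y v then 1 else 0 : R).
  by apply: measurable_fun_ifT => //; apply: measurable_fun_ltr => //; exact: measurable_quad.
rewrite -ge0_integralD//; first last.
- by apply/measurable_EFinP.
- by move=> v _; case: ifP.
- by apply/measurable_EFinP.
- by move=> v _; rewrite lee_fin.
apply: le_integralT.
- by apply/measurable_EFinP; apply: measurable_maxr => //; apply: measurable_funB => //; exact: measurableT_comp.
- by apply/measurable_EFinP; apply: measurable_funD.
- by move=> v; rewrite lee_fin le_max lexx.
move=> v; rewrite -EFinD lee_fin ge_max; apply/andP; split.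
  by rewrite addr_ge0//; case: ifP.
have e1 := expR_ge1Dx (psi v); have e0 := expR_ge0 (psi v).
case: ifPn => h; first by have := T0 v; lra.
rewrite -leNgt in h; have := Tle h; rewrite ler_norml => /andP[h1 _]; lra.
Qed.

Variable w : R.
Hypothesis psiw : forall v, Y v <= r ^+ 2 -> `|psi v| <= w * Y v / 2.
Hypothesis psi_cvx : forall (t : R) (v u : 'cV[R]_p), 0 <= t <= 1 ->
  (1 - t) * psi v + t * psi u - t * (1 - t) / 2 * Y (v - u) <= psi ((1 - t) *: v + t *: u).
Hypothesis T3 : forall (t : R) (v : 'cV[R]_p), T (t *: v) = `|t| ^+ 3 * T v.
Hypothesis w14 : 0 <= w <= 1 / 4.
Hypothesis wP : w * P <= 2 / 3.
Hypothesis psi_out : forall v t, t ^+ 2 = Y v -> r < t ->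
  psi v <= (t ^+ 2 - r ^+ 2) / 2 - 5 / 8 * r * (t - r) + psi ((r / t) *: v).

Lemma core_bound_ge1 (W : R) : 1 <= P -> W = 39 / 5 \/ W = 6 /\ w <= 1 / 6 ->
  (\int[@gaussN R p]_v (Num.max 0 (expR (psi v) - 1))%:E <=
   W%:E * \int[@gaussN R p]_v (T v)%:E + (4 * expR (- x))%:E)%E.
Proof.
move=> P1 hW; have /andP[w0 w1] := w14.
have x13' := x13; have P0' := P0.
have r0 : 0 < r.
  by rewrite rE ltr_pwDl ?sqrtr_ge0// mulr_gt0// sqrtr_gt0.
have [w'|w'] := ltP 0 w.
  by apply: (@core_bound R p l psi T r w) => //; rewrite w' w1.
have w00 : w = 0 by apply/eqP; rewrite eq_le w' w0.
have W6 : (\int[@gaussN R p]_v (Num.max 0 (expR (psi v) - 1))%:E <=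
   6%:E * \int[@gaussN R p]_v (T v)%:E + (4 * expR (- x))%:E)%E.
  (* The grid [deeps] requires w > 0. For w = 0 psi vanishes on the ellipsoid, so any positive value
     is admissible there, and this one satisfies w2 P = 1/6 and w2 <= 1/6. *)
  pose w2 := 1 / (6 * P).
  have w20 : 0 < w2 by rewrite divr_gt0// mulr_gt0.
  have w26 : w2 <= 1 / 6 by rewrite /w2 ler_pdivrMr ?mulr_gt0//; lra.
  apply: (@core_bound R p l psi T r w2) => //.
  - move=> v h; apply: le_trans (psiw h) _; rewrite w00 !mul0r.
    apply: divr_ge0 => //; apply: mulr_ge0; first exact: ltW.
    by apply: quad_ge0 => i; have /andP[] := l01 i.
  - by rewrite w20/=; lra.
  - by rewrite /w2 (_ : 1 / (6 * P) * P = 1 / 6); [lra|field; rewrite gt_eqF].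
  - by right.
apply: le_trans W6 _; rewrite leeD2r// lee_wpmul2r ?lee_fin//.
  by apply: integral_ge0 => v _; rewrite lee_fin.
by case: hW => [->|[-> _]]; lra.
Qed.

End general_dimension.

(** * Reduction of small effective dimension to effective dimension 1 *)

Section rescale.
Context {R : realType} (p : nat) (l : 'I_p -> R).
Hypothesis l01 : forall i, 0 <= l i <= 1.
Local Notation Y := (quad l).
Local Notation P := (\sum_i l i).
Variables (r x : R) (psi T : 'cV[R]_p -> R) (w : R).
Hypothesis P0 : 0 < P.
Hypothesis rE : r = 2 * Num.sqrt P + Num.sqrt (2 * x).
Hypothesis x13 : 32 / 25 <= x.
Hypothesis Tle : forall v, Y v <= r ^+ 2 -> `|psi v| <= T v.
Hypothesis T0 : forall v, 0 <= T v.
Hypothesis mT : measurable_fun setT T.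
Hypothesis mpsi : measurable_fun setT psi.
Hypothesis psiw : forall v, Y v <= r ^+ 2 -> `|psi v| <= w * Y v / 2.
Hypothesis psi_cvx : forall (t : R) (v u : 'cV[R]_p), 0 <= t <= 1 ->
  (1 - t) * psi v + t * psi u - t * (1 - t) / 2 * Y (v - u) <= psi ((1 - t) *: v + t *: u).
Hypothesis T3 : forall (t : R) (v : 'cV[R]_p), T (t *: v) = `|t| ^+ 3 * T v.
Hypothesis w14 : 0 <= w <= 1 / 4.
Hypothesis wP : w * P <= 2 / 3.
Hypothesis psi_out : forall v t, t ^+ 2 = Y v -> r < t ->
  psi v <= (t ^+ 2 - r ^+ 2) / 2 - 5 / 8 * r * (t - r) + psi ((r / t) *: v).

(** If P < 1, the weights l / P have sum 1 and are still at most 1. Replacing x by x / P, r by r /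
    sqrt P and w by w P preserves the hypotheses: the nonnegative bracket in [psi_out] is divided by
    P < 1 and only grows. The tail e^(-x / P) is smaller than e^-x. *)
Lemma upper_bound (W : R) : W = 39 / 5 \/ W = 6 /\ w <= 1 / 6 ->
  (\int[@gaussN R p]_v (Num.max 0 (expR (psi v) - 1))%:E <=
   W%:E * \int[@gaussN R p]_v (T v)%:E + (4 * expR (- x))%:E)%E.
Proof.
move=> hW; have [P1|P1] := leP 1 P.
  by apply: (@core_bound_ge1 R p l l01 r x _ _ psi T _ _ _ _ _ w).
have x13' := x13; have P0' := P0; have /andP[w0 w1] := w14.
have s0 : 0 < Num.sqrt P by rewrite sqrtr_gt0.
have sP : Num.sqrt P ^+ 2 = P by rewrite sqr_sqrtr// ltW.
have r0 : 0 < r by rewrite rE ltr_pwDl ?sqrtr_ge0// mulr_gt0.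
pose l' i := l i / P.
have l'1 : \sum_i l' i = 1 by rewrite -mulr_suml divff// gt_eqF.
have Y' v : quad l' v = Y v / P.
  by rewrite /quad mulr_suml; apply: eq_bigr => i _; rewrite /l' mulrAC.
have l'01 i : 0 <= l' i <= 1.
  have /andP[li0 li1] := l01 i; rewrite /l' divr_ge0 ?(ltW P0)//= ler_pdivrMr// mul1r.
  by rewrite (bigD1 i)//= lerDl sumr_ge0// => j _; have /andP[] := l01 j.
have Yr v : quad l' v <= (r / Num.sqrt P) ^+ 2 -> Y v <= r ^+ 2.
  by rewrite Y' expr_div_n sP ler_pM2r// invr_gt0.
have xP : x <= x / P by rewrite ler_pdivlMr// ler_piMr//; lra.
apply: (@le_trans _ _ (W%:E * \int[@gaussN R p]_v (T v)%:E + (4 * expR (- (x / P)))%:E)%E).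
  apply: (@core_bound_ge1 R p l' l'01 (r / Num.sqrt P) (x / P) _ _ psi T _ _ _ _ _ (w * P)) => //.
  - by rewrite l'1.
  - rewrite l'1 sqrtr1 mulr1 rE mulrDl -mulrA divff ?gt_eqF// mulr1; congr (_ + _).
    have x2 : 0 <= 2 * x by lra.
    by rewrite mulrA (sqrtrM _ x2) sqrtrV// ltW.
  - by apply: le_trans xP.
  - by move=> v /Yr; exact: Tle.
  - move=> v /Yr h; rewrite Y'; have -> : w * P * (Y v / P) / 2 = w * Y v / 2.
      by field; rewrite gt_eqF.
    exact: psiw.
  - move=> t v u t01; apply: le_trans (psi_cvx v u t01); rewrite Y' lerD2l lerN2.
    have /andP[t0 t1] := t01.
    rewrite ler_wpM2l ?divr_ge0 ?mulr_ge0 ?subr_ge0// ler_pdivlMr//.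
    by rewrite ler_piMr ?quad_ge0 ?ltW// => i; have /andP[] := l01 i.
  - by rewrite mulr_ge0 ?(ltW P0)//= (le_trans _ w1)// ler_piMr// ltW.
  - by rewrite l'1 mulr1.
  - move=> v t; rewrite Y' => tE rt.
    have tY : (t * Num.sqrt P) ^+ 2 = Y v by rewrite exprMn tE sP divfK// gt_eqF.
    have rt' : r < t * Num.sqrt P by rewrite -ltr_pdivrMr.
    have -> : r / Num.sqrt P / t = r / (t * Num.sqrt P) by rewrite invfM mulrA mulrAC.
    apply: le_trans (psi_out tY rt') _; rewrite lerD2r.
    have tu : t = t * Num.sqrt P / Num.sqrt P by rewrite mulfK// gt_eqF.
    have E (u a : R) : a != 0 ->
        ((u / a) ^+ 2 - (r / a) ^+ 2) / 2 - 5 / 8 * (r / a) * (u / a - r / a) =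
        ((u ^+ 2 - r ^+ 2) / 2 - 5 / 8 * r * (u - r)) / a ^+ 2 by move=> a0; field.
    rewrite [in leRHS]tu E ?gt_eqF// sP; move: (t * Num.sqrt P) rt' => u rt'.
    have : 0 <= (u ^+ 2 - r ^+ 2) / 2 - 5 / 8 * r * (u - r) by rewrite !expr2; nra.
    move=> h; rewrite ler_pdivlMr// ler_piMr// ltW//.
  - by rewrite l'1.
  - case: hW => [->|[-> w6]]; [by left|right; split => //].
    by rewrite (le_trans _ w6)// ler_piMr// ltW.
by rewrite leeD2l// lee_fin ler_pM2l// ler_expR lerN2.
Qed.

End rescale.

(** * From the two one-sided means to the normalized law *)

Section total_variation.
Context d (X : measurableType d) (R : realType) (N : probability X R) (w : X -> R).
Hypothesis mw : measurable_fun setT w.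
Hypothesis w0 : forall v, 0 <= w v.
Hypothesis wfin : (\int[N]_v (w v)%:E < +oo)%E.
Variable B : R.
Hypothesis Bu : (\int[N]_v (Num.max 0 (w v - 1))%:E <= B%:E)%E.
Hypothesis Bl : (\int[N]_v (Num.max 0 (1 - w v))%:E <= B%:E)%E.

(** Normalization costs no factor 2. If Z >= 1 it lowers the masses of A and of its complement, so
    the excess bounds for both sets give the two sides; if Z < 1 it raises them and the deficit
    bounds do. *)
Lemma reweight_le (A : set X) : measurable A -> 0 < fine (\int[N]_v (w v)%:E) ->
  `|fine (\int[N]_(v in A) (w v)%:E) / fine (\int[N]_v (w v)%:E) - fine (N A)| <= B.
Proof.
move=> mA Z0.
have mE : measurable_fun setT (EFin \o w) by exact/measurable_EFinP.
have wE0 v : (0 <= (w v)%:E)%E by rewrite lee_fin.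
have fin C : measurable C -> (\int[N]_(v in C) (w v)%:E)%E \is a fin_num.
  move=> mC; rewrite ge0_fin_numE ?integral_ge0//.
  by apply: le_lt_trans wfin; apply: ge0_subset_integral.
have up C : measurable C -> fine (\int[N]_(v in C) (w v)%:E) - fine (N C) <= B.
  move=> mC; rewrite lerBlDl -lee_fin EFinD !fineK ?fin// ?fin_num_measure//.
  have := @integral_cst _ _ _ N C mC 1%E; rewrite mul1e => <-.
  apply: (@le_trans _ _ (\int[N]_(v in C) (cst 1%E v) + \int[N]_(v in C) (Num.max 0 (w v - 1))%:E)%E).
    rewrite -ge0_integralD//; first last.
    - apply/measurable_EFinP; apply: measurable_maxr => //.
      by apply: measurable_funB => //; exact: measurable_funTS.
    - by move=> v _; rewrite lee_fin le_max lexx.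
    apply: ge0_le_integral => //; first exact: measurable_funTS.
    - apply/measurable_EFinP; apply: measurable_funD => //; apply: measurable_maxr => //.
      by apply: measurable_funB => //; exact: measurable_funTS.
    - by move=> v _; rewrite -EFinD lee_fin -lerBlDl le_max lexx orbT.
  rewrite leeD2l//; apply: le_trans Bu; apply: ge0_subset_integral => //.
  - by apply/measurable_EFinP; apply: measurable_maxr => //; exact: measurable_funB.
  - by move=> v _; rewrite lee_fin le_max lexx.
have lo C : measurable C -> fine (N C) - fine (\int[N]_(v in C) (w v)%:E) <= B.
  move=> mC; rewrite lerBlDl -lee_fin EFinD !fineK ?fin// ?fin_num_measure//.
  have := @integral_cst _ _ _ N C mC 1%E; rewrite mul1e => <-.
  apply: (@le_trans _ _ (\int[N]_(v in C) (w v)%:E + \int[N]_(v in C) (Num.max 0 (1 - w v))%:E)%E).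
    rewrite -ge0_integralD//; first last.
    - apply/measurable_EFinP; apply: measurable_maxr => //.
      by apply: measurable_funB => //; exact: measurable_funTS.
    - by move=> v _; rewrite lee_fin le_max lexx.
    - exact: measurable_funTS.
    apply: ge0_le_integral => //.
    - apply/measurable_EFinP; apply: measurable_funD => //; first exact: measurable_funTS.
      apply: measurable_maxr => //.
      by apply: measurable_funB => //; exact: measurable_funTS.
    - by move=> v _; rewrite -EFinD lee_fin -lerBlDl le_max lexx orbT.
  rewrite leeD2l//; apply: le_trans Bl; apply: ge0_subset_integral => //.
  - by apply/measurable_EFinP; apply: measurable_maxr => //; exact: measurable_funB.
  - by move=> v _; rewrite lee_fin le_max lexx.
have mAC : measurable (~` A) by exact: measurableC.
have aZ : fine (\int[N]_v (w v)%:E) =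
    fine (\int[N]_(v in A) (w v)%:E) + fine (\int[N]_(v in ~` A) (w v)%:E).
  rewrite -fineD ?fin//; congr fine; rewrite -(setUv A) ge0_integral_setU//.
  - by rewrite setUv.
  - by apply/disj_setPS => v [].
have n1 : fine (N A) + fine (N (~` A)) = 1.
  by rewrite probability_setC// fineB ?fin_num_measure//= subrKC.
have := up _ mA; have := up _ mAC; have := lo _ mA; have := lo _ mAC.
have a0 : 0 <= fine (\int[N]_(v in A) (w v)%:E) by rewrite fine_ge0// integral_ge0.
have a'0 : 0 <= fine (\int[N]_(v in ~` A) (w v)%:E) by rewrite fine_ge0// integral_ge0.
move: a0 a'0 aZ n1 Z0.
set a := fine _; set a' := fine _; set Z := fine _; set n := fine _; set n' := fine _.
move=> a0 a'0 aZ n1 Z0 h1 h2 h3 h4.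
have aa : a / Z + a' / Z = 1 by rewrite -mulrDl -aZ divff// gt_eqF.
have [Z1|Z1] := leP 1 Z.
  have q1 : a / Z <= a by rewrite ler_pdivrMr// ler_peMr.
  have q2 : a' / Z <= a' by rewrite ler_pdivrMr// ler_peMr.
  by rewrite ler_norml; apply/andP; split; lra.
have q1 : a <= a / Z by rewrite ler_pdivlMr// ler_piMr// ltW.
have q2 : a' <= a' / Z by rewrite ler_pdivlMr// ler_piMr// ltW.
by rewrite ler_norml; apply/andP; split; lra.
Qed.

End total_variation.

(** * Means of bounded functions under a probability *)

Section bounded_expectation.
Context d (X : measurableType d) (R : realType) (N : probability X R).
Implicit Types (f g : X -> R) (k : R).

Let NT : (N setT = 1)%E. Proof. exact: probability_setT. Qed.

Lemma bounded_integrable f k : measurable_fun setT f -> (forall x, `|f x| <= k) ->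
  N.-integrable setT (EFin \o f).
Proof.
move=> mf fk; apply: measurable_bounded_integrable => //.
  have h : (N setT < +oo)%E by rewrite NT ltry.
  exact: h.
by exists k; split; [exact: num_real|move=> M kM x _; exact: le_trans (fk x) (ltW kM)].
Qed.

Lemma RintegralT_cst (k : R) : \int[N]_x k = k.
Proof. by rewrite Rintegral_cst// -[RHS]mulr1; congr (_ * _); exact: (congr1 fine NT). Qed.

(** Adding the bound k makes the function nonnegative, so Tonelli, changes of variables and
    comparison, all available for nonnegative integrands, transfer to bounded signed ones. *)
Lemma Rintegral_shift f k : measurable_fun setT f -> (forall x, `|f x| <= k) ->
  (\int[N]_x (f x + k)%:E)%E = (\int[N]_x f x + k)%:E.
Proof.
move=> mf fk; have k0 x : 0 <= f x + k.
  by have := fk x; rewrite ler_norml => /andP[h _]; lra.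
rewrite -[in RHS](RintegralT_cst k) -RintegralD//; first last.
- by apply: (@bounded_integrable _ `|k|) => // x.
- exact: bounded_integrable fk.
rewrite /Rintegral fineK// ge0_fin_numE ?integral_ge0//; last first.
  by move=> x _; rewrite lee_fin.
apply: (@le_lt_trans _ _ (\int[N]_x (cst (k + k)%:E) x)%E).
  apply: le_integralT => //.
  - by apply/measurable_EFinP; exact: measurable_funD.
  - by move=> x; rewrite lee_fin lerD2r (le_trans (ler_norm _)).
by rewrite integral_cst//=; have h : ((k + k)%:E * N setT < +oo)%E by [rewrite NT mule1 ltry]; exact: h.
Qed.

Lemma Rintegral_bounded f k : measurable_fun setT f -> (forall x, `|f x| <= k) ->
  `|\int[N]_x f x| <= k.
Proof.
move=> mf fk; apply: le_trans (le_normr_Rintegral _ (bounded_integrable mf fk)) _ => //.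
rewrite -[leRHS]RintegralT_cst; apply: le_Rintegral => //.
- apply: (@bounded_integrable _ k) => [|x]; first exact: measurableT_comp.
  by rewrite normr_id.
- by apply: (@bounded_integrable _ `|k|) => // x.
Qed.

Lemma Rintegral_lin f g a b k : measurable_fun setT f -> measurable_fun setT g ->
  (forall x, `|f x| <= k) -> (forall x, `|g x| <= k) ->
  \int[N]_x (a * f x + b * g x) = a * \int[N]_x f x + b * \int[N]_x g x.
Proof.
move=> mf mg fk gk; have int (h : X -> R) c : measurable_fun setT h -> (forall x, `|h x| <= k) ->
    N.-integrable setT (EFin \o (fun x => c * h x)).
  move=> mh hk; apply: (@bounded_integrable _ (`|c| * k)) => [|x]; first exact: measurable_funM.
  by rewrite normrM ler_wpM2l.
rewrite RintegralD//; [|exact: int|exact: int].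
by rewrite !RintegralZl//; [exact: bounded_integrable gk|exact: bounded_integrable fk].
Qed.

Lemma le_Rintegral_bounded f g k : measurable_fun setT f -> measurable_fun setT g ->
  (forall x, `|f x| <= k) -> (forall x, `|g x| <= k) -> (forall x, f x <= g x) ->
  \int[N]_x f x <= \int[N]_x g x.
Proof.
move=> mf mg fk gk fg; apply: le_Rintegral => //.
- exact: bounded_integrable fk.
- exact: bounded_integrable gk.
Qed.

End bounded_expectation.

(** * Rotation invariance and Fubini for the Gaussian law *)

Section gauss_expectation_rec.
Context {R : realType}.

Lemma gaussN_orthogonal p (A : 'M[R]_p) (F : 'cV[R]_p -> \bar R) :
  A^T *m A = 1%:M -> measurable_fun setT F -> (forall v, (0 <= F v)%E) ->
  (\int[@gaussN R p]_v F (A *m v) = \int[@gaussN R p]_v F v)%E.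
Proof.
move=> AA mF F0.
have dA : `|\det A| = 1.
  have : \det A * \det A = 1 by rewrite -{1}det_tr -det_mulmx AA det1.
  by move=> h; apply/eqP; rewrite -(@eqrXn2 _ 2)// expr1n real_normK ?num_real// expr2 h.
have d0 : \det A != 0 by rewrite -normr_eq0 dA oner_neq0.
have norm (v : 'cV[R]_p) : \sum_i (A *m v) i 0 ^+ 2 = \sum_i v i 0 ^+ 2.
  have E (u : 'cV[R]_p) : \sum_i u i 0 ^+ 2 = (u^T *m u) 0 0.
    by rewrite mxE; apply: eq_bigr => i _; rewrite mxE expr2.
  by rewrite !E trmx_mul -mulmxA (mulmxA _ A) AA mul1mx.
have mG : measurable_fun setT (fun v => F v * (phi v)%:E)%E.
  by apply: emeasurable_funM => //; apply/measurable_EFinP; exact: measurable_phi.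
rewrite !integral_gaussN//; last by apply: (measurableT_comp mF); exact: measurable_mulmx.
rewrite -[RHS](lebesgue_cV_linear d0 mG); last first.
  by move=> v; rewrite mule_ge0// lee_fin ltW// phi_gt0.
rewrite dA mul1e; apply: eq_integral => v _; congr (_ * _%:E)%E.
by rewrite !phiE norm.
Qed.

Lemma measurable_cV_cons1 p (f : 'cV[R]_p.+1 -> R) x : measurable_fun setT f ->
  measurable_fun setT (fun v => f (cV_cons (x, v))).
Proof.
move=> mf; apply: (measurableT_comp mf); apply: (measurableT_comp (@measurable_cV_cons R p)).
exact: measurable_pair1.
Qed.

Lemma gaussN_recR p (f : 'cV[R]_p.+1 -> R) k : measurable_fun setT f ->
  (forall v, `|f v| <= k) ->
  \int[@gaussN R p.+1]_v f v = \int[@gauss1 R]_x \int[@gaussN R p]_v f (cV_cons (x, v)) /\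
  measurable_fun setT (fun x => \int[@gaussN R p]_v f (cV_cons (x, v))).
Proof.
move=> mf fk.
have E x : (\int[@gaussN R p]_v (f (cV_cons (x, v)) + k)%:E)%E =
    (\int[@gaussN R p]_v f (cV_cons (x, v)) + k)%:E.
  by apply: Rintegral_shift => //; exact: measurable_cV_cons1.
have mF : measurable_fun setT (fun v => (f v + k)%:E).
  by apply/measurable_EFinP; exact: measurable_funD.
have F0 v : (0 <= (f v + k)%:E)%E.
  by rewrite lee_fin; have := fk v; rewrite ler_norml => /andP[h _]; lra.
have mI : measurable_fun setT (fun x => \int[@gaussN R p]_v f (cV_cons (x, v))).
  have : measurable_fun setT (fun x => \int[@gaussN R p]_v (f (cV_cons (x, v)) + k)%:E)%E.
    apply: (@measurable_fun_fubini_tonelli_F _ _ _ _ R (@gaussN R p)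
      ((fun v => (f v + k)%:E) \o @cV_cons R p)) => //=.
    by apply: measurableT_comp => //; exact: measurable_cV_cons.
  move=> /(_ _); under eq_fun do rewrite E; move/measurable_EFinP => h.
  rewrite (_ : (fun x => _) = (fun x => \int[@gaussN R p]_v f (cV_cons (x, v)) + k - k)).
    by apply: measurable_funB.
  by apply/funext => x; rewrite addrK.
split => //.
have bI x : `|\int[@gaussN R p]_v f (cV_cons (x, v))| <= k.
  by apply: Rintegral_bounded => //; exact: measurable_cV_cons1.
have := Rintegral_shift (@gaussN R p.+1) mf fk; rewrite gaussN_rec//.
under eq_integral do rewrite E.
by rewrite (@Rintegral_shift _ _ _ (@gauss1 R) _ _ mI bI) => -[/addIr].
Qed.

Lemma gauss1_opp (F : measurableTypeR R -> \bar R) : measurable_fun setT F -> (forall v, (0 <= F v)%E) ->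
  (\int[@gauss1 R]_x F (- x)%R = \int[@gauss1 R]_x F x)%E.
Proof.
move=> mF F0; rewrite !integral_gauss1//; last by apply: (measurableT_comp mF).
have mG : measurable_fun setT (fun v => F v * (phi1 v)%:E)%E.
  by apply: emeasurable_funM => //; apply/measurable_EFinP; exact: measurable_phi1.
have N1 : (-1 : R) != 0 by rewrite oppr_eq0 oner_eq0.
have h := lebesgue_affine 0 N1 mG (fun v => mule_ge0 (F0 v) (ltW (phi1_gt0 v) : (0 <= (phi1 v)%:E)%E)).
rewrite normrN1 mul1e in h; apply: (etrans _ h).
by apply: eq_integral => x _; rewrite mulN1r addr0 /phi1 sqrrN.
Qed.

End gauss_expectation_rec.

Lemma measurable_le_set d (X : measurableType d) (R : realType) (g : X -> R) h :
  measurable_fun setT g -> measurable [set v | g v <= h].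
Proof.
move=> mg; rewrite (_ : [set v | _] = setT `&` g @^-1` `]-oo, h]%classic).
  exact: mg.
by rewrite setTI; apply/seteqP; split => v /=; rewrite in_itv.
Qed.

(** * Characteristic functions in real form and anticoncentration of quadratic forms *)

Section trig.
Context {R : realType}.

Lemma measurable_sin : measurable_fun setT (@sin R).
Proof. by apply: continuous_measurable_fun; exact: continuous_sin. Qed.

Lemma measurable_cos : measurable_fun setT (@cos R).
Proof. by apply: continuous_measurable_fun; exact: continuous_cos. Qed.

Definition ecos (X : R -> R) : R := \int[@gauss1 R]_x cos (X x).
Definition esin (X : R -> R) : R := \int[@gauss1 R]_x sin (X x).

(** A + i B is the characteristic function E exp (i sum_i X_i), written in real coordinates: its
    squared modulus is the product of those of the coordinates, and the phase t recovers its real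
    and imaginary parts. *)
Lemma gaussN_cos_sum p (X : 'I_p -> R -> R) : (forall i, measurable_fun setT (X i)) ->
  exists A B, A ^+ 2 + B ^+ 2 = \prod_i (ecos (X i) ^+ 2 + esin (X i) ^+ 2) /\
  forall t, \int[@gaussN R p]_v cos (t + \sum_i X i (v i 0)) = A * cos t - B * sin t.
Proof.
elim: p X => [|p IH] X mX.
  exists 1, 0; rewrite big_ord0 expr1n expr0n addr0; split => // t.
  rewrite mul1r mul0r subr0; under eq_Rintegral do rewrite big_ord0 addr0.
  exact: RintegralT_cst.
have [A [B [AB E]]] := IH (fun i => X (lift ord0 i)) (fun i => mX _).
pose c := ecos (X ord0); pose s := esin (X ord0).
exists (A * c - B * s), (A * s + B * c); split.
  by rewrite big_ord_recl -AB -/c -/s; ring.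
move=> t; have mf : measurable_fun setT (fun v : 'cV[R]_p.+1 => cos (t + \sum_i X i (v i 0))).
  apply: (measurableT_comp measurable_cos); apply: measurable_funD => //.
  apply: measurable_sum => i; apply: (measurableT_comp (mX i)).
  exact: measurable_cV_component.
have [-> _] := gaussN_recR mf (fun v => cos_max _).
have mc : measurable_fun setT (fun x => cos (X ord0 x)) by exact: (measurableT_comp measurable_cos).
have ms : measurable_fun setT (fun x => sin (X ord0 x)) by exact: (measurableT_comp measurable_sin).
transitivity (\int[@gauss1 R]_x ((A * cos t - B * sin t) * cos (X ord0 x) +
    (- (A * sin t + B * cos t)) * sin (X ord0 x))).
  apply: eq_Rintegral => x _; rewrite (_ : \int[_]_v _ =
    \int[@gaussN R p]_v cos ((t + X ord0 x) + \sum_i X (lift ord0 i) (v i 0))).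
    by rewrite E cosD sinD; ring.
  apply: eq_Rintegral => v _; rewrite big_ord_recl cV_cons0 addrA; congr (cos (_ + _)).
  by apply: eq_bigr => i _; rewrite cV_consS.
rewrite (@Rintegral_lin _ _ _ _ _ _ _ _ 1) => //; [|by move=> x; exact: cos_max|by move=> x; exact: sin_max].
by rewrite -/(ecos _) -/(esin _) -/c -/s; ring.
Qed.


Lemma esin_linear a : esin (fun x => a * x) = 0.
Proof.
have ms : measurable_fun setT (fun x : R => sin (a * x)).
  by apply: (measurableT_comp measurable_sin); exact: measurable_funM.
have ms' : measurable_fun setT (fun x : R => sin (a * - x)).
  apply: (measurableT_comp measurable_sin); apply: measurable_funM => //.
have h := @gauss1_opp R (fun x => (sin (a * x) + 1)%:E).
have : (\int[@gauss1 R]_x (sin (a * - x) + 1)%:E = \int[@gauss1 R]_x (sin (a * x) + 1)%:E)%E.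
  apply: h; first by apply/measurable_EFinP; exact: measurable_funD.
  by move=> x; rewrite lee_fin; have := sin_geN1 (a * x); lra.
rewrite !(@Rintegral_shift _ _ _ (@gauss1 R) _ 1)//; [|by move=> x; exact: sin_max|by move=> x; exact: sin_max].
move=> [/addIr]; rewrite -/(esin (fun x => a * x)) => E.
have : \int[@gauss1 R]_x sin (a * - x) = - esin (fun x => a * x).
  under eq_Rintegral do rewrite mulrN sinN.
  have := @Rintegral_lin _ _ _ (@gauss1 R) (fun x => sin (a * x)) (fun x => sin (a * x)) (-1) 0 1 ms ms
    (fun x => sin_max _) (fun x => sin_max _).
  rewrite mul0r addr0 mulN1r => <-; apply: eq_Rintegral => x _; ring.
rewrite E; lra.
Qed.

Definition pair2 (x y : R) : 'cV[R]_2 := cV_cons (x, cV_cons (y, 0 : 'cV[R]_0)).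

Lemma pair2_0 x y : pair2 x y 0 0 = x. Proof. exact: cV_cons0. Qed.
Lemma pair2_1 x y : pair2 x y 1 0 = y.
Proof. by rewrite (_ : 1 = lift ord0 ord0) ?cV_consS ?cV_cons0//; exact/val_inj. Qed.

Lemma gauss2_rec (f : 'cV[R]_2 -> R) k : measurable_fun setT f -> (forall v, `|f v| <= k) ->
  \int[@gaussN R 2]_v f v = \int[@gauss1 R]_x \int[@gauss1 R]_y f (pair2 x y).
Proof.
move=> mf fk; have [-> _] := gaussN_recR mf fk.
apply: eq_Rintegral => x _; have mg := measurable_cV_cons1 x mf.
have [-> _] := gaussN_recR mg (fun v => fk _).
apply: eq_Rintegral => y _; rewrite -[RHS](RintegralT_cst (@gaussN R 0)).
by apply: eq_Rintegral => v _; rewrite (flatmx0 v).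
Qed.

Definition rot2 : 'M[R]_2 :=
  \matrix_(i, j) ((if (i == 1) && (j == 1) then -1 else 1) / Num.sqrt 2).

Lemma rot2_orthogonal : rot2^T *m rot2 = 1%:M.
Proof.
have s2 : Num.sqrt 2 * Num.sqrt 2 = 2 :> R by rewrite -expr2 sqr_sqrtr.
have s0 : Num.sqrt 2 != 0 :> R by rewrite gt_eqF// sqrtr_gt0.
apply/matrixP => i j; rewrite mxE !big_ord_recl big_ord0 !mxE.
have E a b : a / Num.sqrt 2 * (b / Num.sqrt 2) = a * b / 2 :> R by rewrite mulrACA -invfM s2.
rewrite !E; case: (split_ordP (i : 'I_(1 + 1))) => i' ->; rewrite (ord1 i');
case: (split_ordP (j : 'I_(1 + 1))) => j' ->; rewrite (ord1 j') /=; by field.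
Qed.

Lemma rot2_0 x y : (rot2 *m pair2 x y) 0 0 = (x + y) / Num.sqrt 2.
Proof.
rewrite mxE !big_ord_recl big_ord0 /pair2 cV_consS !cV_cons0 !mxE /=; ring.
Qed.

Lemma rot2_1 x y : (rot2 *m pair2 x y) 1 0 = (x - y) / Num.sqrt 2.
Proof.
rewrite mxE !big_ord_recl big_ord0 /pair2 cV_consS !cV_cons0 !mxE /=; ring.
Qed.

Lemma gauss2_rot (f : 'cV[R]_2 -> R) k : measurable_fun setT f -> (forall v, `|f v| <= k) ->
  \int[@gaussN R 2]_v f v = \int[@gauss1 R]_x \int[@gauss1 R]_y f (rot2 *m pair2 x y).
Proof.
move=> mf fk; have mg : measurable_fun setT (fun v => f (rot2 *m v)).
  by apply: (measurableT_comp mf); exact: measurable_mulmx.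
rewrite -(gauss2_rec mg (fun v => fk _)).
have := @gaussN_orthogonal R 2 rot2 (fun v => (f v + k)%:E) rot2_orthogonal.
rewrite (@Rintegral_shift _ _ _ (@gaussN R 2) _ k mg)// (@Rintegral_shift _ _ _ (@gaussN R 2) _ k mf)//.
move=> h; have : measurable_fun setT (fun v => (f v + k)%:E).
  by apply/measurable_EFinP; exact: measurable_funD.
move=> /h {}h; apply/esym; have h0 v : (0 <= (f v + k)%:E)%E.
  by rewrite lee_fin; have := fk v; rewrite ler_norml => /andP[h1 _]; lra.
by have [/addIr] := h h0.
Qed.


(** The squared modulus of E exp (i X) is the mean of cos (X(x) - X(y)) over independent x and y; a
    rotation by 45 degrees then replaces them by (x + y) / sqrt 2 and (x - y) / sqrt 2. For
    quadratic X the difference becomes linear in y at fixed x. *)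
Lemma ecos2_esin2 X : measurable_fun setT X ->
  ecos X ^+ 2 + esin X ^+ 2 =
  \int[@gauss1 R]_x \int[@gauss1 R]_y cos (X ((x + y) / Num.sqrt 2) - X ((x - y) / Num.sqrt 2)).
Proof.
move=> mX.
have mf : measurable_fun setT (fun v : 'cV[R]_2 => cos (X (v 0 0) - X (v 1 0))).
  apply: (measurableT_comp measurable_cos); apply: measurable_funB; apply: (measurableT_comp mX);
  exact: measurable_cV_component.
have := gauss2_rot mf (fun v => cos_max _).
under [X in _ = X -> _]eq_Rintegral => x _ do under eq_Rintegral => y _ do rewrite rot2_0 rot2_1.
move=> <-; rewrite (gauss2_rec mf (fun v => cos_max _)).
under eq_Rintegral => x _ do under eq_Rintegral => y _ do rewrite pair2_0 pair2_1 cosB.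
have mc : measurable_fun setT (fun x => cos (X x)) by exact: (measurableT_comp measurable_cos).
have ms : measurable_fun setT (fun x => sin (X x)) by exact: (measurableT_comp measurable_sin).
transitivity (\int[@gauss1 R]_x (ecos X * cos (X x) + esin X * sin (X x))).
  by rewrite (@Rintegral_lin _ _ _ (@gauss1 R) _ _ _ _ 1)// => x; [exact: cos_max|exact: sin_max].
apply: eq_Rintegral => x _.
rewrite (@Rintegral_lin _ _ _ (@gauss1 R) _ _ _ _ 1)//; [|by move=> ?; exact: cos_max|by move=> ?; exact: sin_max].
by rewrite /ecos /esin; ring.
Qed.

(** The Gaussian characteristic function, e^(- a^2 / 2). *)
Definition gcos a := ecos (fun x => a * x).

(* Rotation invariance of the Gaussian measure on R^2; this identity replaces the
   explicit Gaussian characteristic function in everything that follows. *)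
Lemma gcos_double a : gcos (Num.sqrt 2 * a) = gcos a ^+ 2.
Proof.
have s2 : Num.sqrt 2 * Num.sqrt 2 = 2 :> R by rewrite -expr2 sqr_sqrtr.
have s0 : Num.sqrt 2 != 0 :> R by rewrite gt_eqF// sqrtr_gt0.
have mX : measurable_fun setT (fun x : R => a * x) by exact: measurable_funM.
have mf : measurable_fun setT (fun v : 'cV[R]_2 => cos (Num.sqrt 2 * a * v 1 0)).
  by apply: (measurableT_comp measurable_cos); apply: measurable_funM => //; exact: measurable_cV_component.
have := ecos2_esin2 mX; rewrite esin_linear expr0n addr0 => ->.
rewrite -[LHS](RintegralT_cst (@gauss1 R)); apply: eq_Rintegral => x _.
rewrite /gcos /ecos; apply: eq_Rintegral => y _; congr cos.
rewrite -mulrBr -mulrBl.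
have -> : x + y - (x - y) = 2 * y by ring.
have h : 2 / Num.sqrt 2 = Num.sqrt 2 :> R by rewrite -{1}s2 mulfK.
by rewrite -{1}h; ring.
Qed.

Lemma gcos_ge0 a : 0 <= gcos a.
Proof.
have s0 : Num.sqrt 2 != 0 :> R by rewrite gt_eqF// sqrtr_gt0.
by have := gcos_double (a / Num.sqrt 2); rewrite mulrC divfK// => ->; exact: sqr_ge0.
Qed.

Lemma gcosN a : gcos (- a) = gcos a.
Proof. by apply: eq_Rintegral => x _; rewrite mulNr cosN. Qed.

Lemma cos_le0 (y : R) : pi / 2 <= y <= 3 / 2 * pi -> cos y <= 0.
Proof.
move=> /andP[y1 y2]; rewrite -(subrK pi y) cosDpi oppr_le0 cos_ge0_pihalf//.
by apply/andP; split; lra.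
Qed.

Lemma gauss1E (A : set (measurableTypeR R)) :
  @gauss1 R A = (\int[lebesgue_measure]_(x in A) (phi1 x)%:E)%E.
Proof. by rewrite -phi1E. Qed.

Lemma gauss1_itv_ge (a b : R) : 0 <= a -> a <= b ->
  (((b - a) * phi1 b)%:E <= @gauss1 R `[a, b]%classic)%E.
Proof.
move=> a0 ab; rewrite gauss1E mulrC EFinM.
have <- : lebesgue_measure (`[a, b]%classic : set R) = (b - a)%:E.
  by rewrite lebesgue_measure_itv/= lte_fin; case: ltP => // ba; rewrite (_ : b = a) ?subrr//; apply/eqP; rewrite eq_le ab ba.
rewrite -integral_cst//; apply: ge0_le_integral => //.
- by move=> x _; rewrite lee_fin ltW// phi1_gt0.
- by apply/measurable_EFinP; apply: measurable_funTS; exact: measurable_phi1.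
move=> x; rewrite /= in_itv/= => /andP[ax xb]; rewrite lee_fin /phi1 ler_wpM2l ?invr_ge0 ?sqrtr_ge0//.
by rewrite ler_expR lerN2 ler_pM2r// lerXn2r ?nnegrE ?(le_trans a0)// (le_trans ax).
Qed.

Lemma gauss1_itv_le (e : R) : 0 <= e -> (@gauss1 R `[(- e)%R, e]%classic <= (2 * e)%:E)%E.
Proof.
move=> e0; rewrite gauss1E.
have <- : lebesgue_measure (`[(- e)%R, e]%classic : set R) = (2 * e)%:E.
  rewrite lebesgue_measure_itv/= lte_fin; case: ltP => h; first by congr EFin; ring.
  by rewrite (_ : e = 0) ?mulr0//; lra.
rewrite -[leRHS]mul1e -integral_cst//; apply: ge0_le_integral => //.
- by move=> x _; rewrite lee_fin ltW// phi1_gt0.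
- by apply/measurable_EFinP; apply: measurable_funTS; exact: measurable_phi1.
move=> x _; rewrite lee_fin /phi1 -[leRHS]mulr1 ler_pM ?invr_ge0 ?sqrtr_ge0 ?expR_ge0//.
  rewrite invf_le1 ?sqrtr_gt0 ?mulr_gt0 ?pi_gt0// -[leLHS]sqrtr1 ler_sqrt ?mulr_gt0 ?pi_gt0//.
  by have := pi_ge2 R; lra.
  by rewrite mulr_ge0 ?pi_ge0.
by rewrite expR_le1 oppr_le0 divr_ge0// sqr_ge0.
Qed.

Lemma gcos_le1 a : gcos a <= 1.
Proof.
apply: le_trans (ler_norm _) _; apply: Rintegral_bounded => [|x]; last exact: cos_max.
by apply: (measurableT_comp measurable_cos); exact: measurable_funM.
Qed.

(** For a between 1 and sqrt 2 < 3/2 and x in [pi / 2, pi], a x lies in [pi / 2, 3 pi / 2], where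
    cos <= 0; hence gcos a <= 1 - e with e the mass of that interval. *)
Lemma gcos_gap : exists2 e : R, 0 < e & forall a, 1 <= a -> a ^+ 2 <= 2 -> gcos a <= expR (- e).
Proof.
have p0 := pi_gt0 R.
pose A : set (measurableTypeR R) := `[pi / 2, pi]%classic.
have hA := @gauss1_itv_ge (pi / 2) pi ltac:(lra) ltac:(lra).
have mA0 : measurable A by exact: measurable_itv.
have fA : @gauss1 R A \is a fin_num by exact: fin_num_measure.
exists (fine (@gauss1 R A)).
  have : (0 < @gauss1 R A)%E.
    apply: lt_le_trans hA; rewrite lte_fin mulr_gt0 ?phi1_gt0//; lra.
  by move=> h; apply: fine_gt0; rewrite h ltey_eq fA.
move=> a a1 a2; apply: (@le_trans _ _ (1 - fine (@gauss1 R A))); last exact: expR_ge1Dx.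
have a32 : a <= 3 / 2 by nra.
have mc : measurable_fun setT (fun x : R => cos (a * x)).
  by apply: (measurableT_comp measurable_cos); exact: measurable_funM.
have -> : fine (@gauss1 R A) = \int[@gauss1 R]_x \1_A x.
  by rewrite /Rintegral integral_indic// setIT.
have mA : measurable_fun setT (\1_A : R -> R) by exact: measurable_indic.
rewrite lerBrDr -[leRHS](RintegralT_cst (@gauss1 R)) /gcos /ecos -RintegralD//; last 2 first.
- by apply: (@bounded_integrable _ _ _ _ _ 1) => // x; exact: cos_max.
- by apply: (@bounded_integrable _ _ _ _ _ 1) => // x; rewrite indicE; case: (_ \in _); rewrite ?normr0 ?normr1.
apply: (@le_Rintegral_bounded _ _ _ _ _ _ 2) => //.
- exact: measurable_funD.
- move=> x; apply: le_trans (ler_normD _ _) _; rewrite (_ : 2 = 1 + 1 :> R)//; apply: lerD.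
    exact: cos_max.
  by rewrite indicE; case: (_ \in _); rewrite ?normr0 ?normr1 ?ler01.
- by move=> x; rewrite normr1 ler1n.
move=> x; rewrite indicE; case: (boolP (x \in A)) => [|_]; last by rewrite addr0 cos_le1.
rewrite inE /A/= in_itv/= => /andP[x1 x2].
have : cos (a * x) <= 0 by apply: cos_le0; apply/andP; split; nra.
lra.
Qed.

Lemma pow2_ge (z : R) : exists n, z <= 2 ^+ n.
Proof.
exists (Num.truncn z).+1; apply: (@le_trans _ _ (Num.truncn z).+1%:R).
  have [z0|z0] := ltP z 0; first by rewrite (le_trans (ltW z0)).
  by have /andP[_ /ltW] := truncn_itv z0.
by rewrite -natrX ler_nat ltnW// ltn_expl.
Qed.

(** Both directions are stated with natural exponents because [gcos_pow] scales up only: for large y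
    the power is extracted from y, for small y it is applied to y. *)
Lemma pow2_between (y : R) : 0 < y ->
  exists n, (2 ^+ n <= y <= 2 ^+ n * 2) \/ (1 <= 2 ^+ n * y <= 2).
Proof.
move=> y0; have [y1|y1] := leP 1 y.
  have := ex_minnP (pow2_ge y) => -[[|n] yn mn].
    by exists 0%N; left; rewrite expr0 in yn *; apply/andP; split; [|rewrite mul1r; lra].
  exists n; left; rewrite -exprSr yn andbT leNgt; apply/negP => /ltW /mn; rewrite ltnn.
  by [].
have := ex_minnP (pow2_ge y^-1) => -[[|n] yn mn].
  by move: yn; rewrite expr0 invf_le1// leNgt y1.
exists n.+1; right; rewrite -ler_pdivrMr// div1r yn/= exprS -mulrA ger_pMr// -ler_pdivlMr// div1r.
by rewrite leNgt; apply/negP => /ltW /mn; rewrite ltnn.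
Qed.

Lemma gcos_pow n a : gcos (Num.sqrt 2 ^+ n * a) = gcos a ^+ (2 ^ n).
Proof.
elim: n => [|n IH]; first by rewrite expr0 mul1r expr1.
by rewrite exprS -mulrA gcos_double IH -exprM expnSr.
Qed.

(** Scaling by powers of sqrt 2 brings a to some b with 1 <= b^2 <= 2, and repeated doubling turns
    the gap e of [gcos_gap] into e 2^n, or e / 2^n for small a. Since b^2 <= 2, this is at least e
    a^2 / 2, whence the halved constant. *)
Lemma gcos_le_exp : exists2 e : R, 0 < e & forall a, gcos a <= expR (- (e * a ^+ 2)).
Proof.
have [e e0 He] := gcos_gap; exists (e / 2); first by rewrite divr_gt0.
have s20 : 0 < Num.sqrt 2 :> R by rewrite sqrtr_gt0.
have s2 : Num.sqrt 2 ^+ 2 = 2 :> R by rewrite sqr_sqrtr.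
have sn n : (Num.sqrt 2 ^+ n) ^+ 2 = 2 ^+ n :> R by rewrite -exprM mulnC exprM s2.
suff pos a : 0 < a -> gcos a <= expR (- (e / 2 * a ^+ 2)).
  move=> a; have [a0|a0|->] := ltgtP a 0; [|exact: pos|].
    by rewrite -gcosN -sqrrN; apply: pos; rewrite oppr_gt0.
  by rewrite expr0n mulr0 oppr0 expR0 gcos_le1.
move=> a0; have := pow2_between (exprn_gt0 2 a0) => -[n [/andP[h1 h2]|/andP[h1 h2]]].
  pose b := a / Num.sqrt 2 ^+ n.
  have ab : a = Num.sqrt 2 ^+ n * b by rewrite mulrC divfK// gt_eqF// exprn_gt0.
  have b0 : 0 < b by rewrite divr_gt0// exprn_gt0.
  have b2 : a ^+ 2 = 2 ^+ n * b ^+ 2 by rewrite ab exprMn sn.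
  have n0 : 0 < 2 ^+ n :> R by rewrite exprn_gt0.
  have b1 : 1 <= b ^+ 2 by rewrite -(ler_pM2l n0) mulr1 -b2.
  have b22 : b ^+ 2 <= 2 by rewrite -(ler_pM2l n0) -b2.
  have b1' : 1 <= b by rewrite -(expr_ge1 (isT : 0 < 2)%N (ltW b0)).
  rewrite ab gcos_pow; apply: (@le_trans _ _ (expR (- e) ^+ (2 ^ n))).
    by rewrite lerXn2r ?nnegrE ?gcos_ge0 ?expR_ge0// He.
  rewrite -expRM_natl ler_expR -ab b2 natrX; nra.
have n0 : 0 < 2 ^+ n :> R by rewrite exprn_gt0.
pose b := Num.sqrt 2 ^+ n * a.
have b0 : 0 < b by rewrite mulr_gt0// exprn_gt0.
have b2 : b ^+ 2 = 2 ^+ n * a ^+ 2 by rewrite exprMn sn.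
have b1' : 1 <= b by rewrite -(expr_ge1 (isT : 0 < 2)%N (ltW b0)) b2.
have := He b b1'; rewrite b2 => /(_ h2); rewrite gcos_pow => h.
rewrite -(@ler_pXn2r _ (2 ^ n)) ?nnegrE ?gcos_ge0 ?expR_ge0 ?expn_gt0//.
apply: (le_trans h); rewrite -expRM_natl ler_expR natrX; nra.
Qed.

Lemma gauss1_exp_norm : (\int[@gauss1 R]_x (expR (x ^+ 2 / 4))%:E <= (3 / 2)%:E)%E.
Proof.
have := @gauss1_mgf R 0 (1 / 2) ltac:(lra).
under eq_integral => x _.
  rewrite mul0r add0r (_ : 1 / 2 * (x ^+ 2 / 2) = x ^+ 2 / 4); last by field.
  over.
move=> ->; rewrite expr0n mul0r expR0 mulr1 lee_fin.
have h : Num.sqrt (1 - 1 / 2) ^+ 2 = 1 / 2 :> R by rewrite sqr_sqrtr; lra.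
have h0 : 0 < Num.sqrt (1 - 1 / 2) :> R by rewrite sqrtr_gt0; lra.
rewrite -[leLHS]mul1r ler_pdivrMr//; move: h; rewrite expr2; nra.
Qed.

Lemma cos_lipschitz (y : R) : 1 - cos y <= `|y|.
Proof.
rewrite -(cos_norm y); move: `|y| (normr_ge0 y) => {}y y0.
have [c _] : exists2 c : R, c \in `[0, y]%R & cos y - cos 0 = - sin c * (y - 0).
  apply: (@MVT_segment R cos (fun x => - sin x)) => //.
  by apply: continuous_subspaceT => x; exact: continuous_cos.
rewrite cos0 subr0; have := sin_le1 c; nra.
Qed.

(** 1 - cos (a x) <= |a| |x| <= 1/3 (1 + x^2 / 4) <= 1/3 e^(x^2 / 4), and the mean of e^(x^2 / 4) is
    at most 3/2. *)
Lemma gcos_ge_half a : `|a| <= 1 / 3 -> 1 / 2 <= gcos a.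
Proof.
move=> a3.
have mc : measurable_fun setT (fun x : R => cos (a * x)).
  by apply: (measurableT_comp measurable_cos); exact: measurable_funM.
have mc' : measurable_fun setT (fun x : R => - cos (a * x)) by exact: measurable_funN.
have E := @Rintegral_shift _ _ _ (@gauss1 R) (fun x => - cos (a * x)) 1 mc' _.
have gN : \int[@gauss1 R]_x (- cos (a * x)) = - gcos a.
  have := @Rintegral_lin _ _ _ (@gauss1 R) (fun x => cos (a * x)) (fun x => cos (a * x)) (-1) 0 1 mc mc
    (fun x => cos_max _) (fun x => cos_max _).
  rewrite mul0r addr0 mulN1r => <-; apply: eq_Rintegral => x _; ring.
have : (((- gcos a) + 1)%:E <= (1 / 2)%:E)%E.
  rewrite -gN -E; last by move=> x; rewrite normrN cos_max.
  apply: (@le_trans _ _ (\int[@gauss1 R]_x ((1 / 3)%:E * (expR (x ^+ 2 / 4))%:E))%E).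
    apply: le_integralT.
    - by apply/measurable_EFinP; exact: measurable_funD.
    - by apply: measurable_funeM; meas.
    - by move=> x; rewrite lee_fin; have := cos_le1 (a * x); lra.
    move=> x; rewrite -EFinM lee_fin.
    have := cos_lipschitz (a * x); rewrite normrM.
    have h1 : `|x| <= 1 + x ^+ 2 / 4.
      by rewrite -real_normK ?num_real//; have := sqr_ge0 (`|x| - 2); rewrite sqrrB; lra.
    have h2 := expR_ge1Dx (x ^+ 2 / 4).
    have : `|a| * `|x| <= 1 / 3 * (1 + x ^+ 2 / 4) by apply: ler_pM.
    lra.
  rewrite ge0_integralZl//; last by meas.
  apply: le_trans (lee_wpmul2l _ gauss1_exp_norm) _ => //.
  by rewrite -EFinM lee_fin; lra.
rewrite lee_fin; lra.
Qed.

Lemma measurable_gcos : measurable_fun setT gcos.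
Proof.
have E x : (\int[@gauss1 R]_y (cos (x * y) + 1)%:E)%E = (gcos x + 1)%:E.
  apply: Rintegral_shift => [|y]; last exact: cos_max.
  by apply: (measurableT_comp measurable_cos); exact: measurable_funM.
have : measurable_fun setT (fun x : measurableTypeR R => \int[@gauss1 R]_y (cos (x * y) + 1)%:E)%E.
  apply: (@measurable_fun_fubini_tonelli_F _ _ _ _ R (@gauss1 R)
    (fun xy : measurableTypeR R * measurableTypeR R => (cos (xy.1 * xy.2) + 1)%:E)) => /=.
    apply/measurable_EFinP; apply: measurable_funD => //.
    apply: (measurableT_comp measurable_cos); apply: measurable_funM.
      exact: measurable_fst.
    exact: measurable_snd.
  by move=> xy; rewrite lee_fin; have := cos_geN1 (xy.1 * xy.2); lra.
under eq_fun do rewrite E; move/measurable_EFinP => h.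
rewrite (_ : gcos = (fun x => gcos x + 1 - 1)); first exact: measurable_funB.
by apply/funext => x; rewrite addrK.
Qed.

Lemma EFin_Rintegral d (X : measurableType d) (N : probability X R) (f : X -> R) k :
  measurable_fun setT f -> (forall x, `|f x| <= k) ->
  (\int[N]_x f x)%:E = (\int[N]_x (f x)%:E)%E.
Proof.
by move=> mf fk; rewrite /Rintegral fineK// integrable_fin_num// (bounded_integrable N mf fk).
Qed.

Lemma gcos_norm a : `|gcos a| <= 1.
Proof. by rewrite ger0_norm ?gcos_ge0 ?gcos_le1. Qed.

(** By [ecos2_esin2] the squared modulus is the mean of gcos (2 t (x - sqrt 2 b)), which is at most
    a Gaussian integral of size (1 + 8 e t^2)^(-1/2). The shift b only contributes a factor at most
    1, so the decay is uniform in b. *)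
Lemma chi_decay e (t b : R) : 0 < e -> (forall a, gcos a <= expR (- (e * a ^+ 2))) ->
  ecos (fun x => t * (x - b) ^+ 2) ^+ 2 + esin (fun x => t * (x - b) ^+ 2) ^+ 2 <=
  expR (- (ln (1 + 8 * e * t ^+ 2) / 2)).
Proof.
move=> e0 He.
have s2 : Num.sqrt 2 ^+ 2 = 2 :> R by rewrite sqr_sqrtr.
have s0 : Num.sqrt 2 != 0 :> R by rewrite gt_eqF// sqrtr_gt0.
rewrite ecos2_esin2; last first.
  by apply: measurable_funM => //; apply: measurable_funX; exact: measurable_funB.
have E x y : t * ((x + y) / Num.sqrt 2 - b) ^+ 2 - t * ((x - y) / Num.sqrt 2 - b) ^+ 2 =
    2 * t * (x - Num.sqrt 2 * b) * y.
  have -> : x + y = (x / Num.sqrt 2 + y / Num.sqrt 2) * Num.sqrt 2 by field.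
  have -> : x - y = (x / Num.sqrt 2 - y / Num.sqrt 2) * Num.sqrt 2 by field.
  rewrite !mulfK//; transitivity (4 * t * (x / Num.sqrt 2 - b) * (y / Num.sqrt 2)); first by ring.
  have -> : x - Num.sqrt 2 * b = Num.sqrt 2 * (x / Num.sqrt 2 - b) by field.
  transitivity (2 * t * (x / Num.sqrt 2 - b) * (Num.sqrt 2 ^+ 2 * (y / Num.sqrt 2))).
    by rewrite s2; ring.
  by field.
under eq_Rintegral => x _ do under eq_Rintegral => y _ do rewrite E.
have et0 : 0 <= 8 * e * t ^+ 2 by rewrite mulr_ge0 ?sqr_ge0// mulr_ge0// ltW.
pose m := - (8 * e * t ^+ 2); pose a := 8 * e * t ^+ 2 * (Num.sqrt 2 * b).
pose q := expR (- (8 * e * t ^+ 2 * b ^+ 2)).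
have m1 : m < 1 by rewrite /m; lra.
have mgf := @gauss1_mgf R a m m1.
have mg : measurable_fun setT (fun x : R => gcos (2 * t * (x - Num.sqrt 2 * b))).
  by apply: (measurableT_comp measurable_gcos); apply: measurable_funM => //; exact: measurable_funB.
have h := @EFin_Rintegral _ (measurableTypeR R) (@gauss1 R) _ 1 mg (fun x => gcos_norm _).
rewrite -lee_fin (_ : (_%:E)%E = \int[@gauss1 R]_x (gcos (2 * t * (x - Num.sqrt 2 * b)))%:E)%E; last exact: h.
have me : measurable_fun setT (fun x : R => (expR (a * x + m * (x ^+ 2 / 2)))%:E) by meas.
apply: (@le_trans _ _ (\int[@gauss1 R]_x (q%:E * (expR (a * x + m * (x ^+ 2 / 2)))%:E))%E).
  apply: le_integralT.
  - exact/measurable_EFinP.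
  - exact: measurable_funeM.
  - by move=> x; rewrite lee_fin gcos_ge0.
  move=> x; rewrite -EFinM lee_fin; apply: (le_trans (He _)).
  rewrite /q -expRD ler_expR le_eqVlt; apply/orP; left; apply/eqP.
  have -> : (2 * t * (x - Num.sqrt 2 * b)) ^+ 2 =
    4 * t ^+ 2 * (x ^+ 2 - 2 * x * (Num.sqrt 2 * b) + Num.sqrt 2 ^+ 2 * b ^+ 2) by ring.
  by rewrite s2 /a /m; field.
rewrite ge0_integralZl//; last by rewrite lee_fin expR_ge0.
rewrite mgf -EFinM lee_fin inv_sqrt_expR ?subr_gt0// mulrCA /q -expRD -[leRHS]mulr1.
rewrite (_ : 1 - m = 1 + 8 * e * t ^+ 2) /m ?opprK//; apply: ler_pM; rewrite ?expR_ge0//.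
rewrite -[leRHS]expR0 ler_expR addrC subr_le0 ler_pdivrMr; last by lra.
have -> : a ^+ 2 = (8 * e * t ^+ 2) ^+ 2 * (Num.sqrt 2 ^+ 2 * b ^+ 2) by rewrite /a; ring.
rewrite s2; set z := 8 * e * t ^+ 2 in et0 *.
have : 0 <= z * b ^+ 2 by rewrite mulr_ge0 ?sqr_ge0.
nra.
Qed.

Section chi_sum.
Variables (e : R) (p : nat) (mu b : 'I_p -> R) (M : R).
Hypotheses (e0 : 0 < e) (He : forall a, gcos a <= expR (- (e * a ^+ 2))).
Hypotheses (M0 : 0 < M) (muM : forall i, mu i ^+ 2 <= M) (sumM : 5 / 2 * M <= \sum_i mu i ^+ 2).

Definition wchi (v : 'cV[R]_p) := \sum_i mu i * (v i 0 - b i) ^+ 2.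

Lemma measurable_wchi : measurable_fun setT wchi.
Proof.
apply: measurable_sum => i; apply: measurable_funM => //; apply: measurable_funX.
by apply: measurable_funB => //; exact: measurable_cV_component.
Qed.

(** Concavity of ln gives coordinate i at least the share mu_i^2 / M of ln (1 + 8 e M s^2), and the
    shares add up to at least 5/2. The bound decays like |s|^(-5/4), which is integrable at
    infinity. *)
Lemma wchi_decay (s t : R) :
  `|\int[@gaussN R p]_v cos (t + s * wchi v)| <= expR (- (5 / 8 * ln (1 + 8 * e * M * s ^+ 2))).
Proof.
have mX i : measurable_fun setT (fun x : R => s * mu i * (x - b i) ^+ 2).
  by apply: measurable_funM => //; apply: measurable_funX; exact: measurable_funB.
have [A [B [AB E]]] := gaussN_cos_sum mX.
have -> : \int[@gaussN R p]_v cos (t + s * wchi v) = A * cos t - B * sin t.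
  rewrite -E; apply: eq_Rintegral => v _; rewrite /wchi mulr_sumr.
  by congr (cos (_ + _)); apply: eq_bigr => i _; rewrite mulrA.
set L := ln (1 + 8 * e * M * s ^+ 2).
have c0 : 0 <= 8 * e * M * s ^+ 2 by rewrite mulr_ge0 ?sqr_ge0// !mulr_ge0// ltW.
have L0 : 0 <= L by rewrite ln_ge0// lerDl.
have h : (A * cos t - B * sin t) ^+ 2 <= expR (- (5 / 8 * L)) ^+ 2.
  apply: (@le_trans _ _ (A ^+ 2 + B ^+ 2)).
    have := sqr_ge0 (A * sin t + B * cos t); have := cos2Dsin2 t.
    set c := cos t; set d := sin t => cd h1.
    have : A ^+ 2 + B ^+ 2 = (A * c - B * d) ^+ 2 + (A * d + B * c) ^+ 2.
      by transitivity ((A ^+ 2 + B ^+ 2) * (c ^+ 2 + d ^+ 2)); [rewrite cd mulr1|ring].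
    lra.
  rewrite AB -expRM_natl.
  apply: (@le_trans _ _ (\prod_i expR (- (ln (1 + 8 * e * (s * mu i) ^+ 2) / 2)))).
    apply: ler_prod => i _; rewrite addr_ge0 ?sqr_ge0//=; exact: chi_decay.
  rewrite -expR_sum ler_expR sumrN -mulr_suml.
  have : 5 / 2 * L <= \sum_i ln (1 + 8 * e * (s * mu i) ^+ 2).
    apply: (@le_trans _ _ (\sum_i (mu i ^+ 2 / M) * L)).
      by rewrite -!mulr_suml ler_wpM2r// ler_pdivlMr.
    apply: ler_sum => i _.
    have := @ln_convex R (- (8 * e * M * s ^+ 2)) (mu i ^+ 2 / M).
    rewrite opprK divr_ge0 ?sqr_ge0 ?(ltW M0)//= ler_pdivrMr// mul1r => /(_ (muM i)) H.
    apply: le_trans (H _) _; first by lra.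
    rewrite le_eqVlt; apply/orP; left; apply/eqP; congr ln.
    by field; rewrite gt_eqF.
  lra.
rewrite -(@ler_pXn2r _ 2)// ?nnegrE ?expR_ge0//.
by rewrite real_normK ?num_real.
Qed.

End chi_sum.

(* Dyadic (base 16) layers: 16^(-5/4) = 1/32 makes the layer bound a geometric
   series of ratio 1/2. *)
Lemma gauss1_decay_integral (a : R) : 0 < a ->
  (\int[@gauss1 R]_x (expR (- (5 / 8 * ln (1 + a ^+ 2 * x ^+ 2))))%:E <= (128 / a)%:E)%E.
Proof.
move=> a0.
pose I k : set (measurableTypeR R) := `[(- (16 ^+ k / a))%R, 16 ^+ k / a]%classic.
have mI k : measurable (I k) by exact: measurable_itv.
pose F k (x : measurableTypeR R) : \bar R := ((32 * 32^-1 ^+ k)%:E * (\1_(I k) x)%:E)%E.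
have c0 k : 0 <= 32 * 32^-1 ^+ k :> R by rewrite mulr_ge0// exprn_ge0.
have mF k : measurable_fun setT (F k).
  by apply: measurable_funeM; apply/measurable_EFinP; exact: measurable_indic.
have F0 k x : (0 <= F k x)%E by rewrite /F mule_ge0 ?lee_fin.
have half : 0 <= (2^-1 : R) < 1 by rewrite invr_ge0 ler0n invf_lt1// ltr1n.
apply: (@le_trans _ _ (\int[@gauss1 R]_x (\sum_(0 <= k <oo) F k x))%E).
  apply: le_integralT.
  - apply/measurable_EFinP; apply: measurableT_comp => //; apply: measurable_funN.
    apply: measurable_funM => //; apply: measurableT_comp; first exact: measurable_ln.
    by apply: measurable_funD => //; apply: measurable_funM => //; exact: measurable_funX.
  - by apply: ge0_emeasurable_sum => // k _.
  - by move=> x; rewrite lee_fin expR_ge0.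
  move=> x; have y0 : 0 <= a ^+ 2 * x ^+ 2 by rewrite mulr_ge0 ?sqr_ge0.
  suff [k [Ik hk]] : exists k, I k x /\ expR (- (5 / 8 * ln (1 + a ^+ 2 * x ^+ 2))) <= 32 * 32^-1 ^+ k.
    apply: (@le_trans _ _ (F k x)); last exact: (@nneseries_ge_term _ (fun k => F k x)).
    by rewrite /F indicE mem_set// mule1 lee_fin.
  have [n hn] := pow2_ge (a * `|x|).
  have ex : exists n, a * `|x| <= 16 ^+ n.
    by exists n; rewrite (le_trans hn)// lerXn2r ?nnegrE//; lra.
  have inI k : a * `|x| <= 16 ^+ k -> I k x.
    by move=> h; rewrite /I/= in_itv/= -ler_norml ler_pdivlMr// mulrC.
  have := ex_minnP ex => -[[|k] xk mk].
    exists 0%N; split; first exact: inI.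
    rewrite expr0 mulr1 (@le_trans _ _ 1)//; last by lra.
    by rewrite expR_le1 oppr_le0 mulr_ge0// ln_ge0// lerDl.
  exists k.+1; split; first exact: inI.
  have xk' : 16 ^+ k < a * `|x| by rewrite ltNge; apply/negP => /mk; rewrite ltnn.
  rewrite [32^-1 ^+ _]exprS mulrA divff ?pnatr_eq0// mul1r exprVn.
  have -> : (32 ^+ k)^-1 = expR (- (5 / 8 * ln (2 ^+ (8 * k)))) :> R.
    have -> : ln (2 ^+ (8 * k)) = 8%:R * k%:R * ln 2 :> R by rewrite lnXn// -natrM mulr_natl.
    rewrite expRN; congr (_^-1).
    have -> : 5 / 8 * (8%:R * k%:R * ln 2) = (5 * k)%:R * ln 2 :> R by rewrite natrM; field.
    by rewrite expRM_natl lnK ?posrE// exprM; congr (_ ^+ _); ring.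
  rewrite ler_expR lerN2 ler_pM2l; last by lra.
  rewrite ler_ln ?posrE ?exprn_gt0//; last by rewrite ltr_pwDl.
  apply: (@le_trans _ _ (a ^+ 2 * x ^+ 2)); last by rewrite lerDr.
  rewrite -(real_normK (num_real x)) -exprMn.
  have -> : 2 ^+ (8 * k) = (16 ^+ k) ^+ 2 :> R.
    by rewrite (exprM 2 8 k) -(exprM 16 k 2) mulnC (exprM 16 2 k); congr (_ ^+ _); ring.
  by rewrite lerXn2r ?nnegrE ?exprn_ge0// ?mulr_ge0 ?(ltW a0)// ltW.
rewrite -[leRHS]mule1 (_ : 128 / a = (64 / a) / (1 - 2^-1)); last by field; rewrite gt_eqF.
apply: integral_geometric_le => //; first by rewrite divr_ge0// ltW.
move=> k; rewrite mule1 /F ge0_integralZl//; first last.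
  by apply/measurable_EFinP; exact: measurable_indic.
rewrite integral_indic// setIT.
apply: le_trans (lee_wpmul2l _ (gauss1_itv_le _)) _; rewrite ?lee_fin//.
  by rewrite divr_ge0 ?exprn_ge0// ltW.
rewrite le_eqVlt; apply/orP; left; apply/eqP.
have -> : 16 ^+ k = 32 ^+ k * 2^-1 ^+ k :> R.
  by rewrite -exprMn; congr (_ ^+ _); field.
have h : 32^-1 ^+ k * 32 ^+ k = 1 :> R by rewrite -exprMn mulVf ?expr1n.
transitivity (64 * (32^-1 ^+ k * 32 ^+ k) * 2^-1 ^+ k / a); first by ring.
by rewrite h; ring.
Qed.

(* Smoothing with gcos itself: by Fubini, the mean of gcos (wchi - u) is a Gaussian
   mixture of the characteristic functions of wchi, and gcos >= 1/2 near 0. *)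
Lemma wchi_gcos (e : R) p (mu b : 'I_p -> R) (M : R) (u m : R) :
  0 < e -> (forall a, gcos a <= expR (- (e * a ^+ 2))) ->
  0 < M -> (forall i, mu i ^+ 2 <= M) -> 5 / 2 * M <= \sum_i mu i ^+ 2 -> 0 < u ->
  (\int[@gaussN R p]_v (gcos (u * (wchi mu b v - m)))%:E <=
    (128 / (Num.sqrt (8 * e * M) * u))%:E)%E.
Proof.
move=> e0 He M0 muM sumM u0.
have mS := measurable_wchi mu b.
pose F (xv : measurableTypeR R * 'cV[R]_p) : \bar R :=
  (cos (u * (wchi mu b xv.2 - m) * xv.1) + 1)%:E.
have F0 xv : (0 <= F xv)%E by rewrite lee_fin; have := cos_geN1 (u * (wchi mu b xv.2 - m) * xv.1); lra.
have mF : measurable_fun setT F.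
  apply/measurable_EFinP; apply: measurable_funD => //; apply: (measurableT_comp measurable_cos).
  apply: measurable_funM; last exact: measurable_fst.
  apply: measurable_funM => //; apply: measurable_funB => //.
  by apply: (measurableT_comp mS); exact: measurable_snd.
have mg : measurable_fun setT (fun v => gcos (u * (wchi mu b v - m))).
  apply: (measurableT_comp measurable_gcos); apply: measurable_funM => //; exact: measurable_funB.
have E1 v : (\int[@gauss1 R]_x F (x, v))%E = (gcos (u * (wchi mu b v - m)) + 1)%:E.
  apply: Rintegral_shift => [|x]; last exact: cos_max.
  by apply: (measurableT_comp measurable_cos) => /=; apply: measurable_funM.
have mc x : measurable_fun setT (fun v => cos (u * (wchi mu b v - m) * x)).
  apply: (measurableT_comp measurable_cos); apply: measurable_funM => //.
  by apply: measurable_funM => //; exact: measurable_funB.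
pose r x := \int[@gaussN R p]_v cos (u * (wchi mu b v - m) * x).
have E2 x : (\int[@gaussN R p]_v F (x, v))%E = (r x + 1)%:E.
  exact: (@Rintegral_shift _ _ _ (@gaussN R p) (fun v => cos (u * (wchi mu b v - m) * x)) 1 (mc x) (fun v => cos_max _)).
pose a := Num.sqrt (8 * e * M) * u.
have a0 : 0 < a by rewrite mulr_gt0// sqrtr_gt0 !mulr_gt0.
have a2 : a ^+ 2 = 8 * e * M * u ^+ 2 by rewrite exprMn sqr_sqrtr// ltW// !mulr_gt0.
pose g (x : R) := expR (- (5 / 8 * ln (1 + a ^+ 2 * x ^+ 2))).
have mgg : measurable_fun setT (fun x => (g x)%:E).
  apply/measurable_EFinP; apply: measurableT_comp => //; apply: measurable_funN.
  apply: measurable_funM => //; apply: measurableT_comp; first exact: measurable_ln.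
  by apply: measurable_funD => //; apply: measurable_funM => //; exact: measurable_funX.
have rg x : r x <= g x.
  apply: le_trans (ler_norm _) _; rewrite /g a2.
  have := wchi_decay b e0 He M0 muM sumM (u * x) (- (u * x * m)).
  rewrite exprMn mulrA /r; congr (`|_| <= _).
  by apply: eq_Rintegral => v _; congr cos; ring.
have key : (\int[@gaussN R p]_v (gcos (u * (wchi mu b v - m)) + 1)%:E <= (128 / a)%:E + 1)%E.
  have -> : (\int[@gaussN R p]_v (gcos (u * (wchi mu b v - m)) + 1)%:E =
      \int[@gauss1 R]_x (r x + 1)%:E)%E.
    transitivity (\int[@gaussN R p]_v \int[@gauss1 R]_x F (x, v))%E.
      by apply: eq_integral => v _; rewrite E1.
    rewrite -(@fubini_tonelli _ _ _ _ R (@gauss1 R) (@gaussN R p) F mF F0).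
    by apply: eq_integral => x _; rewrite E2.
  apply: (@le_trans _ _ (\int[@gauss1 R]_x ((g x)%:E + 1))%E).
    apply: le_integralT.
    - have := @measurable_fun_fubini_tonelli_F _ _ _ _ R (@gaussN R p) F mF F0.
      by rewrite (_ : fubini_F _ F = (fun x => (r x + 1)%:E))//; apply/funext => x; exact: E2.
    - exact: emeasurable_funD.
    - by move=> x; rewrite -E2; apply: integral_ge0.
    - by move=> x; rewrite -EFinD lee_fin lerD2r.
  rewrite ge0_integralD//; last by move=> x _; rewrite lee_fin expR_ge0.
  have -> : (\int[@gauss1 R]_x (1 : \bar R) = 1)%E.
    rewrite integral_cst// mul1e; exact: probability_setT.
  by rewrite leeD2r//; exact: gauss1_decay_integral.
rewrite (Rintegral_shift _ mg (fun v => gcos_norm _)) in key.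
have <- := EFin_Rintegral (@gaussN R p) mg (fun v => gcos_norm _).
by move: key; rewrite -EFinD !lee_fin lerD2r.
Qed.

(** As gcos >= 1/2 on [-1/3, 1/3], twice gcos ((wchi - m) / (3 h)) dominates the indicator of the
    window; 768 = 2 * 3 * 128 collects this with the constant of [wchi_gcos]. *)
Lemma wchi_anticonc : exists2 K : R, 0 < K &
  forall p (mu b : 'I_p -> R) (M m h : R), 0 < M -> (forall i, mu i ^+ 2 <= M) ->
  5 / 2 * M <= \sum_i mu i ^+ 2 -> 0 < h ->
  (@gaussN R p [set v | (`|wchi mu b v - m| <= h)%R] <= (K * h / Num.sqrt M)%:E)%E.
Proof.
have [e e0 He] := gcos_le_exp.
have [c [c0 cE]] : exists c : R, 0 < c /\ c = 768 by exists 768; rewrite ltr0n.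
have se0 : 0 < Num.sqrt (8 * e) by rewrite sqrtr_gt0 mulr_gt0.
exists (c / Num.sqrt (8 * e)); first by rewrite divr_gt0.
move=> p mu b M m h M0 muM sumM h0.
have mS := measurable_wchi mu b.
have u0 : 0 < 1 / (3 * h) by rewrite divr_gt0// mulr_gt0.
set A := [set v | _].
have mA : measurable A.
  apply: measurable_le_set; apply: measurableT_comp => //; exact: measurable_funB.
have mg : measurable_fun setT (fun v => (gcos (1 / (3 * h) * (wchi mu b v - m)))%:E).
  apply/measurable_EFinP; apply: (measurableT_comp measurable_gcos).
  by apply: measurable_funM => //; exact: measurable_funB.
rewrite -[X in (_ X <= _)%E](setIT A) -integral_indic//.
apply: (@le_trans _ _ (\int[@gaussN R p]_v (2%:E * (gcos (1 / (3 * h) * (wchi mu b v - m)))%:E))%E).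
  apply: le_integralT.
  - by apply/measurable_EFinP; exact: measurable_indic.
  - exact: measurable_funeM.
  - by move=> v; rewrite lee_fin.
  move=> v; rewrite -EFinM lee_fin indicE; case: (boolP (v \in A)) => [|_]; last first.
    by rewrite mulr_ge0// gcos_ge0.
  rewrite inE => Av; have : 1 / 2 <= gcos (1 / (3 * h) * (wchi mu b v - m)).
    apply: gcos_ge_half; rewrite normrM (gtr0_norm u0) mulrC ler_pdivlMr//.
    have -> : `|wchi mu b v - m| * (1 / (3 * h)) * 3 = `|wchi mu b v - m| / h by field; rewrite gt_eqF.
    by rewrite ler_pdivrMr// mul1r.
  by rewrite /=; lra.
rewrite ge0_integralZl//; last by move=> v _; rewrite lee_fin gcos_ge0.
apply: le_trans (lee_wpmul2l _ (wchi_gcos b m e0 He M0 muM sumM u0)) _; first by rewrite lee_fin.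
rewrite -EFinM lee_fin le_eqVlt; apply/orP; left; apply/eqP.
rewrite sqrtrM ?mulr_ge0 ?(ltW e0)// cE; field.
by rewrite !gt_eqF// sqrtr_gt0.
Qed.
End trig.

(** * Shifting one Gaussian coordinate: Anderson's inequality and second order bounds *)

Section anderson.
Context {R : realType}.
Implicit Types (K : R -> R) (b : R).

(** e^(- b^2 / 2) cosh (b y), the average of the densities of N(b, 1) and N(-b, 1) with respect to
    N(0, 1): this is how a shift by b acts on even functions. *)
Definition cosh_weight b (y : R) := (expR (b * y) + expR (- (b * y))) / 2 * expR (- (b ^+ 2 / 2)).

Lemma cosh_weight_ge b y : expR (- (b ^+ 2 / 2)) <= cosh_weight b y.
Proof.
rewrite -[leLHS]mul1r ler_wpM2r ?expR_ge0//.
have := expR_ge1Dx (b * y); have := expR_ge1Dx (- (b * y)); lra.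
Qed.

Lemma cosh_weight_mono b y z : y ^+ 2 <= z ^+ 2 -> cosh_weight b y <= cosh_weight b z.
Proof.
move=> yz; rewrite ler_wpM2r ?expR_ge0// ler_wpM2r//.
have E (u : R) : expR u + expR (- u) = expR `|u| + expR (- `|u|).
  by case: (ger0P u) => _ //; rewrite opprK addrC.
rewrite (E (b * y)) (E (b * z)).
have : `|b * y| <= `|b * z|.
  by rewrite -(@ler_pXn2r _ 2)// ?nnegrE// !real_normK ?num_real// !exprMn ler_wpM2l// sqr_ge0.
move: `|b * y| `|b * z| (normr_ge0 (b * y)) => u v u0 uv.
have uv' : expR u <= expR v by rewrite ler_expR.
have h1 : expR (- v - u) <= 1 by rewrite expR_le1; lra.
have hu : expR (- u) = expR (- v - u) * expR v by rewrite -expRD; congr expR; ring.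
have hv : expR (- v) = expR (- v - u) * expR u by rewrite -expRD; congr expR; ring.
rewrite hu hv; nra.
Qed.

Lemma cosh_weight_gt1 b : b != 0 -> exists y, 1 < cosh_weight b y.
Proof.
move=> b0; exists ((b ^+ 2 + 2) / b); rewrite /cosh_weight mulrC (_ : b * ((b ^+ 2 + 2) / b) = b ^+ 2 + 2).
  have h1 := expR_gt0 (- (b ^+ 2 + 2)); have b2 := sqr_ge0 b.
  have h2 : expR (- (b ^+ 2 / 2)) * expR (b ^+ 2 + 2) = expR (b ^+ 2 / 2 + 2).
    by rewrite -expRD; congr expR; field.
  have h3 : 1 + (b ^+ 2 / 2 + 2) <= expR (b ^+ 2 / 2 + 2) by exact: expR_ge1Dx.
  have h4 : 0 < expR (- (b ^+ 2 / 2)) * expR (- (b ^+ 2 + 2)) by rewrite mulr_gt0 ?expR_gt0.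
  by rewrite mulrA mulrDr h2; lra.
by field.
Qed.

Lemma measurable_cosh_weight b : measurable_fun setT (cosh_weight b).
Proof. by rewrite /cosh_weight; meas. Qed.

Lemma gauss1_shift K b : (forall t, 0 <= K t) ->
  measurable_fun setT (fun x : R => K (x ^+ 2)) ->
  (\int[@gauss1 R]_x (K ((x + b) ^+ 2))%:E = \int[@gauss1 R]_x (K (x ^+ 2) * cosh_weight b x)%:E)%E.
Proof.
move=> K0 mK.
have mKb : measurable_fun setT (fun x : R => K ((x + b) ^+ 2)).
  by apply: (measurableT_comp mK); exact: measurable_funD.
have me c : measurable_fun setT (fun x : measurableTypeR R => (K (x ^+ 2) * expR (c * x - b ^+ 2 / 2))%:E).
  by apply/measurable_EFinP; apply: measurable_funM => //; meas.
have e0 c x : (0 <= (K (x ^+ 2) * expR (c * x - b ^+ 2 / 2))%:E)%E.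
  by rewrite lee_fin mulr_ge0 ?expR_ge0.
have E1 : (\int[@gauss1 R]_x (K ((x + b) ^+ 2))%:E =
    \int[@gauss1 R]_x (K (x ^+ 2) * expR (b * x - b ^+ 2 / 2))%:E)%E.
  rewrite !integral_gauss1//; last 2 first.
  - exact/measurable_EFinP.
  - by move=> x; rewrite lee_fin.
  have mG : measurable_fun setT (fun x : R => (K (x ^+ 2) * expR (b * x - b ^+ 2 / 2))%:E * (phi1 x)%:E)%E.
    by apply: emeasurable_funM; [exact: me|apply/measurable_EFinP; exact: measurable_phi1].
  have h := lebesgue_affine b (oner_neq0 R) mG (fun x => mule_ge0 (e0 b x) (ltW (phi1_gt0 x) : (0 <= (phi1 x)%:E)%E)).
  rewrite normr1 mul1e in h; apply: (etrans _ h).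
  apply: eq_integral => x _; rewrite mul1r -!EFinM -mulrA; congr (_ * _)%:E.
  by rewrite /phi1 mulrCA -expRD; congr (_ * expR _); field.
have E2 : (\int[@gauss1 R]_x (K (x ^+ 2) * expR (b * x - b ^+ 2 / 2))%:E =
    \int[@gauss1 R]_x (K (x ^+ 2) * expR (- b * x - b ^+ 2 / 2))%:E)%E.
  have h := @gauss1_opp R (fun x => (K (x ^+ 2) * expR (- b * x - b ^+ 2 / 2))%:E) (me _) (e0 _).
  by apply: (etrans _ h); apply: eq_integral => x _; rewrite sqrrN mulrNN.
have E3 : (\int[@gauss1 R]_x (K (x ^+ 2) * cosh_weight b x)%:E =
    (1 / 2)%:E * (\int[@gauss1 R]_x (K (x ^+ 2) * expR (b * x - b ^+ 2 / 2))%:E +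
    \int[@gauss1 R]_x (K (x ^+ 2) * expR (- b * x - b ^+ 2 / 2))%:E))%E.
  rewrite -ge0_integralD//; try exact: me.
  have mS := emeasurable_funD (me b) (me (- b)).
  rewrite -(ge0_integralZl_EFin (@gauss1 R) measurableT _ mS (_ : 0 <= 1 / 2)%R); first last.
  - by rewrite divr_ge0.
  - by move=> x _; rewrite adde_ge0.
  by apply: eq_integral => x _; rewrite -EFinD -EFinM /cosh_weight !expRD mulNr; congr EFin; field.
rewrite E3 -E2 E1; set I := (\int[_]_x _)%E.
have I0 : (0 <= I)%E by apply: integral_ge0 => x _; exact: e0.
move: I I0 => -[i _|_|//]; last by rewrite addye// gt0_muley// lte_fin divr_gt0.
by rewrite -EFinD -EFinM; congr EFin; field.
Qed.

Lemma integral_cosh_weight b : (\int[@gauss1 R]_x (cosh_weight b x)%:E = 1)%E.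
Proof.
have := @gauss1_shift (cst 1) b (fun _ => ler01) (measurable_cst _).
under [in X in _ = X -> _]eq_integral => x _ do rewrite mul1r.
move=> <-; transitivity (\int[@gauss1 R]_x (cst (1 : \bar R) x))%E; first by [].
by rewrite integral_cst// mul1e; exact: probability_setT.
Qed.

(** A correlation inequality: K (x^2) and the weight both increase with x^2, and the weight has mean
    1. The level k0 separates the values of K where the weight is at most 1 from those where it
    exceeds 1, so (K - k0) (weight - 1) >= 0, and this is integrated. *)
Lemma anderson1 K b : (forall t, 0 <= K t) -> (forall s t, 0 <= s -> s <= t -> K s <= K t) ->
  measurable_fun setT (fun x : R => K (x ^+ 2)) ->
  (\int[@gauss1 R]_x (K (x ^+ 2))%:E <= \int[@gauss1 R]_x (K ((x + b) ^+ 2))%:E)%E.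
Proof.
move=> K0 Kmono mK; have [->|b0] := eqVneq b 0.
  by under [leRHS]eq_integral do rewrite addr0.
rewrite gauss1_shift//.
have [y1 Wy1] := cosh_weight_gt1 b0.
have cmp y z : cosh_weight b y <= 1 -> 1 < cosh_weight b z -> K (y ^+ 2) <= K (z ^+ 2).
  move=> hy hz; apply: Kmono; first exact: sqr_ge0.
  rewrite leNgt; apply/negP => /ltW /(cosh_weight_mono b); lra.
pose B := [set K (y ^+ 2) | y in [set y | cosh_weight b y <= 1]].
have B0 : B (K (0 ^+ 2)).
  exists 0 => //=; rewrite /cosh_weight mulr0 oppr0 expR0 (_ : (1 + 1) / 2 = 1); last by field.
  by rewrite mul1r expR_le1 oppr_le0 divr_ge0// sqr_ge0.
(* The supremum is finite because y1 has weight above 1, so that K (y1^2) bounds every value in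
   B. *)
have ub : has_sup B.
  split; first by exists (K (0 ^+ 2)).
  by exists (K (y1 ^+ 2)) => _ [y hy <-]; exact: cmp.
pose k0 := sup B.
have k00 : 0 <= k0 by apply: le_trans (ub_le_sup ub.2 B0).
have key x : K (x ^+ 2) + k0 * cosh_weight b x <= K (x ^+ 2) * cosh_weight b x + k0.
  have [h|h] := leP (cosh_weight b x) 1.
    have : K (x ^+ 2) <= k0 by apply: (ub_le_sup ub.2); exists x.
    nra.
  have : k0 <= K (x ^+ 2).
    apply: ge_sup; first by exists (K (0 ^+ 2)).
    by move=> _ [y hy <-]; exact: cmp.
  nra.
have mW := measurable_cosh_weight b.
have W0 x : 0 <= cosh_weight b x by apply: le_trans (cosh_weight_ge b x); exact: expR_ge0.
have : (\int[@gauss1 R]_x ((K (x ^+ 2))%:E + k0%:E * (cosh_weight b x)%:E) <=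
    \int[@gauss1 R]_x ((K (x ^+ 2) * cosh_weight b x)%:E + (cst k0%:E) x))%E.
  apply: le_integralT.
  - apply: emeasurable_funD; first exact/measurable_EFinP.
    by apply: measurable_funeM; exact/measurable_EFinP.
  - apply: emeasurable_funD => //.
    by apply/measurable_EFinP; exact: measurable_funM.
  - by move=> x; rewrite -EFinM -EFinD lee_fin addr_ge0// mulr_ge0.
  - by move=> x; rewrite -EFinM -!EFinD lee_fin.
rewrite !ge0_integralD//; first last.
- by apply: measurable_funeM; exact/measurable_EFinP.
- by move=> x _; rewrite mule_ge0// lee_fin.
- exact/measurable_EFinP.
- by move=> x _; rewrite lee_fin.
- by apply/measurable_EFinP; exact: measurable_funM.
- by move=> x _; rewrite lee_fin mulr_ge0.
rewrite ge0_integralZl//; first last.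
- by move=> x _; rewrite lee_fin.
- exact/measurable_EFinP.
have -> : (\int[@gauss1 R]_x (cst k0%:E) x = k0%:E)%E.
  by rewrite integral_cst//; have := mule1 k0%:E; rewrite -{1}(@probability_setT _ _ _ (@gauss1 R)).
by rewrite integral_cosh_weight mule1 leeD2rE.
Qed.

Lemma shift_ge K b : (forall t, 0 <= K t) -> measurable_fun setT (fun x : R => K (x ^+ 2)) ->
  ((expR (- (b ^+ 2 / 2)))%:E * \int[@gauss1 R]_x (K (x ^+ 2))%:E <=
   \int[@gauss1 R]_x (K ((x + b) ^+ 2))%:E)%E.
Proof.
move=> K0 mK; rewrite gauss1_shift// -ge0_integralZl//; first last.
- by move=> x _; rewrite lee_fin.
- exact/measurable_EFinP.
apply: le_integralT.
- by apply: measurable_funeM; exact/measurable_EFinP.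
- by apply/measurable_EFinP; apply: measurable_funM => //; exact: measurable_cosh_weight.
- by move=> x; rewrite -EFinM lee_fin mulr_ge0 ?expR_ge0.
- by move=> x; rewrite -EFinM lee_fin mulrC ler_wpM2l// cosh_weight_ge.
Qed.

Lemma gauss1_sqr_fin : (\int[@gauss1 R]_x (x ^+ 2)%:E < +oo)%E.
Proof.
apply: (@le_lt_trans _ _ (\int[@gauss1 R]_x (4%:E * (expR (x ^+ 2 / 4))%:E))%E).
  apply: le_integralT.
  - by meas.
  - by apply: measurable_funeM; meas.
  - by move=> x; rewrite lee_fin sqr_ge0.
  - by move=> x; rewrite -EFinM lee_fin; have := expR_ge1Dx (x ^+ 2 / 4); lra.
rewrite ge0_integralZl//; last by meas.
by apply: le_lt_trans (lee_wpmul2l _ gauss1_exp_norm) _ => //; rewrite -EFinM ltry.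
Qed.

(** Symmetry equates the means for b and - b, and their sum has no term linear in x. *)
Lemma gauss1_sqr_shift b :
  (\int[@gauss1 R]_x ((x + b) ^+ 2)%:E = \int[@gauss1 R]_x (x ^+ 2)%:E + (b ^+ 2)%:E)%E.
Proof.
have m2 c : measurable_fun setT (fun x : measurableTypeR R => ((x + c) ^+ 2)%:E).
  by apply/measurable_EFinP; apply: measurable_funX; exact: measurable_funD.
have m0 : measurable_fun setT (fun x : measurableTypeR R => (x ^+ 2)%:E) by meas.
have E1 : (\int[@gauss1 R]_x ((x + b) ^+ 2)%:E = \int[@gauss1 R]_x ((x + - b) ^+ 2)%:E)%E.
  rewrite -(@gauss1_opp R (fun x => ((x + - b) ^+ 2)%:E))//; first last.
  - by move=> x; rewrite lee_fin sqr_ge0.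
  by apply: eq_integral => x _; congr EFin; ring.
have E2 : (\int[@gauss1 R]_x ((x + b) ^+ 2)%:E + \int[@gauss1 R]_x ((x + - b) ^+ 2)%:E =
    2%:E * (\int[@gauss1 R]_x (x ^+ 2)%:E + (b ^+ 2)%:E))%E.
  have -> : (\int[@gauss1 R]_x (x ^+ 2)%:E + (b ^+ 2)%:E =
     \int[@gauss1 R]_x ((x ^+ 2)%:E + (cst (b ^+ 2)%:E) x))%E.
    rewrite ge0_integralD//; first last.
    - by move=> x _; rewrite lee_fin sqr_ge0.
    - by move=> x _; rewrite lee_fin sqr_ge0.
    congr (_ + _)%E; rewrite integral_cst//.
    by have := mule1 (b ^+ 2)%:E; rewrite -{1}(@probability_setT _ _ _ (@gauss1 R)).
  rewrite -ge0_integralD//; try (by exact: m2); try (by move=> x _; rewrite lee_fin sqr_ge0).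
  rewrite -ge0_integralZl//; last 2 first.
  - exact: emeasurable_funD.
  - by move=> x _; rewrite adde_ge0// lee_fin sqr_ge0.
  by apply: eq_integral => x _; rewrite -!EFinD -EFinM; congr EFin; ring.
move: E2; rewrite -E1; set I := (\int[_]_x _)%E; set J := (_ + _)%E => E2.
rewrite -[LHS]mul1e -[RHS]mul1e (_ : 1%E = (1 / 2)%:E * 2%:E)%E; last by rewrite -EFinM; congr EFin; lra.
by rewrite -!muleA -E2 mule_natl.
Qed.


(** H (m t) + L m t is nondecreasing in t because H is L-Lipschitz, so [anderson1] applies to it;
    the added term changes by exactly L m b^2 under the shift. K' cuts it to 0 at negative
    arguments, since [anderson1] wants a nonnegative function while only squares are inserted. *)
Lemma lipschitz_shift (H : R -> R) (L m b : R) : measurable_fun setT H ->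
  (forall t, 0 <= H t <= 1) -> (forall s t, s <= t -> H t <= H s) ->
  (forall s t, s <= t -> H s - H t <= L * (t - s)) -> 0 <= L -> 0 <= m ->
  (\int[@gauss1 R]_x (H (m * x ^+ 2))%:E <=
   \int[@gauss1 R]_x (H (m * (x + b) ^+ 2))%:E + (L * m * b ^+ 2)%:E)%E.
Proof.
move=> mH H01 Hd HL L0 m0; have H0 t : 0 <= H t by have /andP[] := H01 t.
pose K t := H (m * t) + L * m * t.
pose K' t := if 0 <= t then K t else 0.
have Lm : 0 <= L * m by rewrite mulr_ge0.
have K'E x : K' (x ^+ 2) = K (x ^+ 2) by rewrite /K' sqr_ge0.
have mHb c : measurable_fun setT (fun x : R => (H (m * (x + c) ^+ 2))%:E).
  apply/measurable_EFinP; apply: (measurableT_comp mH); apply: measurable_funM => //.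
  by apply: measurable_funX; exact: measurable_funD.
have mHx : measurable_fun setT (fun x : R => (H (m * x ^+ 2))%:E).
  by apply/measurable_EFinP; apply: (measurableT_comp mH); apply: measurable_funM.
have m2 c : measurable_fun setT (fun x : measurableTypeR R => ((x + c) ^+ 2)%:E).
  by apply/measurable_EFinP; apply: measurable_funX; exact: measurable_funD.
have ms : measurable_fun setT (fun x : measurableTypeR R => (x ^+ 2)%:E) by meas.
have := @anderson1 K' b; have K'0 t : 0 <= K' t.
  by rewrite /K'; case: ifP => // t0; rewrite addr_ge0// mulr_ge0.
have K'm s t : 0 <= s -> s <= t -> K' s <= K' t.
  move=> s0 st; rewrite /K' s0 (le_trans s0 st) /K.
  have := HL (m * s) (m * t) (ler_wpM2l m0 st); lra.
have mK' : measurable_fun setT (fun x : R => K' (x ^+ 2)).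
  under eq_fun do rewrite K'E; apply: measurable_funD.
    exact/measurable_EFinP.
  by apply: measurable_funM.
move=> /(_ K'0 K'm mK').
have E (g : R -> R) : measurable_fun setT (fun x => (g x ^+ 2)%:E) ->
    measurable_fun setT (fun x => (H (m * g x ^+ 2))%:E) ->
    (\int[@gauss1 R]_x (K' (g x ^+ 2))%:E =
     \int[@gauss1 R]_x (H (m * g x ^+ 2))%:E + (L * m)%:E * \int[@gauss1 R]_x (g x ^+ 2)%:E)%E.
  move=> mg mHg; rewrite -ge0_integralZl//; last by move=> x _; rewrite lee_fin sqr_ge0.
  rewrite -ge0_integralD//; last 3 first.
  - by move=> x _; rewrite lee_fin.
  - by move=> x _; rewrite -EFinM lee_fin mulr_ge0// sqr_ge0.
  - exact: measurable_funeM.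
  by apply: eq_integral => x _; rewrite K'E.
have Ea := E (fun x => x) ms mHx; have Eb := E (fun x => x + b) (m2 b) (mHb b).
rewrite /= in Ea Eb; rewrite Ea Eb gauss1_sqr_shift.
have f2 : (\int[@gauss1 R]_x (x ^+ 2)%:E)%E \is a fin_num.
  by rewrite ge0_fin_numE ?gauss1_sqr_fin// integral_ge0// => x _; rewrite lee_fin sqr_ge0.
rewrite -(fineK f2) -EFinD -!EFinM mulrDr EFinD addeA addeAC leeD2rE//.
Qed.

Lemma decreasing_shift (H : R -> R) (m b : R) : measurable_fun setT H ->
  (forall t, 0 <= H t <= 1) -> (forall s t, s <= t -> H t <= H s) -> 0 <= m ->
  \int[@gauss1 R]_x H (m * (x + b) ^+ 2) <= \int[@gauss1 R]_x H (m * x ^+ 2).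
Proof.
move=> mH H01 Hd m0.
have mHb c : measurable_fun setT (fun x : R => H (m * (x + c) ^+ 2)).
  apply: (measurableT_comp mH); apply: measurable_funM => //.
  by apply: measurable_funX; exact: measurable_funD.
have mHx : measurable_fun setT (fun x : R => H (m * x ^+ 2)).
  by apply: (measurableT_comp mH); apply: measurable_funM.
pose K t := 1 - H (m * t).
have K0 t : 0 <= K t by rewrite subr_ge0; have /andP[] := H01 (m * t).
have := @anderson1 K b K0; have Km s t : 0 <= s -> s <= t -> K s <= K t.
  by move=> _ st; rewrite lerD2l lerN2; apply: Hd; rewrite ler_wpM2l.
have Hn t : `|- H t| <= 1 by have /andP[h1 h2] := H01 t; rewrite normrN ger0_norm.
have Hp t : `|H t| <= 1 by have /andP[h1 h2] := H01 t; rewrite ger0_norm.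
have E (g : R -> R) : measurable_fun setT (fun x => H (m * g x ^+ 2)) ->
    (\int[@gauss1 R]_x (K (g x ^+ 2))%:E = (- (\int[@gauss1 R]_x H (m * g x ^+ 2)) + 1)%:E)%E.
  move=> mg; have mgN : measurable_fun setT (fun x => - H (m * g x ^+ 2)) by exact: measurable_funN.
  have <- : \int[@gauss1 R]_x (- H (m * g x ^+ 2)) = - \int[@gauss1 R]_x H (m * g x ^+ 2).
    have := @Rintegral_lin _ _ _ (@gauss1 R) _ _ (-1) 0 1 mg mg (fun x => Hp _) (fun x => Hp _).
    rewrite mul0r addr0 mulN1r => <-; apply: eq_Rintegral => x _; ring.
  have <- := @Rintegral_shift _ _ _ (@gauss1 R) (fun x => - H (m * g x ^+ 2)) 1 mgN (fun x => Hn _).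
  by apply: eq_integral => x _; rewrite /K addrC.
have Ea := E (fun x => x) mHx; have Eb := E (fun x => x + b) (mHb b).
rewrite /= in Ea Eb; move=> /(_ Km); rewrite Ea Eb.
have mK : measurable_fun setT (fun x : R => K (x ^+ 2)) by exact: measurable_funB.
by move=> /(_ mK); rewrite lee_fin lerD2r lerN2.
Qed.
End anderson.

(** * Recentring a Gaussian quadratic form *)

Section gauss_shift.
Context {R : realType}.

(** Brings an arbitrary coordinate to the front, where [wchi_section] integrates it separately from
    the others. *)
Lemma gaussN_perm p (s : {perm 'I_p}) (mu b : 'I_p -> R) r :
  @gaussN R p [set v | wchi (mu \o s) (b \o s) v <= r] = @gaussN R p [set v | wchi mu b v <= r].
Proof.
have mA mu' b' : measurable [set v : 'cV[R]_p | wchi mu' b' v <= r].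
  by apply: measurable_le_set; exact: measurable_wchi.
rewrite -[X in gaussN X = _]setIT -integral_indic// -[X in _ = gaussN X]setIT -integral_indic//.
rewrite -[LHS](@gaussN_orthogonal R p (perm_mx s)).
- apply: eq_integral => v _; rewrite !indicE; congr (_%:R%:E); congr nat_of_bool.
  have E : wchi (mu \o s) (b \o s) (perm_mx s *m v) = wchi mu b v.
    rewrite /wchi [RHS](reindex_inj (@perm_inj _ s))/=; apply: eq_bigr => i _.
    by rewrite -row_permE mxE.
  by apply/idP/idP => /set_mem/= h; apply/mem_set; move: h; rewrite /= E.
- by rewrite tr_perm_mx -perm_mxM mulVg perm_mx1.
- by apply/measurable_EFinP; exact: measurable_indic.
- by move=> v; rewrite lee_fin.
Qed.

Section first_coordinate.
Variables (p : nat) (mu : 'I_p.+1 -> R) (b : 'I_p.+1 -> R) (r : R).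
Let mu' i := mu (lift ord0 i).
Let b' i := b (lift ord0 i).
Let H t := fine (@gaussN R p [set v | wchi mu' b' v <= r - t]).

Let mA t : measurable [set v : 'cV[R]_p | wchi mu' b' v <= t].
Proof. by apply: measurable_le_set; exact: measurable_wchi. Qed.

Lemma section_cdf01 t : 0 <= H t <= 1.
Proof.
rewrite /H fine_ge0//= -lee_fin fineK ?fin_num_measure//.
exact: probability_le1.
Qed.

Lemma section_cdf_noninc s t : s <= t -> H t <= H s.
Proof.
move=> st; rewrite /H fine_le ?fin_num_measure// le_measure//; try exact: mem_set (mA _).
by move=> v /= h; rewrite (le_trans h)// lerD2l lerN2.
Qed.

Lemma measurable_section_cdf : measurable_fun setT H.
Proof.
apply: nonincreasing_measurable => // s t; exact: section_cdf_noninc.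
Qed.

(** The increment is the mass of a window of half-width (t - s) / 2 centred at r - (s + t) / 2, to
    which the anticoncentration bound applies. *)
Lemma section_cdf_lipschitz L s t : 0 <= L ->
  (forall m h, 0 < h -> (@gaussN R p [set v | (`|wchi mu' b' v - m| <= h)%R] <= (L * h)%:E)%E) ->
  s <= t -> H s - H t <= L * (t - s).
Proof.
move=> L0 HL; rewrite le_eqVlt => /predU1P[->|st]; first by rewrite !subrr mulr0.
have h0 : 0 < (t - s) / 2 by rewrite divr_gt0// subr_gt0.
have := HL (r - (s + t) / 2) _ h0; set B := [set v | _] => hB.
have mB : measurable B.
  apply: measurable_le_set; apply: measurableT_comp => //; apply: measurable_funB => //.
  exact: measurable_wchi.
rewrite lerBlDl -lee_fin EFinD !fineK ?fin_num_measure//.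
apply: (@le_trans _ _ (@gaussN R p [set v | (wchi mu' b' v <= r - t)%R] + @gaussN R p B)%E).
  apply: le_trans (measureU2 _ _ _) => //; apply: le_measure; [exact: mem_set (mA _)|by apply: mem_set; apply: measurableU; [exact: mA|]|].
  move=> v /= hv; have [h|h] := leP (wchi mu' b' v) (r - t); [by left|right].
  by rewrite /B/= ler_norml; apply/andP; split; lra.
rewrite leeD2l//; apply: (le_trans hB); rewrite lee_fin ler_wpM2l//; lra.
Qed.

Lemma wchi_section : fine (@gaussN R p.+1 [set v | wchi mu b v <= r]) =
  \int[@gauss1 R]_x H (mu ord0 * (x - b ord0) ^+ 2).
Proof.
have mC : measurable [set v : 'cV[R]_p.+1 | wchi mu b v <= r].
  by apply: measurable_le_set; exact: measurable_wchi.
rewrite -[in LHS](setIT [set v | _]) -integral_indic// /Rintegral; congr fine.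
rewrite gaussN_rec//; last first.
  by apply/measurable_EFinP; exact: measurable_indic.
apply: eq_integral => x _; rewrite fineK ?fin_num_measure//.
rewrite -[X in _ = gaussN X]setIT -integral_indic//; apply: eq_integral => v _.
rewrite !indicE; congr (_%:R%:E); congr nat_of_bool.
have E : wchi mu b (cV_cons (x, v)) = mu ord0 * (x - b ord0) ^+ 2 + wchi mu' b' v.
  rewrite /wchi big_ord_recl cV_cons0; congr (_ + _).
  by apply: eq_bigr => i _; rewrite cV_consS.
by apply/idP/idP => /set_mem/= h; apply/mem_set; move: h; rewrite /= E lerBrDl.
Qed.

End first_coordinate.

Definition wchi_cdf p (mu b : 'I_p -> R) r := fine (@gaussN R p [set v | wchi mu b v <= r]).

Definition zero_at p (b : 'I_p -> R) (i j : 'I_p) := if j == i then 0 else b j.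

Definition shift_const (C : R) := forall p (mu b : 'I_p.+1 -> R) r F,
  (forall i, 0 <= mu i) -> 0 < F -> F ^+ 2 = \sum_i mu i ^+ 2 ->
  (forall i, 3 * mu i ^+ 2 <= F ^+ 2) ->
  wchi_cdf mu b r <= wchi_cdf mu (zero_at b ord0) r <=
  wchi_cdf mu b r + C * (mu ord0 * b ord0 ^+ 2) / F.

(* Moving b_0 to 0 changes the law of y + b_0 only through the even weight
   cosh (b_0 y), so that the effect is of order b_0^2. *)
Lemma shift_first : exists2 C, 0 <= C & shift_const C.
Proof.
have constP (K a : R) : 0 < K -> 1 / 3 <= a -> 2^-1 <= (K * 2 + 2) * a by move=> *; nra.
have heavyP (I J e c t : R) : 1 - t <= e -> t <= c -> e * I <= J -> 0 <= t -> I <= 1 -> 0 <= I ->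
    I <= J + c by move=> *; nra.
have ratioP (F m : R) : 0 < F -> 0 <= m -> F ^+ 2 <= 6 * m ^+ 2 -> 1 / 3 <= m / F.
  move=> F0 m0 Fm; rewrite ler_pdivlMr//.
  by rewrite -(@ler_pXn2r _ 2)// ?nnegrE ?mulr_ge0// ?(ltW F0)// exprMn; nra.
have lightP (K F s : R) : 0 < K -> 0 < F -> 0 < s -> F / 2 <= s -> K / s <= (K * 2 + 2) / F.
  by move=> K0 F0 s0 Fs; rewrite ler_pdivrMr// mulrAC ler_pdivlMr//; nra.
have [K K0 HK] := @wchi_anticonc R.
exists (K * 2 + 2); first by rewrite addr_ge0// mulr_ge0// ltW.
move=> p mu b r F mu0 F0 FE mu3.
rewrite /wchi_cdf !wchi_section.
have zb i : zero_at b ord0 (lift ord0 i) = b (lift ord0 i) by rewrite /zero_at.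
have -> : (fun i => zero_at b ord0 (lift ord0 i)) = (fun i => b (lift ord0 i)) by apply/funext.
have -> : zero_at b ord0 ord0 = 0 by rewrite /zero_at eqxx.
set H := fun t => fine (@gaussN R p [set v | wchi (fun i => mu (lift ord0 i)) (fun i => b (lift ord0 i)) v <= r - t]).
have H01 := section_cdf01 mu b r; have Hd := @section_cdf_noninc p mu b r.
have mH := measurable_section_cdf mu b r.
have {}mu0i := mu0 ord0; set b0 := b ord0; set m0 := mu ord0 in mu0i *.
have H0 t : 0 <= H t by have /andP[] := H01 t.
have m_shift c : measurable_fun setT (fun x : R => H (m0 * (x + c) ^+ 2)).
  apply: (measurableT_comp mH); apply: measurable_funM => //.
  by apply: measurable_funX; exact: measurable_funD.
have m_0 : measurable_fun setT (fun x : R => H (m0 * x ^+ 2)).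
  by apply: (measurableT_comp mH); apply: measurable_funM.
have Hn t : `|H t| <= 1 by have /andP[h1 h2] := H01 t; rewrite ger0_norm.
have -> : \int[@gauss1 R]_x H (m0 * (x - 0) ^+ 2) = \int[@gauss1 R]_x H (m0 * x ^+ 2).
  by apply: eq_Rintegral => x _; rewrite subr0.
apply/andP; split; first exact: decreasing_shift.
have EI := EFin_Rintegral (@gauss1 R) (m_shift (- b0)) (fun x => Hn _).
have E0 := EFin_Rintegral (@gauss1 R) m_0 (fun x => Hn _).
have I1 := Rintegral_bounded (@gauss1 R) m_0 (fun x => Hn _).
have I0 : 0 <= \int[@gauss1 R]_x H (m0 * x ^+ 2) by apply: Rintegral_ge0 => // x _; exact: H0.
rewrite ger0_norm// in I1.
(* If m0 carries at least 1/6 of F^2, then m0 / F >= 1/3 and the crude loss 1 - e^(- b0^2 / 2) <=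
   b0^2 / 2 is already of the required order. Otherwise the other coordinates keep at least 5/6 F^2
   = 5/2 (F^2 / 3), and with M = F^2 / 3 >= mu_i^2 their distribution function is Lipschitz of order
   1 / F. *)
have [heavy|light] := leP (F ^+ 2) (6 * m0 ^+ 2).
  have := @shift_ge R (fun t => H (m0 * t)) (- b0) (fun t => H0 _) m_0.
  rewrite -EI -E0 -EFinM lee_fin sqrrN => h1.
  apply: heavyP (expR_ge1Dx _) _ h1 _ I1 I0; last by rewrite divr_ge0// sqr_ge0.
  rewrite (_ : _ / F = (K * 2 + 2) * (m0 / F) * b0 ^+ 2); last by ring.
  by rewrite [leLHS]mulrC ler_wpM2r ?sqr_ge0// constP// ratioP.
have M0 : 0 < F ^+ 2 / 3 by rewrite divr_gt0// exprn_gt0.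
have sM : F / 2 <= Num.sqrt (F ^+ 2 / 3).
  rewrite -(@ler_pXn2r _ 2)// ?nnegrE ?sqrtr_ge0 ?divr_ge0 ?(ltW F0)// sqr_sqrtr ?(ltW M0)//.
  by rewrite expr_div_n; have := sqr_ge0 F; lra.
have sM0 : 0 < Num.sqrt (F ^+ 2 / 3) by rewrite sqrtr_gt0.
have L0 : 0 <= K / Num.sqrt (F ^+ 2 / 3) by rewrite divr_ge0 ?ltW.
have HL s t : s <= t -> H s - H t <= K / Num.sqrt (F ^+ 2 / 3) * (t - s).
  apply: section_cdf_lipschitz => // m h h0; rewrite mulrAC; apply: HK => //.
    by move=> i; rewrite ler_pdivlMr// mulrC.
  by move: FE; rewrite big_ord_recl -/m0 => FE; lra.
have := lipschitz_shift (- b0) mH H01 Hd HL L0 mu0i.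
rewrite -E0 -EI -EFinD lee_fin sqrrN => /le_trans; apply; rewrite lerD2l.
rewrite (_ : _ / F = (K * 2 + 2) / F * (m0 * b0 ^+ 2)); last by ring.
rewrite -mulrA ler_wpM2r ?(mulr_ge0 mu0i (sqr_ge0 _))//.
exact: lightP.
Qed.

(** [bk k] is b with its first k coordinates replaced by 0. Consecutive hybrids differ in one
    coordinate, which a transposition brings to the front; all steps increase the probability, and
    the second order losses add up. *)
Lemma gauss_shift : exists2 C : R, 0 <= C &
  forall p (mu b : 'I_p -> R) r F, (forall i, 0 <= mu i) -> 0 < F ->
  F ^+ 2 = \sum_i mu i ^+ 2 -> (forall i, 3 * mu i ^+ 2 <= F ^+ 2) ->
  `|wchi_cdf mu b r - wchi_cdf mu (fun=> 0) r| <= C * (\sum_i mu i * b i ^+ 2) / F.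
Proof.
have [C C0 HC] := shift_first; exists C => // -[|p] mu b r F mu0 F0 FE mu3.
  by move: FE; rewrite big_ord0 => /eqP; rewrite expf_eq0/= gt_eqF.
pose bk k (i : 'I_p.+1) := if (i < k)%N then 0 else b i.
have step (i0 : 'I_p.+1) : wchi_cdf mu (bk i0) r <= wchi_cdf mu (bk i0.+1) r <=
    wchi_cdf mu (bk i0) r + C * (mu i0 * b i0 ^+ 2) / F.
  pose s := tperm ord0 i0.
  have := HC p (mu \o s) (bk i0 \o s) r F (fun i => mu0 _) F0.
  rewrite (_ : zero_at (bk i0 \o s) ord0 = bk i0.+1 \o s); last first.
    apply/funext => j; rewrite /zero_at/= /bk [in RHS]ltnS [in RHS]leq_eqVlt.
    rewrite (_ : (nat_of_ord (s j) == i0) = (j == ord0)); first by case: eqP.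
    by rewrite (inj_eq val_inj) (_ : i0 = s ord0) ?(inj_eq perm_inj)// /s tpermL.
  have FE' : F ^+ 2 = \sum_i (mu \o s) i ^+ 2.
    by rewrite FE (reindex_inj (@perm_inj _ s)).
  move=> /(_ FE' (fun i => mu3 _)); rewrite /wchi_cdf !gaussN_perm /= tpermL.
  by rewrite (_ : bk i0 i0 = b i0)// /bk ltnn.
have hyb k : (k <= p.+1)%N -> wchi_cdf mu b r <= wchi_cdf mu (bk k) r <=
    wchi_cdf mu b r + C * (\sum_(i < p.+1 | (i < k)%N) mu i * b i ^+ 2) / F.
  elim: k => [|k IH] kp.
    by rewrite big_pred0// mulr0 mul0r addr0 (_ : bk 0%N = b) ?lexx//.
  have /andP[h1 h2] := IH (ltnW kp); have /andP[h3 h4] := step (Ordinal kp).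
  rewrite (bigD1 (Ordinal kp))//= (eq_bigl (fun i : 'I_p.+1 => (i < k)%N)); last first.
    by move=> i; rewrite ltnS ltn_neqAle -val_eqE andbC.
  rewrite mulrDr mulrDl; apply/andP; split; [apply: le_trans h1 h3|].
  by apply: le_trans h4 _; rewrite /=; lra.
have /andP[] := hyb p.+1 (leqnn _).
rewrite (_ : bk p.+1 = fun=> 0); last by apply/funext => i; rewrite /bk ltn_ord.
rewrite (eq_bigl xpredT); last by move=> i; rewrite ltn_ord.
by move=> h1 h2; rewrite ler_norml; apply/andP; split; lra.
Qed.

End gauss_shift.

(** * A quadratic lower bound for cosh *)

Section cosh.
Context {R : realType}.

Lemma sinh_ge (y : R) : 0 <= y -> 2 * y <= expR y - expR (- y).
Proof.
rewrite le_eqVlt => /predU1P[<-|y0]; first by rewrite oppr0 subrr mulr0.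
pose f (z : R) := expR z - expR (- z) - 2 * z.
have df z : is_derive (z : R^o) (1 : R^o) f (expR z + expR (- z) - 2).
  apply: (is_derive_eq _ _).
  by rewrite mulrN1 opprK /GRing.scale/= mulr1.
have cf : {within `[0, y], continuous f}.
  by apply: derivable_within_continuous => z _; have [] := df z.
have [c _] := MVT y0 (fun z _ => df z) cf.
have -> : f 0 = 0 by rewrite /f oppr0 subrr mulr0 subrr.
rewrite !subr0 => fy; have : 0 <= f y; last by rewrite /f subr_ge0.
rewrite fy mulr_ge0 ?(ltW y0)//.
have : expR c * expR (- c) = 1 by rewrite -expRD subrr expR0.
have : 0 <= (expR c - 1) ^+ 2 * expR (- c) by rewrite mulr_ge0 ?sqr_ge0 ?expR_ge0.
move: (expR c) (expR (- c)) => u v h uv; suff -> : u + v - 2 = (u - 1) ^+ 2 * v by [].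
have -> : (u - 1) ^+ 2 * v = u * (u * v) - 2 * (u * v) + v by ring.
by rewrite uv; ring.
Qed.

(** With z = 2 y, the quantity e^z + e^(-z) - 2 is the square of e^y - e^(-y), and [sinh_ge] bounds
    the latter. *)
Lemma cosh_ge (z : R) : 2 + z ^+ 2 <= expR z + expR (- z).
Proof.
have sinh2 (y : R) : 2 + (2 * y) ^+ 2 - (expR (2 * y) + expR (- (2 * y))) =
    (2 * y) ^+ 2 - (expR y - expR (- y)) ^+ 2.
  rewrite !mulr_natl !mulr2n opprD !expRD.
  have : expR y * expR (- y) = 1 by rewrite -expRD subrr expR0.
  rewrite opprD expRD; move: (expR y) (expR (- y)) => u v uv.
  rewrite (_ : (u - v) ^+ 2 = u * u + v * v - 2 * (u * v)); last by ring.
  by rewrite uv; ring.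
wlog z0 : z / 0 <= z.
  move=> W; have [/W//|/ltW z0] := leP 0 z.
  by have := W (- z); rewrite oppr_ge0 opprK sqrrN addrC => /(_ z0); rewrite addrC (addrC (expR _)).
rewrite -subr_le0 (_ : z = 2 * (z / 2)) ?sinh2; last by field.
have z20 : 0 <= z / 2 by rewrite divr_ge0.
rewrite subr_le0 lerXn2r// ?nnegrE ?mulr_ge0 ?sinh_ge//.
by apply: le_trans (sinh_ge z20); rewrite mulr_ge0.
Qed.

End cosh.

(** * Exponentially weighted moments of linear and quadratic forms *)

Section moments.
Context {R : realType}.
Variables (p : nat) (l : 'I_p -> R).
Hypothesis l01 : forall i, 0 <= l i <= 1.
Local Notation Y := (quad l).
Local Notation P := (\sum_i l i).

Definition lin (a : 'I_p -> R) (v : 'cV[R]_p) : R := \sum_i a i * v i 0.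

Lemma measurable_lin a : measurable_fun setT (lin a).
Proof. by rewrite /lin; meas. Qed.

(** (1 - m)^(- P / 2), the bound of [gaussN_quad_mgf]. *)
Definition mgfQ m : R := expR (- P / 2 * ln (1 - m)).

Lemma measurable_expquad m : measurable_fun setT (fun v : 'cV[R]_p => expR (m * (Y v / 2))).
Proof.
apply: measurableT_comp => //; apply: measurable_funM => //.
by apply: measurable_funM => //; exact: measurable_quad.
Qed.

(** From s^2 z^2 <= e^(s z) + e^(- s z) - 2, whose weighted Gaussian mean is explicit. The choice
    s^2 = (1 - m) / (8 sg^2) keeps the exponent at most 1/16, e^(1/16) - 1 <= 1/15, and 8 * 2/15 =
    16/15. *)
Lemma lin_sqr_mgf a sg m : 0 < sg -> \sum_i a i ^+ 2 <= sg ^+ 2 -> 0 <= m < 1 ->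
  (\int[@gaussN R p]_v (lin a v ^+ 2 * expR (m * (Y v / 2)))%:E <=
   (16 / 15 * sg ^+ 2 / (1 - m) * mgfQ m)%:E)%E.
Proof.
move=> sg0 asg /andP[m0 m1].
have ml i : m * l i < 1.
  by have /andP[l0 l1] := l01 i; rewrite (le_lt_trans _ m1)// ler_piMr.
pose s := Num.sqrt ((1 - m) / (8 * sg ^+ 2)).
have sg2 : 0 < sg ^+ 2 by rewrite exprn_gt0.
have s2 : s ^+ 2 = (1 - m) / (8 * sg ^+ 2).
  by rewrite sqr_sqrtr// divr_ge0 ?mulr_ge0 ?(ltW sg2)//; lra.
have s20 : 0 < s ^+ 2 by rewrite s2 divr_gt0 ?mulr_gt0//; lra.
pose w c v := expR (c * lin a v + m * (Y v / 2)).
have mw c : measurable_fun setT (fun v => (w c v)%:E).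
  apply/measurable_EFinP; apply: measurableT_comp => //; apply: measurable_funD.
    by apply: measurable_funM => //; exact: measurable_lin.
  by apply: measurable_funM => //; apply: measurable_funM => //; exact: measurable_quad.
pose D := \prod_(i < p) (Num.sqrt (1 - m * l i))^-1.
have D0 : 0 <= D by apply: prodr_ge0 => i _; rewrite invr_ge0 sqrtr_ge0.
have wE c : (\int[@gaussN R p]_v (w c v)%:E =
    (D * expR (c ^+ 2 * \sum_i (a i ^+ 2 / (2 * (1 - m * l i)))))%:E)%E.
  rewrite -[in RHS](_ : \sum_i (c * a i) ^+ 2 / (2 * (1 - m * l i)) = c ^+ 2 * _); last first.
    by rewrite mulr_sumr; apply: eq_bigr => i _; rewrite exprMn -mulrA.
  rewrite /D -gaussN_mgf//; apply: eq_integral => v _; congr (expR _)%:E.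
  rewrite /lin /quad mulrA !mulr_sumr mulr_suml -big_split/=; apply: eq_bigr => i _.
  by ring.
have DQ : D <= mgfQ m.
  have := gaussN_quad_mgf l01 (introT andP (conj m0 m1)).
  rewrite (_ : (\int[_]_v _)%E = (\int[@gaussN R p]_v (w 0 v)%:E)%E); last first.
    by apply: eq_integral => v _; rewrite /w mul0r add0r.
  by rewrite wE expr0n/= mul0r expR0 mulr1 lee_fin.
pose V := \sum_i (a i ^+ 2 / (2 * (1 - m * l i))).
have sV : s ^+ 2 * V <= 1 / 16.
  have : V <= sg ^+ 2 / (2 * (1 - m)).
    apply: (@le_trans _ _ (\sum_i (a i ^+ 2 / (2 * (1 - m))))).
      apply: ler_sum => i _; rewrite ler_wpM2l ?sqr_ge0// lef_pV2 ?posrE ?mulr_gt0 ?subr_gt0//.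
      by rewrite ler_pM2l// lerD2l lerN2; have /andP[l0 l1] := l01 i; rewrite ler_piMr.
    by rewrite -mulr_suml ler_wpM2r// invr_ge0 mulr_ge0//; lra.
  move=> hV; apply: le_trans (ler_wpM2l (ltW s20) hV) _.
  rewrite s2 le_eqVlt; apply/orP; left; apply/eqP; field.
  by rewrite !gt_eqF//; lra.
have eV : expR (s ^+ 2 * V) - 1 <= 1 / 15.
  have : expR (s ^+ 2 * V) <= 16 / 15; last by lra.
  have h := expR_ge1Dx (- (s ^+ 2 * V)).
  rewrite -[s ^+ 2 * V]opprK expRN -[leLHS]mul1r ler_pdivrMr ?expR_gt0//; lra.
pose T v := lin a v ^+ 2 * expR (m * (Y v / 2)).
have T0 v : 0 <= T v by rewrite mulr_ge0 ?sqr_ge0 ?expR_ge0.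
have mT : measurable_fun setT (fun v => (T v)%:E).
  apply/measurable_EFinP; apply: measurable_funM; last exact: measurable_expquad.
  by apply: measurable_funX; exact: measurable_lin.
have w0 c v : (0 <= (w c v)%:E)%E by rewrite lee_fin expR_ge0.
have pw v : s ^+ 2 * T v + 2 * w 0 v <= w s v + w (- s) v.
  rewrite /T /w mul0r add0r mulNr !expRD; have := cosh_ge (s * lin a v).
  move: (expR_ge0 (m * (Y v / 2))); move: (expR (m * _)) => e; rewrite exprMn.
  by move: (expR (s * _)) (expR (- _)) (lin a v ^+ 2) => u v' z e0 h; nra.
have key : ((s ^+ 2)%:E * \int[@gaussN R p]_v (T v)%:E + 2%:E * \int[@gaussN R p]_v (w 0 v)%:E <=
    \int[@gaussN R p]_v (w s v)%:E + \int[@gaussN R p]_v (w (- s) v)%:E)%E.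
  rewrite -!ge0_integralZl//; last 2 first.
  - by move=> v _; rewrite lee_fin.
  - by rewrite lee_fin ltW.
  rewrite -!ge0_integralD//; try exact: measurable_funeM;
    try (by move=> v _; rewrite mule_ge0// lee_fin ?T0 ?(ltW s20)).
  apply: (@le_trans _ _ (\int[@gaussN R p]_v ((w s v)%:E + (w (- s) v)%:E))%E); last by [].
  apply: le_integralT.
  - by apply: emeasurable_funD; exact: measurable_funeM.
  - exact: emeasurable_funD.
  - by move=> v; rewrite adde_ge0// mule_ge0// lee_fin ?T0 ?(ltW s20).
  by move=> v; exact: pw.
have If : (\int[@gaussN R p]_v (T v)%:E)%E \is a fin_num.
  rewrite ge0_fin_numE; last by apply: integral_ge0 => v _; rewrite lee_fin.
  have : ((s ^+ 2)%:E * \int[@gaussN R p]_v (T v)%:E < +oo)%E.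
    apply: (@le_lt_trans _ _ (\int[@gaussN R p]_v (w s v)%:E + \int[@gaussN R p]_v (w (- s) v)%:E)%E).
      apply: le_trans key; rewrite leeDl// mule_ge0// integral_ge0//.
    by rewrite !wE -EFinD ltry.
  have : (0 <= \int[@gaussN R p]_v (T v)%:E)%E by apply: integral_ge0 => v _; rewrite lee_fin.
  case: (\int[_]_v _)%E => //=; first by move=> ? _ _; rewrite ltry.
  by rewrite gt0_muley ?lte_fin.
move: key; rewrite !wE sqrrN expr0n/= mul0r expR0 mulr1 -/(T _) -(fineK If) -!EFinM -!EFinD !lee_fin -/V.
set I := fine _ => key.
have I2 : s ^+ 2 * I <= 2 / 15 * mgfQ m by nra.
have -> : 16 / 15 * sg ^+ 2 / (1 - m) * mgfQ m = 2 / 15 * mgfQ m / s ^+ 2.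
  by rewrite s2; field; rewrite !gt_eqF//; lra.
by rewrite ler_pdivlMr// mulrC.
Qed.

(** |z| <= z^2 / (2 c) + c / 2 with c = sg / sqrt (1 - m), which balances the two terms; 31/30 is
    the average of 16/15 and 1. *)
Lemma lin_abs_mgf a sg m : 0 < sg -> \sum_i a i ^+ 2 <= sg ^+ 2 -> 0 <= m < 1 ->
  (\int[@gaussN R p]_v (`|lin a v| * expR (m * (Y v / 2)))%:E <=
   (31 / 30 * sg / Num.sqrt (1 - m) * mgfQ m)%:E)%E.
Proof.
move=> sg0 asg m01; have /andP[m0 m1] := m01.
have t0 : 0 < Num.sqrt (1 - m) by rewrite sqrtr_gt0; lra.
have t2 : Num.sqrt (1 - m) ^+ 2 = 1 - m by rewrite sqr_sqrtr//; lra.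
set t := Num.sqrt (1 - m) in t0 t2 *.
pose c := sg / t; have c0 : 0 < c by rewrite divr_gt0.
have mT : measurable_fun setT (fun v => (lin a v ^+ 2 * expR (m * (Y v / 2)))%:E).
  apply/measurable_EFinP; apply: measurable_funM; last exact: measurable_expquad.
  by apply: measurable_funX; exact: measurable_lin.
have mE : measurable_fun setT (fun v => (expR (m * (Y v / 2)))%:E).
  by apply/measurable_EFinP; exact: measurable_expquad.
apply: (@le_trans _ _ (\int[@gaussN R p]_v ((c^-1 / 2)%:E * (lin a v ^+ 2 * expR (m * (Y v / 2)))%:E +
    (c / 2)%:E * (expR (m * (Y v / 2)))%:E))%E).
  apply: le_integralT.
  - apply/measurable_EFinP; apply: measurable_funM; last exact: measurable_expquad.
    by apply: measurableT_comp => //; exact: measurable_lin.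
  - by apply: emeasurable_funD; exact: measurable_funeM.
  - by move=> v; rewrite lee_fin mulr_ge0 ?expR_ge0.
  move=> v; rewrite -!EFinM -EFinD lee_fin [X in _ <= X + _]mulrA -mulrDl ler_wpM2r ?expR_ge0//.
  rewrite -(@real_normK _ (lin a v)) ?num_real//; set z := `|_|.
  rewrite -subr_ge0 (_ : _ - _ = (z - c) ^+ 2 * (c^-1 / 2)).
    by rewrite mulr_ge0 ?sqr_ge0// divr_ge0// invr_ge0 ltW.
  by field; rewrite gt_eqF.
have ci : 0 <= c^-1 / 2 by rewrite divr_ge0// invr_ge0 ltW.
have c2 : 0 <= c / 2 by rewrite divr_ge0// ltW.
rewrite ge0_integralD//; first last.
- exact: measurable_funeM.
- by move=> v _; rewrite -EFinM lee_fin mulr_ge0 ?expR_ge0.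
- exact: measurable_funeM.
- by move=> v _; rewrite -EFinM lee_fin mulr_ge0// mulr_ge0 ?expR_ge0 ?sqr_ge0.
rewrite !ge0_integralZl//; last by move=> v _; rewrite lee_fin mulr_ge0 ?sqr_ge0 ?expR_ge0.
apply: le_trans (leeD (lee_wpmul2l _ (lin_sqr_mgf sg0 asg m01)) (lee_wpmul2l _ (gaussN_quad_mgf l01 m01))) _.
- by rewrite lee_fin.
- by rewrite lee_fin.
rewrite -!EFinM -EFinD lee_fin -/(mgfQ m) -t2 /c le_eqVlt; apply/orP; left; apply/eqP.
by field; rewrite !gt_eqF.
Qed.

(** y^3 e^(- s y) is largest at y = 3 / s, so the cube is traded for a larger exponential weight, 2
    s + w instead of w. *)
Lemma quad_pow3_mgf s w : 0 < s -> 0 <= 2 * s + w < 1 ->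
  (\int[@gaussN R p]_v (Y v ^+ 3 * expR (w * (Y v / 2)))%:E <=
   ((3 / s) ^+ 3 * expR (- 3) * mgfQ (2 * s + w))%:E)%E.
Proof.
move=> s0 m01.
apply: (@le_trans _ _ (\int[@gaussN R p]_v (((3 / s) ^+ 3 * expR (- 3))%:E * (expR ((2 * s + w) * (Y v / 2)))%:E))%E).
  apply: le_integralT.
  - apply/measurable_EFinP; apply: measurable_funM; last exact: measurable_expquad.
    by apply: measurable_funX; exact: measurable_quad.
  - by apply: measurable_funeM; apply/measurable_EFinP; exact: measurable_expquad.
  - by move=> v; rewrite lee_fin mulr_ge0 ?expR_ge0 ?exprn_ge0// quad_ge0// => i; have /andP[] := l01 i.
  move=> v; rewrite -EFinM lee_fin.
  have Y0 : 0 <= Y v by apply: quad_ge0 => i; have /andP[] := l01 i.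
  have -> : (2 * s + w) * (Y v / 2) = 3%:R * (s * Y v / 3) + w * (Y v / 2) by field.
  rewrite expRD [leRHS]mulrA ler_wpM2r ?expR_ge0//.
  have -> : expR (- 3) = expR (- 1) ^+ 3 :> R by rewrite -expRM_natl; congr expR; ring.
  rewrite expRM_natl -!exprMn lerXn2r ?nnegrE//; first by rewrite mulr_ge0 ?expR_ge0// mulr_ge0 ?expR_ge0// divr_ge0// ltW.
  have := expR_ge1Dx (s * Y v / 3 - 1); rewrite addrCA subrr addr0 addrC expRD => h.
  rewrite -mulrA (le_trans _ (ler_wpM2l _ h))//; last by rewrite divr_ge0// ltW.
  by rewrite le_eqVlt; apply/orP; left; apply/eqP; field; rewrite gt_eqF.
have c0 : 0 <= (3 / s) ^+ 3 * expR (- 3) by rewrite mulr_ge0 ?expR_ge0// exprn_ge0// divr_ge0// ltW.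
rewrite ge0_integralZl//; last by apply/measurable_EFinP; exact: measurable_expquad.
by apply: le_trans (lee_wpmul2l _ (gaussN_quad_mgf l01 m01)) _ => //; rewrite -EFinM.
Qed.

(** Each second moment of a coordinate is the case m = 0 of [lin_sqr_mgf], which is the origin of
    the factor 16/15. *)
Lemma quad_mean : (\int[@gaussN R p]_v (Y v)%:E <= (16 / 15 * P)%:E)%E.
Proof.
have e1 i : (\int[@gaussN R p]_v (v i 0 ^+ 2)%:E <= (16 / 15)%:E)%E.
  have := @lin_sqr_mgf (fun j => (j == i)%:R) 1 0 ltr01.
  rewrite (bigD1 i)//= eqxx big1 ?addr0; last by move=> j /negbTE ->; rewrite expr0n.
  rewrite expr1n => /(_ (lexx _)); rewrite lexx ltr01 => /(_ isT); rewrite subr0 /mgfQ subr0 ln1 mulr0 expR0 divr1 !mulr1.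
  apply: le_trans; rewrite le_eqVlt; apply/orP; left; apply/eqP; apply: eq_integral => v _.
  rewrite mul0r expR0 mulr1 /lin (bigD1 i)//= eqxx mul1r big1 ?addr0// => j /negbTE ->.
  by rewrite mul0r.
have mi i : measurable_fun setT (fun v : 'cV[R]_p => (v i 0 ^+ 2)%:E) by meas.
have l0 i : 0 <= l i by have /andP[] := l01 i.
have -> : (\int[@gaussN R p]_v (Y v)%:E = \int[@gaussN R p]_v (\sum_(i < p) ((l i)%:E * (v i 0 ^+ 2)%:E)))%E.
  by apply: eq_integral => v _; rewrite -sumEFin; apply: eq_bigr => i _; rewrite EFinM.
rewrite ge0_integral_sum//; last 2 first.
- by move=> i; exact: measurable_funeM.
- by move=> i v _; rewrite -EFinM lee_fin mulr_ge0// sqr_ge0.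
rewrite mulr_sumr -sumEFin; apply: lee_sum => i _.
rewrite ge0_integralZl//; last 2 first.
- by move=> v _; rewrite lee_fin sqr_ge0.
- by rewrite lee_fin.
by rewrite [(_ * l i)%R]mulrC EFinM lee_wpmul2l// lee_fin.
Qed.

End moments.

(** * Scalar inequalities for the mean bound *)

Section mean_scalars.
Context {R : realType}.
Implicit Types (P w x s u : R).

(** c + 1/c is increasing for c >= 1, and [cosh_ge] bounds e^z + e^(-z) from below; this gives sharp
    rational lower bounds for e^z at small z. *)
Lemma expR_ge_cosh (z c : R) : 0 <= z -> 1 <= c -> c + c^-1 <= 2 + z ^+ 2 -> c <= expR z.
Proof.
move=> z0 c1 h; have v1 : 1 <= expR z by rewrite expR_ge1.
have := cosh_ge z; rewrite expRN => hz; set v := expR z in v1 hz *.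
rewrite leNgt; apply/negP => vc.
have c0 : 0 < c by lra.
have v0 : 0 < v by lra.
have : c + c^-1 <= v + v^-1 by lra.
apply/negP; rewrite -ltNge -subr_gt0.
have -> : c + c^-1 - (v + v^-1) = (c - v) * (c * v - 1) / (c * v) by field; rewrite !gt_eqF.
by rewrite divr_gt0 ?mulr_gt0 ?subr_gt0//; nra.
Qed.

(** The 19th power of e^(1/10) >= 221/200. The right side is what [mgfQ_cubic] requires: 65/2 is its
    constant and 6^3 the product of its powers of 3 and 2. *)
Lemma expRN19 : expR (- (19 / 10)) <= 65 / 2 / 6 ^+ 3 :> R.
Proof.
have [c [cE c0]] : exists c : R, c = 221 / 200 /\ 0 <= c by exists (221 / 200); split; lra.
have h : c <= expR (1 / 10) by apply: expR_ge_cosh; [lra|lra|rewrite cE; lra].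
rewrite expRN (_ : 19 / 10 = 19%:R * (1 / 10)); last by lra.
rewrite expRM_natl -[leLHS]mul1r ler_pdivrMr ?exprn_gt0 ?expR_gt0//.
have h19 : c ^+ 19 <= expR (1 / 10) ^+ 19 by rewrite lerXn2r ?nnegrE ?expR_ge0.
apply: le_trans (ler_wpM2l _ h19); last by lra.
by rewrite cE; lra.
Qed.

(** This bounds the mean of Y^3 e^(w Y / 2), with s = 1 / (P + 3) in [quad_pow3_mgf]. With u = P /
    (P + 1) >= 1/2 the exponentials combine to e^(- 3/2 - 4 u / 5), at most e^(- 19/10). *)
Lemma mgfQ_cubic P w : 1 <= P -> 0 <= w <= 1 / 4 -> w * P <= 2 / 3 ->
  (3 / (P + 3)^-1) ^+ 3 * expR (- 3) * expR (- P / 2 * ln (1 - (2 * (P + 3)^-1 + w))) <=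
  65 / 2 * (P + 1) ^+ 3.
Proof.
move=> P1 /andP[w0 w1] wP.
have P3 : 0 < P + 3 by lra.
have Pp : 0 < P + 1 by lra.
pose d := P + 1 - w * (P + 3).
have d0 : 0 < d by rewrite /d; nra.
have -> : 1 - (2 * (P + 3)^-1 + w) = d / (P + 3) by rewrite /d; field; rewrite gt_eqF.
have lnd : - ln (d / (P + 3)) <= 2 / (P + 1) + w * (P + 3) / d.
  rewrite -lnV ?posrE ?divr_gt0// invf_div.
  have -> : (P + 3) / d = (1 + 2 / (P + 1)) * (1 + w * (P + 3) / d).
    have wE : w * (P + 3) = P + 1 - d by rewrite /d; ring.
    by rewrite wE; field; rewrite !gt_eqF.
  have a0 : 0 <= 2 / (P + 1) by rewrite divr_ge0// ltW.
  have b0 : 0 <= w * (P + 3) / d by rewrite divr_ge0 ?mulr_ge0 ?(ltW P3) ?(ltW d0).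
  rewrite lnM ?posrE ?ltr_pwDl// lerD// le_ln1Dx//; lra.
have bd : w * (P + 3) / d <= 12 / 5 / (P + 1).
  rewrite ler_pdivrMr// mulrAC ler_pdivlMr// /d.
  have [P8|P8] := leP P (8 / 3); first by nra.
  have : w * P * (P + 3) * (P + 17 / 5) <= 2 / 3 * ((P + 3) * (P + 17 / 5)).
    by rewrite -mulrA ler_wpM2r// mulr_ge0//; lra.
  have : 2 / 3 * ((P + 3) * (P + 17 / 5)) <= 12 / 5 * (P * (P + 1)) by nra.
  move=> h1 h2; have {h1}h : P * (w * ((P + 3) * (P + 17 / 5))) <= P * (12 / 5 * (P + 1)) by lra.
  rewrite ler_pM2l in h; last by lra.
  by move: h; lra.
pose u := P / (P + 1).
have u1 : 1 / 2 <= u by rewrite ler_pdivlMr//; lra.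
have hP : P / 2 * (2 / (P + 1) + 12 / 5 / (P + 1)) = 11 / 5 * u.
  by rewrite /u; field; rewrite gt_eqF.
have ex : - P / 2 * ln (d / (P + 3)) <= 11 / 5 * u.
  rewrite mulNr mulNr -mulrN -hP ler_wpM2l//; lra.
have h3 : P + 3 <= 2 * (P + 1) * expR (1 / 2 - u).
  have -> : P + 3 = 2 * (P + 1) * (1 + (1 / 2 - u)).
    by rewrite /u; field; rewrite gt_eqF.
  by rewrite ler_wpM2l ?expR_ge1Dx// mulr_ge0// ltW.
rewrite invrK exprMn.
have h33 : (P + 3) ^+ 3 <= 8 * (P + 1) ^+ 3 * expR (3 / 2 - 3 * u).
  have -> : 8 * (P + 1) ^+ 3 * expR (3 / 2 - 3 * u) = (2 * (P + 1) * expR (1 / 2 - u)) ^+ 3.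
    rewrite !exprMn -expRM_natl; congr (_ * _ * expR _); ring.
  by rewrite lerXn2r// ?nnegrE ?mulr_ge0 ?expR_ge0// ltW.
apply: (@le_trans _ _ (3 ^+ 3 * (8 * (P + 1) ^+ 3 * expR (3 / 2 - 3 * u)) * expR (- 3) * expR (11 / 5 * u))).
  rewrite ler_pM ?ler_expR ?mulr_ge0 ?expR_ge0 ?exprn_ge0 ?(ltW P3)//.
  by rewrite ler_wpM2r ?expR_ge0// ler_wpM2l// exprn_ge0.
have -> : 3 ^+ 3 * (8 * (P + 1) ^+ 3 * expR (3 / 2 - 3 * u)) * expR (- 3) * expR (11 / 5 * u) =
    6 ^+ 3 * (P + 1) ^+ 3 * (expR (3 / 2 - 3 * u) * expR (- 3) * expR (11 / 5 * u)) by ring.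
rewrite -!expRD.
apply: (@le_trans _ _ (6 ^+ 3 * (P + 1) ^+ 3 * (65 / 2 / 6 ^+ 3))).
  rewrite ler_wpM2l ?mulr_ge0 ?exprn_ge0 ?(ltW Pp)//; apply: le_trans expRN19.
  by rewrite ler_expR; lra.
by rewrite le_eqVlt; apply/orP; left; apply/eqP; field.
Qed.

Lemma mgfQ_quadratic P w : 0 <= P -> 0 <= w <= 1 / 4 -> w * P <= 2 / 3 ->
  16 / 15 / (1 - w) * expR (- P / 2 * ln (1 - w)) <= 56 / 25.
Proof.
move=> P0 /andP[w0 w1] wP.
have d0 : 0 < 1 - w by lra.
have lnw : - ln (1 - w) <= 4 / 3 * w.
  rewrite -lnV ?posrE// (_ : (1 - w)^-1 = 1 + w / (1 - w)); last by field; rewrite gt_eqF.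
  have h : w / (1 - w) <= 4 / 3 * w by rewrite ler_pdivrMr//; nra.
  by apply: le_trans h; apply: le_ln1Dx; apply: (@lt_le_trans _ _ 0); [lra|rewrite divr_ge0// ltW].
have ex : expR (- P / 2 * ln (1 - w)) <= 63 / 40.
  apply: (@le_trans _ _ (expR (4 / 9))).
    by rewrite ler_expR mulNr mulNr -mulrN; nra.
  by apply: (@expR_le_num R 19); lra.
have iv : 16 / 15 / (1 - w) <= 64 / 45 by rewrite ler_pdivrMr//; lra.
apply: le_trans (ler_pM _ _ iv ex) _; rewrite ?expR_ge0 ?divr_ge0 ?(ltW d0)//; lra.
Qed.

(** Counterpart of [radius_exponent] when a linear form is integrated: the linear form adds 1 to the
    factor s^2 of the logarithm, and psi at the boundary is bounded by w r^2 / 2. *)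
Lemma radius_mean_exponent s u w : 1 <= s -> 0 <= u -> 0 <= w <= 1 / 4 ->
  s ^+ 2 / 2 - (2 * s + u) ^+ 2 / 2 + (s ^+ 2 + 1) * ln ((2 * s + u) / s) +
    w * ((2 * s + u) ^+ 2 / 2) <= 71 / 100 - u ^+ 2 / 2 + w * (u ^+ 2 / 2).
Proof.
move=> s1 u0 /andP[w0 w1]; have s0 : 0 < s by lra.
have H : (s ^+ 2 + 1) * ln ((2 * s + u) / s) <= (s ^+ 2 + 1) * (71 / 100 + u / (2 * s)).
  by rewrite ler_wpM2l ?ln_2D// addr_ge0// sqr_ge0.
have us : u / (2 * s) <= s * u / 2.
  have ss : 1 <= s * s by nra.
  rewrite ler_pdivrMr ?mulr_gt0//.
  have : u <= s * s * u by rewrite ler_peMl.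
  lra.
have E : s ^+ 2 * (u / (2 * s)) = s * u / 2 by field; rewrite gt_eqF.
have su : 0 <= s * u by rewrite mulr_ge0// ltW.
have hw : w * (2 * s ^+ 2 + 2 * (s * u)) <= 1 / 4 * (2 * s ^+ 2 + 2 * (s * u)).
  by rewrite ler_wpM2r//; have := sqr_ge0 s; lra.
have s2 : 1 <= s ^+ 2 by rewrite exprn_ege1.
have e2 : (2 * s + u) ^+ 2 = 4 * s ^+ 2 + 4 * (s * u) + u ^+ 2 by ring.
rewrite e2; lra.
Qed.

Lemma expR_sub1_le (y : R) : `|expR y - 1| <= `|y| * expR `|y|.
Proof.
have [y0|y0] := leP 0 y.
  rewrite (ger0_norm y0) ger0_norm ?subr_ge0 ?expR_ge1//.
  have := expR_ge1Dx (- y); have : expR y * expR (- y) = 1 by rewrite -expRD subrr expR0.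
  by have := expR_gt0 y; nra.
rewrite (ltr0_norm y0) ler0_norm; last by rewrite subr_le0 expR_le1 ltW.
have := expR_ge1Dx y; have : 1 <= expR (- y) by rewrite expR_ge1 oppr_ge0 ltW.
nra.
Qed.

End mean_scalars.

Section gaussN_odd.
Context {R : realType}.

(** The positive and negative parts have equal integrals by the symmetry v -> - v. If both are
    infinite, the real-valued integral is 0 by the convention that [fine] sends infinities to 0. *)
Lemma gaussN_odd p (F : 'cV[R]_p -> R) : measurable_fun setT F ->
  (forall v, F (- v) = - F v) -> \int[@gaussN R p]_v F v = 0.
Proof.
move=> mF Fodd.
have mFp : measurable_fun setT ((EFin \o F)^\+)%E.
  by apply: measurable_funepos; exact/measurable_EFinP.
have H : (\int[@gaussN R p]_v ((EFin \o F)^\- v) = \int[@gaussN R p]_v ((EFin \o F)^\+ v))%E.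
  rewrite -[RHS](@gaussN_orthogonal R p (- 1%:M))//.
    apply: eq_integral => v _; rewrite mulNmx mul1mx funeposE funenegE/=.
    by rewrite Fodd EFinN.
  by rewrite (_ : (- 1%:M)^T = - 1%:M) ?mulNmx ?mul1mx ?opprK// linearN/= tr_scalar_mx.
have E : (\int[@gaussN R p]_v (F v)%:E =
    \int[@gaussN R p]_v ((EFin \o F)^\+ v) - \int[@gaussN R p]_v ((EFin \o F)^\- v))%E.
  exact: integralE.
by rewrite /Rintegral E H; case: (\int[_]_v _)%E => //= r; rewrite subrr.
Qed.

End gaussN_odd.

(** * Absolute constants of the mean bound *)

Section mean_constants.
Context {R : realType}.

(** [absorbC] is the total weight of the shells, a geometric series of ratio e^(-1/8), in front of
    e^(- x + w x). [absorbK] separates the two last cases of [absorb]. In [meanC], 6 exceeds 100/17,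
    the inverse of the least partition function met in [mean_ratio], and e^(7/2) serves its case of
    bounded x and P. *)
Definition absorbC : R := 3 * expR 1 / (1 - expR (- (1 / 8))).

Definition absorbK : R := 10 * (10 * 10).

Definition meanC : R := 6 * (7 * expR (7 / 2) + absorbC * (expR 1 + absorbK * absorbC)).

Lemma absorbC_gt0 : 0 < absorbC.
Proof. by rewrite divr_gt0 ?mulr_gt0 ?expR_gt0// subr_gt0 expR_lt1 oppr_lt0; lra. Qed.

Lemma meanC_ge0 : 0 <= meanC.
Proof.
have K0 : 0 <= absorbK by rewrite /absorbK; lra.
rewrite /meanC; move: absorbK K0 (absorbC) absorbC_gt0 => K K0 C C0.
have h1 : 0 <= C * expR 1 by rewrite mulr_ge0 ?expR_ge0// ltW.
have h2 : 0 <= C * (K * C) by rewrite !mulr_ge0// ltW.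
have := expR_ge0 (7 / 2 : R); lra.
Qed.

(** The shells give e^(- x + w x) instead of e^-x. If w x <= 1 this costs a factor e. Otherwise kap
    r x / 3 >= w x > 1 bounds kap from below, while e^(- x + w x) <= e^(- 3 x / 4): the term is
    either far below kap q^3, or e^(- x / 2) exceeds 1 / ([absorbK] [absorbC]) and a constant
    multiple of e^-x suffices. *)
Lemma absorb (P u r x kap w q : R) : 1 <= P -> 0 < x -> 0 <= u -> u ^+ 2 = 2 * x ->
  r = 2 * Num.sqrt P + u -> 1 <= q -> q = Num.sqrt (P + 1) -> q ^+ 2 = P + 1 -> 0 <= kap ->
  0 <= w <= 1 / 4 -> w <= kap * r / 3 ->
  absorbC * expR (- x + w * x) <=
  1 / 40 * (kap * q ^+ 3) + absorbC * (expR 1 + absorbK * absorbC) * expR (- x).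
Proof.
move=> P1 x0 u0 ux rsu q1 qE q2 kap0 /andP[w0 w1] wk; have C0 : 0 < absorbC :> R := absorbC_gt0.
have [K [KE K0 KV]] : exists K : R, [/\ absorbK = K, 0 < K & K^-1 = 1 / 10 / 10 / 10].
  by exists absorbK; split=> //; rewrite /absorbK; lra.
rewrite KE; set C := absorbC in C0 *; have E0 : 0 < expR (- x) by exact: expR_gt0.
have kq0 : 0 <= kap * q ^+ 3 by rewrite mulr_ge0// exprn_ge0// (le_trans ler01).
have e10 : 0 < expR 1 :> R by exact: expR_gt0.
have [wx|wx] := leP (w * x) 1.
  have h : expR (- x + w * x) <= expR 1 * expR (- x) by rewrite -expRD ler_expR; lra.
  apply: (@le_trans _ _ (C * (expR 1 * expR (- x)))); first by rewrite ler_pM2l.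
  rewrite mulrA; apply: le_trans (_ : C * (expR 1 + K * C) * expR (- x) <= _); last by lra.
  by rewrite ler_wpM2r ?(ltW E0)// ler_pM2l// lerDl mulr_ge0 ?(ltW C0) ?(ltW K0).
have wx4 : w * x <= x / 4 by nra.
have h1 : C * expR (- x + w * x) <= C * (expR (- (x / 2)) * expR (- (x / 4))).
  by rewrite ler_pM2l// -expRD ler_expR; lra.
apply: (le_trans h1).
have [big|small] := leP (expR (- (x / 2))) (K^-1 / C).
  apply: (@le_trans _ _ (K^-1 * expR (- (x / 4)))).
    rewrite mulrA ler_wpM2r ?expR_ge0// mulrC -ler_pdivlMr//.
  have e4 : x * (3 + x) / 64 <= expR (x / 4).
    have -> : x / 4 = 2%:R * (x / 8) by lra.
    rewrite expRM_natl; have := expR_ge1Dx (x / 8); have := expR_ge0 (x / 8); rewrite expr2; nra.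
  have q0 : 0 < q by lra.
  have sq : Num.sqrt P <= q by rewrite qE ler_wsqrtr// lerDl.
  have u1x : u <= 1 + x.
    by rewrite -(@ler_pXn2r _ 2)// ?nnegrE ?addr_ge0 ?(ltW x0)// ux; nra.
  have rq : r <= q * (3 + x) by rewrite rsu; nra.
  have k3 : 3 <= kap * q * (x * (3 + x)).
    have : kap * r * x <= kap * (q * (3 + x)) * x.
      by rewrite ler_wpM2r ?(ltW x0)// ler_wpM2l.
    have : w * x <= kap * r / 3 * x by rewrite ler_wpM2r// ltW.
    lra.
  have kq : kap * q <= kap * q ^+ 3.
    by rewrite ler_wpM2l// exprS q2 ler_peMr ?(ltW q0)// lerDr; lra.
  have k0 : 0 <= kap * q by rewrite mulr_ge0// ltW.
  have h3 : 3 <= kap * q * (64 * expR (x / 4)).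
    by apply: (le_trans k3); rewrite ler_wpM2l//; lra.
  have h4 : 3 * expR (- (x / 4)) <= 64 * (kap * q).
    have : 3 * expR (- (x / 4)) <= kap * q * (64 * expR (x / 4)) * expR (- (x / 4)).
      by rewrite ler_wpM2r ?expR_ge0.
    have : expR (x / 4) * expR (- (x / 4)) = 1 by rewrite -expRD subrr expR0.
    move=> e1; have -> : kap * q * (64 * expR (x / 4)) * expR (- (x / 4)) =
      64 * (kap * q) * (expR (x / 4) * expR (- (x / 4))) by ring.
    by rewrite e1 mulr1.
  have : 0 <= C * (expR 1 + K * C) * expR (- x).
    by rewrite !mulr_ge0 ?(ltW C0) ?(ltW E0)// addr_ge0 ?(ltW e10)// mulr_ge0 ?(ltW C0) ?(ltW K0).
  rewrite KV; lra.
have sm : 1 <= K * C * expR (- (x / 2)).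
  move: small; rewrite ltr_pdivrMr// => /ltW small.
  by have := ler_wpM2l (ltW K0) small; rewrite mulfV ?gt_eqF//; lra.
have h2 : C * (expR (- (x / 2)) * expR (- (x / 4))) <= C * (K * C) * expR (- x).
  rewrite -mulrA ler_pM2l//.
  apply: (@le_trans _ _ (expR (- (x / 2)))).
    by rewrite ler_piMr ?expR_ge0// expR_le1; lra.
  have -> : expR (- x) = expR (- (x / 2)) * expR (- (x / 2)) by rewrite -expRD; congr expR; field.
  by rewrite mulrA ler_peMl ?expR_ge0.
apply: (le_trans h2).
have : 0 <= C * expR 1 * expR (- x) by rewrite !mulr_ge0 ?(ltW C0) ?(ltW E0) ?(ltW e10).
lra.
Qed.

Lemma expRN_7_2 : expR (- (7 / 2)) <= 41 / 100 / 10 :> R.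
Proof. by apply: (@expRN_le_num R 19); lra. Qed.

Lemma expRN_79_100 : expR (- (79 / 100)) <= 47 / 100 :> R.
Proof. by apply: (@expRN_le_num R 19); lra. Qed.

(** If x + 79/100 P >= 7/2, then Z >= 0.6034 and 12/5 Z exceeds 1.423 + 1/40, with almost no room.
    Otherwise x and P are bounded, so kap q^3 is bounded and e^-x e^(7/2) >= 1: the second constant
    absorbs the first term, since Z >= 17/100. *)
Lemma mean_ratio (P r x kap w q Z : R) : 1 <= P -> 0 < x -> 2 <= r -> 1 <= q -> q ^+ 2 = P + 1 ->
  0 <= kap -> w * P <= 2 / 3 -> kap * r <= 3 / 4 ->
  1 - 8 / 15 * (w * P) - expR (- (x + 79 / 100 * P)) <= Z ->
  absorbC * expR (- x + w * x) <=
    1 / 40 * (kap * q ^+ 3) + absorbC * (expR 1 + absorbK * absorbC) * expR (- x) ->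
  (14 + 23 / 100) / 10 * kap * q ^+ 3 + absorbC * expR (- x + w * x) <=
  (12 / 5 * kap * q ^+ 3 + meanC * expR (- x)) * Z.
Proof.
move=> P1 x0 r2 q1 q2 kap0 wP kr hZ.
rewrite /meanC; set C4 := absorbC * (_ + _) => hab.
have C40 : 0 <= C4.
  rewrite /C4 mulr_ge0 ?(ltW absorbC_gt0)// addr_ge0 ?expR_ge0// mulr_ge0 ?(ltW absorbC_gt0)//.
  by rewrite /absorbK; lra.
have E0 := expR_gt0 (- x).
have k0 : 0 <= kap * q ^+ 3 by rewrite mulr_ge0// exprn_ge0// (le_trans ler01).
have e72 := expR_gt0 (7 / 2 : R).
move: (absorbC * expR _) hab; clearbody C4 => c hab.
have [A|B] := leP (7 / 2) (x + 79 / 100 * P).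
  have h41 : expR (- (x + 79 / 100 * P)) <= 41 / 100 / 10.
    by apply: le_trans expRN_7_2; rewrite ler_expR lerN2.
  have [z zE] : exists z : R, z = (60 + 34 / 100) / 100 by exists ((60 + 34 / 100) / 100).
  have Z6 : z <= Z by rewrite zE; lra.
  have h1 : z * (kap * q ^+ 3) <= Z * (kap * q ^+ 3) by rewrite ler_wpM2r.
  have h2 : z * (expR (- x) * (7 * expR (7 / 2) + C4)) <=
      Z * (expR (- x) * (7 * expR (7 / 2) + C4)).
    by rewrite ler_wpM2r// mulr_ge0 ?(ltW E0)// addr_ge0// mulr_ge0// ltW.
  have h3 : 0 <= expR (- x) * expR (7 / 2) by rewrite mulr_ge0 ?ltW.
  have h4 : 0 <= expR (- x) * C4 by rewrite mulr_ge0// ltW.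
  rewrite zE in h1 h2; lra.
have h46 : expR (- (x + 79 / 100 * P)) <= 47 / 100.
  by apply: le_trans expRN_79_100; rewrite ler_expR; lra.
have Z2 : 17 / 100 <= Z by lra.
have kap38 : kap <= 3 / 8 by nra.
have q24 : q <= 12 / 5.
  have : q ^+ 2 <= 544 / 100 by lra.
  rewrite expr2; nra.
have k5 : kap * q ^+ 3 <= 52 / 10.
  have : q ^+ 3 <= (12 / 5) ^+ 3 by rewrite lerXn2r ?nnegrE//; lra.
  nra.
have h1 : 1 <= expR (- x) * expR (7 / 2) by rewrite -expRD expR_ge1; lra.
have h2 : 17 / 100 * (expR (- x) * (7 * expR (7 / 2) + C4)) <=
    Z * (expR (- x) * (7 * expR (7 / 2) + C4)).
  by rewrite ler_wpM2r// mulr_ge0 ?(ltW E0)// addr_ge0// mulr_ge0// ltW.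
have h3 : 17 / 100 * (kap * q ^+ 3) <= Z * (kap * q ^+ 3) by rewrite ler_wpM2r.
have h4 : 0 <= expR (- x) * C4 by rewrite mulr_ge0// ltW.
lra.
Qed.

End mean_constants.

(** * Mean of a linear form under the reweighted law, effective dimension at least 1 *)

Section mean.
Context {R : realType} (p : nat) (l : 'I_p -> R).
Hypothesis l01 : forall i, 0 <= l i <= 1.
Local Notation Y := (quad l).
Local Notation P := (\sum_i l i).
Variables (r x kap w sg : R) (psi : 'cV[R]_p -> R) (a : 'I_p -> R).
Hypothesis P1 : 1 <= P.
Hypothesis x0 : 0 < x.
Hypothesis rE : r = 2 * Num.sqrt P + Num.sqrt (2 * x).
Hypothesis mpsi : measurable_fun setT psi.
Hypothesis kap0 : 0 <= kap.
Hypothesis w14 : 0 <= w <= 1 / 4.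
Hypothesis wP : w * P <= 2 / 3.
Hypothesis psi3 : forall v, Y v <= r ^+ 2 -> `|psi v| <= kap / 6 * (Y v * Num.sqrt (Y v)).
Hypothesis psiw : forall v, Y v <= r ^+ 2 -> `|psi v| <= w * (Y v / 2).
Hypothesis psi_out : forall v t, t ^+ 2 = Y v -> r < t ->
  psi v <= (t ^+ 2 - r ^+ 2) / 2 - 5 / 8 * (r * (t - r)) + w * (r ^+ 2 / 2).
Hypothesis sg0 : 0 < sg.
Hypothesis asg : \sum_i a i ^+ 2 <= sg ^+ 2.

Let s := Num.sqrt P.
Let u := Num.sqrt (2 * x).
Let P0 : 0 < P. Proof. by have := P1; lra. Qed.
Let s1 : 1 <= s. Proof. by rewrite -[1]sqrtr1 ler_wsqrtr. Qed.
Let s0 : 0 < s. Proof. by have := s1; lra. Qed.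
Let sP : s ^+ 2 = P. Proof. by rewrite sqr_sqrtr// ltW. Qed.
Let u0 : 0 <= u. Proof. exact: sqrtr_ge0. Qed.
Let ux : u ^+ 2 = 2 * x. Proof. by rewrite sqr_sqrtr// mulr_ge0// ltW. Qed.
Let rsu : r = 2 * s + u. Proof. exact: rE. Qed.
Let r2 : 2 <= r. Proof. by have := s1; have := u0; rewrite rsu; lra. Qed.
Let r0 : 0 < r. Proof. by have := r2; lra. Qed.
Let r2P : 4 * P <= r ^+ 2.
Proof. by rewrite -sP rsu; have := s1; have := u0; rewrite !expr2; nra. Qed.

(** As [shellt], [shellm] and [shellF], now carrying |lin a v|. The value of psi at the radial
    projection is replaced by its bound w r^2 / 2 in [mshellc], and the factor 2 in [mshell]
    accounts for the 1 in |e^psi - 1|. *)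
Definition mshellt (j : nat) := r + j%:R / r.
Definition mshellm j := 1 - P / mshellt j ^+ 2.
Definition mshellc j := (P / mshellt j ^+ 2 * mshellt j.+1 ^+ 2 - r ^+ 2) / 2 -
  5 / 8 * j%:R + w * (r ^+ 2 / 2).
Definition mshell j v := 2 * expR (mshellc j) * (`|lin a v| * expR (mshellm j * (Y v / 2))).

Let tge j : r <= mshellt j.
Proof. by rewrite lerDl divr_ge0// ltW. Qed.
Let t0 j : 0 < mshellt j.
Proof. exact: lt_le_trans (tge j). Qed.

Lemma mshellm01 j : 0 <= mshellm j < 1.
Proof.
have h := t0 j; have t2 : 0 < mshellt j ^+ 2 by rewrite exprn_gt0.
rewrite /mshellm subr_ge0 ltrBlDr ltrDl divr_gt0// andbT ler_pdivrMr// mul1r.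
apply: (@le_trans _ _ (r ^+ 2)); first by have h1 := r2P; have := P0; lra.
by rewrite lerXn2r// ?nnegrE ?(ltW r0) ?(ltW h).
Qed.

Lemma mshell_ge0 j v : 0 <= mshell j v.
Proof. by rewrite !mulr_ge0 ?expR_ge0. Qed.

Lemma measurable_linquad m : measurable_fun setT (fun v => `|lin a v| * expR (m * (Y v / 2))).
Proof.
apply: measurable_funM; last exact: measurable_expquad.
by apply: measurableT_comp => //; exact: measurable_lin.
Qed.

Lemma measurable_mshell j : measurable_fun setT (mshell j).
Proof. by apply: measurable_funM => //; exact: measurable_linquad. Qed.

(** P + 1 replaces P because the factor (1 - m)^(-1/2) of [lin_abs_mgf] is merged with (1 - m)^(- P
    / 2). The bound keeps w x, which [absorb] removes later. *)
Lemma mshell_exponent j :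
  mshellc j + (P + 1) * (- (ln (1 - mshellm j) / 2)) <= 1 - x + w * x - j%:R / 8.
Proof.
have tj := t0 j; have t2 : 0 < mshellt j ^+ 2 by rewrite exprn_gt0.
have P0' := P0; have P1' := P1; have r20 : 0 < r ^+ 2 by rewrite exprn_gt0.
have rr := r2P; have s0' := s0; have sP' := sP; have r0' := r0.
pose e := (r ^+ 2)^-1.
have e0 : 0 < e by rewrite invr_gt0.
have e4 : e <= 1 / 4 by rewrite /e -[leLHS]mul1r ler_pdivrMr//; lra.
have Pe : P * e <= 1 / 4 by rewrite ler_pdivrMr//; lra.
have h1 : P / mshellt j ^+ 2 * mshellt j.+1 ^+ 2 <= P * (1 + e) ^+ 2.
  rewrite mulrAC -mulrA ler_pM2l// -expr_div_n lerXn2r// ?nnegrE.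
  - by rewrite divr_ge0// ltW.
  - by rewrite addr_ge0// ltW.
  rewrite ler_pdivrMr//.
  have -> : mshellt j.+1 = mshellt j + e * r.
    rewrite /mshellt -natr1 mulrDl mul1r addrA; congr (_ + _).
    by rewrite /e expr2 invfM -mulrA mulVf ?mulr1// gt_eqF.
  by rewrite mulrDl mul1r lerD2l ler_pM2l.
have h2 : - (ln (1 - mshellm j) / 2) = ln (mshellt j / s).
  have -> : 1 - mshellm j = (mshellt j / s) ^- 2.
    by rewrite expr_div_n sP' invf_div /mshellm; ring.
  rewrite lnV ?posrE ?exprn_gt0 ?divr_gt0// lnXn ?divr_gt0// -mulr_natl; lra.
have je : 0 <= j%:R * e by rewrite mulr_ge0// ltW.
have h3 : ln (mshellt j / s) <= ln (r / s) + j%:R * e.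
  have -> : mshellt j / s = r / s * (1 + j%:R * e).
    by rewrite /mshellt /e; field; rewrite !gt_eqF.
  rewrite lnM ?posrE ?divr_gt0 ?ltr_pwDl// lerD2l; apply: le_ln1Dx.
  by apply: lt_le_trans je; rewrite ltrN10.
have h4 : (P + 1) * ln (mshellt j / s) <= (P + 1) * ln (r / s) + (P + 1) * e * j%:R.
  by rewrite -mulrA (mulrC e) -mulrDr ler_pM2l//; lra.
have h5 : (P + 1) * e * j%:R <= 1 / 2 * j%:R by rewrite ler_wpM2r//; lra.
have h6 : P * (1 + e) ^+ 2 <= P + 57 / 100 by rewrite expr2; nra.
have h7 := radius_mean_exponent s1 u0 w14; rewrite -rsu sP' ux in h7.
rewrite h2 /mshellc; lra.
Qed.

Definition mshellC : R := sg * (3 * expR 1 * expR (- x + w * x)).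

Lemma integral_mshell j :
  (\int[@gaussN R p]_v (mshell j v)%:E <= (mshellC * expR (- (1 / 8)) ^+ j)%:E)%E.
Proof.
have m01 := mshellm01 j; have /andP[m0 m1] := m01.
have d0 : 0 < 1 - mshellm j by lra.
under eq_integral do rewrite EFinM.
rewrite ge0_integralZl//; last by apply/measurable_EFinP; exact: measurable_linquad.
apply: le_trans (lee_wpmul2l _ (lin_abs_mgf l01 sg0 asg m01)) _.
  by rewrite lee_fin mulr_ge0 ?expR_ge0.
rewrite -EFinM lee_fin inv_sqrt_expR// /mgfQ.
have -> : 2 * expR (mshellc j) * (31 / 30 * sg * expR (- (ln (1 - mshellm j) / 2)) *
    expR (- P / 2 * ln (1 - mshellm j))) = sg * (31 / 15) *
    (expR (mshellc j) * expR (- (ln (1 - mshellm j) / 2)) * expR (- P / 2 * ln (1 - mshellm j))).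
  by field.
rewrite -!expRD.
have -> : mshellC * expR (- (1 / 8)) ^+ j = sg * 3 * expR (1 - x + w * x - j%:R / 8).
  have -> : expR (1 - x + w * x - j%:R / 8) = expR 1 * expR (- x + w * x) * expR (- (1 / 8)) ^+ j.
    by rewrite -expRM_natl -!expRD; congr expR; field.
  by rewrite /mshellC; ring.
apply: ler_pM; rewrite ?expR_ge0//; first by rewrite mulr_ge0// ltW.
  by rewrite ler_pM2l//; lra.
by rewrite ler_expR; have := mshell_exponent j; lra.
Qed.

Lemma mshell_pointwise v : r ^+ 2 < Y v ->
  exists j, `|lin a v| * `|expR (psi v) - 1| <= mshell j v.
Proof.
have r0' := r0; move=> rY; pose t := Num.sqrt (Y v).
have Y0 : 0 <= Y v by rewrite (le_trans _ (ltW rY))// exprn_ge0// ltW.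
have tY : t ^+ 2 = Y v by rewrite sqr_sqrtr.
have rt : r < t by rewrite -(@ltr_pXn2r _ 2)// ?nnegrE ?sqrtr_ge0 ?(ltW r0')// tY.
have tr : 0 < t - r by rewrite subr_gt0.
have y0 : 0 <= r * (t - r) by rewrite mulr_ge0// ltW.
have /andP[j1 j2] := truncn_itv y0; set j := Num.truncn _ in j1 j2.
exists j; rewrite /mshell [leRHS]mulrCA ler_wpM2l//.
have w0 : 0 <= w * (r ^+ 2 / 2).
  by rewrite mulr_ge0// ?divr_ge0// ?exprn_ge0// ?(ltW r0')//; have /andP[] := w14.
pose g := (t ^+ 2 - r ^+ 2) / 2 - 5 / 8 * (r * (t - r)) + w * (r ^+ 2 / 2).
have g0 : 0 <= g by rewrite addr_ge0// /g; nra.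
have gpsi : psi v <= g by exact: psi_out.
have hg : `|expR (psi v) - 1| <= 2 * expR g.
  have e1 : expR (psi v) <= expR g by rewrite ler_expR.
  have e2 : 1 <= expR g by rewrite expR_ge1.
  by have := expR_gt0 (psi v); rewrite ler_norml => e3; apply/andP; split; lra.
apply: (le_trans hg); rewrite -mulrA ler_wpM2l// -expRD ler_expR.
have ej : 5 / 8 * j%:R <= 5 / 8 * (r * (t - r)) by rewrite ler_wpM2l//; lra.
have t2 : t ^+ 2 <= mshellt j.+1 ^+ 2.
  rewrite lerXn2r ?nnegrE ?(ltW (lt_trans r0' rt)) ?(ltW (t0 _))//.
  by rewrite /mshellt -lerBlDl ler_pdivlMr// mulrC ltW.
have m0 : 0 <= P / mshellt j ^+ 2 by rewrite divr_ge0 ?(ltW P0)// exprn_ge0// ltW.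
by have := ler_wpM2l m0 t2; rewrite -tY /mshellm /mshellc /g; lra.
Qed.

Let q := Num.sqrt (P + 1).
Let q2 : q ^+ 2 = P + 1. Proof. by rewrite sqr_sqrtr//; have := P1; lra. Qed.
Let q1 : 1 <= q.
Proof. by rewrite -[1]sqrtr1 ler_wsqrtr//; have := P1; lra. Qed.

(** |z| Y^(3/2) is split as (A z^2 + Y^3 / A) / 2 with A = 19/5 q^3 / sg and q^2 = P + 1, so that
    only the two weighted moments are needed. The value 19/5 nearly minimizes 56/25 a + 65/2 / a,
    these being the constants of the moments; half of 1/6 gives the 1/12. *)
Definition mcore v := kap / 12 * ((19 / 5 * q ^+ 3 / sg * lin a v ^+ 2 +
  Y v ^+ 3 / (19 / 5 * q ^+ 3 / sg)) * expR (w * (Y v / 2))).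

Lemma mcore_ge0 v : 0 <= mcore v.
Proof.
have A0 : 0 <= 19 / 5 * q ^+ 3 / sg.
  by rewrite divr_ge0 ?(ltW sg0)// mulr_ge0// exprn_ge0// (le_trans ler01)//; exact: q1.
have Y0 : 0 <= Y v by apply: quad_ge0 => i; have /andP[] := l01 i.
set A := _ / sg in A0 *.
rewrite /mcore -/A mulr_ge0 ?(mulr_ge0 kap0)// mulr_ge0 ?expR_ge0// addr_ge0//.
  by rewrite mulr_ge0 ?sqr_ge0.
by rewrite divr_ge0// exprn_ge0.
Qed.

Lemma measurable_mcore : measurable_fun setT mcore.
Proof.
apply: measurable_funM => //; apply: measurable_funM; last exact: measurable_expquad.
apply: measurable_funD; apply: measurable_funM => //.
  by apply: measurable_funX; exact: measurable_lin.
by apply: measurable_funX; exact: measurable_quad.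
Qed.

Lemma mcore_pointwise v : Y v <= r ^+ 2 -> `|lin a v| * `|expR (psi v) - 1| <= mcore v.
Proof.
move=> Yr; have Y0 : 0 <= Y v by apply: quad_ge0 => i; have /andP[] := l01 i.
have q1' := q1; have A0 : 0 < 19 / 5 * q ^+ 3 / sg.
  by rewrite divr_gt0// mulr_gt0// exprn_gt0// (lt_le_trans ltr01).
set A := 19 / 5 * q ^+ 3 / sg in A0 *.
pose z := Y v * Num.sqrt (Y v).
have z0 : 0 <= z by rewrite mulr_ge0 ?sqrtr_ge0.
have z2 : z ^+ 2 = Y v ^+ 3 by rewrite exprMn sqr_sqrtr// -exprSr.
have h : `|expR (psi v) - 1| <= kap / 6 * z * expR (w * (Y v / 2)).
  by apply: le_trans (expR_sub1_le _) _; rewrite ler_pM ?expR_ge0 ?ler_expR// ?psi3 ?psiw.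
apply: le_trans (ler_wpM2l (normr_ge0 _) h) _.
rewrite /mcore -/A [leLHS]mulrA [leRHS]mulrA ler_wpM2r ?expR_ge0//.
rewrite -(@real_normK _ (lin a v)) ?num_real// -z2; move: `|lin a v| => y.
rewrite -subr_ge0 (_ : _ - _ = kap / 12 * ((A * y - z) ^+ 2 / A)); last by field; rewrite gt_eqF.
by rewrite mulr_ge0 ?(mulr_ge0 kap0)// divr_ge0 ?sqr_ge0// ltW.
Qed.

Lemma integral_mcore :
  (\int[@gaussN R p]_v (mcore v)%:E <= ((14 + 23 / 100) / 10 * kap * q ^+ 3 * sg)%:E)%E.
Proof.
have q1' := q1; have A0 : 0 < 19 / 5 * q ^+ 3 / sg.
  by rewrite divr_gt0// mulr_gt0// exprn_gt0// (lt_le_trans ltr01).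
have [A [AE {}A0]] : exists A, A = 19 / 5 * q ^+ 3 / sg /\ 0 < A by exists (19 / 5 * q ^+ 3 / sg).
have /andP[w0 w1] := w14; have P1' := P1.
have Y0 v : 0 <= Y v by apply: quad_ge0 => i; have /andP[] := l01 i.
have mz : measurable_fun setT (fun v => (lin a v ^+ 2 * expR (w * (Y v / 2)))%:E).
  apply/measurable_EFinP; apply: measurable_funM; last exact: measurable_expquad.
  by apply: measurable_funX; exact: measurable_lin.
have my : measurable_fun setT (fun v => (Y v ^+ 3 * expR (w * (Y v / 2)))%:E).
  apply/measurable_EFinP; apply: measurable_funM; last exact: measurable_expquad.
  by apply: measurable_funX; exact: measurable_quad.
have c1 : 0 <= kap / 12 * A by rewrite mulr_ge0 ?divr_ge0// ltW.
have c2 : 0 <= kap / 12 / A by rewrite divr_ge0 ?divr_ge0// ltW.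
have z0 v : (0 <= (lin a v ^+ 2 * expR (w * (Y v / 2)))%:E)%E.
  by rewrite lee_fin mulr_ge0 ?sqr_ge0 ?expR_ge0.
have y0 v : (0 <= (Y v ^+ 3 * expR (w * (Y v / 2)))%:E)%E.
  by rewrite lee_fin mulr_ge0 ?exprn_ge0 ?expR_ge0.
rewrite (_ : (\int[_]_v _)%E = (\int[@gaussN R p]_v ((kap / 12 * A)%:E *
    (lin a v ^+ 2 * expR (w * (Y v / 2)))%:E + (kap / 12 / A)%:E * (Y v ^+ 3 * expR (w * (Y v / 2)))%:E))%E); last first.
  apply: eq_integral => v _; rewrite -!EFinM -EFinD; congr EFin.
  by rewrite /mcore -AE; field; rewrite gt_eqF.
rewrite ge0_integralD//; try exact: measurable_funeM; try (by move=> v _; rewrite mule_ge0).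
rewrite !ge0_integralZl//.
have w01 : 0 <= w < 1 by lra.
have P3 : 0 < (P + 3)^-1 by rewrite invr_gt0; lra.
have P34 : (P + 3)^-1 <= 1 / 4 by rewrite -[leLHS]mul1r ler_pdivrMr; lra.
have m01 : 0 <= 2 * (P + 3)^-1 + w < 1 by lra.
have H1 := lin_sqr_mgf l01 sg0 asg w01; have H2 := quad_pow3_mgf l01 P3 m01.
apply: le_trans (leeD (lee_wpmul2l _ H1) (lee_wpmul2l _ H2)) _; rewrite ?lee_fin//.
have := mgfQ_cubic P1 w14 wP; rewrite -/(mgfQ l _) -q2 -exprM => K2.
have := mgfQ_quadratic (ltW P0) w14 wP; rewrite -/(mgfQ l _) => K1.
apply: (@le_trans _ _ (kap / 12 * A * (56 / 25 * sg ^+ 2) + kap / 12 / A * (65 / 2 * q ^+ (2 * 3)))).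
  apply: lerD; apply: ler_wpM2l => //.
  have -> : 16 / 15 * sg ^+ 2 / (1 - w) * mgfQ l w = 16 / 15 / (1 - w) * mgfQ l w * sg ^+ 2.
    by ring.
  by rewrite ler_wpM2r// sqr_ge0.
have -> : kap / 12 * A * (56 / 25 * sg ^+ 2) + kap / 12 / A * (65 / 2 * q ^+ (2 * 3)) =
    (19 / 5 * (56 / 25) / 12 + 65 / 2 / (19 / 5) / 12) * (kap * q ^+ 3 * sg).
  by rewrite AE; field; rewrite !gt_eqF// (lt_le_trans ltr01).
rewrite -2![(14 + 23 / 100) / 10 * _ * _]mulrA mulrA -[leRHS]mulrA [in leRHS]mulrA ler_wpM2r//; last by lra.
by rewrite !mulr_ge0 ?exprn_ge0// ?(ltW sg0)// (le_trans ler01).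
Qed.

Lemma mean_abs_bound :
  (\int[@gaussN R p]_v (`|lin a v| * `|expR (psi v) - 1|)%:E <=
   (((14 + 23 / 100) / 10 * kap * q ^+ 3 + 3 * expR 1 / (1 - expR (- (1 / 8))) * expR (- x + w * x)) * sg)%:E)%E.
Proof.
pose S v := (\sum_(0 <= j <oo) (mshell j v)%:E)%E.
have mS : measurable_fun setT S.
  apply: ge0_emeasurable_sum => [j v _ _|j _]; first by rewrite lee_fin mshell_ge0.
  by apply/measurable_EFinP; exact: measurable_mshell.
have S0 v : (0 <= S v)%E by apply: nneseries_ge0 => j _ _; rewrite lee_fin mshell_ge0.
apply: (@le_trans _ _ (\int[@gaussN R p]_v ((mcore v)%:E + S v))%E).
  apply: le_integralT.
  - apply/measurable_EFinP; apply: measurable_funM.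
      by apply: measurableT_comp => //; exact: measurable_lin.
    by apply: measurableT_comp => //; apply: measurable_funB => //; exact: measurableT_comp.
  - by apply: emeasurable_funD => //; apply/measurable_EFinP; exact: measurable_mcore.
  - by move=> v; rewrite lee_fin mulr_ge0.
  move=> v; have [h|h] := leP (Y v) (r ^+ 2).
    by apply: le_trans (leeDl _ (S0 v)); rewrite lee_fin mcore_pointwise.
  have [j hj] := mshell_pointwise h.
  apply: (@le_trans _ _ (S v)); last by rewrite leeDr// lee_fin mcore_ge0.
  apply: (@le_trans _ _ (mshell j v)%:E); first by rewrite lee_fin.
  by apply: (@nneseries_ge_term _ (fun j => (mshell j v)%:E)) => k; rewrite lee_fin mshell_ge0.
rewrite ge0_integralD//; last 2 first.
- by move=> v _; rewrite lee_fin mcore_ge0.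
- by apply/measurable_EFinP; exact: measurable_mcore.
rewrite mulrDl EFinD leeD ?integral_mcore//.
apply: le_trans (_ : (mshellC / (1 - expR (- (1 / 8))))%:E <= _)%E; last first.
  by rewrite lee_fin le_eqVlt; apply/orP; left; apply/eqP; rewrite /mshellC; ring.
rewrite -[leRHS]mule1; apply: integral_geometric_le => //.
- by move=> k; apply/measurable_EFinP; exact: measurable_mshell.
- by move=> k v; rewrite lee_fin mshell_ge0.
- by rewrite /mshellC !mulr_ge0 ?expR_ge0// ltW.
- by rewrite expR_ge0 expR_lt1 oppr_lt0; lra.
by move=> k; rewrite mule1; exact: integral_mshell.
Qed.

(** e^psi >= 1 - w Y / 2 inside the ellipsoid, whose complement has mass at most e^(- x - 79/100 P);
    8/15 is half of the constant in [quad_mean]. *)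
Lemma partition_ge : (\int[@gaussN R p]_v (expR (psi v))%:E < +oo)%E ->
  1 - 8 / 15 * (w * P) - expR (- (x + 79 / 100 * P)) <= \int[@gaussN R p]_v expR (psi v).
Proof.
move=> Zfin; pose I v : R := if r ^+ 2 < Y v then 1 else 0.
have /andP[w0 w1] := w14.
have Y0 v : 0 <= Y v by apply: quad_ge0 => i; have /andP[] := l01 i.
have mI : measurable_fun setT I.
  by apply: measurable_fun_ifT => //; apply: measurable_fun_ltr => //; exact: measurable_quad.
have I0 v : 0 <= I v by rewrite /I; case: ifP.
have mY : measurable_fun setT (fun v : 'cV[R]_p => (Y v)%:E) by apply/measurable_EFinP; exact: measurable_quad.
have mE : measurable_fun setT (fun v => (expR (psi v))%:E).
  by apply/measurable_EFinP; exact: measurableT_comp.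
have Ef : (\int[@gaussN R p]_v (expR (psi v))%:E)%E \is a fin_num.
  by rewrite ge0_fin_numE// integral_ge0// => v _; rewrite lee_fin expR_ge0.
have key v : 1 <= expR (psi v) + (w / 2 * Y v + I v).
  have w20 : 0 <= w / 2 * Y v by rewrite mulr_ge0// divr_ge0.
  rewrite /I; case: ifPn => h; first by have := expR_ge0 (psi v); lra.
  rewrite -leNgt in h; have := psiw h; rewrite ler_norml => /andP[h1 _].
  by have := expR_ge1Dx (psi v); lra.
have : (\int[@gaussN R p]_v (cst 1%E) v <= \int[@gaussN R p]_v ((expR (psi v))%:E + ((w / 2)%:E * (Y v)%:E + (I v)%:E)))%E.
  apply: le_integralT => //.
    by apply: emeasurable_funD => //; apply: emeasurable_funD => //; [exact: measurable_funeM|exact/measurable_EFinP].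
rewrite integral_cst// (_ : (1 * _ = 1)%E); last by rewrite mul1e; exact: probability_setT.
have w20 : 0 <= w / 2 by lra.
rewrite ge0_integralD//; last 2 first.
- by move=> v _; rewrite adde_ge0// ?lee_fin// mulr_ge0.
- by apply: emeasurable_funD => //; [exact: measurable_funeM|exact/measurable_EFinP].
rewrite ge0_integralD//; try exact: measurable_funeM; try exact/measurable_EFinP;
  try (by move=> v _; rewrite ?mule_ge0 ?lee_fin).
rewrite ge0_integralZl//; last by move=> v _; rewrite lee_fin.
have H1 := gaussN_tail_strong l01 P0 rE (ltW x0).
have H2 : ((w / 2)%:E * \int[@gaussN R p]_v (Y v)%:E <= (w / 2 * (16 / 15 * P))%:E)%E.
  by rewrite [leRHS]EFinM; apply: lee_wpmul2l; [rewrite lee_fin|exact: quad_mean].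
move=> /le_trans /(_ (leeD2l _ (leeD H2 H1))).
by rewrite -(fineK Ef) -!EFinD lee_fin /Rintegral; lra.
Qed.

Lemma mean_integrable : (\int[@gaussN R p]_v `|lin a v * expR (psi v)|%:E < +oo)%E.
Proof.
have m01 : 0 <= (0 : R) < 1 by rewrite lexx ltr01.
have ml0 : measurable_fun setT (fun v => (`|lin a v| * expR (0 * (Y v / 2)))%:E).
  by apply/measurable_EFinP; exact: measurable_linquad.
have mle : measurable_fun setT (fun v => (`|lin a v| * `|expR (psi v) - 1|)%:E).
  apply/measurable_EFinP; apply: measurable_funM.
    by apply: measurableT_comp => //; exact: measurable_lin.
  by apply: measurableT_comp => //; apply: measurable_funB => //; exact: measurableT_comp.
apply: (@le_lt_trans _ _ (\int[@gaussN R p]_v ((`|lin a v| * `|expR (psi v) - 1|)%:E +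
    (`|lin a v| * expR (0 * (Y v / 2)))%:E))%E).
  apply: le_integralT.
  - apply/measurable_EFinP; apply: measurableT_comp => //; apply: measurable_funM.
      exact: measurable_lin.
    exact: measurableT_comp.
  - exact: emeasurable_funD.
  - by move=> v; rewrite lee_fin.
  move=> v; rewrite -EFinD lee_fin mul0r expR0 -mulrDr normrM ler_wpM2l//.
  by rewrite -[X in `|X|](subrK 1) (le_trans (ler_normD _ _))// normr1.
rewrite ge0_integralD//.
by rewrite lte_add_pinfty//; [apply: le_lt_trans mean_abs_bound _|
  apply: le_lt_trans (lin_abs_mgf l01 sg0 asg m01) _]; rewrite ltry.
Qed.

Lemma mean_centered : `|\int[@gaussN R p]_v (lin a v * expR (psi v))| <=
  ((14 + 23 / 100) / 10 * kap * q ^+ 3 + 3 * expR 1 / (1 - expR (- (1 / 8))) * expR (- x + w * x)) * sg.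
Proof.
have m01 : 0 <= (0 : R) < 1 by rewrite lexx ltr01.
have ml := measurable_lin a.
have me : measurable_fun setT (fun v => expR (psi v)) by exact: measurableT_comp.
have ilin : (@gaussN R p).-integrable setT (EFin \o lin a).
  apply/integrableP; split; first exact/measurable_EFinP.
  apply: le_lt_trans (_ : _ <= \int[@gaussN R p]_v (`|lin a v| * expR (0 * (Y v / 2)))%:E)%E _.
    rewrite le_eqVlt; apply/orP; left; apply/eqP; apply: eq_integral => v _.
    by rewrite mul0r expR0 mulr1.
  by apply: le_lt_trans (lin_abs_mgf l01 sg0 asg m01) _; rewrite ltry.
have iexp : (@gaussN R p).-integrable setT (EFin \o (fun v => lin a v * expR (psi v))).
  apply/integrableP; split; last exact: mean_integrable.
  by apply/measurable_EFinP; exact: measurable_funM.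
have lin0 : \int[@gaussN R p]_v lin a v = 0.
  by apply: gaussN_odd => // v; rewrite /lin -sumrN; apply: eq_bigr => i _; rewrite mxE mulrN.
have -> : \int[@gaussN R p]_v (lin a v * expR (psi v)) =
    \int[@gaussN R p]_v (lin a v * expR (psi v) - lin a v).
  by rewrite RintegralB// lin0 subr0.
have idiff : (@gaussN R p).-integrable setT (EFin \o (fun v => lin a v * expR (psi v) - lin a v)).
  by have := integrableB measurableT iexp ilin; apply: eq_integrable.
apply: le_trans (le_normr_Rintegral _ idiff) _ => //.
have E : (\int[@gaussN R p]_v `|lin a v * expR (psi v) - lin a v|%:E =
    \int[@gaussN R p]_v (`|lin a v| * `|expR (psi v) - 1|)%:E)%E.
  by apply: eq_integral => v _; rewrite -normrM mulrBr mulr1.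
have h := mean_abs_bound; rewrite -E in h.
rewrite -lee_fin /Rintegral fineK// ge0_fin_numE; first by rewrite (le_lt_trans h)// ltry.
by apply: integral_ge0 => v _; rewrite lee_fin.
Qed.

Hypothesis wk : w <= kap * r / 3.
Hypothesis kr : kap * r <= 3 / 4.

Lemma mean_ge1 : (\int[@gaussN R p]_v (expR (psi v))%:E < +oo)%E ->
  `|\int[@gaussN R p]_v (lin a v * expR (psi v))| <=
  (12 / 5 * kap * q ^+ 3 + meanC * expR (- x)) * sg * \int[@gaussN R p]_v expR (psi v).
Proof.
move=> /partition_ge; set Z := \int[_]_v expR _ => hZ.
apply: (le_trans mean_centered); rewrite [leRHS]mulrAC ler_pM2r//.
apply: (mean_ratio P1 x0 r2 q1 q2 kap0 wP kr hZ).
exact: (absorb P1 x0 u0 ux rsu q1 erefl q2 kap0 w14 wk).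
Qed.

End mean.

(** * The mean bound for any positive effective dimension *)

Section mean_general.
Context {R : realType} (p : nat) (l : 'I_p -> R).
Hypothesis l01 : forall i, 0 <= l i <= 1.
Local Notation Y := (quad l).
Local Notation P := (\sum_i l i).
Variables (r x kap w sg : R) (psi : 'cV[R]_p -> R) (a : 'I_p -> R).
Hypothesis P0 : 0 < P.
Hypothesis x0 : 0 < x.
Hypothesis rE : r = 2 * Num.sqrt P + Num.sqrt (2 * x).
Hypothesis mpsi : measurable_fun setT psi.
Hypothesis kap0 : 0 <= kap.
Hypothesis w14 : 0 <= w <= 1 / 4.
Hypothesis wP : w * P <= 2 / 3.
Hypothesis psi3 : forall v, Y v <= r ^+ 2 -> `|psi v| <= kap / 6 * (Y v * Num.sqrt (Y v)).
Hypothesis psiw : forall v, Y v <= r ^+ 2 -> `|psi v| <= w * (Y v / 2).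
Hypothesis psi_out : forall v t, t ^+ 2 = Y v -> r < t ->
  psi v <= (t ^+ 2 - r ^+ 2) / 2 - 5 / 8 * (r * (t - r)) + w * (r ^+ 2 / 2).
Hypothesis sg0 : 0 < sg.
Hypothesis asg : \sum_i a i ^+ 2 <= sg ^+ 2.
Hypothesis wk : w <= kap * r / 3.
Hypothesis kr : kap * r <= 3 / 4.

(* When P < 1, replacing l by l / P, x by x / P, r by r / sqrt P, w by w P and
   kap by kap P^(3/2) preserves the hypotheses and normalizes P to 1. *)
Lemma mean_general : (\int[@gaussN R p]_v `|lin a v * expR (psi v)|%:E < +oo)%E /\
  ((\int[@gaussN R p]_v (expR (psi v))%:E < +oo)%E ->
  `|\int[@gaussN R p]_v (lin a v * expR (psi v))| <=
  (12 / 5 * kap * Num.sqrt (P + 1) ^+ 3 + meanC * expR (- x)) * sg *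
  \int[@gaussN R p]_v expR (psi v)).
Proof.
have P0' := P0; have x0' := x0.
have [P1|P1] := leP 1 P.
  split; first exact: (mean_integrable l01 P1 x0 rE mpsi kap0 w14 wP psi3 psiw psi_out sg0 asg).
  exact: (mean_ge1 l01 P1 x0 rE mpsi kap0 w14 wP psi3 psiw psi_out sg0 asg wk kr).
pose s := Num.sqrt P; have s0 : 0 < s by rewrite sqrtr_gt0.
have sP : s ^+ 2 = P by rewrite sqr_sqrtr// ltW.
have s1 : s < 1 by rewrite -(@ltr_pXn2r _ 2)// ?nnegrE ?(ltW s0)// sP expr1n.
pose l' i := l i / P.
have lP i : l i <= P.
  by rewrite (bigD1 i)//= lerDl sumr_ge0// => j _; have /andP[] := l01 j.
have l01' i : 0 <= l' i <= 1.
  by have /andP[l0 _] := l01 i; rewrite /l' divr_ge0 ?(ltW P0)//= ler_pdivrMr// mul1r.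
have P1E : \sum_i l' i = 1 by rewrite -mulr_suml mulfV// gt_eqF.
have P1' : 1 <= \sum_i l' i by rewrite P1E.
have YE v : quad l' v = Y v / P.
  by rewrite /quad mulr_suml; apply: eq_bigr => i _; rewrite /l'; ring.
have xP : 0 < x / P by rewrite divr_gt0.
pose r' := r / s.
have rE' : r' = 2 * Num.sqrt (\sum_i l' i) + Num.sqrt (2 * (x / P)).
  rewrite P1E sqrtr1 mulr1 /r' rE mulrDl mulfK ?gt_eqF// mulrA.
  by rewrite (@sqrtrM _ (2 * x)) ?mulr_ge0 ?(ltW x0)// sqrtrV// ltW.
have r0 : 0 < r by rewrite rE -/s; have := sqrtr_ge0 (2 * x); lra.
have rr : r' ^+ 2 = r ^+ 2 / P by rewrite /r' expr_div_n sP.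
have Yr v : quad l' v <= r' ^+ 2 -> Y v <= r ^+ 2.
  by rewrite YE rr ler_pM2r// invr_gt0.
pose kap' := kap * (P * s).
have Ps0 : 0 < P * s by rewrite mulr_gt0.
have kap0' : 0 <= kap' by rewrite mulr_ge0// ltW.
have w14' : 0 <= w * P <= 1 / 4.
  by have /andP[w0 w1] := w14; rewrite mulr_ge0 ?(ltW P0)//=; nra.
have wP' : w * P * \sum_i l' i <= 2 / 3 by rewrite P1E mulr1.
have psi3' v : quad l' v <= r' ^+ 2 -> `|psi v| <= kap' / 6 * (quad l' v * Num.sqrt (quad l' v)).
  move=> /Yr /psi3; rewrite YE sqrtrM ?quad_ge0// => [|i]; last by have /andP[] := l01 i.
  rewrite sqrtrV ?(ltW P0)// -/s.
  suff -> : kap' / 6 * (Y v / P * (Num.sqrt (Y v) / s)) = kap / 6 * (Y v * Num.sqrt (Y v)) by [].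
  by rewrite /kap'; field; rewrite !gt_eqF.
have psiw' v : quad l' v <= r' ^+ 2 -> `|psi v| <= w * P * (quad l' v / 2).
  move=> /Yr /psiw; rewrite YE; suff -> : w * P * (Y v / P / 2) = w * (Y v / 2) by [].
  by field; rewrite gt_eqF.
have psi_out' v t : t ^+ 2 = quad l' v -> r' < t ->
    psi v <= (t ^+ 2 - r' ^+ 2) / 2 - 5 / 8 * (r' * (t - r')) + w * P * (r' ^+ 2 / 2).
  move=> tY rt; have tsY : (t * s) ^+ 2 = Y v.
    by rewrite exprMn tY YE sP divfK// gt_eqF.
  have rts : r < t * s by rewrite -ltr_pdivrMr.
  apply: le_trans (psi_out tsY rts) _.
  have rE2 : r = r' * s by rewrite /r' divfK// gt_eqF.
  have r0' : 0 < r' by rewrite divr_gt0.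
  clearbody r'; rewrite rE2 !exprMn -sP.
  have g0 : 0 <= (t ^+ 2 - r' ^+ 2) / 2 - 5 / 8 * (r' * (t - r')).
    have h : 0 < t - r' by rewrite subr_gt0.
    nra.
  have -> : (t ^+ 2 * s ^+ 2 - r' ^+ 2 * s ^+ 2) / 2 - 5 / 8 * (r' * s * (t * s - r' * s)) +
      w * (r' ^+ 2 * s ^+ 2 / 2) =
      s ^+ 2 * ((t ^+ 2 - r' ^+ 2) / 2 - 5 / 8 * (r' * (t - r'))) + w * s ^+ 2 * (r' ^+ 2 / 2) by ring.
  by rewrite lerD2r ler_piMl// sP ltW.
have wk' : w * P <= kap' * r' / 3.
  suff -> : kap' * r' / 3 = kap * r / 3 * P by rewrite ler_pM2r.
  by rewrite /kap' /r'; field; rewrite gt_eqF.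
have kr' : kap' * r' <= 3 / 4.
  have -> : kap' * r' = kap * r * P by rewrite /kap' /r'; field; rewrite gt_eqF.
  have : 0 <= kap * r by rewrite mulr_ge0// ltW.
  by have := kr; nra.
have I := mean_integrable l01' P1' xP rE' mpsi kap0' w14' wP' psi3' psiw' psi_out' sg0 asg.
split=> // Zfin.
have M := mean_ge1 l01' P1' xP rE' mpsi kap0' w14' wP' psi3' psiw' psi_out' sg0 asg wk' kr' Zfin.
apply: (le_trans M); rewrite ler_wpM2r//; first by apply: Rintegral_ge0 => v _; exact: expR_ge0.
rewrite ler_pM2r// lerD//; last first.
  rewrite ler_wpM2l//; last by rewrite ler_expR lerN2 ler_pdivlMr//; nra.
  exact: meanC_ge0.
rewrite P1E /kap' -!mulrA ler_wpM2l//; rewrite ler_wpM2l//.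
have q0 : 0 <= Num.sqrt (P + 1) by exact: sqrtr_ge0.
have -> : P * (s * Num.sqrt (1 + 1) ^+ 3) = (s * Num.sqrt (1 + 1)) ^+ 3.
  by rewrite exprMn -sP; ring.
rewrite ler_wpM2l// lerXn2r ?nnegrE ?mulr_ge0 ?sqrtr_ge0 ?(ltW s0)//.
by rewrite -sqrtrM ?(ltW P0)// ler_wsqrtr//; lra.
Qed.

End mean_general.

(** * Third order Taylor remainders on the line *)

Section real_line.
Context {R : realType}.
Implicit Types (F G : R -> R).

Lemma is_derive_le F G (F' G' : R -> R) (a b : R) :
  (forall t : R, is_derive t 1 F (F' t)) -> (forall t : R, is_derive t 1 G (G' t)) -> a <= b ->
  (forall t, a <= t <= b -> F' t <= G' t) -> F b - F a <= G b - G a.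
Proof.
move=> dF dG ab FG.
have dH (t : R) : is_derive t 1 (G - F) (G' t - F' t) by exact: is_deriveB.
have [|c] := @MVT_segment R (G - F) (fun t => G' t - F' t) a b ab (fun t _ => dH t).
  apply: continuous_subspaceT => t; apply: differentiable_continuous.
  by apply/derivable1_diffP; have [] := dH t.
rewrite in_itv/= => cab E; rewrite -subr_ge0.
have -> : G b - G a - (F b - F a) = (G - F) b - (G - F) a by rewrite !fctE; ring.
by rewrite E mulr_ge0 ?subr_ge0// FG.
Qed.

Section cubic_remainder.
Variables (g0 g1 g2 g3 : R -> R) (K : R).
Hypothesis d0 : forall t : R, is_derive t 1 g0 (g1 t).
Hypothesis d1 : forall t : R, is_derive t 1 g1 (g2 t).
Hypothesis d2 : forall t : R, is_derive t 1 g2 (g3 t).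
Hypothesis g3K : forall t, 0 <= t <= 1 -> `|g3 t| <= K.

Let dpow n (c : R) (t : R) : is_derive t 1 (fun t : R => c * t ^+ n.+1) (c * (n.+1%:R * t ^+ n)).
Proof.
have h : is_derive t 1 (fun t : R => t ^+ n.+1) (n.+1%:R * t ^+ n).
  have := @is_deriveX R R id n.+1 t 1 1 (is_derive_id t 1).
  rewrite (_ : id ^+ n.+1 = fun t : R => t ^+ n.+1); last by apply/funext => s; rewrite exprfctE.
  by rewrite /GRing.scale/= mulr1.
exact: is_deriveZ.
Qed.

Let der_le F F' (n : nat) (c : R) : (forall t : R, is_derive t 1 F (F' t)) -> F 0 = 0 ->
  (forall t, 0 <= t <= 1 -> `|F' t| <= c * (n.+1%:R * t ^+ n)) ->
  forall s t, 0 <= s -> s <= t -> t <= 1 -> `|F t - F s| <= c * t ^+ n.+1 - c * s ^+ n.+1.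
Proof.
move=> dF F0 H s t s0 st t1; rewrite ler_norml; apply/andP; split.
  have dN (u : R) : is_derive u 1 (- F) (- F' u) by exact: is_deriveN.
  have := is_derive_le dN (dpow n c) st; rewrite !fctE.
  move=> /(_ _) h; rewrite lerNl; apply: le_trans (h _); first by lra.
  move=> u /andP[u0 u1]; have := H u; rewrite (le_trans s0 u0) (le_trans u1 t1) => /(_ isT).
  by rewrite ler_norml => /andP[h1 _]; rewrite lerNl.
apply: (@is_derive_le F (fun t => c * t ^+ n.+1) F' (fun t => c * (n.+1%:R * t ^+ n)) s t dF (dpow n c) st).
move=> u /andP[u0 u1]; have := H u; rewrite (le_trans s0 u0) (le_trans u1 t1) => /(_ isT).
by rewrite ler_norml => /andP[].
Qed.

Let r2 t := g2 t - g2 0.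
Let r1 t := g1 t - g1 0 - t * g2 0.
Let rem t := g0 t - g0 0 - t * g1 0 - t ^+ 2 / 2 * g2 0.

Let dr2 (t : R) : is_derive t 1 r2 (g3 t).
Proof.
rewrite -[g3 t]subr0; have := @is_deriveB R R R g2 (cst (g2 0)) t 1 _ _ (d2 t) (is_derive_cst _ _ _).
exact.
Qed.

Let dr1 (t : R) : is_derive t 1 r1 (r2 t).
Proof.
have h1 := @is_deriveB R R R g1 (cst (g1 0)) t 1 _ _ (d1 t) (is_derive_cst _ _ _).
have h2 := dpow 0 (g2 0) t.
have := is_deriveB h1 h2; rewrite subr0 expr0 mulr1 mulr1.
have -> : g1 - cst (g1 0) - (fun t => g2 0 * t ^+ 1) = r1.
  by apply/funext => s; rewrite !fctE/= /r1 expr1; ring.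
exact.
Qed.

Let drem (t : R) : is_derive t 1 rem (r1 t).
Proof.
have h1 := @is_deriveB R R R g0 (cst (g0 0)) t 1 _ _ (d0 t) (is_derive_cst _ _ _).
have h2 := is_deriveB (is_deriveB h1 (dpow 0 (g1 0) t)) (dpow 1 (g2 0 / 2) t).
have -> : rem = g0 - cst (g0 0) - (fun t => g1 0 * t ^+ 1) - (fun t => g2 0 / 2 * t ^+ 2).
  by apply/funext => s; rewrite !fctE/= /rem expr1; field.
by apply: is_derive_eq; rewrite /r1 expr0 expr1; field.
Qed.

(** The bound on the third derivative is integrated three times by comparison with powers of t.
    Controlling increments, and not only the value, of the remainder is what yields its slope at the
    boundary of the ellipsoid. *)
Lemma cubic_remainder_lipschitz s t : 0 <= s -> s <= t -> t <= 1 ->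
  `|rem t - rem s| <= K / 6 * t ^+ 3 - K / 6 * s ^+ 3.
Proof.
have z2 : r2 0 = 0 by rewrite /r2 subrr.
have z1 : r1 0 = 0 by rewrite /r1 mul0r subrr subr0.
have z0 : rem 0 = 0 by rewrite /rem expr0n/= !mul0r !subr0 subrr.
have b2 u : 0 <= u <= 1 -> `|r2 u| <= K / 2 * (2%:R * u ^+ 1).
  move=> /andP[u0 u1]; have := der_le (n := 0) (c := K) dr2 z2 _ (lexx 0) u0 u1.
  rewrite z2 subr0 expr1 mulr0 subr0 => /(_ _) h.
  rewrite (_ : K / 2 * (2%:R * u) = K * u); last by field.
  apply: h => v v01; rewrite expr0 !mulr1; exact: g3K.
have b1 u : 0 <= u <= 1 -> `|r1 u| <= K / 6 * (3%:R * u ^+ 2).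
  move=> /andP[u0 u1]; have := der_le dr1 z1 b2 (lexx 0) u0 u1.
  by rewrite z1 subr0 expr0n/= mulr0 subr0; congr (_ <= _); field.
exact: (der_le drem z0 b1).
Qed.

End cubic_remainder.

(** Replaces limits of difference quotients: an inequality with an error linear in t is enough for
    small t. *)
Lemma le_of_small (a b c t0 : R) : 0 < t0 -> (forall t, 0 < t -> t <= t0 -> a <= b + t * c) -> a <= b.
Proof.
move=> t00 H; rewrite leNgt; apply/negP => ba.
have c1 : 0 < 1 + `|c| by rewrite ltr_pwDl.
pose t := Num.min t0 ((a - b) / 2 / (1 + `|c|)).
have tp : 0 < t by rewrite lt_min t00 !divr_gt0// subr_gt0.
have := H t tp; rewrite ge_min lexx => /(_ isT).
have : t * c <= (a - b) / 2.
  apply: (@le_trans _ _ (t * (1 + `|c|))).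
    by rewrite ler_wpM2l ?(ltW tp)// (le_trans (ler_norm c))// lerDr.
  by rewrite -ler_pdivlMr// ge_min lexx orbT.
by have : b < a by []; lra.
Qed.

End real_line.

(** * Derivatives along lines and of quadratic perturbations *)

Section lines.
Context {R : realType} {p : nat}.
Implicit Types (f : 'cV[R]_p -> R) (x u : 'cV[R]_p).

Lemma Ck_continuous m f : Ck m f -> continuous f.
Proof.
elim: m f => [//|m IH] f Cf; apply: C1_continuous => i; first by have [] := Cf i.
by apply: IH; have [] := Cf i.
Qed.

Lemma Ck_is_derive m f x u : Ck m.+1 f -> is_derive x u f (\sum_i u i 0 * partial i f x).
Proof.
move=> Cf; apply: C1_is_derive => i; first by have [] := Cf i.
by apply: (@Ck_continuous m); have [] := Cf i.
Qed.

Lemma Ck_line m f x u (t : R) : Ck m.+1 f ->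
  is_derive t 1 (fun t : R => f (x + t *: u)) (\sum_i u i 0 * partial i f (x + t *: u)).
Proof.
move=> Cf; have df y : derivable f y u by have [] := Ck_is_derive y u Cf.
have [_ <-] := Ck_is_derive (x + t *: u) u Cf.
exact: derivable_line.
Qed.

Lemma is_derive_bigsum (I : finType) (F : I -> R -> R) (dF : I -> R) (t : R) :
  (forall i, is_derive t 1 (F i) (dF i)) -> is_derive t 1 (fun t => \sum_i F i t) (\sum_i dF i).
Proof.
move=> H; rewrite (_ : (fun t => _) = \sum_i F i); last first.
  by apply/funext => s; rewrite fct_sumE.
by elim/big_ind2 : _ => // [|] *; [exact: is_derive_cst|exact: is_deriveD].
Qed.

Lemma grad_line m f x u (t : R) : Ck m.+2 f ->
  is_derive t 1 (fun t : R => dot (grad f (x + t *: u)) u) (qform (hess f (x + t *: u)) u).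
Proof.
move=> Cf; rewrite (_ : qform _ _ =
    \sum_j u j 0 * \sum_i u i 0 * partial i (partial j f) (x + t *: u)); last first.
  rewrite /qform /dot (eq_bigr (fun i => \sum_j u i 0 * (partial i (partial j f) (x + t *: u) * u j 0))).
    rewrite exchange_big; apply: eq_bigr => j _; rewrite mulr_sumr; apply: eq_bigr => i _; ring.
  by move=> i _; rewrite mxE mulr_sumr; apply: eq_bigr => j _; rewrite mxE.
rewrite (_ : (fun t => _) = fun t : R => \sum_j u j 0 * partial j f (x + t *: u)); last first.
  by apply/funext => s; apply: eq_bigr => j _; rewrite mxE mulrC.
apply: is_derive_bigsum => j; apply: is_deriveZ.
by apply: (@Ck_line m); have [] := Cf j.
Qed.

Lemma hess_line m f x u (t : R) : Ck m.+3 f ->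
  is_derive t 1 (fun t : R => qform (hess f (x + t *: u)) u) (third f (x + t *: u) u).
Proof.
move=> Cf; rewrite (_ : third _ _ _ = \sum_j \sum_k u j 0 * u k 0 *
    \sum_i u i 0 * partial i (partial j (partial k f)) (x + t *: u)); last first.
  rewrite /third exchange_big; apply: eq_bigr => j _; rewrite exchange_big; apply: eq_bigr => k _.
  by rewrite mulr_sumr; apply: eq_bigr => i _; ring.
rewrite (_ : (fun t => _) = fun t : R => \sum_j \sum_k u j 0 * u k 0 * partial j (partial k f) (x + t *: u)); last first.
  apply/funext => s; rewrite /qform /dot; apply: eq_bigr => j _; rewrite mxE mulr_sumr.
  by apply: eq_bigr => k _; rewrite mxE; ring.
apply: is_derive_bigsum => j; apply: is_derive_bigsum => k; apply: is_deriveZ.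
by apply: (@Ck_line m); have [_ /(_ j)[]] := Cf k.
Qed.

Lemma qformZ (A : 'M[R]_p) (t : R) u : qform A (t *: u) = t ^+ 2 * qform A u.
Proof.
rewrite /qform -scalemxAr /dot mulr_sumr; apply: eq_bigr => i _; rewrite !mxE; ring.
Qed.

Lemma value_line m f x u (t : R) : Ck m.+1 f ->
  is_derive t 1 (fun t : R => f (x + t *: u)) (dot (grad f (x + t *: u)) u).
Proof.
move=> /(@Ck_line m f x u t); congr is_derive.
by apply: eq_bigr => i _; rewrite mxE mulrC.
Qed.

Lemma delta3_line f x u (t : R) : delta3 f x (t *: u) =
  f (x + t *: u) - f (x + 0 *: u) - t * dot (grad f (x + 0 *: u)) u -
  t ^+ 2 / 2 * qform (hess f (x + 0 *: u)) u.
Proof.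
rewrite /delta3 scale0r addr0; congr (_ - _ - _).
  by rewrite !dotE -scalemxAr mxE.
by rewrite qformZ; field.
Qed.

Lemma delta3_lipschitz f x u (K s t : R) : Ck 3 f ->
  (forall t, 0 <= t <= 1 -> `|third f (x + t *: u) u| <= K) -> 0 <= s -> s <= t -> t <= 1 ->
  `|delta3 f x (t *: u) - delta3 f x (s *: u)| <= K / 6 * t ^+ 3 - K / 6 * s ^+ 3.
Proof.
move=> Cf HK s0 st t1; rewrite !delta3_line.
exact: (@cubic_remainder_lipschitz R (fun t => f (x + t *: u))
  (fun t => dot (grad f (x + t *: u)) u) (fun t => qform (hess f (x + t *: u)) u)
  (fun t => third f (x + t *: u) u) K (fun t => value_line x u t Cf)
  (fun t => grad_line x u t Cf) (fun t => hess_line x u t Cf) HK).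
Qed.

Lemma delta30 f x : delta3 f x 0 = 0.
Proof. by have := delta3_line f x 0 0; rewrite scale0r => ->; rewrite expr0n/= !mul0r !subr0 subrr. Qed.

Lemma delta3_bound f x u (K : R) : Ck 3 f ->
  (forall t, 0 <= t <= 1 -> `|third f (x + t *: u) u| <= K) -> `|delta3 f x u| <= K / 6.
Proof.
move=> Cf HK; have := delta3_lipschitz Cf HK (lexx 0) ler01 (lexx 1).
by rewrite scale1r scale0r delta30 subr0 expr1n expr0n/= mulr1 mulr0 subr0.
Qed.

Section quadratic_shift.
Variables (f : 'cV[R]_p -> R) (A : 'M[R]_p) (x0 : 'cV[R]_p) (c : R).
Hypothesis Cf : Ck 3 f.
Hypothesis AT : A^T = A.
Let g y := c * (f y + qform A (y - x0) / 2).

Let is_derive_affine (a d : R) (b : 'cV[R]_p -> R) (y v : 'cV[R]_p) :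
  (forall h : R, b (h *: v + y) = b y + h * a + h ^+ 2 * d) -> is_derive y v b a.
Proof.
move=> H; suff K : h^-1 *: (b (h *: v + y) - b y) @[h --> 0^'] --> a.
  by split; [apply/cvg_ex; exists a|exact/cvg_lim].
apply: (@cvg_trans _ ((fun h : R => a + h * d) @ 0^')).
  apply: near_eq_cvg; near=> h; have h0 : h != 0 by near: h; exact: nbhs_dnbhs_neq.
  by rewrite H /GRing.scale/=; field.
have : (fun h : R => a + h * d) @ 0^' --> a + 0 * d.
  apply: cvgD; first exact: cvg_cst.
  apply: cvgMl; exact: nbhs_dnbhs.
by rewrite mul0r addr0.
Unshelve. all: by end_near. Qed.

Lemma qformD (B : 'M[R]_p) v z : B^T = B -> qform B (v + z) = qform B v + 2 * dot v (B *m z) + qform B z.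
Proof.
move=> BT; have E : dot z (B *m v) = dot v (B *m z).
  rewrite !dotE (_ : z^T *m (B *m v) = (v^T *m (B *m z))^T); first by rewrite mxE.
  by rewrite !trmx_mul trmxK BT mulmxA.
rewrite /qform mulmxDr; have D (a b c' : 'cV[R]_p) : dot (a + b) c' = dot a c' + dot b c'.
  by rewrite /dot -big_split; apply: eq_bigr => i _; rewrite mxE mulrDl.
have D' (a b c' : 'cV[R]_p) : dot a (b + c') = dot a b + dot a c'.
  by rewrite /dot -big_split; apply: eq_bigr => i _; rewrite mxE mulrDr.
by rewrite D !D' E; ring.
Qed.

Lemma dotZl (t : R) (v z : 'cV[R]_p) : dot (t *: v) z = t * dot v z.
Proof. by rewrite /dot mulr_sumr; apply: eq_bigr => i _; rewrite mxE mulrA. Qed.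

Let dot_delta i (z : 'cV[R]_p) : dot (delta_mx i 0) z = z i 0.
Proof.
rewrite /dot (bigD1 i)//= mxE !eqxx mul1r big1 ?addr0// => j ji.
by rewrite mxE (negbTE ji) mul0r.
Qed.

Lemma partial_quadratic_shift i : partial i g = fun y => c * (partial i f y + (A *m (y - x0)) i 0).
Proof.
apply/funext => y.
have h1 : is_derive y (delta_mx i 0) f (partial i f y).
  by have [h _] := Cf i; exact/derivableP.
have h2 : is_derive y (delta_mx i 0) (fun y => qform A (y - x0) / 2) (dot (delta_mx i 0) (A *m (y - x0))).
  apply: (@is_derive_affine _ (qform A (delta_mx i 0) / 2)) => h.
  by rewrite -addrA qformD// qformZ dotZl; field.
have h3 := is_deriveZ c (is_deriveD h1 h2).
by have [_ E] := h3; rewrite dot_delta in E; exact: E.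
Qed.

Lemma partial2_quadratic_shift i j :
  partial i (partial j g) = fun y => c * (partial i (partial j f) y + A j i).
Proof.
rewrite partial_quadratic_shift; apply/funext => y.
have h1 : is_derive y (delta_mx i 0) (partial j f) (partial i (partial j f) y).
  by have [_ /(_ i)[h _]] := Cf j; exact/derivableP.
have h2 : is_derive y (delta_mx i 0) (fun y => (A *m (y - x0)) j 0) (A j i).
  apply: (@is_derive_affine _ 0) => h.
  rewrite -addrA mulmxDr -scalemxAr [in LHS]mxE [X in X + _]mxE -colE !mxE; ring.
have h3 := is_deriveZ c (is_deriveD h1 h2).
by have [_ E] := h3; exact: E.
Qed.

(** With c = - 1 / n, A = G^2 and x0 the maximizer, g is h; its Hessian there is D^2 / n, and its
    third derivative is - 1 / n times that of f. *)
Lemma hess_quadratic_shift y : hess g y = c *: (hess f y + A).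
Proof.
apply/matrixP => i j; rewrite !mxE partial2_quadratic_shift.
by rewrite -[in A j i]AT mxE.
Qed.

Lemma third_quadratic_shift y u : third g y u = c * third f y u.
Proof.
have E i j k : partial i (partial j (partial k g)) y = c * partial i (partial j (partial k f)) y.
  rewrite partial2_quadratic_shift.
  have h1 : is_derive y (delta_mx i 0) (partial j (partial k f)) (partial i (partial j (partial k f)) y).
    by have [_ /(_ j)[_ /(_ i)[h _]]] := Cf k; exact/derivableP.
  have h2 := @is_derive_cst R 'cV[R]_p R (A k j) y (delta_mx i 0).
  have h3 := is_deriveZ c (is_deriveD h1 h2).
  by have [_ E] := h3; rewrite addr0 in E; exact: E.
rewrite /third mulr_sumr; apply: eq_bigr => i _; rewrite mulr_sumr; apply: eq_bigr => j _.
rewrite [RHS]mulr_sumr; apply: eq_bigr => k _.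
rewrite [RHS]mulrA.
by apply: (f_equal2 (fun a b : R => a * b) (E i j k)).
Qed.

End quadratic_shift.

End lines.

(** * Euclidean, operator and Frobenius norms *)

Section norms.
Context {R : realType}.

Lemma dotC p (u v : 'cV[R]_p) : dot u v = dot v u.
Proof. by apply: eq_bigr => i _; rewrite mulrC. Qed.

Lemma dot_mulmx q p (A : 'M[R]_(q, p)) (u : 'cV[R]_p) (w : 'cV[R]_q) :
  dot w (A *m u) = dot (A^T *m w) u.
Proof. by rewrite !dotE trmx_mul trmxK mulmxA. Qed.

Lemma dot_ge0 p (u : 'cV[R]_p) : 0 <= dot u u.
Proof. by apply: sumr_ge0 => i _; rewrite -expr2 sqr_ge0. Qed.

Lemma norm2_ge0 p (u : 'cV[R]_p) : 0 <= norm2 u.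
Proof. exact: sqrtr_ge0. Qed.

Lemma norm2_sqr p (u : 'cV[R]_p) : norm2 u ^+ 2 = dot u u.
Proof. by rewrite sqr_sqrtr// dot_ge0. Qed.

Lemma dot_eq0 p (u : 'cV[R]_p) : (dot u u == 0) = (u == 0).
Proof.
apply/idP/eqP => [|->]; last by rewrite /dot big1// => i _; rewrite mxE mul0r.
rewrite psumr_eq0 => [/allP u0|j _]; last by rewrite -expr2 sqr_ge0.
apply/colP => i; rewrite mxE; have := u0 i (mem_index_enum _).
by rewrite /= -expr2 expf_eq0/= => /eqP.
Qed.

Lemma norm2_eq0 p (u : 'cV[R]_p) : (norm2 u == 0) = (u == 0).
Proof. by rewrite sqrtr_eq0 -dot_eq0 eq_le dot_ge0 andbT. Qed.

Lemma norm2_mulmx q p (A : 'M[R]_(q, p)) u : norm2 (A *m u) ^+ 2 = qform (A^T *m A) u.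
Proof. by rewrite norm2_sqr dot_mulmx dotC /qform mulmxA. Qed.

Lemma norm2Z p (t : R) (u : 'cV[R]_p) : norm2 (t *: u) = `|t| * norm2 u.
Proof.
rewrite /norm2 (_ : dot (t *: u) (t *: u) = t ^+ 2 * dot u u).
  by rewrite sqrtrM ?sqr_ge0// sqrtr_sqr.
by rewrite /dot mulr_sumr; apply: eq_bigr => i _; rewrite mxE; ring.
Qed.

Lemma cauchy_schwarz p (u v : 'cV[R]_p) : dot u v <= norm2 u * norm2 v.
Proof.
have [/eqP u0|u0] := boolP (norm2 u == 0).
  have : u = 0 by apply/eqP; rewrite -norm2_eq0 u0.
  by move=> ->; rewrite /dot big1 ?mulr_ge0 ?norm2_ge0// => i _; rewrite mxE mul0r.
have un : 0 < norm2 u by rewrite lt_neqAle eq_sym u0 norm2_ge0.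
have : 0 <= \sum_i (norm2 v * u i 0 - norm2 u * v i 0) ^+ 2 by apply: sumr_ge0 => i _; exact: sqr_ge0.
rewrite (_ : \sum_i _ = norm2 v ^+ 2 * dot u u - 2 * (norm2 u * norm2 v) * dot u v + norm2 u ^+ 2 * dot v v); last first.
  by rewrite /dot !mulr_sumr -sumrB -big_split; apply: eq_bigr => i _ /=; ring.
rewrite -!norm2_sqr => h; have [v0|v0] := eqVneq (norm2 v) 0.
  have : v = 0 by apply/eqP; rewrite -norm2_eq0 v0.
  by move=> ->; rewrite /dot big1 ?mulr_ge0 ?norm2_ge0// => i _; rewrite mxE mulr0.
have vn : 0 < norm2 v by rewrite lt_neqAle eq_sym v0 norm2_ge0.
have uv : 0 < norm2 u * norm2 v by rewrite mulr_gt0.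
rewrite -(ler_pM2l uv); lra.
Qed.

Lemma frobenius_ge0 q p (A : 'M[R]_(q, p)) : 0 <= frobenius A.
Proof. exact: sqrtr_ge0. Qed.

Lemma frobenius_sqr q p (A : 'M[R]_(q, p)) : frobenius A ^+ 2 = \tr (A^T *m A).
Proof.
rewrite sqr_sqrtr; last by apply: sumr_ge0 => i _; apply: sumr_ge0 => j _; exact: sqr_ge0.
rewrite exchange_big /mxtrace; apply: eq_bigr => j _; rewrite mxE.
by apply: eq_bigr => i _; rewrite mxE expr2.
Qed.

Lemma norm2_le_frobenius q p (A : 'M[R]_(q, p)) u : norm2 (A *m u) <= frobenius A * norm2 u.
Proof.
rewrite -(@ler_pXn2r _ 2)// ?nnegrE ?mulr_ge0 ?norm2_ge0 ?frobenius_ge0//.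
rewrite exprMn norm2_sqr /frobenius sqr_sqrtr; last first.
  by apply: sumr_ge0 => i _; apply: sumr_ge0 => j _; exact: sqr_ge0.
rewrite mulr_suml; apply: ler_sum => i _; rewrite -expr2 mxE.
pose a : 'cV[R]_p := \col_j A i j.
have -> : \sum_j A i j * u j 0 = dot a u by apply: eq_bigr => j _; rewrite mxE.
have -> : \sum_j A i j ^+ 2 = norm2 a ^+ 2.
  by rewrite norm2_sqr; apply: eq_bigr => j _; rewrite mxE expr2.
rewrite -exprMn -(@real_normK _ (dot a u)) ?num_real// lerXn2r ?nnegrE ?mulr_ge0 ?norm2_ge0//.
rewrite ler_norml cauchy_schwarz andbT lerNl.
have -> : - dot a u = dot a (- u) by rewrite /dot -sumrN; apply: eq_bigr => j _; rewrite [X in _ = _ * X]mxE mulrN.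
apply: le_trans (cauchy_schwarz _ _) _; rewrite -scaleN1r norm2Z normrN1 mul1r//.
Qed.

Let opset q p (A : 'M[R]_(q, p)) := [set norm2 (A *m u) | u in [set u | norm2 u <= 1]].

Let opset0 q p (A : 'M[R]_(q, p)) : opset A 0.
Proof.
have n0 k : norm2 (0 : 'cV[R]_k) = 0 by apply/eqP; rewrite norm2_eq0.
by exists 0 => /=; [rewrite n0|rewrite mulmx0 n0].
Qed.

Let opset_ub q p (A : 'M[R]_(q, p)) : has_ubound (opset A).
Proof.
exists (frobenius A) => _ [u /= u1 <-]; apply: le_trans (norm2_le_frobenius A u) _.
by rewrite ler_piMr// frobenius_ge0.
Qed.

Lemma opnorm_ge0 q p (A : 'M[R]_(q, p)) : 0 <= opnorm A.
Proof. exact: (ub_le_sup (opset_ub A) (opset0 A)). Qed.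

Lemma norm2_le_opnorm q p (A : 'M[R]_(q, p)) u : norm2 (A *m u) <= opnorm A * norm2 u.
Proof.
have [u0|u0] := eqVneq (norm2 u) 0.
  have -> : u = 0 by apply/eqP; rewrite -norm2_eq0 u0.
  have n0 k : norm2 (0 : 'cV[R]_k) = 0 by apply/eqP; rewrite norm2_eq0.
  by rewrite mulmx0 !n0 mulr0.
have un : 0 < norm2 u by rewrite lt_neqAle eq_sym u0 norm2_ge0.
rewrite -ler_pdivrMr//; apply: (ub_le_sup (opset_ub A)); exists ((norm2 u)^-1 *: u) => /=.
  by rewrite norm2Z ger0_norm ?invr_ge0 ?norm2_ge0// mulVf.
by rewrite -scalemxAr norm2Z ger0_norm ?invr_ge0 ?norm2_ge0// mulrC.
Qed.

Lemma opnorm_le q p (A : 'M[R]_(q, p)) c : (forall u, norm2 u <= 1 -> norm2 (A *m u) <= c) -> opnorm A <= c.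
Proof. by move=> H; apply: ge_sup; [exists 0; exact: opset0|move=> _ [u /= u1 <-]; exact: H]. Qed.

Lemma qform_le_opnorm q (A : 'M[R]_q) u : qform A u <= opnorm A * norm2 u ^+ 2.
Proof.
apply: le_trans (cauchy_schwarz _ _) _; rewrite expr2 mulrA mulrC ler_wpM2r ?norm2_ge0//.
exact: norm2_le_opnorm.
Qed.

(** If M is a contraction so is its transpose, because |M^T w|^2 = <w, M M^T w> is at most |w| |M^T
    w|. *)
Lemma opnorm_gram_le1 q p (M : 'M[R]_(q, p)) :
  (forall v, norm2 (M *m v) <= norm2 v) -> opnorm (M *m M^T) <= 1.
Proof.
move=> HM; have HT w : norm2 (M^T *m w) <= norm2 w.
  have h : norm2 (M^T *m w) ^+ 2 <= norm2 w * norm2 (M^T *m w).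
    rewrite norm2_sqr -dot_mulmx; apply: le_trans (cauchy_schwarz _ _) _.
    by rewrite ler_wpM2l ?norm2_ge0.
  have [n0|n0] := eqVneq (norm2 (M^T *m w)) 0; first by rewrite n0 norm2_ge0.
  have np : 0 < norm2 (M^T *m w) by rewrite lt_neqAle eq_sym n0 norm2_ge0.
  by rewrite -(ler_pM2r np) -expr2.
apply: opnorm_le => u u1; rewrite -mulmxA; apply: le_trans (HM _) _.
exact: le_trans (HT _) u1.
Qed.

(** The theorem measures M M^T, whereas the Gaussian quadratic form is that of M^T M. The two share
    their nonzero eigenvalues, so the weights mu of the form inherit the bound by the operator norm,
    and the Frobenius norm follows from cyclicity of the trace. *)
Lemma gram_diag q p (M : 'M[R]_(q, p)) : exists (V : 'M[R]_p) (mu : 'rV[R]_p),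
  [/\ V^T *m V = 1%:M, (forall v, norm2 (M *m (V *m v)) ^+ 2 = \sum_i mu 0 i * v i 0 ^+ 2),
      (forall i, 0 <= mu 0 i <= opnorm (M *m M^T)) &
      frobenius (M *m M^T) ^+ 2 = \sum_i mu 0 i ^+ 2].
Proof.
have p1 : posdef (1%:M : 'M[R]_p).
  split=> [|u u0]; first exact: trmx1.
  rewrite qform1 lt_neqAle eq_sym sumr_ge0 ?andbT => [|i _]; last exact: sqr_ge0.
  apply: contra_neq u0 => h; apply/eqP; rewrite -dot_eq0 -h.
  by apply/eqP/eq_bigr => i _; rewrite expr2.
have MT : (M^T *m M)^T = M^T *m M by rewrite trmx_mul trmxK.
have [V [mu [Vu V1 VM]]] := simultaneous_diag p1 MT.
rewrite mulmx1 in V1; have V2 : V *m V^T = 1%:M by exact: mulmx1C.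
have normM v : norm2 (M *m (V *m v)) ^+ 2 = \sum_i mu 0 i * v i 0 ^+ 2.
  by rewrite norm2_mulmx qform_mulmx VM qform_diag.
exists V, mu; split=> //.
  move=> i; pose y : 'cV[R]_q := M *m (V *m delta_mx i 0).
  have y2 : norm2 y ^+ 2 = mu 0 i.
    rewrite normM (bigD1 i)//= mxE !eqxx expr1n mulr1 big1 ?addr0// => j ji.
    by rewrite mxE (negbTE ji) expr0n mulr0.
  rewrite -{1}y2 sqr_ge0/=.
  have [y0|y0] := eqVneq (norm2 y) 0; first by rewrite -y2 y0 expr0n opnorm_ge0.
  have yp : 0 < norm2 y by rewrite lt_neqAle eq_sym y0 norm2_ge0.
  (* The image y of the i-th eigenvector is an eigenvector of M M^T; when y = 0 the eigenvalue
     itself is 0. *)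
  have E : M *m M^T *m y = mu 0 i *: y.
    have -> : M *m M^T *m y = M *m (V *m (V^T *m (M^T *m M) *m V *m delta_mx i 0)).
      by rewrite /y !mulmxA -(mulmxA M V) V2 mulmx1.
    rewrite VM mul_diag_mx /y !scalemxAr; congr (M *m (V *m _)).
    apply/matrixP => j k; rewrite !mxE; case: eqP => [->//|_].
    by rewrite !mulr0.
  rewrite -(ler_pM2r yp); have := norm2_le_opnorm (M *m M^T) y.
  by rewrite E norm2Z ger0_norm// -y2 sqr_ge0.
rewrite frobenius_sqr trmx_mul trmxK.
have -> : \tr (M *m M^T *m (M *m M^T)) = \tr (diag_mx mu *m diag_mx mu).
  rewrite -VM; transitivity (\tr (M^T *m M *m (M^T *m M))).
    by rewrite -!mulmxA mxtrace_mulC !mulmxA.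
  rewrite -[in RHS](mulmxA (V^T *m (M^T *m M))) (mulmxA V) (mulmxA V V^T) V2 mul1mx.
  by rewrite -!mulmxA [RHS]mxtrace_mulC !mulmxA -(mulmxA _ V V^T) V2 mulmx1.
rewrite /mxtrace; apply: eq_bigr => i _; rewrite mul_diag_mx mxE mxE eqxx mulr1n expr2//.
Qed.

End norms.

(** * Gibbs integrals as Gaussian integrals *)

Section transfer.
Context {R : realType} {p : nat}.
Variables (f : 'cV[R]_p -> R) (x0 : 'cV[R]_p) (B : 'M[R]_p).
Hypothesis mf : measurable_fun setT f.
Hypothesis uB : B \in unitmx.

(** Up to an additive constant, the logarithm of the density, with respect to the standard Gaussian
    law, of v when x0 + B v has density proportional to e^f. The normalization makes it vanish at v
    = 0; the constant is collected in [c]. *)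
Definition log_density (v : 'cV[R]_p) : R := f (x0 + B *m v) - f x0 + (\sum_i v i 0 ^+ 2) / 2.

Local Notation psi := log_density.

Let c : R := `|\det B| * (expR (f x0) * Num.sqrt ((2 * pi) ^+ p)).

Let c0 : 0 < c.
Proof.
rewrite !mulr_gt0 ?expR_gt0 ?sqrtr_gt0 ?exprn_gt0 ?mulr_gt0 ?pi_gt0// normr_gt0.
by have := uB; rewrite unitmxE unitfE.
Qed.

Lemma measurable_affine : measurable_fun setT (fun v : 'cV[R]_p => x0 + B *m v).
Proof.
rewrite (_ : (fun v => _) = (fun v : 'cV[R]_p => v + x0) \o mulmx B); last first.
  by apply/funext => v /=; rewrite addrC.
by apply: measurableT_comp; [exact: measurable_cV_trans|exact: measurable_mulmx].
Qed.

Lemma measurable_sumsq : measurable_fun setT (fun v : 'cV[R]_p => \sum_i v i 0 ^+ 2).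
Proof. by meas. Qed.

Lemma measurable_log_density : measurable_fun setT psi.
Proof.
apply: measurable_funD; last by apply: measurable_funM => //; exact: measurable_sumsq.
by apply: measurable_funB => //; apply: (measurableT_comp mf); exact: measurable_affine.
Qed.

Lemma transfer_ge0 (F : 'cV[R]_p -> R) : measurable_fun setT F -> (forall y, 0 <= F y) ->
  (\int[lebesgue_cV p]_y (F y * expR (f y))%:E =
   c%:E * \int[@gaussN R p]_v (F (x0 + B *m v) * expR (psi v))%:E)%E.
Proof.
move=> mF F0; pose G y := (F y * expR (f y))%:E.
have mG : measurable_fun setT G.
  by apply/measurable_EFinP; apply: measurable_funM => //; exact: measurableT_comp.
have G0 y : (0 <= G y)%E by rewrite lee_fin mulr_ge0 ?expR_ge0.
have mG' : measurable_fun setT (fun v : 'cV[R]_p => G (v + x0)).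
  by apply: (measurableT_comp mG); exact: measurable_cV_trans.
rewrite -(lebesgue_cV_trans x0 mG G0).
have dB : \det B != 0 by have := uB; rewrite unitmxE unitfE.
rewrite -(lebesgue_cV_linear dB mG' (fun v => G0 _)).
have mFe : measurable_fun setT (fun v => (F (x0 + B *m v) * expR (psi v))%:E).
  apply/measurable_EFinP; apply: measurable_funM.
    by apply: (measurableT_comp mF); exact: measurable_affine.
  by apply: measurableT_comp => //; exact: measurable_log_density.
have Fe0 v : (0 <= (F (x0 + B *m v) * expR (psi v))%:E)%E by rewrite lee_fin mulr_ge0 ?expR_ge0.
rewrite integral_gaussN// /c EFinM -muleA; congr (_ * _)%E.
have k0 : 0 <= expR (f x0) * Num.sqrt ((2 * pi) ^+ p) by rewrite mulr_ge0 ?expR_ge0 ?sqrtr_ge0.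
rewrite -ge0_integralZl//; last 2 first.
- by apply: emeasurable_funM => //; apply/measurable_EFinP; exact: measurable_phi.
- by move=> v _; rewrite mule_ge0// lee_fin ltW// phi_gt0.
apply: eq_integral => v _; rewrite /G -!EFinM phiE /log_density (addrC (B *m v)); congr EFin.
set S := (\sum_i _) / 2; have s0 : 0 < Num.sqrt ((2 * pi : R) ^+ p).
  by rewrite sqrtr_gt0 exprn_gt0// mulr_gt0// pi_gt0.
have -> : expR (f (x0 + B *m v)) = expR (f x0) * expR (f (x0 + B *m v) - f x0 + S) * expR (- S).
  by rewrite -!expRD; congr expR; ring.
by field; rewrite gt_eqF.
Qed.

Lemma fine_scale (k : R) (z : \bar R) : 0 < k -> fine (k%:E * z)%E = k * fine z.
Proof.
move=> k0; case: z => [z||] //=.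
- by rewrite gt0_muley ?lte_fin//= mulr0.
- by rewrite gt0_muleNy ?lte_fin//= mulr0.
Qed.

(** The positive and negative parts, max (s F) 0 for s = 1 and s = - 1, are transferred separately.
    Integrability is required on the Gaussian side, where it is available, and makes the difference
    meaningful. *)
Lemma transfer (F : 'cV[R]_p -> R) : measurable_fun setT F ->
  (@gaussN R p).-integrable setT (EFin \o (fun v => F (x0 + B *m v) * expR (psi v))) ->
  \int[lebesgue_cV p]_y (F y * expR (f y)) =
  c * \int[@gaussN R p]_v (F (x0 + B *m v) * expR (psi v)).
Proof.
move=> mF iF; rewrite /Rintegral.
have pos (s : R) : let g y := Num.max (s * F y) 0 in
    (\int[lebesgue_cV p]_y (g y * expR (f y))%:E =
     c%:E * \int[@gaussN R p]_v (g (x0 + B *m v) * expR (psi v))%:E)%E.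
  apply: transfer_ge0 => [|y]; last by rewrite le_max lexx orbT.
  by apply: measurable_maxr => //; exact: measurable_funM.
have E1 : (\int[lebesgue_cV p]_y (F y * expR (f y))%:E =
    \int[lebesgue_cV p]_y (Num.max (1 * F y) 0 * expR (f y))%:E -
    \int[lebesgue_cV p]_y (Num.max (-1 * F y) 0 * expR (f y))%:E)%E.
  rewrite integralE; congr (_ - _)%E; apply: eq_integral => y _.
    by rewrite funeposE -EFin_max maxr_pMl ?expR_ge0// mul0r mul1r.
  by rewrite funenegE -EFinN -EFin_max maxr_pMl ?expR_ge0// mul0r mulN1r mulNr.
have E2 : (\int[@gaussN R p]_v (F (x0 + B *m v) * expR (psi v))%:E =
    \int[@gaussN R p]_v (Num.max (1 * F (x0 + B *m v)) 0 * expR (psi v))%:E -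
    \int[@gaussN R p]_v (Num.max (-1 * F (x0 + B *m v)) 0 * expR (psi v))%:E)%E.
  rewrite integralE; congr (_ - _)%E; apply: eq_integral => y _.
    by rewrite funeposE -EFin_max maxr_pMl ?expR_ge0// mul0r mul1r.
  by rewrite funenegE -EFinN -EFin_max maxr_pMl ?expR_ge0// mul0r mulN1r mulNr.
have fin (s : R) : (\int[@gaussN R p]_v (Num.max (s * F (x0 + B *m v)) 0 * expR (psi v))%:E)%E \is a fin_num.
  rewrite ge0_fin_numE; last first.
    by apply: integral_ge0 => v _; rewrite lee_fin mulr_ge0 ?expR_ge0// le_max lexx orbT.
  have /integrableP[_] := integrableZl measurableT s iF.
  apply: le_lt_trans; apply: le_integralT.
  - apply/measurable_EFinP; apply: measurable_funM.
      apply: measurable_maxr => //; apply: measurable_funM => //.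
      by apply: (measurableT_comp mF); exact: measurable_affine.
    by apply: measurableT_comp => //; exact: measurable_log_density.
  - apply: measurableT_comp => //; apply: measurable_funeM; apply/measurable_EFinP.
    apply: measurable_funM; first by apply: (measurableT_comp mF); exact: measurable_affine.
    by apply: measurableT_comp => //; exact: measurable_log_density.
  - by move=> v; rewrite lee_fin mulr_ge0 ?expR_ge0// le_max lexx orbT.
  move=> v; rewrite /= lee_fin mulrA normrM (ger0_norm (expR_ge0 _)) ler_wpM2r ?expR_ge0//.
  by rewrite ge_max ler_norm normr_ge0.
rewrite E1 E2 !pos -(fineK (fin 1)) -(fineK (fin (-1))) -!EFinM -!EFinB /=; ring.
Qed.

Lemma transfer_set (A : set 'cV[R]_p) : measurable A ->
  (\int[lebesgue_cV p]_(y in A) (expR (f y))%:E =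
   c%:E * \int[@gaussN R p]_(v in [set v | A (x0 + B *m v)%R]) (expR (psi v))%:E)%E.
Proof.
move=> mA; have mA' : measurable [set v | A (x0 + B *m v)%R].
  by rewrite -[X in measurable X]setTI; exact: measurable_affine.
have mI : measurable_fun setT (\1_A : 'cV[R]_p -> R) by exact: measurable_indic.
have I0 y : 0 <= \1_A y :> R by rewrite indicE.
rewrite integral_mkcond [in RHS]integral_mkcond.
have := transfer_ge0 mI I0.
rewrite (_ : (\int[lebesgue_cV p]_y (\1_A y * expR (f y))%:E =
    \int[lebesgue_cV p]_y ((fun y => (expR (f y))%:E) \_ A) y)%E); last first.
  apply: eq_integral => y _; rewrite /patch indicE; case: (y \in A); last by rewrite mul0r.
  by rewrite mul1r.
move=> ->; congr (_ * _)%E; apply: eq_integral => v _; rewrite /patch indicE.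
have -> : (v \in [set v | A (x0 + B *m v)%R]) = (x0 + B *m v \in A).
  by apply/idP/idP => /set_mem h; apply/mem_set.
by case: (_ \in A); rewrite ?mul1r ?mul0r.
Qed.

Lemma transfer_partition : (\int[lebesgue_cV p]_y (expR (f y))%:E =
  c%:E * \int[@gaussN R p]_v (expR (psi v))%:E)%E.
Proof. exact: (transfer_set measurableT). Qed.

Lemma partition_fin : (\int[lebesgue_cV p]_y (expR (f y))%:E < +oo)%E ->
  (\int[@gaussN R p]_v (expR (psi v))%:E < +oo)%E.
Proof.
rewrite transfer_partition; have : (0 <= \int[@gaussN R p]_v (expR (psi v))%:E)%E.
  by apply: integral_ge0 => v _; rewrite lee_fin expR_ge0.
case: (\int[_]_v _)%E => // [r _ _|]; first by rewrite ltry.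
by rewrite gt0_muley ?lte_fin ?c0.
Qed.

Lemma gibbs_gaussN (A : set 'cV[R]_p) : measurable A -> gibbs f A =
  fine (\int[@gaussN R p]_(v in [set v | A (x0 + B *m v)%R]) (expR (psi v))%:E) /
  fine (\int[@gaussN R p]_v (expR (psi v))%:E).
Proof.
move=> mA; rewrite /gibbs /Rintegral transfer_set// transfer_partition !fine_scale ?c0//.
by rewrite -mulf_div mulfV ?mul1r// gt_eqF ?c0.
Qed.

Lemma gibbs_mean_gaussN i :
  (@gaussN R p).-integrable setT (EFin \o (fun v => (x0 + B *m v) i 0 * expR (psi v))) ->
  gibbs_mean f i 0 = \int[@gaussN R p]_v ((x0 + B *m v) i 0 * expR (psi v)) /
    \int[@gaussN R p]_v expR (psi v).
Proof.
move=> H; rewrite mxE (transfer (measurable_cV_component i) H).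
rewrite [in LHS]/Rintegral transfer_partition fine_scale ?c0//.
by rewrite -mulf_div mulfV ?mul1r// gt_eqF ?c0.
Qed.

End transfer.

(** * The limiting Gaussian law in whitened coordinates *)

Section gauss_transfer.
Context {R : realType} {p : nat}.
Variables (A B : 'M[R]_p).
Hypothesis uB : B \in unitmx.
Hypothesis BA : B^T *m A *m B = 1%:M.

Lemma congr_invmx : [/\ A \in unitmx, invmx A = B *m B^T & \det (invmx A) = \det B ^+ 2].
Proof.
have h : B *m B^T *m A = 1%:M by rewrite -mulmxA; exact: mulmx1C.
have [_ uA] := mulmx1_unit h.
have E : invmx A = B *m B^T by rewrite -[LHS]mul1mx -h mulmxK.
by split=> //; rewrite E det_mulmx det_tr expr2.
Qed.

Let f (y : 'cV[R]_p) : R := - (qform A y / 2).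

Let mf : measurable_fun setT f.
Proof.
rewrite (_ : f = fun y => - ((\sum_i y i 0 * (A *m y) i 0) / 2)) //.
apply: measurable_funN; apply: measurable_funM => //; apply: measurable_sum => i.
apply: measurable_funM; first exact: measurable_cV_component.
apply: (@measurableT_comp _ _ _ _ _ _ (fun y : 'cV[R]_p => y i 0)).
  exact: measurable_cV_component.
exact: measurable_mulmx.
Qed.

Let psi0 v : log_density f 0 B v = 0.
Proof.
rewrite /log_density /f add0r qform_mulmx BA qform1.
have -> : qform A 0 = 0 by rewrite /qform /dot big1// => i _; rewrite mxE mul0r.
by field.
Qed.

(** The case f = - <A y, y> / 2 and x0 = 0 of the transfer formula: the log density vanishes
    identically, and the constants cancel since det (A^-1) = (det B)^2. *)
Lemma gauss_pdf_gaussN (F : 'cV[R]_p -> R) : measurable_fun setT F -> (forall y, 0 <= F y) ->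
  (\int[lebesgue_cV p]_y (F y * gauss_pdf (invmx A) y)%:E =
   \int[@gaussN R p]_v (F (B *m v))%:E)%E.
Proof.
move=> mF F0; have [uA _ dA] := congr_invmx.
pose k : R := (Num.sqrt ((2 * pi) ^+ p * \det (invmx A)))^-1.
have k0 : 0 <= k by rewrite invr_ge0 sqrtr_ge0.
have mE : measurable_fun setT (fun y => (F y * expR (f y))%:E).
  by apply/measurable_EFinP; apply: measurable_funM => //; exact: measurableT_comp.
transitivity (k%:E * \int[lebesgue_cV p]_y (F y * expR (f y))%:E)%E.
  rewrite -ge0_integralZl//; last by move=> y _; rewrite lee_fin mulr_ge0 ?expR_ge0.
  by apply: eq_integral => y _; rewrite -EFinM /gauss_pdf invmxK; congr EFin; rewrite /k /f; ring.
rewrite (transfer_ge0 0 mf uB mF F0) muleA -EFinM.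
have dB : `|\det B| != 0 by rewrite normr_eq0; have := uB; rewrite unitmxE unitfE.
have pp : 0 < (2 * pi : R) ^+ p by rewrite exprn_gt0// mulr_gt0// pi_gt0.
have -> : k * (`|\det B| * (expR (f 0) * Num.sqrt ((2 * pi) ^+ p))) = 1.
  have -> : f 0 = 0.
    by rewrite /f /qform /dot big1 ?mul0r ?oppr0// => i _; rewrite mxE mul0r.
  rewrite expR0 mul1r /k dA sqrtrM ?(ltW pp)// sqrtr_sqr.
  by field; rewrite dB gt_eqF// sqrtr_gt0.
rewrite mul1e; apply: eq_integral => v _; rewrite psi0 expR0 mulr1 add0r//.
Qed.

Lemma gauss_gaussN (C : set 'cV[R]_p) : measurable C ->
  gauss (invmx A) C = fine (@gaussN R p [set v | C (B *m v)]).
Proof.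
move=> mC; rewrite /gauss /Rintegral; congr fine.
have mC' : measurable [set v | C (B *m v)].
  by rewrite -[X in measurable X]setTI; exact: measurable_mulmx.
rewrite integral_mkcond -[X in _ = gaussN X]setIT -integral_indic//.
have mI : measurable_fun setT (\1_C : 'cV[R]_p -> R) by exact: measurable_indic.
have I0 y : 0 <= \1_C y :> R by rewrite indicE.
rewrite (_ : (\int[@gaussN R p]_v (\1_[set v | C (B *m v)] v)%:E =
    \int[@gaussN R p]_v (\1_C (B *m v))%:E)%E); last first.
  apply: eq_integral => v _; rewrite !indicE.
  have -> // : (v \in [set v | C (B *m v)]) = (B *m v \in C).
  by apply/idP/idP => /set_mem h; apply/mem_set.
rewrite -(gauss_pdf_gaussN mI I0); apply: eq_integral => y _; rewrite /patch indicE.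
by case: (y \in C); rewrite ?mul1r ?mul0r.
Qed.

Lemma gauss_expectation_gaussN (F : 'cV[R]_p -> R) : measurable_fun setT F -> (forall y, 0 <= F y) ->
  gauss_expectation (invmx A) F = (\int[@gaussN R p]_v (F (B *m v))%:E)%E.
Proof. exact: gauss_pdf_gaussN. Qed.

End gauss_transfer.

Section convexity.
Context {R : realType}.

Lemma convex_functionP p (f : 'cV[R]_p -> R) (a b : 'cV[R]_p) (t : R) :
  convex_function setT f -> 0 <= t <= 1 ->
  f (t *: a + (1 - t) *: b) <= t * f a + (1 - t) * f b.
Proof.
move=> cf /andP[t0 t1].
exact: (cf (Itv01 t0 t1) a b (in_setT _) (in_setT _)).
Qed.

End convexity.

(** * Local expansion of f and its behaviour along rays *)

Section local_geometry.
Context {R : realType} {p : nat}.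
Variables (f : 'cV[R]_p -> R) (xs : 'cV[R]_p) (G D : 'M[R]_p).
Variables (r n c3 : R) (tau3 : 'cV[R]_p -> R) (h : 'cV[R]_p -> R) (U : set 'cV[R]_p).

Local Notation DG2 := (- hess f xs).
Local Notation D2 := (DG2 - G *m G).
Local Notation ell := (fun y => f y + norm2 (G *m (y - xs)) ^+ 2 / 2).

Hypothesis p0 : (0 < p)%N.
Hypothesis r0 : 0 < r.
Hypothesis Cf : Ck 3 f.
Hypothesis fmax : forall y, f y <= f xs.
Hypothesis GT : G^T = G.
Hypothesis DT : D^T = D.
Hypothesis DD : D *m D = D2.
Hypothesis subU : forall u, norm2 (D *m u) <= r -> U u.
Hypothesis tau3Z : forall (t : R) u, tau3 (t *: u) = `|t| ^+ 3 * tau3 u.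
Hypothesis tau3_le : forall u, U u -> `|delta3 f xs u| <= tau3 u / 6.
Hypothesis ell_concave : convex_function setT (fun u => - ell (xs + u)).
Hypothesis n0 : 0 < n.
Hypothesis ellE : forall y, - ell y = n * h y.
Hypothesis h_convex : strongly_convex h.
Hypothesis third_le : (third_ratio_sup h xs U <= c3%:E)%E.

Let kap := c3 * n `^ (- (1 / 2)).

Lemma normD u : norm2 (D *m u) ^+ 2 = qform D2 u.
Proof. by rewrite norm2_mulmx DT DD. Qed.

Lemma normG u : norm2 (G *m u) ^+ 2 = qform (G *m G) u.
Proof. by rewrite norm2_mulmx GT. Qed.

Lemma qformB (A B : 'M[R]_p) u : qform (A - B) u = qform A u - qform B u.
Proof.
by rewrite !qformE mulmxBr mulmxBl mxE [X in _ + X]mxE.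
Qed.

Lemma qformN (A : 'M[R]_p) u : qform (- A) u = - qform A u.
Proof. by rewrite !qformE mulmxN mulNmx mxE. Qed.

Lemma small_ellipsoid u : exists2 t0 : R, 0 < t0 & forall t, 0 < t -> t <= t0 ->
  norm2 (D *m (t *: u)) <= r /\ norm2 (D *m (- t *: u)) <= r.
Proof.
have c0 : 0 < 1 + norm2 (D *m u) by rewrite ltr_pwDl// norm2_ge0.
exists (r / (1 + norm2 (D *m u))); first by rewrite divr_gt0.
move=> t t0; rewrite ler_pdivlMr// => tr.
have E : t * norm2 (D *m u) <= r.
  by apply: le_trans tr; rewrite ler_wpM2l ?(ltW t0)// lerDr.
by rewrite -!scalemxAr !norm2Z normrN gtr0_norm.
Qed.

(** The bound by tau_3 holds on U only; homogeneity extends the sign from small multiples of u to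
    u. *)
Lemma tau3_ge0 u : 0 <= tau3 u.
Proof.
have [t0 t00 H] := small_ellipsoid u.
have [h1 _] := H t0 t00 (lexx _); have := le_trans (normr_ge0 _) (tau3_le (subU h1)).
rewrite tau3Z => h2; have t3 : 0 < `|t0| ^+ 3 by rewrite exprn_gt0// normr_gt0 gt_eqF.
by rewrite -(pmulr_rge0 _ t3); lra.
Qed.

Lemma delta3E u : f (xs + u) - f xs = dot (grad f xs) u - qform DG2 u / 2 + delta3 f xs u.
Proof. by rewrite /delta3 qformN; field. Qed.

Lemma delta3_small u t : norm2 (D *m (t *: u)) <= r -> `|delta3 f xs (t *: u)| <= `|t| ^+ 3 * tau3 u / 6.
Proof. by move=> h1; rewrite -tau3Z; exact/tau3_le/subU. Qed.

(** Maximality along t w, with quadratic and cubic terms of order t^2, bounds the directional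
    derivative by 0, for w and for - w. *)
Lemma grad_max u : dot (grad f xs) u = 0.
Proof.
have key w : dot (grad f xs) w <= 0.
  have [t0 t00 H] := small_ellipsoid w.
  have m0 : 0 < Num.min t0 1 by rewrite lt_min t00 ltr01.
  apply: (@le_of_small R _ _ (`|qform DG2 w| / 2 + tau3 w / 6) _ m0) => t tp.
  rewrite le_min => /andP[tt t1].
  have [h1 _] := H t tp tt; have := delta3_small h1; have := fmax (xs + t *: w).
  rewrite -subr_le0 delta3E qformZ dotC dotZl dotC (gtr0_norm tp) ler_norml => h2 /andP[h3 h4].
  have tau0 := tau3_ge0 w.
  have t3 : t ^+ 3 * tau3 w / 6 <= t ^+ 2 * (tau3 w / 6).
    by rewrite -mulrA ler_wpM2r ?divr_ge0// exprS ler_piMl ?exprn_ge0 ?(ltW tp).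
  have q2 : t ^+ 2 * qform DG2 w <= t ^+ 2 * `|qform DG2 w| by rewrite ler_wpM2l ?sqr_ge0 ?ler_norm.
  rewrite -(ler_pM2l tp) add0r; move: h2 h3 t3 q2; rewrite !expr2; lra.
apply/eqP; rewrite eq_le key /=; have := key (- u).
by rewrite -scaleN1r dotC dotZl dotC mulN1r oppr_le0.
Qed.

(** Strong convexity of h is used through the midpoint of xs + t u and xs - t u: first order terms
    cancel, division by t^2 leaves n m |u|^2 <= <D^2 u, u> + t tau_3(u) / 3, and t tends to 0. *)
Lemma D2_posdef u : u != 0 -> 0 < qform D2 u.
Proof.
move=> un0; have [m m0 cm] := h_convex.
have u2 : 0 < norm2 u ^+ 2 by rewrite exprn_gt0// lt_neqAle norm2_ge0 eq_sym norm2_eq0 un0.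
have [t0 t00 H] := small_ellipsoid u.
have := @le_of_small R (n * m * norm2 u ^+ 2) (qform D2 u) (tau3 u / 3) t0 t00.
move=> key; apply: (@lt_le_trans _ _ (n * m * norm2 u ^+ 2)); first by rewrite mulr_gt0// mulr_gt0.
apply: key => t tp tt; have [h1 h2] := H t tp tt.
have d1 := delta3_small h1; have d2 := delta3_small h2.
have := convex_functionP (xs + t *: u) (xs - t *: u) cm (_ : 0 <= 1 / 2 <= 1).
have -> : 1 / 2 *: (xs + t *: u) + (1 - 1 / 2) *: (xs - t *: u) = xs.
  by apply/colP => i; rewrite !mxE; field.
move=> /(_ _) H1; have {}H1 := H1 ltac:(lra).
have par : norm2 (xs + t *: u) ^+ 2 + norm2 (xs - t *: u) ^+ 2 = 2 * norm2 xs ^+ 2 + 2 * (t ^+ 2 * norm2 u ^+ 2).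
  rewrite !norm2_sqr /dot -big_split !mulr_sumr -big_split/=; apply: eq_bigr => i _.
  by rewrite !mxE; ring.
have hE y : h y = - (f y + qform (G *m G) (y - xs) / 2) / n.
  by rewrite -normG ellE mulrC mulKf// gt_eqF.
have hp s : h (xs + s *: u) = - (f xs - s ^+ 2 * qform D2 u / 2 + delta3 f xs (s *: u)) / n.
  rewrite hE -[f (xs + _)](subrK (f xs)) delta3E grad_max add0r qformZ (addrC xs) addrK.
  by rewrite qformZ qformB; congr (- _ / _); field.
have hx : h xs = - f xs / n.
  have := hp 0; rewrite scale0r addr0 => ->; rewrite delta30 expr0n/= !mul0r; congr (- _ / _); ring.
have hm : h (xs + - t *: u) = - (f xs - t ^+ 2 * qform D2 u / 2 + delta3 f xs (- t *: u)) / n.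
  by rewrite (hp (- t)); have -> : (- t) ^+ 2 = t ^+ 2 by exact: sqrrN.
have E2 : xs - t *: u = xs + - t *: u by rewrite scaleNr.
rewrite E2 in H1 par; rewrite (hp t) hm hx in H1.
have H2 : n * m * (t ^+ 2 * norm2 u ^+ 2) <= t ^+ 2 * qform D2 u -
    (delta3 f xs (t *: u) + delta3 f xs (- t *: u)).
  have e1 : - f xs / n = - (1 / n) * f xs by field; rewrite gt_eqF.
  have e2 z : - (f xs - t ^+ 2 * qform D2 u / 2 + z) / n = (1 / n) * (- f xs + t ^+ 2 * qform D2 u / 2 - z).
    by field; rewrite gt_eqF.
  rewrite !e2 e1 in H1.
  have ni : n * (1 / n) = 1 by field; rewrite gt_eqF.
  have H3 := ler_wpM2l (ltW n0) H1.
  have := par; move: (norm2 (xs + t *: u) ^+ 2) (norm2 (xs + - t *: u) ^+ 2) H3 => A B H3 AB.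
  have : n * (1 / n) * (t ^+ 2 * qform D2 u - (delta3 f xs (t *: u) + delta3 f xs (- t *: u))) -
    n * m * (t ^+ 2 * norm2 u ^+ 2) = 2 * (n * (1 / 2 * (1 / n * (- f xs + t ^+ 2 * qform D2 u / 2 - delta3 f xs (t *: u)) - m / 2 * A) +
          (1 - 1 / 2) * (1 / n * (- f xs + t ^+ 2 * qform D2 u / 2 - delta3 f xs (- t *: u)) - m / 2 * B)) -
       n * (- (1 / n) * f xs - m / 2 * norm2 xs ^+ 2)).
    rewrite (_ : A = 2 * norm2 xs ^+ 2 + 2 * (t ^+ 2 * norm2 u ^+ 2) - B); last by rewrite -AB addrK.
    by field; rewrite gt_eqF.
  by rewrite ni mul1r => E; rewrite -subr_ge0 E mulr_ge0// subr_ge0.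
have t2 : 0 < t ^+ 2 by rewrite exprn_gt0.
rewrite -(ler_pM2l t2); move: d1 d2; rewrite normrN (gtr0_norm tp) !ler_norml => /andP[d1 _] /andP[d2 _].
have -> : t ^+ 2 * (n * m * norm2 u ^+ 2) = n * m * (t ^+ 2 * norm2 u ^+ 2) by ring.
apply: (le_trans H2); have -> : t ^+ 2 * (qform D2 u + t * (tau3 u / 3)) = t ^+ 2 * qform D2 u + t ^+ 3 * tau3 u / 3 by ring.
lra.
Qed.

Lemma hE y : h y = - (1 / n) * (f y + qform (G *m G) (y - xs) / 2).
Proof.
rewrite -normG; have := ellE y; set e := f y + _ => E.
by apply: (mulfI (lt0r_neq0 n0)); rewrite -E; field; rewrite gt_eqF.
Qed.

Lemma ratio_le_c3 u t : norm2 (D *m u) <= r -> u != 0 -> 0 <= t <= 1 ->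
  `|third h (xs + t *: u) u| / qform (hess h xs) u `^ (3 / 2) <= c3.
Proof.
move=> uU un0 t01; rewrite -lee_fin; apply: le_trans third_le.
apply: (@le_trans _ _ (ereal_sup [set (`|third h (xs + t *: u) u| / qform (hess h xs) u `^ (3 / 2))%:E
    | t in `[0, 1]])).
  by apply: ereal_sup_ubound; exists t => //=; rewrite in_itv.
apply: ereal_sup_ubound; exists u => //; split; first exact: subU.
by move=> /= u0; rewrite u0 eqxx in un0.
Qed.

(** This is where p > 0 matters: the suprema defining [omega] and [third_ratio_sup] range over
    nonempty sets of nonnegative numbers, so [omega] and c3 are nonnegative. *)
Lemma exists_direction : exists2 u : 'cV[R]_p, u != 0 & norm2 (D *m u) <= r.
Proof.
case: p p0 f xs G D U subU DT DD => [//|q] _ f' xs' G' D' U' _ _ _.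
have c0 : 0 < 1 + norm2 (D' *m delta_mx ord0 0) by rewrite ltr_pwDl// norm2_ge0.
exists ((r / (1 + norm2 (D' *m delta_mx ord0 0))) *: delta_mx ord0 0).
  apply/eqP => /colP /(_ ord0); rewrite !mxE !eqxx mulr1 => /eqP.
  by rewrite gt_eqF// divr_gt0.
rewrite -scalemxAr norm2Z gtr0_norm ?divr_gt0// mulrAC ler_pdivrMr// ler_pM2l//.
by rewrite lerDr.
Qed.

Lemma c3_ge0 : 0 <= c3.
Proof.
have [u un0 uU] := exists_direction.
apply: le_trans (ratio_le_c3 uU un0 (_ : 0 <= 0 <= 1)); last by rewrite lexx ler01.
by rewrite divr_ge0// powR_ge0.
Qed.

Lemma kap_ge0 : 0 <= kap.
Proof. by rewrite mulr_ge0 ?c3_ge0 ?powR_ge0. Qed.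

(** Since h = - ell / n and the quadratic term has no third derivative, |third h| = |third f| / n,
    while the Hessian form of h at xs is |D u|^2 / n. The powers of n combine to the n^(-1/2)
    contained in kap. *)
Lemma third_bound u t : norm2 (D *m u) <= r -> 0 <= t <= 1 ->
  `|third f (xs + t *: u) u| <= kap * norm2 (D *m u) ^+ 3.
Proof.
move=> uU t01; have [->|un0] := eqVneq u 0.
  rewrite (_ : third _ _ _ = 0); first by rewrite normr0 mulr_ge0 ?kap_ge0// exprn_ge0// norm2_ge0.
  rewrite /third big1// => i _; rewrite big1// => j _; rewrite big1// => k _.
  by rewrite mxE !mul0r mulr0.
have := ratio_le_c3 uU un0 t01.
have AT : (G *m G)^T = G *m G by rewrite trmx_mul GT.
have hF : h = fun y => - (1 / n) * (f y + qform (G *m G) (y - xs) / 2).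
  by apply/funext => y; exact: hE.
rewrite hF third_quadratic_shift// hess_quadratic_shift//.
have -> : qform (- (1 / n) *: (hess f xs + G *m G)) u = qform D2 u / n.
  have -> : - (1 / n) *: (hess f xs + G *m G) = n^-1 *: D2.
    by rewrite -opprD scaleNr scalerN mul1r.
  by rewrite qformE -scalemxAr -scalemxAl mxE -qformE mulrC.
rewrite -normD; have N0 : 0 < norm2 (D *m u).
  rewrite lt_neqAle norm2_ge0 andbT eq_sym.
  by have := D2_posdef un0; rewrite -normD; case: eqP => // ->; rewrite expr0n ltxx.
set N := norm2 (D *m u) in N0 *.
have sn : 0 < n `^ (1 / 2) by rewrite powR_gt0.
have sn2 : n `^ (1 / 2) * n `^ (1 / 2) = n.
  by rewrite -powRD ?gt_eqF// (_ : 1 / 2 + 1 / 2 = 1) ?powRr1 ?(ltW n0)//; field.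
have kE : kap = c3 / n `^ (1 / 2) by rewrite /kap powRN.
have -> : (N ^+ 2 / n) `^ (3 / 2) = (N / n `^ (1 / 2)) ^+ 3.
  have -> : N ^+ 2 / n = (N / n `^ (1 / 2)) `^ 2.
    rewrite powR_mulrn ?divr_ge0 ?(ltW N0) ?(ltW sn)// expr_div_n.
    by rewrite [n `^ _ ^+ 2]expr2 sn2.
  rewrite -powRrM (_ : 2 * (3 / 2) = 3%:R :> R); last by field.
  by rewrite powR_mulrn// divr_ge0 ?(ltW N0) ?(ltW sn).
have Nn : 0 < (N / n `^ (1 / 2)) ^+ 3 by rewrite exprn_gt0// divr_gt0.
move: (third f (xs + t *: u) u) => z.
have -> : `|- (1 / n) * z| = `|z| / n.
  rewrite normrM normrN.
  by rewrite (gtr0_norm (divr_gt0 ltr01 n0)); field; rewrite gt_eqF.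
rewrite ler_pdivrMr// ler_pdivrMr//.
move=> /le_trans; apply; rewrite kE le_eqVlt; apply/orP; left; apply/eqP.
by rewrite -[X in _ * X = _]sn2; field; rewrite gt_eqF.
Qed.

Lemma delta3_cubic u : norm2 (D *m u) <= r -> `|delta3 f xs u| <= kap / 6 * norm2 (D *m u) ^+ 3.
Proof.
by move=> uU; rewrite mulrAC; apply: delta3_bound => // t t01; exact: third_bound.
Qed.

(* Along the ray through a boundary point u of the ellipsoid, ell is concave and
   its slope at u is at most - (5 / 8) r ^ 2, because kap r <= 3 / 4. *)
Lemma delta3_outside u s : kap * r <= 3 / 4 -> norm2 (D *m u) = r -> 1 < s ->
  delta3 f xs (s *: u) <= (s ^+ 2 - 1) / 2 * r ^+ 2 - 5 / 8 * r ^+ 2 * (s - 1) + delta3 f xs u.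
Proof.
(* A is t -> ell (xs + t u) - f xs; its quadratic part is - t^2 r^2 / 2 because |D u| = r. *)
move=> kr ur s1; pose A (t : R) := - (t ^+ 2 / 2) * r ^+ 2 + delta3 f xs (t *: u).
have eA t : ell (xs + t *: u) = f xs + A t.
  rewrite (addrC xs) addrK -scalemxAr norm2Z exprMn real_normK ?num_real// normG.
  rewrite -[f _](subrK (f xs)) (addrC _ xs) delta3E grad_max qformZ /A -ur normD qformB.
  by field.
have cA a b t : 0 <= t <= 1 -> t * A a + (1 - t) * A b <= A (t * a + (1 - t) * b).
  move=> t01; have := convex_functionP (a *: u) (b *: u) ell_concave t01.
  rewrite !scalerA -scalerDl !eA; lra.
suff : A s <= A 1 - 5 / 8 * r ^+ 2 * (s - 1).
  by rewrite /A scale1r expr1n; lra.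
apply: (@le_of_small R _ _ (r ^+ 2 / 2 * (s - 1)) 1 ltr01) => e e0 e1.
(* The quadratic part has slope - r^2 at 1, and the remainder contributes at most kap r^3 / 2 <= 3/8
   r^2; their sum is - 5/8 r^2. *)
have d : A 1 - A (1 - e) <= - (5 / 8) * r ^+ 2 * e + r ^+ 2 / 2 * e ^+ 2.
  have := @delta3_lipschitz R p f xs u (kap * r ^+ 3) (1 - e) 1 Cf.
  have H t : 0 <= t <= 1 -> `|third f (xs + t *: u) u| <= kap * r ^+ 3.
    by move=> t01; rewrite -ur; apply: third_bound => //; rewrite ur.
  move=> /(_ H); rewrite subr_ge0 e1 gerBl (ltW e0) lexx scale1r => /(_ isT isT isT).
  rewrite ler_norml expr1n => /andP[_ h1].
  have k3 : kap * r ^+ 3 <= 3 / 4 * r ^+ 2 by rewrite exprSr mulrA mulrAC ler_wpM2r ?sqr_ge0.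
  have k0 : 0 <= kap * r ^+ 3 by rewrite mulr_ge0 ?kap_ge0// exprn_ge0// ltW.
  have h2 : kap * r ^+ 3 / 6 * (1 - (1 - e) ^+ 3) <= 3 / 4 * r ^+ 2 / 6 * (3 * e).
    apply: ler_pM => //; first by rewrite divr_ge0.
    - by rewrite subr_ge0 exprn_ile1// ?subr_ge0// gerBl ltW.
    - by rewrite ler_pM2r.
    - by rewrite !exprS expr0; nra.
  by rewrite /A scale1r expr1n; move: h1 h2; rewrite !expr2; lra.
(* t is the weight that writes 1 as a convex combination of s and 1 - e, so concavity extrapolates
   the slope from inside the ellipsoid to s. *)
pose t := e / (s - 1 + e); have se : 0 < s - 1 + e by lra.
have t01 : 0 <= t <= 1 by rewrite divr_ge0 ?(ltW e0) ?(ltW se)//= ler_pdivrMr// mul1r; lra.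
have := cA s (1 - e) t t01; have -> : t * s + (1 - t) * (1 - e) = 1.
  by rewrite /t; field; rewrite gt_eqF.
have tE : t * (s - 1 + e) = e by rewrite /t divfK// gt_eqF.
move=> hc; have {}hc : e * A s + (s - 1) * A (1 - e) <= (s - 1 + e) * A 1.
  apply: le_trans (ler_wpM2l (ltW se) hc); rewrite le_eqVlt; apply/orP; left; apply/eqP.
  by rewrite -{1}tE; move: (A s) (A (1 - e)) => X Y; rewrite /t; field; rewrite gt_eqF.
have h2 : (s - 1) * (A 1 - A (1 - e)) <= (s - 1) * (- (5 / 8) * r ^+ 2 * e + r ^+ 2 / 2 * e ^+ 2).
  by rewrite ler_wpM2l//; lra.
rewrite -(ler_pM2l e0); move: hc h2; rewrite (expr2 e); lra.
Qed.

End local_geometry.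

(** * Simultaneous whitening and positivity of the partition function *)

Section whitening.
Context {R : realType}.

Lemma whitening p (A C : 'M[R]_p) : posdef A -> C^T = C ->
  (forall u, u != 0 -> 0 < qform C u) -> (forall u, qform C u <= qform A u) ->
  exists (B : 'M[R]_p) (l : 'I_p -> R), [/\ B \in unitmx, B^T *m A *m B = 1%:M,
    forall v, qform C (B *m v) = quad l v, forall i, 0 < l i <= 1 &
    eff_dim C A = \sum_i l i].
Proof.
move=> Apos CT Cpos CA; have [B [d [uB BA BC]]] := simultaneous_diag Apos CT.
have qC v : qform C (B *m v) = quad (fun i => d 0 i) v by rewrite qform_mulmx BC qform_diag.
have qi i : quad (fun i => d 0 i) (delta_mx i 0 : 'cV[R]_p) = d 0 i.
  rewrite /quad (bigD1 i)//= big1 ?addr0; first by rewrite mxE !eqxx expr1n mulr1.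
  by move=> j ji; rewrite mxE (negbTE ji) expr0n mulr0.
exists B, (fun i => d 0 i); split => // [i|].
  have n0 : B *m (delta_mx i 0 : 'cV[R]_p) != 0.
    apply/eqP => /(congr1 (mulmx (invmx B))); rewrite mulKmx// mulmx0 => /colP /(_ i).
    by rewrite !mxE !eqxx => /eqP; rewrite oner_eq0.
  rewrite -qi -qC Cpos//=; apply: (le_trans (CA _)).
  rewrite qform_mulmx BA qform1 (bigD1 i)//= big1 ?addr0; first by rewrite mxE !eqxx expr1n.
  by move=> j ji; rewrite mxE (negbTE ji) expr0n.
have [_ congr_inv _] := congr_invmx BA.
by rewrite /eff_dim congr_inv mulmxA mxtrace_mulC mulmxA BC mxtrace_diag.
Qed.

Lemma partition_gt0 p (psi : 'cV[R]_p -> R) : measurable_fun setT psi ->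
  (\int[@gaussN R p]_v (expR (psi v))%:E < +oo)%E ->
  0 < fine (\int[@gaussN R p]_v (expR (psi v))%:E).
Proof.
move=> mpsi fin; have I0 : (0 <= \int[@gaussN R p]_v (expR (psi v))%:E)%E.
  by apply: integral_ge0 => v _; rewrite lee_fin expR_ge0.
have me : measurable_fun setT (fun v => (expR (psi v))%:E).
  by apply/measurable_EFinP; exact: measurableT_comp.
rewrite lt_neqAle fine_ge0// andbT eq_sym fine_eq0 ?ge0_fin_numE//.
apply/eqP => E0.
have : (\int[@gaussN R p]_v `|(expR (psi v))%:E| = 0)%E.
  by rewrite -E0; apply: eq_integral => v _; rewrite gee0_abs// lee_fin expR_ge0.
move/(ae_eq_integral_abs _ measurableT me) => -[A [mA A0 sub]].
have AT : A = setT.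
  apply/seteqP; split => // v _; apply: sub => /= /(_ I) /eqP.
  by rewrite eqe gt_eqF// expR_gt0.
have A1 : @gaussN R p A = 1%E by rewrite AT; exact: probability_setT.
by have /eqP := etrans (esym A1) A0; rewrite eqe oner_eq0.
Qed.

End whitening.

(** * The total variation bound with explicit constants *)

Section total_variation_bound.
Context {R : realType}.

(** For such x the total variation claim is void. The number e^(-32/25) is the 16th power of
    e^(-2/25) >= 23/25, computed by repeated squaring. *)
Lemma expRN_ge (x : R) : x <= 32 / 25 -> 1 <= 4 * expR (- x).
Proof.
move=> xle; have h1 : expR (- (32 / 25)) <= expR (- x) by rewrite ler_expR lerN2.
have h2 : 23 / 25 <= expR (- (2 / 25) : R) by apply: le_trans (expR_ge1Dx _); lra.
have E : expR (- (32 / 25) : R) = (((expR (- (2 / 25)) ^+ 2) ^+ 2) ^+ 2) ^+ 2.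
  by rewrite -!exprM -expRM_natr; congr expR; lra.
move: h2 E h1; set a := expR (- (2 / 25)) => h2 E h1.
have k1 : (84 + 6 / 10) / 100 <= a ^+ 2 by rewrite expr2; nra.
have k2 : 71 / 100 <= (a ^+ 2) ^+ 2 by rewrite expr2; nra.
have k3 : 1 / 2 <= ((a ^+ 2) ^+ 2) ^+ 2 by rewrite (expr2 ((a ^+ 2) ^+ 2)); move: k2; set c := (a ^+ 2) ^+ 2; nra.
have k4 : 1 / 4 <= (((a ^+ 2) ^+ 2) ^+ 2) ^+ 2 by rewrite (expr2 (((a ^+ 2) ^+ 2) ^+ 2)); move: k3; set c := ((a ^+ 2) ^+ 2) ^+ 2; nra.
lra.
Qed.

Variables (p : nat) (l : 'I_p -> R) (r x : R) (psi T : 'cV[R]_p -> R) (w w0 y : R).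
Local Notation Y := (quad l).
Hypothesis l01 : forall i, 0 <= l i <= 1.
Hypothesis P0 : 0 < \sum_i l i.
Hypothesis rE : r = 2 * Num.sqrt (\sum_i l i) + Num.sqrt (2 * x).
Hypothesis Tle : forall v, Y v <= r ^+ 2 -> `|psi v| <= T v.
Hypothesis T0 : forall v, 0 <= T v.
Hypothesis mT : measurable_fun setT T.
Hypothesis mpsi : measurable_fun setT psi.
Hypothesis psiw : forall v, Y v <= r ^+ 2 -> `|psi v| <= w * Y v / 2.
Hypothesis psi_cvx : forall (t : R) (v u : 'cV[R]_p), 0 <= t <= 1 ->
  (1 - t) * psi v + t * psi u - t * (1 - t) / 2 * Y (v - u) <= psi ((1 - t) *: v + t *: u).
Hypothesis T3 : forall (t : R) (v : 'cV[R]_p), T (t *: v) = `|t| ^+ 3 * T v.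
Hypothesis w14 : 0 <= w <= 1 / 4.
Hypothesis wP : w * \sum_i l i <= 2 / 3.
Hypothesis psi_out : forall (v : 'cV[R]_p) (t : R), t ^+ 2 = Y v -> r < t ->
  psi v <= (t ^+ 2 - r ^+ 2) / 2 - 5 / 8 * r * (t - r) + psi ((r / t) *: v).
Hypothesis ww0 : w <= w0.
Hypothesis w013 : w0 <= 1 / 3.
Hypothesis y0 : 0 < y.
Hypothesis yy : y * y = (1 - w0) ^+ 3.
Hypothesis fin : (\int[@gaussN R p]_v (expR (psi v))%:E < +oo)%E.

(* W / 6 <= (1 - w0)^(-3/2): for w > 1/6 the right side exceeds
   (6/5)^(3/2) > 13/10 = (39/5) / 6. *)
Lemma weight_const : exists2 W : R, W = 39 / 5 \/ W = 6 /\ w <= 1 / 6 & W <= 6 / y.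
Proof.
have h := w14; have h2 := ww0; have h3 := w013; have h4 := y0; have h5 := yy.
have c1 : (1 - w0) ^+ 3 <= 1 by rewrite exprn_ile1//; lra.
have [w6|w6] := leP w (1 / 6).
  exists 6; first by right.
  by rewrite ler_pdivlMr//; nra.
exists (39 / 5); first by left.
rewrite ler_pdivlMr//; have c2 : (1 - w0) ^+ 3 <= (5 / 6) ^+ 3.
  by rewrite ler_pXn2r ?nnegrE//; lra.
have : y * y <= (10 / 13) ^+ 2 by rewrite h5; apply: (le_trans c2); rewrite !exprS !expr0; lra.
by rewrite !exprS expr0; nra.
Qed.

(** Here w0 stands for omega and y for (1 - omega)^(3/2), given through y * y to stay with integer
    powers; as T is tau_3 / 6, the term 6 E T / (4 y) is [diamond3]. Small x and an infinite mean of
    T are trivial cases. *)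
Lemma reweighted_tv A : measurable A ->
  (`|fine (\int[@gaussN R p]_(v in A) (expR (psi v))%:E) /
     fine (\int[@gaussN R p]_v (expR (psi v))%:E) - fine (gaussN A)|%:E <=
   4%:E * ((6%:E * \int[@gaussN R p]_v (T v)%:E) * ((4 * y)^-1)%:E + (expR (- x))%:E))%E.
Proof.
move=> mA; have Z0 := partition_gt0 mpsi fin.
have I0 : (0 <= \int[@gaussN R p]_v (T v)%:E)%E.
  by apply: integral_ge0 => v _; rewrite lee_fin.
have y40 : 0 < (4 * y)^-1 by rewrite invr_gt0 mulr_gt0.
have J0 : (0 <= (6%:E * \int[@gaussN R p]_v (T v)%:E) * ((4 * y)^-1)%:E)%E.
  by rewrite !mule_ge0// lee_fin ltW.
have me : measurable_fun setT (fun v => expR (psi v)) by exact: measurableT_comp.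
have mE : measurable_fun setT (fun v => (expR (psi v))%:E) by exact/measurable_EFinP.
have [x13|x13] := ltP x (32 / 25).
  apply: (@le_trans _ _ (4%:E * (expR (- x))%:E)%E); last first.
    by rewrite lee_pmul2l// leeDr.
  rewrite -EFinM lee_fin; apply: le_trans (expRN_ge (ltW x13)).
  have IA0 : (0 <= \int[@gaussN R p]_(v in A) (expR (psi v))%:E)%E.
    by apply: integral_ge0 => v _; rewrite lee_fin expR_ge0.
  have IA : (\int[@gaussN R p]_(v in A) (expR (psi v))%:E <= \int[@gaussN R p]_v (expR (psi v))%:E)%E.
    by apply: ge0_subset_integral => // v _; rewrite lee_fin expR_ge0.
  have a1 : 0 <= fine (\int[@gaussN R p]_(v in A) (expR (psi v))%:E) / fine (\int[@gaussN R p]_v (expR (psi v))%:E) <= 1.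
    rewrite divr_ge0 ?fine_ge0//; last by apply: integral_ge0 => v _; rewrite lee_fin expR_ge0.
    rewrite ler_pdivrMr// mul1r fine_le// ge0_fin_numE//; first exact: le_lt_trans fin.
    by apply: integral_ge0 => v _; rewrite lee_fin expR_ge0.
  have a2 : 0 <= fine (@gaussN R p A) <= 1.
    rewrite fine_ge0//= -[leRHS]/(fine 1%:E) fine_le ?probability_le1//.
    exact: fin_num_measure.
  by rewrite ler_norml; lra.
have [->|Tfin] := eqVneq (\int[@gaussN R p]_v (T v)%:E)%E +oo%E.
  by rewrite gt0_muley// gt0_mulye// addye// gt0_muley// leey.
have Tf : (\int[@gaussN R p]_v (T v)%:E)%E \is a fin_num by rewrite ge0_fin_numE// ltey.
have TE := fineK Tf; have t0 : 0 <= fine (\int[@gaussN R p]_v (T v)%:E) by rewrite fine_ge0.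
have [W WW Wy] := weight_const.
have ub := upper_bound l01 P0 rE x13 Tle T0 mT mpsi psiw psi_cvx T3 w14 wP psi_out WW.
have lb := lower_bound l01 P0 rE x13 Tle T0 mT mpsi.
rewrite -TE in ub lb *.
set t := fine _ in t0 ub lb *.
have W1 : 1 <= W by case: WW => [->|[-> _]]; lra.
have tW : t <= 6 / y * t by rewrite ler_peMl//; exact: le_trans Wy.
have E : 4 * (6 * t * (4 * y)^-1 + expR (- x)) = 6 / y * t + 4 * expR (- x).
  by field; rewrite gt_eqF.
have E2 : (4%:E * ((6%:E * t%:E) * ((4 * y)^-1)%:E + (expR (- x))%:E) = (6 / y * t + 4 * expR (- x))%:E)%E.
  by rewrite -E.
rewrite E2 lee_fin; have ex := expR_ge0 (- x).
have Wt := ler_wpM2r t0 Wy.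
apply: (reweight_le me _ fin) => //.
- by apply: (le_trans ub); rewrite lee_fin lerD2r.
- by apply: (le_trans lb); rewrite lee_fin lerD//; lra.
Qed.

End total_variation_bound.

(** * Probabilities of shifted balls *)

Section gauss_balls.
Context {R : realType}.

Lemma gaussN_orthogonal_set p (V : 'M[R]_p) (A : set 'cV[R]_p) :
  V^T *m V = 1%:M -> measurable A -> gaussN A = @gaussN R p [set v | A (V *m v)].
Proof.
move=> VV mA; have mA' : measurable [set v | A (V *m v)].
  have /(_ measurableT A mA) := measurable_mulmx V; rewrite setTI; exact.
have I A' : measurable A' -> @gaussN R p A' = (\int[@gaussN R p]_v (\1_A' v)%:E)%E.
  by move=> m; rewrite integral_indic// setIT.
rewrite (I A)// I// -(@gaussN_orthogonal R p V (fun v => (\1_A v)%:E))//.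
by apply/measurable_EFinP; exact: measurable_indic.
Qed.

Lemma measurable_norm2_set q p (M : 'M[R]_(q, p)) (z : 'cV[R]_p) (r : R) : 0 <= r ->
  measurable [set v : 'cV[R]_p | (norm2 (M *m (v - z)) <= r)%R].
Proof.
move=> r0; rewrite (_ : mkset _ = [set v : 'cV[R]_p | dot (M *m (v - z)) (M *m (v - z)) <= r ^+ 2]).
  apply: measurable_le_set; rewrite /dot; apply: measurable_sum => i.
  have m1 : measurable_fun setT (fun v : 'cV[R]_p => (M *m (v - z)) i 0).
    under eq_fun do rewrite mxE.
    apply: measurable_sum => j; apply: measurable_funM => //.
    under eq_fun do rewrite mxE.
    by apply: measurable_funD => //; exact: measurable_cV_component.
  exact: measurable_funM.
apply/seteqP; split => v /=; rewrite -norm2_sqr.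
  by move=> h; rewrite ler_pXn2r ?nnegrE ?norm2_ge0.
by rewrite ler_pXn2r ?nnegrE ?norm2_ge0.
Qed.

(** Rotating by the V of [gram_diag] turns the ball into {wchi <= r^2} with weights mu_i and shift
    V^T z. As mu_i is at most the operator norm, the assumption on norms becomes 3 mu_i^2 <= F^2. *)
Lemma gauss_ball_shift : exists2 C : R, 0 <= C &
  forall (q p : nat) (M : 'M[R]_(q, p)) (z : 'cV[R]_p) (r : R), 0 < r ->
  3 * opnorm (M *m M^T) ^+ 2 <= frobenius (M *m M^T) ^+ 2 ->
  `|fine (gaussN [set v : 'cV[R]_p | (norm2 (M *m (v - z)) <= r)%R]) -
    fine (gaussN [set v : 'cV[R]_p | (norm2 (M *m v) <= r)%R])| <=
  C * norm2 (M *m z) ^+ 2 / frobenius (M *m M^T).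
Proof.
have [C C0 H] := @gauss_shift R; exists C => // q p M z r r0 hF.
have [V [mu [VV qV mu0 FE]]] := gram_diag M.
have VVt : V *m V^T = 1%:M by exact: mulmx1C.
pose b i := (V^T *m z) i 0.
have key z' : fine (gaussN [set v : 'cV[R]_p | (norm2 (M *m (v - z')) <= r)%R]) =
    wchi_cdf (fun i => mu 0 i) (fun i => (V^T *m z') i 0) (r ^+ 2).
  rewrite (gaussN_orthogonal_set VV); last exact: measurable_norm2_set (ltW r0).
  rewrite /wchi_cdf; congr (fine (gaussN _)); apply/seteqP.
  have E v : norm2 (M *m (V *m v - z')) ^+ 2 = wchi (fun i => mu 0 i) (fun i => (V^T *m z') i 0) v.
    have -> : V *m v - z' = V *m (v - V^T *m z') by rewrite mulmxBr mulmxA VVt mul1mx.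
    by rewrite qV; apply: eq_bigr => i _; rewrite !mxE.
  by split => v /=; rewrite -E ler_pXn2r ?nnegrE ?norm2_ge0 ?(ltW r0).
have k0 : fine (gaussN [set v : 'cV[R]_p | (norm2 (M *m v) <= r)%R]) =
    wchi_cdf (fun i => mu 0 i) (fun=> 0) (r ^+ 2).
  rewrite (_ : mkset _ = [set v : 'cV[R]_p | (norm2 (M *m (v - 0)) <= r)%R]).
    by rewrite key; congr wchi_cdf; apply/funext => i; rewrite mulmx0 mxE.
  by apply/seteqP; split => v /=; rewrite subr0.
rewrite key k0.
have zE : norm2 (M *m z) ^+ 2 = \sum_i mu 0 i * b i ^+ 2.
  by rewrite -{1}[z]mul1mx -VVt -(mulmxA V) qV.
(* If the Frobenius norm is 0, all weights vanish and both probabilities agree; the right side is 0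
   too, by the convention on division by 0. *)
have [F0|F0] := eqVneq (frobenius (M *m M^T)) 0.
  have mz i : mu 0 i = 0.
    have : \sum_i mu 0 i ^+ 2 = 0 by rewrite -FE F0 expr0n.
    move/eqP; rewrite psumr_eq0; last by move=> j _; exact: sqr_ge0.
    by move/allP => /(_ i); rewrite mem_index_enum => /(_ isT) /=; rewrite sqrf_eq0 => /eqP.
  have -> : wchi_cdf (fun i => mu 0 i) (fun i => (V^T *m z) i 0) (r ^+ 2) =
      wchi_cdf (fun i => mu 0 i) (fun=> 0) (r ^+ 2).
    rewrite /wchi_cdf; congr (fine (gaussN _)); apply/seteqP.
    have E b' v : wchi (fun i => mu 0 i) b' v = 0 by apply: big1 => i _; rewrite mz mul0r.
    by split => v /=; rewrite !E.
  by rewrite subrr normr0 F0 invr0 mulr0.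
rewrite zE; apply: H => //.
- by move=> i; have /andP[] := mu0 i.
- by rewrite lt_neqAle eq_sym F0 frobenius_ge0.
- move=> i; apply: le_trans hF; rewrite ler_pM2l//.
  have /andP[m0 m1] := mu0 i.
  by rewrite ler_pXn2r ?nnegrE// (le_trans m0).
Qed.

End gauss_balls.

(** * From linear forms to the distance between mean and maximizer *)

Section mean_bound.
Context {R : realType} {p : nat}.

Lemma Rintegral_lincomb d (X : measurableType d) (mu : {measure set X -> \bar R})
    (I : Type) (s : seq I) (c : I -> R) (F : I -> X -> R) :
  (forall i, mu.-integrable setT (EFin \o F i)) ->
  mu.-integrable setT (EFin \o (fun v => \sum_(i <- s) c i * F i v)) /\
  \int[mu]_v (\sum_(i <- s) c i * F i v) = \sum_(i <- s) c i * \int[mu]_v F i v.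
Proof.
move=> iF; have icF i : mu.-integrable setT (EFin \o (fun v => c i * F i v)).
  rewrite (_ : _ \o _ = (fun v => ((c i)%:E * (EFin \o F i) v)%E)); last by apply/funext => v.
  exact: integrableZl.
elim: s => [|i s [ih1 ih2]].
  split.
    rewrite (_ : _ \o _ = cst 0%E); first exact: integrable0.
    by apply/funext => v /=; rewrite big_nil.
  rewrite big_nil (_ : (fun v => _) = cst 0); last by apply/funext => v; rewrite big_nil.
  by rewrite Rintegral_cst// mul0r.
split.
  rewrite (_ : _ \o _ = ((EFin \o (fun v => c i * F i v)%R) \+ (EFin \o (fun v => \sum_(i <- s) c i * F i v)%R))%E).
    exact: integrableD.
  by apply/funext => v /=; rewrite big_cons EFinD.
rewrite big_cons -ih2 -RintegralZl// -RintegralD//.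
by congr Rintegral; apply/funext => v; rewrite big_cons.
Qed.

Variables (f : 'cV[R]_p -> R) (xs : 'cV[R]_p) (B : 'M[R]_p) (K : R).
Local Notation psi := (log_density f xs B).
Hypothesis mf : measurable_fun setT f.
Hypothesis uB : B \in unitmx.
Hypothesis fin : (\int[@gaussN R p]_v (expR (psi v))%:E < +oo)%E.
Hypothesis K0 : 0 <= K.
Hypothesis lin_le : forall (a : 'I_p -> R) sg, 0 < sg -> \sum_i a i ^+ 2 <= sg ^+ 2 ->
  (\int[@gaussN R p]_v `|lin a v * expR (psi v)|%:E < +oo)%E /\
  `|\int[@gaussN R p]_v (lin a v * expR (psi v))| <= K * sg * \int[@gaussN R p]_v expR (psi v).

Let mpsi := measurable_log_density xs B mf.

(** In whitened coordinates the left side is the mean of the linear form with coefficients a = B^T b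
    under the reweighted law. *)
Lemma mean_dot_le (b : 'cV[R]_p) : `|dot b (gibbs_mean f - xs)| <= K * norm2 (B^T *m b).
Proof.
have Z0 : 0 < \int[@gaussN R p]_v expR (psi v) by exact: partition_gt0.
have me : measurable_fun setT (fun v => expR (psi v)) by exact: measurableT_comp.
have ie : (@gaussN R p).-integrable setT (EFin \o (fun v => expR (psi v))).
  apply/integrableP; split; first exact/measurable_EFinP.
  rewrite (_ : (fun v => _) = (fun v => (expR (psi v))%:E))//.
  by apply/funext => v /=; rewrite gtr0_norm// expR_gt0.
have il a : (@gaussN R p).-integrable setT (EFin \o (fun v => lin a v * expR (psi v))).
  apply/integrableP; split.
    by apply/measurable_EFinP; apply: measurable_funM => //; exact: measurable_lin.
  have s0 : 0 <= \sum_i a i ^+ 2 by apply: sumr_ge0 => i _; exact: sqr_ge0.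
  by have [] := @lin_le a (1 + \sum_i a i ^+ 2) ltac:(lra) ltac:(rewrite expr2; nra).
set Z := \int[_]_v _ in Z0.
have coordE i : gibbs_mean f i 0 - xs i 0 = (\int[@gaussN R p]_v (lin (B i) v * expR (psi v))) / Z.
  have E v : (xs + B *m v) i 0 * expR (psi v) =
      xs i 0 * expR (psi v) + lin (B i) v * expR (psi v) by rewrite !mxE mulrDl.
  have ix : (@gaussN R p).-integrable setT (EFin \o (fun v => xs i 0 * expR (psi v))).
    rewrite (_ : _ \o _ = (fun v => ((xs i 0)%:E * (EFin \o (fun v => expR (psi v))) v)%E)); last by apply/funext => v.
    exact: integrableZl.
  rewrite (@gibbs_mean_gaussN R p f xs B mf uB i).
    under eq_Rintegral do rewrite E.
    by rewrite RintegralD// RintegralZl// -/Z; field; rewrite gt_eqF.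
  rewrite (_ : _ \o _ = ((EFin \o (fun v => xs i 0 * expR (psi v))%R) \+
      (EFin \o (fun v => lin (B i) v * expR (psi v))%R))%E); first exact: integrableD.
  by apply/funext => v /=; rewrite E EFinD.
pose a i := (B^T *m b) i 0.
have -> : dot b (gibbs_mean f - xs) = (\int[@gaussN R p]_v (lin a v * expR (psi v))) / Z.
  have [_] := @Rintegral_lincomb _ _ (@gaussN R p) 'I_p (index_enum 'I_p) (fun i => b i 0) _ (fun i => il (B i)).
  have -> : (fun v => \sum_i b i 0 * (lin (B i) v * expR (psi v))) = (fun v => lin a v * expR (psi v)).
    apply/funext => v; under eq_bigr do rewrite mulrA.
    rewrite -mulr_suml; congr (_ * _); rewrite /lin /a.
    under eq_bigr do rewrite mulr_sumr.
    rewrite exchange_big/=; apply: eq_bigr => j _; rewrite mxE mulr_suml.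
    by apply: eq_bigr => i _; rewrite mxE; ring.
  move=> ->; rewrite /dot mulr_suml; apply: eq_bigr => i _.
  by rewrite -mulrA -coordE !mxE.
rewrite normrM normfV (gtr0_norm Z0) ler_pdivrMr//.
(* The hypothesis requires sg > 0 whereas B^T b may vanish, so sg is |B^T b| + t with t tending to
   0. *)
apply: (@le_of_small _ _ _ (K * Z) 1 ltr01) => t t0 _.
have [] := @lin_le a (norm2 (B^T *m b) + t).
- by rewrite ltr_wpDl// norm2_ge0.
- rewrite (_ : \sum_i _ = norm2 (B^T *m b) ^+ 2); last first.
    by rewrite norm2_sqr; apply: eq_bigr => i _; rewrite expr2.
  by rewrite ler_pXn2r ?nnegrE ?addr_ge0 ?norm2_ge0 ?(ltW t0)// lerDl ltW.
move=> _ /le_trans; apply; rewrite -/Z le_eqVlt; apply/orP; left; apply/eqP; ring.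
Qed.

(** Duality: testing with Q^T w, for w the vector to be measured, gives |w|^2 <= K |(Q B)^T w|, and
    this is at most K |w| times the square root of the operator norm. *)
Lemma mean_norm_le q (Q : 'M[R]_(q, p)) :
  norm2 (Q *m (gibbs_mean f - xs)) <= K * Num.sqrt (opnorm (Q *m (B *m B^T) *m Q^T)).
Proof.
set w := Q *m _; set op := opnorm _; have op0 : 0 <= op by exact: opnorm_ge0.
have := mean_dot_le (Q^T *m w); rewrite -dot_mulmx -/w -norm2_sqr ger0_norm ?sqr_ge0// => h.
have h2 : norm2 (B^T *m (Q^T *m w)) <= Num.sqrt op * norm2 w.
  rewrite -(@ler_pXn2r _ 2)// ?nnegrE ?norm2_ge0 ?mulr_ge0 ?sqrtr_ge0 ?norm2_ge0//.
  have -> : B^T *m (Q^T *m w) = (Q *m B)^T *m w by rewrite trmx_mul mulmxA.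
  rewrite exprMn (sqr_sqrtr op0) (norm2_mulmx (Q *m B)^T w); apply: le_trans (qform_le_opnorm _ _).
  by rewrite trmxK trmx_mul !mulmxA.
have [->|w0] := eqVneq (norm2 w) 0; first by rewrite mulr_ge0 ?sqrtr_ge0.
have {}w0 : 0 < norm2 w by rewrite lt_neqAle eq_sym w0 norm2_ge0.
rewrite -(ler_pM2r w0) -expr2; apply: (le_trans h); rewrite -mulrA.
exact: ler_wpM2l.
Qed.

End mean_bound.

(** * The hypotheses of the theorem in whitened coordinates *)

Section laplace.
Context {R : realType} {p : nat}.
Variables (f : 'cV[R]_p -> R) (xs : 'cV[R]_p) (G D : 'M[R]_p).
Variables (nu x : R) (tau3 : 'cV[R]_p -> R) (n : R) (h : 'cV[R]_p -> R) (c3 : R).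

Local Notation DG2 := (- hess f xs).
Local Notation D2 := (DG2 - G *m G).
Local Notation S := (invmx DG2).
Local Notation pG := (eff_dim D2 DG2).
Local Notation r := (conc_radius pG x).
Local Notation U := (ellipsoid D (nu^-1 * r)).
Local Notation om := (omega f xs D U).
Local Notation dia := (diamond3 S tau3 om).
Local Notation ell := (fun y => f y + norm2 (G *m (y - xs)) ^+ 2 / 2).
Local Notation kap := (c3 * n `^ (- (1 / 2))).

Hypothesis p0 : (0 < p)%N.
Hypothesis Cf : Ck 3 f.
Hypothesis f_int : (\int[lebesgue_cV p]_y (expR (f y))%:E < +oo)%E.
Hypothesis fmax : forall y, f y <= f xs.
Hypothesis GT : G^T = G.
Hypothesis DT : D^T = D.
Hypothesis DD : D *m D = D2.
Hypothesis nu01 : 0 < nu < 1.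
Hypothesis x0 : 0 < x.
Hypothesis mtau3 : measurable_fun [set: 'cV[R]_p] tau3.
Hypothesis tau3Z : forall (t : R) u, tau3 (t *: u) = `|t| ^+ 3 * tau3 u.
Hypothesis tau3_le : forall u, U u -> `|delta3 f xs u| <= tau3 u / 6.
Hypothesis ell_concave : convex_function setT (fun u => - ell (xs + u)).
Hypothesis n0 : 0 < n.
Hypothesis ellE : forall y, - ell y = n * h y.
Hypothesis h_convex : strongly_convex h.
Hypothesis third_le : (third_ratio_sup h xs U <= c3%:E)%E.
Hypothesis c3r : c3 * r * n `^ (- (1 / 2)) <= 3 / 4.
Hypothesis om13 : (om <= (1 / 3)%:E)%E.
Hypothesis ompG : (om * pG%:E <= (2 / 3)%:E)%E.

Variables (B : 'M[R]_p) (l : 'I_p -> R).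
Hypothesis uB : B \in unitmx.
Hypothesis BA : B^T *m DG2 *m B = 1%:M.
Hypothesis BC : forall v, qform D2 (B *m v) = quad l v.
Hypothesis l01 : forall i, 0 < l i <= 1.
Hypothesis effE : pG = \sum_i l i.

Local Notation Y := (quad l).
Local Notation psi := (log_density f xs B).

Let l01' i : 0 <= l i <= 1.
Proof. by have /andP[/ltW-> ->] := l01 i. Qed.

Let P0 : 0 < \sum_i l i.
Proof.
case: p p0 l l01 => [//|q] _ l' l'01; rewrite big_ord_recl ltr_wpDr//.
  by apply: sumr_ge0 => i _; have /andP[/ltW] := l'01 (lift ord0 i).
by have /andP[] := l'01 ord0.
Qed.

Let rE : r = 2 * Num.sqrt (\sum_i l i) + Num.sqrt (2 * x).
Proof. by rewrite -effE. Qed.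

Let r0 : 0 < r.
Proof. by rewrite rE ltr_wpDr ?sqrtr_ge0// mulr_gt0// sqrtr_gt0. Qed.

Let subU u : norm2 (D *m u) <= r -> U u.
Proof.
move=> /le_trans; apply; have /andP[nu0 nu1] := nu01.
by rewrite ler_peMl ?(ltW r0)// invf_ge1// ltW.
Qed.

Let mf : measurable_fun setT f.
Proof. exact: continuous_measurable_cV (Ck_continuous Cf). Qed.

Let mpsi := measurable_log_density xs B mf.

Let fin : (\int[@gaussN R p]_v (expR (psi v))%:E < +oo)%E.
Proof. exact: partition_fin. Qed.

Let kap0 : 0 <= kap.
Proof. exact: kap_ge0 p0 r0 DT DD subU third_le. Qed.

Let kr : kap * r <= 3 / 4.
Proof. by rewrite mulrAC. Qed.

Lemma quadE v : Y v = norm2 (D *m (B *m v)) ^+ 2.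
Proof. by rewrite -BC (normD DT DD). Qed.

Lemma sumsqE (v : 'cV[R]_p) : \sum_i v i 0 ^+ 2 = qform DG2 (B *m v).
Proof. by rewrite qform_mulmx BA qform1. Qed.

Lemma psiE v : psi v = delta3 f xs (B *m v).
Proof.
rewrite /log_density delta3E (grad_max r0 fmax subU tau3Z tau3_le) sumsqE; ring.
Qed.

Lemma norm_le_quad v : Y v <= r ^+ 2 -> norm2 (D *m (B *m v)) <= r.
Proof. by rewrite quadE ler_pXn2r ?nnegrE ?norm2_ge0 ?(ltW r0). Qed.

Lemma om_ge0 : (0 <= om)%E.
Proof.
have [u un0 ur] := exists_direction p0 r0 DT DD subU.
apply: (@le_trans _ _ (`|delta3 f xs u| / (norm2 (D *m u) ^+ 2 / 2))%:E).
  by rewrite lee_fin divr_ge0// divr_ge0// sqr_ge0.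
apply: ereal_sup_ubound; exists u => //; split; first exact: subU.
by move=> /= u0; rewrite u0 eqxx in un0.
Qed.

Lemma om_fin : om = (fine om)%:E.
Proof.
by rewrite fineK// ge0_fin_numE ?om_ge0//; apply: (le_lt_trans om13); rewrite ltry.
Qed.

Lemma fine_om : 0 <= fine om <= 1 / 3.
Proof. by have := om13; have := om_ge0; rewrite om_fin !lee_fin => -> ->. Qed.

Lemma delta3_om u : norm2 (D *m u) <= r -> `|delta3 f xs u| <= fine om * (norm2 (D *m u) ^+ 2 / 2).
Proof.
move=> ur; have [->|un0] := eqVneq u 0.
  by rewrite delta30 normr0 mulr_ge0 ?divr_ge0 ?sqr_ge0//; have /andP[] := fine_om.
have N0 : 0 < norm2 (D *m u) ^+ 2 / 2.
  rewrite divr_gt0// (normD DT DD).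
  exact: (D2_posdef r0 fmax GT subU tau3Z tau3_le n0 ellE h_convex).
rewrite -ler_pdivrMr// -lee_fin -om_fin; apply: ereal_sup_ubound; exists u => //.
by split; [exact: subU | move=> /= u0; rewrite u0 eqxx in un0].
Qed.

(** Both terms are needed: w <= omega gives w P <= 2/3 and the comparison with (1 - omega)^(-3/2),
    while omega <= 1/3 is too weak for w <= 1/4, which comes from kap r / 3. *)
Let w : R := Num.min (fine om) (kap * r / 3).

Let w14 : 0 <= w <= 1 / 4.
Proof.
have /andP[om0 _] := fine_om; have := kr => k.
rewrite /w le_min ge_min om0 (divr_ge0 (mulr_ge0 kap0 (ltW r0)))//=.
by apply/orP; right; lra.
Qed.

Let w_om : w <= fine om.
Proof. by rewrite ge_min lexx. Qed.

Let wP : w * \sum_i l i <= 2 / 3.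
Proof.
apply: (@le_trans _ _ (fine om * \sum_i l i)); first by apply: ler_wpM2r; [exact: ltW P0|exact: w_om].
by have := ompG; rewrite om_fin -EFinM lee_fin effE.
Qed.

Let wk : w <= kap * r / 3.
Proof. by rewrite ge_min lexx orbT. Qed.

Let psi3 v : Y v <= r ^+ 2 -> `|psi v| <= kap / 6 * (Y v * Num.sqrt (Y v)).
Proof.
move=> /norm_le_quad vr; rewrite psiE quadE sqrtr_sqr (ger0_norm (norm2_ge0 _)) -exprSr.
exact: (delta3_cubic p0 r0 Cf fmax GT DT DD subU tau3Z tau3_le n0 ellE h_convex third_le).
Qed.

Let psiw v : Y v <= r ^+ 2 -> `|psi v| <= w * (Y v / 2).
Proof.
move=> vr; have nr := norm_le_quad vr; have Y0 : 0 <= Y v by rewrite quadE sqr_ge0.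
rewrite /w minr_pMl ?divr_ge0// le_min; apply/andP; split.
  by rewrite psiE quadE delta3_om.
apply: (le_trans (psi3 vr)); have -> : kap * r / 3 * (Y v / 2) = kap / 6 * (Y v * r) by field.
rewrite ler_wpM2l ?divr_ge0// ler_wpM2l// quadE sqrtr_sqr ger0_norm ?norm2_ge0//.
Qed.

Let psi_out v (t : R) : t ^+ 2 = Y v -> r < t ->
  psi v <= (t ^+ 2 - r ^+ 2) / 2 - 5 / 8 * r * (t - r) + psi ((r / t) *: v).
Proof.
move=> tY rt; have t0 : 0 < t := lt_trans r0 rt.
have ur : norm2 (D *m (B *m ((r / t) *: v))) = r.
  rewrite -!scalemxAr norm2Z gtr0_norm ?divr_gt0//.
  have -> : norm2 (D *m (B *m v)) = t.
    by apply/eqP; rewrite -(@eqrXn2 _ 2) ?norm2_ge0 ?(ltW t0)// -quadE tY.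
  by rewrite divfK// gt_eqF.
have s1 : 1 < t / r by rewrite ltr_pdivlMr// mul1r.
have := @delta3_outside R p f xs G D r n c3 tau3 h U p0 r0 Cf fmax GT DT DD subU tau3Z
  tau3_le ell_concave n0 ellE h_convex third_le _ _ kr ur s1.
have -> : (t / r) *: (B *m ((r / t) *: v)) = B *m v.
  rewrite scalemxAr scalerA (_ : t / r * (r / t) = 1) ?scale1r//.
  by field; rewrite !gt_eqF.
rewrite -!psiE => /le_trans; apply; rewrite le_eqVlt; apply/orP; left; apply/eqP.
by field; rewrite gt_eqF.
Qed.

Let psi_cvx (t : R) (v u : 'cV[R]_p) : 0 <= t <= 1 ->
  (1 - t) * psi v + t * psi u - t * (1 - t) / 2 * Y (v - u) <= psi ((1 - t) *: v + t *: u).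
Proof.
move=> t01; have t01' : 0 <= 1 - t <= 1 by lra.
have E v' : ell (xs + B *m v') = f xs + psi v' - Y v' / 2.
  rewrite (addrC xs) addrK (addrC _ xs) (normG GT) -[f (xs + _)](subrK (f xs)).
  by rewrite /log_density sumsqE -BC qformB; field.
have := convex_functionP (B *m v) (B *m u) ell_concave t01'.
have -> : 1 - (1 - t) = t by ring.
rewrite !scalemxAr -mulmxDr !E.
have -> : Y ((1 - t) *: v + t *: u) = (1 - t) * Y v + t * Y u - t * (1 - t) * Y (v - u).
  rewrite /quad !mulr_sumr -big_split -sumrB/=; apply: eq_bigr => i _.
  by rewrite !mxE; ring.
lra.
Qed.

Let tau0 u : 0 <= tau3 u := tau3_ge0 r0 subU tau3Z tau3_le u.

Lemma mean_bound_Q q (Q : 'M[R]_(q, p)) : norm2 (Q *m (gibbs_mean f - xs)) <=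
  (12 / 5 * kap * Num.sqrt (pG + 1) ^+ 3 + meanC * expR (- x)) * Num.sqrt (opnorm (Q *m S *m Q^T)).
Proof.
have [_ SE _] := congr_invmx BA; rewrite SE; apply: mean_norm_le => //.
  by rewrite addr_ge0// mulr_ge0 ?meanC_ge0 ?expR_ge0 ?exprn_ge0 ?sqrtr_ge0// mulr_ge0.
move=> a sg sg0 asg.
have pout v (t : R) : t ^+ 2 = Y v -> r < t ->
    psi v <= (t ^+ 2 - r ^+ 2) / 2 - 5 / 8 * (r * (t - r)) + w * (r ^+ 2 / 2).
  move=> tY rt; apply: (le_trans (psi_out tY rt)); rewrite (mulrA (5 / 8)) lerD2l.
  have t0 : 0 < t := lt_trans r0 rt.
  have Yr : Y ((r / t) *: v) = r ^+ 2 by rewrite quadZ -tY -exprMn divfK// gt_eqF.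
  by apply: (le_trans (ler_norm _)); have := @psiw ((r / t) *: v); rewrite Yr; exact.
have [h1 h2] := mean_general l01' P0 x0 rE mpsi kap0 w14 wP psi3 psiw pout sg0 asg wk kr.
by split => //; have := h2 fin; rewrite effE.
Qed.

(** The shift estimate is a hypothesis so that its constant can be fixed before p and f. In whitened
    coordinates, with M = Q B and z = B^-1 (xbar - xs), the Gibbs ball is |M (v - z)| <= r'; the
    triangle inequality passes through its Gaussian mass. *)
Lemma ball_comparison (C : R) q (Q : 'M[R]_(q, p)) (r' : R) :
  (forall (M : 'M[R]_(q, p)) (z : 'cV[R]_p) (r : R), 0 < r ->
    3 * opnorm (M *m M^T) ^+ 2 <= frobenius (M *m M^T) ^+ 2 ->
    `|fine (gaussN [set v : 'cV[R]_p | (norm2 (M *m (v - z)) <= r)%R]) -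
      fine (gaussN [set v : 'cV[R]_p | (norm2 (M *m v) <= r)%R])| <=
    C * norm2 (M *m z) ^+ 2 / frobenius (M *m M^T)) -> 0 < r' ->
  3 * opnorm (Q *m S *m Q^T) ^+ 2 <= frobenius (Q *m S *m Q^T) ^+ 2 ->
  (`|gibbs f [set y | (norm2 (Q *m (y - gibbs_mean f)) <= r')%R]
      - gauss S [set u | (norm2 (Q *m u) <= r')%R]|%:E <=
   4%:E * (dia + (expR (- x))%:E) +
   (C * norm2 (Q *m (gibbs_mean f - xs)) ^+ 2 / frobenius (Q *m S *m Q^T))%:E)%E.
Proof.
move=> shift r'0 hF; have [_ SE _] := congr_invmx BA.
pose M := Q *m B; pose z := invmx B *m (gibbs_mean f - xs).
have MM : M *m M^T = Q *m S *m Q^T by rewrite /M SE trmx_mul !mulmxA.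
have Mz : M *m z = Q *m (gibbs_mean f - xs) by rewrite /M /z -mulmxA mulKVmx.
have mA : measurable [set y : 'cV[R]_p | (norm2 (Q *m (y - gibbs_mean f)) <= r')%R].
  exact: measurable_norm2_set (ltW r'0).
have mU : measurable [set u : 'cV[R]_p | (norm2 (Q *m u) <= r')%R].
  have := measurable_norm2_set Q 0 (ltW r'0).
  by rewrite (_ : mkset _ = [set u : 'cV[R]_p | (norm2 (Q *m u) <= r')%R])//;
    apply/seteqP; split => u /=; rewrite subr0.
rewrite (gibbs_gaussN xs mf uB mA) (gauss_gaussN uB BA mU).
have -> : [set v | [set y | (norm2 (Q *m (y - gibbs_mean f)) <= r')%R] (xs + B *m v)] =
    [set v : 'cV[R]_p | (norm2 (M *m (v - z)) <= r')%R].
  have E v : Q *m (xs + B *m v - gibbs_mean f) = M *m (v - z).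
    rewrite (mulmxBr M) Mz /M -mulmxA -mulmxBr; congr (_ *m _).
    by rewrite opprB addrCA addrA addrAC.
  by apply/seteqP; split => v /=; rewrite E.
have -> : [set v | [set u | (norm2 (Q *m u) <= r')%R] (B *m v)] =
    [set v : 'cV[R]_p | (norm2 (M *m v) <= r')%R].
  by apply/seteqP; split => v /=; rewrite mulmxA.
have mA' := measurable_norm2_set M z (ltW r'0).
set A' := [set v | _ <= _] in mA' *; set N' := gaussN _.
set ratio := fine _ / fine _.
have := shift M z r' r'0; rewrite MM Mz => /(_ hF) sh.
apply: (@le_trans _ _ (`|ratio - fine (gaussN A')|%:E + `|fine (gaussN A') - fine N'|%:E)%E).
  by rewrite -EFinD lee_fin (le_trans _ (ler_normD _ _))// addrA subrK.
apply: leeD; last by rewrite lee_fin.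
pose T v := tau3 (B *m v) / 6; pose y := (1 - fine om) `^ (3 / 2).
have /andP[om0 om3] := fine_om; have o1 : 0 < 1 - fine om by lra.
have y0 : 0 < y by exact: powR_gt0.
have yy : y * y = (1 - fine om) ^+ 3.
  by rewrite /y -powRD ?(gt_eqF o1) ?implybT// (_ : 3 / 2 + 3 / 2 = 3%:R) ?powR_mulrn ?(ltW o1)//; field.
have mtB : measurable_fun setT (fun v : 'cV[R]_p => tau3 (B *m v)).
  by apply: (measurableT_comp mtau3); exact: measurable_mulmx.
have T0 v : 0 <= T v by rewrite divr_ge0.
have mT : measurable_fun setT T by exact: measurable_funM.
have diaE : dia = ((6%:E * \int[@gaussN R p]_v (T v)%:E) * ((4 * y)^-1)%:E)%E.
  rewrite /diamond3 (gauss_expectation_gaussN uB BA)//; congr (_ * _)%E.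
  have mTE : measurable_fun setT (fun v => (T v)%:E) by exact/measurable_EFinP.
  rewrite -(ge0_integralZl_EFin _ measurableT _ mTE)//; last by move=> v _; rewrite lee_fin.
  by apply: eq_integral => v _; rewrite -EFinM /T mulrC divfK.
rewrite diaE; apply: (@reweighted_tv R p l r x psi T w (fine om) y l01' P0 rE) => //.
- by move=> v /norm_le_quad vr; rewrite psiE; apply: tau3_le; exact: subU.
- by move=> v vr; rewrite -mulrA; exact: psiw.
- by move=> t v; rewrite /T -scalemxAr tau3Z mulrA.
Qed.

End laplace.

Theorem theorem2p10 (R : realType) :
  exists C1 C2 : R, 0 < C1 /\ 0 < C2 /\
  forall (p : nat) (f : 'cV[R]_p -> R) (xs : 'cV[R]_p) (G D : 'M[R]_p)
    (nu x : R) (tau3 : 'cV[R]_p -> R)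
    (n : R) (h : 'cV[R]_p -> R) (c3 : R),
  let DG2 := - hess f xs in
  let D2 := DG2 - G *m G in
  let S := invmx DG2 in
  let pG := eff_dim D2 DG2 in
  let rG := conc_radius pG x in
  let U := ellipsoid D (nu^-1 * rG) in
  let om := omega f xs D U in
  let dia := diamond3 S tau3 om in
  let ell := fun y => f y + norm2 (G *m (y - xs)) ^+ 2 / 2 in
  let xbar := gibbs_mean f in
  (0 < p)%N ->
  Ck 3 f ->
  (\int[lebesgue_cV p]_y (expR (f y))%:E < +oo)%E ->
  (forall y, f y <= f xs) ->
  posdef DG2 ->
  psd G -> loewner (G *m G) DG2 ->
  psd D -> D *m D = D2 ->
  0 < nu < 1 -> 0 < x ->
  measurable_fun [set: 'cV[R]_p] tau3 ->
  (forall (t : R) u, tau3 (t *: u) = `|t| ^+ 3 * tau3 u) ->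
  (forall u, U u -> `|delta3 f xs u| <= tau3 u / 6) ->
  convex_function setT (fun u => - ell (xs + u)) ->
  0 < n ->
  (forall y, - ell y = n * h y) ->
  strongly_convex h ->
  (third_ratio_sup h xs U <= c3%:E)%E ->
  c3 * rG * n `^ (- (1 / 2)) <= 3 / 4 ->
  (om <= (1 / 3)%:E)%E ->
  (om * pG%:E <= (2 / 3)%:E)%E ->
  (forall (q : nat) (Q : 'M[R]_(q, p)),
    let QSQ := Q *m S *m Q^T in
    loewner (Q^T *m Q) D2 ->
    3 * opnorm QSQ ^+ 2 <= frobenius QSQ ^+ 2 ->
    (ereal_sup [set
        `|gibbs f [set y | (norm2 (Q *m (y - xbar)) <= r)%R]
          - gauss S [set u | (norm2 (Q *m u) <= r)%R]|%:E
      | r in [set r : R | (0 < r)%R]]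
     <= 4%:E * (dia + (expR (- x))%:E)
        + (C1 * norm2 (Q *m (xbar - xs)) ^+ 2 / frobenius QSQ)%:E)%E
    /\
    norm2 (Q *m (xbar - xs))
      <= 24 / 10 * c3 * opnorm QSQ `^ (1 / 2) * (pG + 1) `^ (3 / 2)
           * n `^ (- (1 / 2))
         + C2 * expR (- x))
  /\
  norm2 (D *m (xbar - xs))
    <= 24 / 10 * c3 * (pG + 1) `^ (3 / 2) * n `^ (- (1 / 2))
       + C2 * expR (- x).

Proof.
have [C C0 shift] := @gauss_ball_shift R.
(* C and [meanC] are only known to be nonnegative, and positive constants are asked for. *)
exists (C + 1), (meanC + 1); split; first by rewrite ltr_wpDl.
split; first by rewrite ltr_wpDl ?meanC_ge0.
move=> p f xs G D nu x tau3 n h c3 DG2 D2 S pG rG U om dia ell xbar.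
move=> p0 Cf f_int fmax DG2pos [GT _] [_ DG2G] [DT Dge0] DD nu01 x0 mtau3 tau3Z tau3_le.
move=> ell_concave n0 ellE h_convex third_le c3r om13 ompG.
have r00 : 0 < rG by rewrite ltr_wpDl ?mulr_ge0 ?sqrtr_ge0// sqrtr_gt0 mulr_gt0.
have subU u : norm2 (D *m u) <= rG -> U u.
  move=> /le_trans; apply; have /andP[nu0 nu1] := nu01.
  by rewrite ler_peMl ?(ltW r00)// invf_ge1// ltW.
have D2T : D2^T = D2 by rewrite -DD trmx_mul DT.
have D2pos u : u != 0 -> 0 < qform D2 u.
  exact: (D2_posdef r00 fmax GT subU tau3Z tau3_le n0 ellE h_convex).
have D2le u : qform D2 u <= qform DG2 u.
  by rewrite qformB lerBlDr lerDl -(normG GT) sqr_ge0.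
have [B [l [uB BA BC l01 effE]]] := whitening DG2pos D2T D2pos D2le.
have SE : S = B *m B^T by have [] := congr_invmx BA.
have c30 : 0 <= c3 := c3_ge0 p0 r00 DT DD subU third_le.
have pG1 : 0 <= pG + 1.
  by rewrite /pG effE addr_ge0// sumr_ge0// => i _; have /andP[/ltW] := l01 i.
have mean q (Q : 'M[R]_(q, p)) : loewner (Q^T *m Q) D2 ->
    opnorm (Q *m S *m Q^T) <= 1 /\ norm2 (Q *m (xbar - xs)) <=
      24 / 10 * c3 * opnorm (Q *m S *m Q^T) `^ (1 / 2) * (pG + 1) `^ (3 / 2)
        * n `^ (- (1 / 2)) + (meanC + 1) * expR (- x).
  (* Q^T Q <= D^2 <= D_G^2 makes Q B a contraction. The resulting bound by 1 removes the square root
     of the operator norm from the e^-x term. *)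
  move=> [_ QD]; have op1 : opnorm (Q *m S *m Q^T) <= 1.
    have -> : Q *m S *m Q^T = (Q *m B) *m (Q *m B)^T by rewrite SE trmx_mul !mulmxA.
    apply: opnorm_gram_le1 => v; rewrite -(@ler_pXn2r _ 2)// ?nnegrE ?norm2_ge0//.
    have h1 := QD (B *m v); rewrite qformB subr_ge0 in h1.
    rewrite -mulmxA norm2_mulmx; apply: (le_trans h1); apply: (le_trans (D2le _)).
    rewrite qform_mulmx BA qform1 norm2_sqr le_eqVlt; apply/orP; left; apply/eqP.
    by apply: eq_bigr => i _; rewrite expr2.
  split => //.
  have := mean_bound_Q p0 Cf f_int fmax GT DT DD nu01 x0 tau3Z tau3_le ell_concave n0 ellE
    h_convex third_le c3r om13 ompG uB BA BC l01 effE Q.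
  rewrite -/DG2 -/D2 -/S -/pG -/xbar.
  have op0 := opnorm_ge0 (Q *m S *m Q^T).
  set op := opnorm _ in op0 op1 *; move=> /le_trans; apply.
  have -> : op `^ (1 / 2) = Num.sqrt op by rewrite -powR12_sqrt// div1r.
  have -> : (pG + 1) `^ (3 / 2) = Num.sqrt (pG + 1) ^+ 3.
    by rewrite -powR12_sqrt// -powR_mulrn ?powR_ge0// -powRrM; congr powR; field.
  have s1 : Num.sqrt op <= 1 by rewrite -sqrtr1 ler_wsqrtr.
  have e0 := expR_ge0 (- x); have m0 := @meanC_ge0 R; have s0 := sqrtr_ge0 op.
  rewrite mulrDl; apply: lerD.
    by rewrite le_eqVlt; apply/orP; left; apply/eqP; field.
  apply: (@le_trans _ _ (meanC * expR (- x))); first by rewrite ler_piMr// mulr_ge0.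
  by rewrite ler_wpM2r// lerDl.
split.
  move=> q Q QSQ QD hF; split; last by have [] := mean q Q QD.
  apply: ge_ereal_sup => _ [r' r'0 <-].
  apply: (@le_trans _ _ (4%:E * (dia + (expR (- x))%:E)
      + (C * norm2 (Q *m (xbar - xs)) ^+ 2 / frobenius QSQ)%:E)%E).
    exact: (ball_comparison p0 Cf f_int fmax GT DT DD nu01 mtau3 tau3Z tau3_le ell_concave
      n0 ellE h_convex third_le c3r om13 ompG uB BA BC l01 effE (shift q p) r'0 hF).
  rewrite leeD2l// lee_fin ler_wpM2r ?invr_ge0 ?frobenius_ge0// ler_wpM2r ?sqr_ge0//.
  by rewrite lerDl.
(* Q = D is admissible for the mean bound, with equality in the Loewner order; its operator norm
   factor is then at most 1. *)
have LD : loewner (D^T *m D) D2.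
  rewrite /loewner DT DD subrr; split; first by rewrite trmx0.
  by move=> u; rewrite /qform mul0mx /dot big1// => i _; rewrite mxE mulr0.
have [op1 /le_trans] := mean p D LD; apply; rewrite lerD2r.
rewrite ler_wpM2r ?powR_ge0// ler_wpM2r ?powR_ge0// ler_piMr//; first by rewrite mulr_ge0.
have op0 := opnorm_ge0 (D *m S *m D^T).
have half0 : (0 : R) <= 1 / 2 by rewrite divr_ge0.
by have := ge0_ler_powR half0 _ _ op1; rewrite powR1 !nnegrE; apply.
Qed.
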